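(* Let $L$ be an even lattice of signature $(b_{+},b_{-})$ and let $M\subseteq L$ be a primitive non-degenerate sub-lattice of signature $(c_{+},c_{-})$; put $M^{\perp}_{L}:=M^{\perp}\cap L$. Fix $u^{\perp}\in\operatorname{Gr}(M_{\mathbb{R}}^{\perp})$ and consider the embedding $\iota_{u^{\perp}}:\operatorname{Gr}(M_{\mathbb{R}})\hookrightarrow\operatorname{Gr}(L_{\mathbb{R}})$, $u\mapsto u\oplus u^{\perp}$. Let $v\mapsto p_{v}$ be a smooth assignment, to each $v\in\operatorname{Gr}(L_{\mathbb{R}})$, of a polynomial on $L_{\mathbb{R}}$ homogeneous of degree $(m_{+},m_{-})$ with respect to $v$. Assume that for every $v=u\oplus u^{\perp}$ in $\iota_{u^{\perp}}(\operatorname{Gr}(M_{\mathbb{R}}))$ we have $p_{v}=p_{u}\,p_{u^{\perp}}$, where $p_{u}$ is a polynomial on $M_{\mathbb{R}}$ homogeneous of degree $(n_{+},n_{-})$ with respect to $u$, and $p_{u^{\perp}}$ is a polynomial on $M_{\mathbb{R}}^{\perp}$ homogeneous of degree $(m_{+}-n_{+},m_{-}-n_{-})$ with respect to $u^{\perp}$ which does not depend on $u$ (i.e., is constant along $\iota_{u^{\perp}}(\operatorname{Gr}(M_{\mathbb{R}}))$). Let $F:\mathcal{H}\to\mathbb{C}[D_{L(-1)}]$ be a smooth function transforming like a modular form of weight $\frac{b_{-}-b_{+}}{2}+m_{-}-m_{+}$ and representation $\rho_{L}^{*}$, for which the theta lifts below are defined. Then the theta contraction \[\Theta_{(L,M)}(F;u^{\perp},p_{u^{\perp}}):\tau\mapsto\big\langle\Theta_{L,M}(\tau;u^{\perp},p_{u^{\perp}}),F(\tau)\big\rangle_{L}\in\mathbb{C}[D_{M(-1)}]\]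 transforms like a modular form of weight $\frac{c_{-}-c_{+}}{2}+n_{-}-n_{+}$ and representation $\rho_{M}^{*}$, and for every $v=u\oplus u^{\perp}\in\iota_{u^{\perp}}(\operatorname{Gr}(M_{\mathbb{R}}))$ we have \[\Phi_{L}(F;v,p_{v})=\Phi_{M}\big(\Theta_{(L,M)}(F;u^{\perp},p_{u^{\perp}});u,p_{u}\big).\]
   Context: A lattice $L$ is a free $\mathbb{Z}$-module of finite rank with a non-degenerate symmetric bilinear form $(\cdot,\cdot)$; write $\lambda^{2}=(\lambda,\lambda)$; $L$ is even if $\lambda^{2}\in2\mathbb{Z}$ for all $\lambda\in L$. $L^{*}=\{\nu\in L_{\mathbb{R}}:(\nu,L)\subseteq\mathbb{Z}\}$, $D_{L}=L^{*}/L$ with induced $\mathbb{Q}/\mathbb{Z}$-valued bilinear form and quadratic form $\gamma\mapsto\gamma^{2}/2$; $\mathbb{C}[D_{L}]$ has basis $\{\mathfrak{e}_{\gamma}\}_{\gamma\in D_{L}}$. Write $\mathbf{e}(w)=e^{2\pi iw}$. $\operatorname{Mp}_{2}(\mathbb{R})$ is the set of pairs $(A,\phi)$ with $A\in\operatorname{SL}_{2}(\mathbb{R})$ and $\phi$ holomorphic on $\mathcal{H}$ with $\phi(\tau)^{2}=c\tau+d$ where $A=\binom{a\ b}{c\ d}$, with product $(A,\phi)(B,\psi)=(AB,(\phi\circ B)\psi)$; $\operatorname{Mp}_{2}(\mathbb{Z})$ is the preimage of $\operatorname{SL}_{2}(\mathbb{Z})$, generated by $T=(\binom{1\ 1}{0\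 1},1)$ and $S=(\binom{0\ -1}{1\ \ 0},\sqrt{\tau})$. The Weil representation $\rho_{L}$ of $\operatorname{Mp}_{2}(\mathbb{Z})$ on $\mathbb{C}[D_{L}]$ is given by $\rho_{L}(T)\mathfrak{e}_{\gamma}=\mathbf{e}(\gamma^{2}/2)\mathfrak{e}_{\gamma}$ and $\rho_{L}(S)\mathfrak{e}_{\gamma}=\frac{\mathbf{e}((b_{-}-b_{+})/8)}{\sqrt{|D_{L}|}}\sum_{\delta\in D_{L}}\mathbf{e}(-(\gamma,\delta))\mathfrak{e}_{\delta}$, where $(b_{+},b_{-})$ is the signature of $L$. $L(-1)$ is $L$ with negated form; $D_{L(-1)}=D_{L}$ as groups, the basis of $\mathbb{C}[D_{L(-1)}]$ is written $\{\mathfrak{e}^{*}_{\gamma}\}$, and $\langle\cdot,\cdot\rangle_{L}$ is the bilinear pairing $\mathbb{C}[D_{L}]\times\mathbb{C}[D_{L(-1)}]\to\mathbb{C}$ with $\langle\mathfrak{e}_{\gamma},\mathfrak{e}^{*}_{\delta}\rangle_{L}=1$ if $\gamma=\delta$ and $0$ otherwise; $\rho_{L(-1)}$ is then the dual representation $\rho_{L}^{*}$. We identify $\mathbb{C}[D_{L_{1}\oplus L_{2}}]=\mathbb{C}[D_{L_{1}}]\otimes\mathbb{C}[D_{L_{2}}]$, and $\langle\cdot,\cdot\rangle_{L}$ is extended to tensor products by pairing only the $\mathbb{C}[D_{L}]$- and $\mathbb{C}[D_{L(-1)}]$-factors. A function $G:\mathcal{H}\to V$ transforms like a modular form of weight $k$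 and representation $\rho$ if $G(A\tau)=\phi(\tau)^{2k}\rho((A,\phi))G(\tau)$ for all $(A,\phi)\in\operatorname{Mp}_{2}(\mathbb{Z})$. $\operatorname{Gr}(L_{\mathbb{R}})$ is the set of decompositions $L_{\mathbb{R}}=v_{+}\oplus v_{-}$ with $v_{+}$ positive definite, $v_{-}$ negative definite, $v_{+}\perp v_{-}$; $\lambda_{v_{\pm}}$ denote orthogonal projections. A polynomial $p$ on $L_{\mathbb{R}}$ is homogeneous of degree $(m_{+},m_{-})$ with respect to $v$ if $p(c_{+}\lambda_{v_{+}}+c_{-}\lambda_{v_{-}})=c_{+}^{m_{+}}c_{-}^{m_{-}}p(\lambda)$ for all $\lambda$ and scalars $c_{\pm}$. $\Delta_{v}$ is the Laplacian of the positive definite majorant $\lambda\mapsto\lambda_{v_{+}}^{2}-\lambda_{v_{-}}^{2}$, and $e^{c\Delta_{v}}=\sum_{j\ge0}\frac{c^{j}}{j!}\Delta_{v}^{j}$ on polynomials. For $\tau=x+iy\in\mathcal{H}$: $\Theta_{L}(\tau;v,p_{v})=y^{b_{-}/2+m_{-}}\sum_{\lambda\in L^{*}}e^{-\Delta_{v}/(8\pi y)}(p_{v})(\lambda)\,\mathbf{e}\big(\tau\frac{\lambda_{v_{+}}^{2}}{2}+\bar\tau\frac{\lambda_{v_{-}}^{2}}{2}\big)\mathfrak{e}_{\lambda+L}$. For a primitive non-degenerate sub-lattice $M$ of signature $(c_{+},c_{-})$, $u\in\operatorname{Gr}(M_{\mathbb{R}})$, $u^{\perp}\in\operatorname{Gr}(M_{\mathbb{R}}^{\perp})$,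 $u\oplus u^{\perp}\in\operatorname{Gr}(L_{\mathbb{R}})$ is $(u_{+}\oplus u^{\perp}_{+})\oplus(u_{-}\oplus u^{\perp}_{-})$; polynomials on $M_{\mathbb{R}}$ or $M_{\mathbb{R}}^{\perp}$ are regarded as polynomials on $L_{\mathbb{R}}$ via orthogonal projection. The orthogonal projection $L_{\mathbb{R}}\to M_{\mathbb{R}}$ maps $L^{*}$ onto $M^{*}$, inducing $\pi_{M}:L^{*}/M\to D_{M}$. Define the $\mathbb{C}[D_{L}]\otimes\mathbb{C}[D_{M(-1)}]$-valued function $\Theta_{L,M}(\tau;u^{\perp},p_{u^{\perp}})=y^{\frac{b_{-}-c_{-}}{2}+m_{-}-n_{-}}\sum_{\delta\in D_{M}}\sum_{\lambda\in L^{*}/M,\ \pi_{M}(\lambda)=\delta}e^{-\Delta_{u^{\perp}}/(8\pi y)}(p_{u^{\perp}})(\lambda_{M_{\mathbb{R}}^{\perp}})\,\mathbf{e}\big(\tau\frac{(\lambda_{M_{\mathbb{R}}^{\perp}})_{u^{\perp}_{+}}^{2}}{2}+\bar\tau\frac{(\lambda_{M_{\mathbb{R}}^{\perp}})_{u^{\perp}_{-}}^{2}}{2}\big)\mathfrak{e}_{\lambda+L}\otimes\mathfrak{e}^{*}_{\delta}$, with $p_{u^{\perp}}$ homogeneous of degree $(m_{+}-n_{+},m_{-}-n_{-})$ w.r.t. $u^{\perp}$. Theta lift: with $\mathcal{F}=\{\tau\in\mathcal{H}:|x|\le\frac12,|\tau|\ge1\}$ and $\mathcal{F}_{Y}=\{\tau\in\mathcal{F}:y\le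 Y\}$, for $F$ of weight $\frac{b_{-}-b_{+}}{2}+m_{-}-m_{+}$ and representation $\rho_{L}^{*}$, $\Phi_{L}(F;v,p_{v}):=\operatorname{CT}_{s=0}\lim_{Y\to\infty}\int_{\mathcal{F}_{Y}}\langle\Theta_{L}(\tau;v,p_{v}),F(\tau)\rangle_{L}\,y^{-s}\frac{dx\,dy}{y^{2}}$, defined when the limit is holomorphic in $s$ on a right half-plane with meromorphic continuation to $\mathbb{C}$; $\operatorname{CT}_{s=0}$ is the constant term of the Laurent expansion at $s=0$. $\Phi_{M}$ is defined in the same way for $M$. *)

(* Defs.v *)
From HB Require Import structures.
From mathcomp Require Import all_boot all_order all_algebra.
From mathcomp Require Import generic_quotient ring_quotient.
From mathcomp Require Import all_classical all_reals all_analysis.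
From mathcomp Require Import complex.
From mathcomp Require summability.
(* Only the structures of multinomials: its notations clash with those of
   analysis. *)
From mathcomp Require Import(canonicals, coercions, hints) mpoly.

Set Implicit Arguments.
Unset Strict Implicit.
Unset Printing Implicit Defensive.

Import Order.TTheory GRing.Theory Num.Theory.
Import numFieldNormedType.Exports.

Local Open Scope classical_set_scope.
Local Open Scope ring_scope.
Local Open Scope complex_scope.

(** * Lattices *)

(* Z^rank, as row vectors, with the Gram matrix of the form; a choice of a
   Z-basis brings every even lattice to this shape, since a form with even
   norms has integral values.  L_R is 'rV[R]_(rank L). *)
Record lattice := Lattice {
  rank : nat;
  gram : 'M[int]_rank;
  gram_sym : gram^T = gram;
  gram_nondeg : \det gram != 0 }.

(* A non-degenerate sub-lattice, given by a Z-basis: the rows of sub_emb. *)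
Record sublattice (L : lattice) := Sublattice {
  sub_lattice :> lattice;
  sub_emb : 'M[int]_(rank sub_lattice, rank L);
  sub_gram : gram sub_lattice = sub_emb *m gram L *m sub_emb^T }.

Definition even_lattice (L : lattice) : Prop :=
  forall x : 'rV[int]_(rank L), (2 %| (x *m gram L *m x^T) ord0 ord0)%Z.

Definition in_sublattice (L : lattice) (M : sublattice L)
    (x : 'rV[int]_(rank L)) : Prop :=
  exists z : 'rV[int]_(rank M), x = z *m sub_emb M.

(* L/M is torsion-free *)
Definition primitive (L : lattice) (M : sublattice L) : Prop :=
  forall (d : int) (x : 'rV[int]_(rank L)),
    d != 0 -> in_sublattice M (d *: x) -> in_sublattice M x.

Definition is_orth_complement (L : lattice) (M N : sublattice L) : Prop :=
  forall x : 'rV[int]_(rank L),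
    in_sublattice N x <-> x *m gram L *m (sub_emb M)^T = 0.

Section RealSpaces.
Variable R : realType.
Local Notation C := R[i].

Definition gramR (L : lattice) : 'M[R]_(rank L) := map_mx intr (gram L).

Definition embR (L : lattice) (M : sublattice L) : 'M[R]_(rank M, rank L) :=
  map_mx intr (sub_emb M).

Definition form n (Q : 'M[R]_n) (x y : 'rV[R]_n) : R := (x *m Q *m y^T) 0 0.

(* The coordinates, in the basis of M, of the orthogonal projection to M_R. *)
Definition orth_proj (L : lattice) (M : sublattice L) (x : 'rV[R]_(rank L)) :
    'rV[R]_(rank M) :=
  x *m gramR L *m (embR M)^T *m invmx (gramR M).

Lemma gramR_unit (L : lattice) : gramR L \in unitmx.
Proof.
by rewrite unitmxE unitfE /gramR det_map_mx intr_eq0 gram_nondeg.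
Qed.

Lemma gramR_sub (L : lattice) (M : sublattice L) :
  gramR M = embR M *m gramR L *m (embR M)^T.
Proof. by rewrite /gramR sub_gram !map_mxM map_trmx. Qed.

Lemma orth_projP (L : lattice) (M : sublattice L) (x : 'rV[R]_(rank L))
    (y : 'rV[R]_(rank M)) :
  form (gramR L) (x - orth_proj M x *m embR M) (y *m embR M) = 0.
Proof.
rewrite /form trmx_mul mulmxA mulmxBl -mulmxBl mulmxBl.
rewrite -(mulmxA (orth_proj M x)) mulmxBl -(mulmxA (orth_proj M x)).
by rewrite -gramR_sub mulmxKV ?gramR_unit// subrr mul0mx mxE.
Qed.

(** * The Grassmannian *)

(* A decomposition v_+ (+) v_- is the pair (v_+, v_-). *)
Definition decomp (n : nat) : Type :=
  ({vspace 'rV[R]_n} * {vspace 'rV[R]_n})%type.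

Definition Gr n (Q : 'M[R]_n) : set (decomp n) :=
  [set v | [/\ (v.1 + v.2)%VS = fullv, (v.1 :&: v.2)%VS = 0%VS,
     forall x, x \in v.1 -> x != 0 -> 0 < form Q x x,
     forall x, x \in v.2 -> x != 0 -> form Q x x < 0 &
     forall x y, x \in v.1 -> y \in v.2 -> form Q x y = 0]].

Definition has_signature (L : lattice) (bp bm : nat) : Prop :=
  exists v, [/\ Gr (gramR L) v, \dim v.1 = bp & \dim v.2 = bm].

(* For v in Gr, the projection to v_+ along v_- is the orthogonal one. *)
Definition projp n (v : decomp n) (x : 'rV[R]_n) : 'rV[R]_n :=
  daddv_pi v.1 v.2 x.
Definition projm n (v : decomp n) (x : 'rV[R]_n) : 'rV[R]_n :=
  daddv_pi v.2 v.1 x.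

(* u (+) u^perp *)
Definition oplus (L : lattice) (M N : sublattice L)
    (u : decomp (rank M)) (w : decomp (rank N)) : decomp (rank L) :=
  ((linfun (mulmxr (embR M)) @: u.1 + linfun (mulmxr (embR N)) @: w.1)%VS,
   (linfun (mulmxr (embR M)) @: u.2 + linfun (mulmxr (embR N)) @: w.2)%VS).

(** * Smoothness *)

Fixpoint Ck (k : nat) (V : normedModType R) (U : set V) (f : V -> R^o) : Prop :=
  (forall x, U x -> {for x, continuous f}) /\
  match k with
  | 0 => True
  | k'.+1 => forall d, (forall x, U x -> derivable f x d) /\ Ck k' U ('D_d f)
  end.

Definition smooth_on (V : normedModType R) (U : set V) (f : V -> R^o) : Prop :=
  forall k, Ck k U f.

(* v |-> (projection to v_+) embeds Gr as a submanifold of the space of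
   matrices; a function is smooth if it locally extends to a smooth function
   of the matrix. *)
Definition gr_mx n (v : decomp n) : 'M[R]_n := lin1_mx (projp v).

Definition smooth_Gr n (Q : 'M[R]_n) (f : decomp n -> R) : Prop :=
  forall v, Gr Q v -> exists (U : set 'M[R]_n) (g : 'M[R]_n -> R),
    [/\ open U, U (gr_mx v), smooth_on U g &
        forall w, Gr Q w -> U (gr_mx w) -> f w = g (gr_mx w)].

Definition upper : set C := [set t | 0 < complex.Im t].

Definition smooth_upper (D : finType) (F : C -> {ffun D -> C^o}) : Prop :=
  forall g : D,
    smooth_on [set z : R * R | 0 < z.2]
      (fun z => complex.Re (F (z.1 +i* z.2) g)) /\
    smooth_on [set z : R * R | 0 < z.2]
      (fun z => complex.Im (F (z.1 +i* z.2) g)).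

(** * Polynomials *)

Local Notation polyn n := (mpoly.mpoly n C).

Definition peval n (p : polyn n) (x : 'rV[R]_n) : C :=
  mpoly.meval (fun i => (x 0 i)%:C) p.

Definition homogeneous n (v : decomp n) (mp mm : nat) (p : polyn n) : Prop :=
  forall (x : 'rV[R]_n) (cp cm : R),
    peval p (cp *: projp v x + cm *: projm v x) =
    (cp ^+ mp * cm ^+ mm)%:C * peval p x.

Definition smooth_family n (Q : 'M[R]_n) (p : decomp n -> polyn n) : Prop :=
  forall m, smooth_Gr Q (fun v => complex.Re (mpoly.mcoeff m (p v))) /\
            smooth_Gr Q (fun v => complex.Im (mpoly.mcoeff m (p v))).

(* The Gram matrix of the positive definite majorant in the standard basis. *)
Definition majorant n (Q : 'M[R]_n) (v : decomp n) : 'M[R]_n :=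
  \matrix_(i, j)
    (form Q (projp v (delta_mx 0 i)) (projp v (delta_mx 0 j)) -
     form Q (projm v (delta_mx 0 i)) (projm v (delta_mx 0 j))).

(* The Laplacian of a metric with constant coefficients g_ij is
   sum g^ij d_i d_j. *)
Definition laplacian n (Q : 'M[R]_n) (v : decomp n) (p : polyn n) : polyn n :=
  \sum_(i < n) \sum_(j < n)
    (invmx (majorant Q v) i j)%:C *: mpoly.mderiv i (mpoly.mderiv j p).

(* The exponential series stops: Laplacians lower the degree, < msize p. *)
Definition exp_laplacian n (Q : 'M[R]_n) (v : decomp n) (c : R) (p : polyn n) :
    polyn n :=
  \sum_(j < mpoly.msize p) (c ^+ j / j`!%:R)%:C *: iter j (laplacian Q v) p.

(** * Complex functions *)

Definition cexp (z : C) : C :=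
  (expR (complex.Re z))%:C * (cos (complex.Im z) +i* sin (complex.Im z)).

Definition ebf (w : C) : C := cexp ((0 +i* (2 * pi)) * w).

Definition holomorphic_on (U : set C^o) (f : C^o -> C^o) : Prop :=
  forall z, U z -> derivable f z 1.

(* f has a Laurent expansion sum_(k >= -N) a_(k+N) (s - z)^k at z *)
Definition laurent (f : C^o -> C^o) (z : C^o) (N : nat) (a : nat -> C) : Prop :=
  \forall s \near z^',
    series (fun k => a k * (s - z) ^+ k : C^o) @ \oo --> (s - z) ^+ N * f s.

Definition meromorphic (f : C^o -> C^o) : Prop :=
  forall z, exists N a, laurent f z N a.

Definition constant_term (f : C^o -> C^o) (z : C^o) (c : C) : Prop :=
  exists N a, laurent f z N a /\ c = a N.

(** * Discriminant groups *)

Section Dual.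
Variable L : lattice.

Definition dual_pred : {pred 'rV[R]_(rank L)} :=
  [pred x | x *m gramR L \is a mxOver Num.int].

Lemma dual_pred_zmod : zmod_closed dual_pred.
Proof.
split=> [|x y]; rewrite !unfold_in /= ?mul0mx ?mulmxBl.
  by apply/mxOverP => i j; rewrite mxE rpred0.
move=> /mxOverP hx /mxOverP hy; apply/mxOverP => i j.
by rewrite [X in X \is a _]mxE [X in _ + X]mxE rpredB.
Qed.
HB.instance Definition _ :=
  GRing.isZmodClosed.Build 'rV[R]_(rank L) dual_pred dual_pred_zmod.

(* The dual lattice L^* in L_R. *)
Record dual := Dual { dual_val :> 'rV[R]_(rank L); _ : dual_val \in dual_pred }.
HB.instance Definition _ := [isSub for dual_val].
HB.instance Definition _ := [Choice of dual by <:].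
HB.instance Definition _ := [SubChoice_isSubZmodule of dual by <:].

(* L as a subgroup of L^* *)
Definition lat_pred : {pred dual} := [pred x | dual_val x \is a mxOver Num.int].

Lemma lat_pred_zmod : zmod_closed lat_pred.
Proof.
split=> [|x y]; rewrite !unfold_in /=.
  by apply/mxOverP => i j; rewrite mxE rpred0.
move=> /mxOverP hx /mxOverP hy; apply/mxOverP => i j.
by rewrite [X in X \is a _]mxE [X in _ + X]mxE rpredB.
Qed.
HB.instance Definition _ :=
  GRing.isZmodClosed.Build dual lat_pred lat_pred_zmod.

Definition discr : Type := {ideal_quot lat_pred}.
HB.instance Definition _ := Choice.on discr.
HB.instance Definition _ := GRing.Zmodule.on discr.

Definition dclass (x : dual) : discr := \pi_({ideal_quot lat_pred})%qT x.
Definition drepr (g : discr) : dual := repr (g : {ideal_quot lat_pred}).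

Lemma dclass_eq (x y : dual) :
  (dclass x == dclass y) = (dual_val x - dual_val y \is a mxOver Num.int).
Proof. by rewrite /dclass -Quotient.idealrBE unfold_in. Qed.

Lemma dreprK (g : discr) : dclass (drepr g) = g.
Proof. exact: reprK. Qed.

(* D_L is finite: L^* is contained in det(gram L)^-1 L. *)
Let N : nat := `|\det (gram L)|%N.

Lemma dual_scaled (x : dual) i : N%:R * dual_val x 0 i \is a Num.int.
Proof.
case: x => x xP /=; have /mxOverP hx : x *m gramR L \is a mxOver Num.int by [].
have adjint j k : (\adj (gramR L)) j k \is a Num.int.
  by rewrite /gramR -map_mx_adj mxE intr_int.
have hd : (\det (gram L))%:~R * x 0 i \is a Num.int.
  have -> : (\det (gram L))%:~R * x 0 i = (x *m gramR L *m \adj (gramR L)) 0 i.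
    by rewrite -mulmxA mul_mx_adj mul_mx_scalar mxE /gramR det_map_mx.
  by rewrite mxE rpred_sum// => j _; rewrite rpredM.
have [e|e] : N%:R = (\det (gram L))%:~R :> R \/
             N%:R = - (\det (gram L))%:~R :> R.
  rewrite /N; case: (\det _) => k; first by left.
  by right; rewrite NegzE abszN absz_nat rmorphN /= opprK.
- by rewrite e.
by rewrite e mulNr rpredN.
Qed.

Definition discr_code (g : discr) : {ffun 'I_(rank L) -> 'I_N.+1} :=
  [ffun i => inord (absz (modz (Num.floor (N%:R * dual_val (drepr g) 0 i)) N))].

Definition discr_decode (y : {ffun 'I_(rank L) -> 'I_N.+1}) : option discr :=
  omap dclass (insub (\row_i ((y i)%:R / N%:R))).

Lemma discr_codeK : pcancel discr_code discr_decode.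
Proof.
move=> g; rewrite /discr_decode; set r := \row_i _.
have N0 : N != 0%N by rewrite absz_eq0 gram_nondeg.
have N0R : N%:R != 0 :> R by rewrite pnatr_eq0.
have rE : dual_val (drepr g) - r \is a mxOver Num.int.
  apply/mxOverP => i j; rewrite ord1 !mxE ffunE.
  set x := dual_val _ 0 j; set k := Num.floor _.
  have kE : k%:~R = N%:R * x by rewrite floorK// dual_scaled.
  have m0 : (0 <= k %% N)%Z by rewrite modz_ge0// -absz_eq0 absz_nat.
  rewrite inordK; last first.
    by rewrite ltnS -lez_nat gez0_abs// ltW// ltz_pmod// ltz_nat lt0n.
  have -> : x = k%:~R / N%:R by rewrite kE mulrAC mulfV ?mul1r.
  rewrite -[X in _ - X / _]/(_%:Z%:~R) gez0_abs// -mulrBl -rmorphB /=.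
  rewrite {1}(divz_eq k N) addrK rmorphM /= mulfK//.
have rP : r \in dual_pred.
  rewrite -[r](subKr (dual_val (drepr g))).
  apply: rpredB; first exact: (valP (drepr g)).
  move: rE => /mxOverP rE; rewrite unfold_in; apply/mxOverP => i j.
  rewrite mxE rpred_sum// => k _; rewrite rpredM// ?rE//.
  by rewrite mxE intr_int.
rewrite (insubT (fun x => x \in dual_pred) rP) /=; congr Some.
by rewrite -[RHS]dreprK; apply/esym/eqP; rewrite dclass_eq.
Qed.

HB.instance Definition _ : isCountable discr := PCanIsCountable discr_codeK.
HB.instance Definition _ := fintype.isFinite.Build discr (pcan_enumP discr_codeK).

End Dual.
(* C[D_L], and also C[D_L(-1)], with bases e_g, resp. e^*_g *)
Local Notation CD L := {ffun discr L -> C^o}.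

Definition dbasis (L : lattice) (g : discr L) : CD L :=
  [ffun h => (h == g)%:R].

(* <.,.>_L *)
Definition pairing (L : lattice) (f h : CD L) : C :=
  \sum_g f g * h g.

(* Representatives of the Q/Z-valued quadratic (L is even) and bilinear forms
   on D_L. *)
Definition dquad (L : lattice) (g : discr L) : R :=
  form (gramR L) (drepr g) (drepr g) / 2.
Definition dbil (L : lattice) (g h : discr L) : R :=
  form (gramR L) (drepr g) (drepr h).

Local Notation mp2 := ('M[R]_2 * (C -> C))%type.

(** * The metaplectic group and the Weil representation *)

Definition moebius (A : 'M[R]_2) (t : C) : C :=
  ((A 0 0)%:C * t + (A 0 1)%:C) / ((A 1 0)%:C * t + (A 1 1)%:C).

(* The functions phi on the upper half-plane are extended by 0, so that equal
   elements of the group are equal pairs. *)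
Definition Mp2R : set mp2 :=
  [set g | [/\ \det g.1 = 1, holomorphic_on upper g.2,
     forall t, upper t -> g.2 t ^+ 2 = (g.1 1 0)%:C * t + (g.1 1 1)%:C &
     forall t, ~ upper t -> g.2 t = 0]].

Definition Mp2Z : set mp2 :=
  [set g | Mp2R g /\ exists A : 'M[int]_2, \det A = 1 /\ g.1 = map_mx intr A].

Definition on_upper (f : C -> C) (t : C) : C :=
  if 0 < complex.Im t then f t else 0.

Definition mp_mul (g h : mp2) : mp2 :=
  (g.1 *m h.1, on_upper (fun t => g.2 (moebius h.1 t) * h.2 t)).

Definition mp_one : mp2 := (1%:M, on_upper (fun=> 1)).

Definition mx22 (a b c d : R) : 'M[R]_2 :=
  \matrix_(i, j) (if i == 0 then (if j == 0 then a else b)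
                  else if j == 0 then c else d).

Definition mpT : mp2 := (mx22 1 1 0 1, on_upper (fun=> 1)).

(* sqrtc is the principal branch *)
Definition mpS : mp2 :=
  (mx22 0 (-1) 1 0, on_upper (fun t => sqrtc t)).

(* rho is the Weil representation: it exists, and is unique on Mp_2(Z), which S
   and T generate.  Its values outside Mp_2(Z) are irrelevant. *)
Definition is_weil_rep (L : lattice) (bp bm : nat)
    (rho : mp2 -> 'End(CD L)) : Prop :=
  [/\ rho mp_one = \1%VF,
      forall g h, Mp2Z g -> Mp2Z h -> rho (mp_mul g h) = (rho g \o rho h)%VF,
      forall g, rho mpT (dbasis g) = ebf (dquad g)%:C *: dbasis g &
      forall g, rho mpS (dbasis g) =
        (ebf ((bm%:R - bp%:R) / 8)%:C / (Num.sqrt #|{: discr L}|%:R)%:C) *: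
        \sum_h (ebf (- dbil g h)%:C *: dbasis h)].

(* <rho(g) f, rho^*(g) h> = <f, h> *)
Definition dual_rep (L : lattice)
    (rho : mp2 -> 'End(CD L))
    (g : mp2) (h : CD L) :
    CD L :=
  [ffun d => pairing ((rho g)^-1%VF (dbasis d)) h].

(* The weight k = k2 / 2 is given by the integer k2. *)
Definition modular (D : finType) (k2 : int)
    (rho : mp2 -> {ffun D -> C^o} -> {ffun D -> C^o})
    (G : C -> {ffun D -> C^o}) : Prop :=
  forall g, Mp2Z g -> forall t, upper t ->
    G (moebius g.1 t) = (g.2 t ^ k2) *: rho g (G t).

(** * Theta functions *)

(* e^(-Laplacian / 8 pi y)(p)(x) e(t x_+^2/2 + conj(t) x_-^2/2) *)
Definition theta_term n (Q : 'M[R]_n) (v : decomp n) (p : polyn n) (t : C)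
    (x : 'rV[R]_n) : C :=
  peval (exp_laplacian Q v (- (8 * pi * complex.Im t)^-1) p) x *
  ebf (t * (form Q (projp v x) (projp v x) / 2)%:C +
       conjc t * (form Q (projm v x) (projm v x) / 2)%:C).

Definition theta (L : lattice) (bm mm : nat) (v : decomp (rank L))
    (p : polyn (rank L)) (t : C) : CD L :=
  [ffun g =>
    (complex.Im t `^ (bm%:R / 2 + mm%:R))%:C *
    summability.sum (fun x : dual L =>
      theta_term (gramR L) v p t x * dbasis (dclass x) g : C^o)].

Section Contraction.
Variables (L : lattice) (M : sublattice L).

Lemma orth_proj_dual (x : dual L) : orth_proj M x \in @dual_pred M.
Proof.
case: x => x xP /=; move: xP; rewrite !unfold_in => /mxOverP xP.
rewrite /orth_proj mulmxKV ?gramR_unit//; apply/mxOverP => i j.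
rewrite mxE rpred_sum// => k _; rewrite rpredM ?xP//.
by rewrite !mxE intr_int.
Qed.

Definition dual_proj (x : dual L) : dual M := Dual (orth_proj_dual x).

(* M as a subgroup of L^* *)
Definition sub_pred : {pred dual L} :=
  [pred x | `[< exists z : 'rV[int]_(rank M),
                  dual_val x = map_mx intr (z *m sub_emb M) >]].

Lemma sub_pred_zmod : zmod_closed sub_pred.
Proof.
split=> [|x y]; rewrite !unfold_in /=.
  by apply/asboolP; exists 0; rewrite mul0mx map_mx0.
move=> /asboolP[a xa] /asboolP[b yb]; apply/asboolP; exists (a - b).
by rewrite mulmxBl map_mxB -xa -yb.
Qed.
HB.instance Definition _ :=
  GRing.isZmodClosed.Build (dual L) sub_pred sub_pred_zmod.

(* L^*/M *)
Definition dual_mod : Type := {ideal_quot sub_pred}.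
HB.instance Definition _ := Choice.on dual_mod.
Definition mrepr (x : dual_mod) : dual L := repr (x : {ideal_quot sub_pred}).

Definition piM (x : dual_mod) : discr M := dclass (dual_proj (mrepr x)).

(* An element of C[D_L] (x) C[D_M(-1)] is a function on D_L * D_M. *)
Definition theta_sub (N : sublattice L) (bm cm mm nm : nat)
    (w : decomp (rank N)) (p : polyn (rank N)) (t : C) :
    {ffun discr L * discr M -> C^o} :=
  [ffun gd =>
    (complex.Im t `^ ((bm%:R - cm%:R) / 2 + mm%:R - nm%:R))%:C *
    \sum_(d : discr M) summability.sum (fun x : dual_mod =>
      (if piM x == d then
         theta_term (gramR N) w p t (orth_proj N (mrepr x)) *
         (dbasis (dclass (mrepr x)) gd.1 * dbasis d gd.2)
       else 0) : C^o)].

(* <., .>_L on C[D_L] (x) C[D_M(-1)] times C[D_L(-1)] *)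
Definition pairing_sub (f : {ffun discr L * discr M -> C^o})
    (h : CD L) : CD M :=
  [ffun d => \sum_g f (g, d) * h g].

Definition theta_contraction (N : sublattice L) (bm cm mm nm : nat)
    (w : decomp (rank N)) (p : polyn (rank N)) (F : C -> CD L)
    (t : C) : CD M :=
  pairing_sub (theta_sub bm cm mm nm w p t) (F t).

End Contraction.

(** * Theta lifts *)

Definition fund_dom (Y : R) : set (R * R) :=
  [set z | [/\ `|z.1| <= 2^-1, 1 <= z.1 ^+ 2 + z.2 ^+ 2, 0 < z.2 & z.2 <= Y]].

Definition cintegral (D : set (R * R)) (f : R * R -> C) : C :=
  let mu := (lebesgue_measure \x lebesgue_measure)%E in
  (\int[mu]_(z in D) complex.Re (f z)) +i* (\int[mu]_(z in D) complex.Im (f z)).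

Definition truncated_lift (h : C -> C) (s : C) (Y : R) : C :=
  cintegral (fund_dom Y)
    (fun z => h (z.1 +i* z.2) * cexp (- s * (ln z.2)%:C) * (z.2 ^- 2)%:C).

(* c is the constant term at s = 0 of the continuation of
   lim_Y truncated_lift h s Y, which converges to a holomorphic function for
   Re s > a *)
Definition is_regularized_integral (h : C -> C) (c : C) : Prop :=
  exists (a : R) (Phi : C^o -> C^o),
    [/\ forall s, a < complex.Re s ->
          (truncated_lift h s Y : C^o) @[Y --> +oo%R] --> Phi s,
        holomorphic_on [set s | a < complex.Re s] Phi,
        meromorphic Phi & constant_term Phi 0 c].

Definition lift_integrand (L : lattice) (bm mm : nat)
    (F : C -> CD L) (v : decomp (rank L))
    (p : polyn (rank L)) (t : C) : C :=
  pairing (theta bm mm v p t) (F t).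

Definition theta_lift_defined (L : lattice) (bm mm : nat)
    (F : C -> CD L) (v : decomp (rank L))
    (p : polyn (rank L)) : Prop :=
  exists c, is_regularized_integral (lift_integrand bm mm F v p) c.

Definition theta_lift (L : lattice) (bm mm : nat)
    (F : C -> CD L) (v : decomp (rank L))
    (p : polyn (rank L)) : C :=
  xget 0 [set c | is_regularized_integral (lift_integrand bm mm F v p) c].

End RealSpaces.

(* Main.v *)
Require Import Defs.
From mathcomp Require Import all_boot all_order all_algebra.
From mathcomp Require Import finmap.
From mathcomp Require Import generic_quotient ring_quotient.
From mathcomp Require Import all_classical all_reals all_analysis.
From mathcomp Require Import complex ring lra zify.
From mathcomp Require summability.
From mathcomp Require Import(canonicals, coercions, hints) mpoly.

Set Implicit Arguments.
Unset Strict Implicit.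
Unset Printing Implicit Defensive.

Import Order.TTheory GRing.Theory Num.Theory.
Import numFieldNormedType.Exports.
Import Defs.
Local Open Scope ring_scope.
Local Open Scope complex_scope.

(* A vector of L^* is the sum of its projections to M^* and N^*, where N is the
   orthogonal complement of M.  Along v = u + w the quadratic form, and, because
   the Laplacian of the majorant is the sum of those of M and N, also the factor
   exp(-Laplacian / 8 pi y)(p) split accordingly.  Hence <Theta_L, F> is a sum
   over the pairs (m, n) in M^* x N^* with m + n in L^*; summing over n first
   gives the pairing of Theta_M with the theta contraction.  The two integrands
   agree at every point, so the regularized integrals agree.

   Modularity is checked on S and T; this is enough, because S and T generate
   Mp_2(Z): a word in them reaches every element up to a sign of phi, which is
   constant by connectedness of the half-plane, and S^4 = (1, -1).  The law for
   S is that of the theta functions of the cosets of N, and the finite Fourier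
   transforms on D_M x D_N and on D_L are compared by gluing.  The inversion
   formula itself comes from the Jacobi identity in one variable (finite Fourier
   inversion on Riemann sums of a Gaussian), by induction on the number of
   variables through Schur complements, with polynomial coefficients from the
   Taylor coefficients in the characteristic. *)

(** No integral is evaluated. The limit of the Gaussian Riemann sums is read off from the case c =
    1, b = 0, where both sides of the inversion formula are the same nonzero series. In the same
    spirit the constant 1 / sqrt |D_N| comes from the law at its fixed point t = i, applied twice to
    a positive theta constant, and the index of M + N in L from two evaluations of one character
    sum. The obstacle is the choice of square roots. The multiplier in several variables,
    [invsqrt_det], is built from iterated pivots; only its square is a determinant, and its sign is
    followed along a path to i, where the matrix is real. The operator e^(-Laplacian / 8 pi y) makes
    polynomials compatible with inversion: the quadratic term that inversion adds to the exponent is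
    exactly compensated by the change of 1 / y. Homogeneity then turns the remaining linear
    substitution into a scalar. Since [dual_rep] contains an inverse of [rho g], the laws are proved
    in the transposed form of [dual_law]. *)

Section ComplexAbs.
Variable R : realType.
Local Notation C := R[i].

Implicit Types z w : C.

Definition cabs z : R := Num.sqrt (complex.Re z ^+ 2 + complex.Im z ^+ 2).

Lemma ReD z w : complex.Re (z + w) = complex.Re z + complex.Re w.
Proof. by case: z w => [a b] [c d]. Qed.
Lemma ImD z w : complex.Im (z + w) = complex.Im z + complex.Im w.
Proof. by case: z w => [a b] [c d]. Qed.
Lemma ReN z : complex.Re (- z) = - complex.Re z.
Proof. by case: z. Qed.
Lemma ImN z : complex.Im (- z) = - complex.Im z.
Proof. by case: z. Qed.
Lemma ReM z w : complex.Re (z * w) =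
  complex.Re z * complex.Re w - complex.Im z * complex.Im w.
Proof. by case: z w => [a b] [c d]. Qed.
Lemma ImM z w : complex.Im (z * w) =
  complex.Re z * complex.Im w + complex.Im z * complex.Re w.
Proof. by case: z w => [a b] [c d]. Qed.
Lemma complex_eq z w : complex.Re z = complex.Re w -> complex.Im z = complex.Im w -> z = w.
Proof. by case: z w => [a b] [c d] /= -> ->. Qed.
Lemma Re_sum (I : Type) (s : seq I) (f : I -> C) :
  complex.Re (\sum_(i <- s) f i) = \sum_(i <- s) complex.Re (f i).
Proof. by elim/big_rec2: _ => // i a b _ <-; rewrite ReD. Qed.
Lemma Im_sum (I : Type) (s : seq I) (f : I -> C) :
  complex.Im (\sum_(i <- s) f i) = \sum_(i <- s) complex.Im (f i).
Proof. by elim/big_rec2: _ => // i a b _ <-; rewrite ImD. Qed.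

Lemma cabsE z : (cabs z)%:C = `|z|.
Proof. by rewrite normc_def. Qed.

Lemma cabs_ge0 z : 0 <= cabs z.
Proof. exact: sqrtr_ge0. Qed.

Lemma cabsM z w : cabs (z * w) = cabs z * cabs w.
Proof. by apply: (@complexI R); rewrite rmorphM /= !cabsE normrM. Qed.

Lemma cabsV z : cabs z^-1 = (cabs z)^-1.
Proof. by apply: (@complexI R); rewrite fmorphV /= !cabsE normfV. Qed.

Lemma cabsD z w : cabs (z + w) <= cabs z + cabs w.
Proof. by rewrite -lecR rmorphD /= !cabsE ler_normD. Qed.

Lemma cabsN z : cabs (- z) = cabs z.
Proof. by apply: (@complexI R); rewrite !cabsE normrN. Qed.

Lemma cabsB z w : cabs (z - w) <= cabs z + cabs w.
Proof. by rewrite -(cabsN w) cabsD. Qed.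

Lemma cabsBC z w : cabs (z - w) = cabs (w - z).
Proof. by rewrite -cabsN opprB. Qed.

Lemma cabs_tri w z v : cabs (z - v) <= cabs (z - w) + cabs (w - v).
Proof. by rewrite -[z - v](subrKA w) cabsD. Qed.

Lemma cabs0 : cabs 0 = 0.
Proof. by apply: (@complexI R); rewrite cabsE normr0. Qed.

Lemma cabs1 : cabs 1 = 1.
Proof. by apply: (@complexI R); rewrite cabsE normr1. Qed.

Lemma cabs_eq0 z : (cabs z == 0) = (z == 0).
Proof. by rewrite -(inj_eq (@complexI R)) cabsE normr_eq0. Qed.

Lemma cabs_gt0 z : (0 < cabs z) = (z != 0).
Proof. by rewrite lt_def cabs_eq0 cabs_ge0 andbT. Qed.

Lemma cabsX z n : cabs (z ^+ n) = cabs z ^+ n.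
Proof. by elim: n => [|n IH]; rewrite ?expr0 ?cabs1// !exprS cabsM IH. Qed.

Lemma cabs_real (x : R) : cabs x%:C = `|x|.
Proof. by rewrite /cabs /= expr0n addr0 sqrtr_sqr. Qed.

Lemma cabs_nat n : cabs n%:R = n%:R.
Proof. by apply: (@complexI R); rewrite cabsE normr_nat rmorph_nat. Qed.

Lemma cabs_conj (z : C) : cabs (conjc z) = cabs z.
Proof. by case: z => a b; rewrite /cabs /= sqrrN. Qed.

Lemma mul_conj (z : C) : z * conjc z = (cabs z ^+ 2)%:C.
Proof. by rewrite -sqr_normc -cabsE rmorphXn. Qed.

Lemma Re_le_cabs z : `|complex.Re z| <= cabs z.
Proof. by rewrite -sqrtr_sqr ler_sqrt ?lerDl ?addr_ge0 ?sqr_ge0. Qed.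

Lemma Im_le_cabs z : `|complex.Im z| <= cabs z.
Proof. by rewrite -sqrtr_sqr ler_sqrt ?lerDr ?addr_ge0 ?sqr_ge0. Qed.

Lemma cabs_le_ReIm z : cabs z <= `|complex.Re z| + `|complex.Im z|.
Proof.
rewrite -[leRHS]ger0_norm ?addr_ge0// -sqrtr_sqr ler_sqrt ?sqr_ge0//.
rewrite sqrrD !real_normK ?num_real// addrAC lerDl.
by rewrite mulrn_wge0// mulr_ge0.
Qed.

Lemma cabs_sum (I : Type) (s : seq I) (f : I -> C) :
  cabs (\sum_(i <- s) f i) <= \sum_(i <- s) cabs (f i).
Proof.
elim/big_rec2: _ => [|i a b _ h]; first by rewrite cabs0.
by rewrite (le_trans (cabsD _ _))// lerD2l.
Qed.

End ComplexAbs.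

(** * Absolutely summable families of complex numbers *)

Section Families.
Variable R : realType.
Local Notation C := R[i].

(** Finite subsets are represented by duplicate-free lists, so index types need no order and no
    enumeration. Absolute summability is boundedness of these finite sums, and [evt] is the filter
    of finite subsets containing a given one. *)
Definition sbound (I : choiceType) (g : I -> R) (B : R) : Prop :=
  forall s : seq I, uniq s -> \sum_(i <- s) g i <= B.

Definition asum (I : choiceType) (f : I -> C) : Prop :=
  exists B, sbound (fun i => cabs (f i)) B.

Definition evt (I : choiceType) (P : seq I -> Prop) : Prop :=
  exists s0 : seq I, forall s, uniq s -> {subset s0 <= s} -> P s.

Definition has_sum (I : choiceType) (f : I -> C) (l : C) : Prop :=
  forall e, 0 < e -> evt (fun s => cabs (\sum_(i <- s) f i - l) < e).

Definition tsum (I : choiceType) (f : I -> C) : C :=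
  xget 0 [set l | has_sum f l]%classic.

Section Basic.
Variable I : choiceType.
Implicit Types (f g : I -> C) (P Q : seq I -> Prop).

Lemma evtI P Q : evt P -> evt Q -> evt (fun s => P s /\ Q s).
Proof.
move=> [s hs] [t ht]; exists (s ++ t) => r ur hr.
by split; [apply: hs|apply: ht] => // i hi; apply: hr; rewrite mem_cat hi ?orbT.
Qed.

Lemma evtW P Q : (forall s, P s -> Q s) -> evt P -> evt Q.
Proof. by move=> h [s hs]; exists s => t ut st; apply/h/hs. Qed.

Lemma evt_ex P : evt P -> exists s, uniq s /\ P s.
Proof.
move=> [s hs]; exists (undup s); split; first exact: undup_uniq.
by apply: hs; rewrite ?undup_uniq// => i; rewrite mem_undup.
Qed.

Lemma has_sum_unique f l l' : has_sum f l -> has_sum f l' -> l = l'.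
Proof.
move=> h h'; apply/eqP; rewrite -subr_eq0 -cabs_eq0; apply/eqP.
apply: le_anti; rewrite cabs_ge0 andbT; apply/ler_addgt0Pr => e e0.
rewrite add0r.
have e2 : 0 < e / 2 by rewrite divr_gt0.
have [s [_ [a b]]] := evt_ex (evtI (h _ e2) (h' _ e2)).
rewrite (le_trans (cabs_tri (\sum_(i <- s) f i) _ _))// cabsBC.
by rewrite ltW// [ltRHS]splitr ltrD.
Qed.

Lemma has_sum_tsum f l : has_sum f l -> tsum f = l.
Proof. by move=> h; apply: xget_unique => // l' h'; apply: has_sum_unique h' h. Qed.

Lemma eq_has_sum f g l : f =1 g -> has_sum f l -> has_sum g l.
Proof.
move=> fg h e e0; apply: evtW (h e e0) => s.
by rewrite (eq_bigr g)// => i _; rewrite fg.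
Qed.

Lemma eq_tsum f g : f =1 g -> tsum f = tsum g.
Proof. by move=> /funext ->. Qed.

Lemma has_sumD f g l m :
  has_sum f l -> has_sum g m -> has_sum (fun i => f i + g i) (l + m).
Proof.
move=> hf hg e e0; have e2 : 0 < e / 2 by rewrite divr_gt0.
apply: evtW (evtI (hf _ e2) (hg _ e2)) => s [a b].
rewrite big_split /= opprD addrACA (le_lt_trans (cabsD _ _))//.
by rewrite [ltRHS]splitr ltrD.
Qed.

Lemma has_sumZ c f l : has_sum f l -> has_sum (fun i => c * f i) (c * l).
Proof.
move=> hf e e0.
have c1 : 0 < cabs c + 1 by rewrite ltr_wpDl ?cabs_ge0.
apply: evtW (hf _ (divr_gt0 e0 c1)) => s a.
rewrite -big_distrr -mulrBr cabsM.
apply: (@le_lt_trans _ _ ((cabs c + 1) * cabs (\sum_(i <- s) f i - l))).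
  by rewrite ler_wpM2r ?cabs_ge0// lerDl.
by rewrite mulrC -ltr_pdivlMr.
Qed.

Lemma has_sum0 : has_sum (fun _ : I => 0 : C) (0 : C).
Proof. by move=> e e0; exists [::] => s _ _; rewrite big1// subrr cabs0. Qed.

Lemma has_sumN f l : has_sum f l -> has_sum (fun i => - f i) (- l).
Proof.
move=> /(has_sumZ (-1)); rewrite mulN1r; apply: eq_has_sum => i.
by rewrite mulN1r.
Qed.

Lemma has_sumB f g l m :
  has_sum f l -> has_sum g m -> has_sum (fun i => f i - g i) (l - m).
Proof. by move=> hf /has_sumN; apply: has_sumD. Qed.

Lemma has_sum_sum (K : Type) (s : seq K) (P : pred K) (f : K -> I -> C) (l : K -> C) :
  (forall k, P k -> has_sum (f k) (l k)) ->
  has_sum (fun i => \sum_(k <- s | P k) f k i) (\sum_(k <- s | P k) l k).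
Proof.
move=> h; elim: s => [|k s IH].
  by rewrite big_nil; apply: eq_has_sum has_sum0 => i; rewrite big_nil.
rewrite big_cons; case: ifP => Pk.
  by apply: eq_has_sum (has_sumD (h k Pk) IH) => i; rewrite big_cons Pk.
by apply: eq_has_sum IH => i; rewrite big_cons Pk.
Qed.

Lemma has_sum_fin (s : seq I) f : uniq s -> (forall i, i \notin s -> f i = 0) ->
  has_sum f (\sum_(i <- s) f i).
Proof.
move=> us f0 e e0; exists s => t ut st.
suff -> : \sum_(i <- t) f i = \sum_(i <- s) f i by rewrite subrr cabs0.
rewrite (bigID (mem s)) /= addrC big1 ?add0r//.
rewrite -big_filter; apply/perm_big/uniq_perm => //; first exact: filter_uniq.
move=> i; rewrite mem_filter /=; case: (boolP (i \in s)) => //= /st //.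
Qed.

Lemma sbound_sub (g : I -> R) (s t : seq I) : (forall i, 0 <= g i) ->
  uniq s -> uniq t -> {subset s <= t} ->
  \sum_(i <- s) g i <= \sum_(i <- t) g i.
Proof.
move=> g0 us ut st; rewrite [leRHS](bigID (mem s)) /=.
rewrite -[leLHS]addr0 lerD ?sumr_ge0//.
rewrite -[leRHS]big_filter le_eqVlt; apply/orP; left; apply/eqP.
apply/perm_big/uniq_perm => //; first exact: filter_uniq.
by move=> i; rewrite mem_filter /=; case: (boolP (i \in s)) => //= /st ->.
Qed.

(** The finite sums have a supremum. A list [s] within e of it exhausts the family up to e, since
    any disjoint list can be appended to [s] without exceeding the supremum. *)
Lemma sbound_tail (g : I -> R) B : (forall i, 0 <= g i) -> sbound g B ->
  forall e, 0 < e -> exists s0, uniq s0 /\ forall s, uniq s ->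
    (forall i, i \in s -> i \notin s0) -> \sum_(i <- s) g i <= e.
Proof.
move=> g0 gB e e0.
pose A := [set x | exists2 s : seq I, uniq s & x = \sum_(i <- s) g i]%classic.
have hA : has_sup A.
  split; first by exists 0, [::]; rewrite ?big_nil.
  by exists B => _ [s us ->]; apply: gB.
have [_ [s us ->] hs] := sup_adherent e0 hA.
exists s; split=> // t ut ts.
have : \sum_(i <- s ++ t) g i <= sup A.
  apply: sup_upper_bound => //; exists (s ++ t) => //.
  rewrite cat_uniq us ut andbT /=; apply/hasPn => i /ts //.
rewrite big_cat /=; lra.
Qed.

Lemma has_sum_nneg (g : I -> R) B : (forall i, 0 <= g i) -> sbound g B ->
  exists l, has_sum (fun i => (g i)%:C) l.
Proof.
move=> g0 gB.
pose A := [set x | exists2 s : seq I, uniq s & x = \sum_(i <- s) g i]%classic.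
have hA : has_sup A.
  split; first by exists 0, [::]; rewrite ?big_nil.
  by exists B => _ [s us ->]; apply: gB.
exists (sup A)%:C => e e0.
have [_ [s us ->] hs] := sup_adherent e0 hA.
exists s => t ut st; rewrite -rmorph_sum -rmorphB cabs_real.
have h1 : \sum_(i <- t) g i <= sup A.
  by apply: sup_upper_bound => //; exists t.
have h2 := sbound_sub g0 us ut st.
by rewrite ler0_norm ?subr_le0//; lra.
Qed.

Lemma sbound_le (g h : I -> R) B : (forall i, g i <= h i) -> sbound h B -> sbound g B.
Proof. by move=> gh hB s us; apply: le_trans (hB s us); apply: ler_sum. Qed.

Lemma sboundZ c (g : I -> R) B : 0 <= c -> sbound g B -> sbound (fun i => c * g i) (c * B).
Proof. by move=> c0 h s us; rewrite -big_distrr ler_wpM2l//; apply: h. Qed.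

Lemma sboundD (g h : I -> R) A B :
  sbound g A -> sbound h B -> sbound (fun i => g i + h i) (A + B).
Proof. by move=> a b s us; rewrite big_split lerD// ?a ?b. Qed.

Lemma sbound_ge0 (g : I -> R) B : sbound g B -> 0 <= B.
Proof. by move=> /(_ [::] isT); rewrite big_nil. Qed.

Lemma asum_has_sum f : asum f -> has_sum f (tsum f).
Proof.
move=> [B hB].
suff [l hl] : exists l, has_sum f l by rewrite (has_sum_tsum hl).
(* With u the real or the imaginary part, u (f i) = p u i - n u i is a difference of two
   non-negative bounded families. *)
pose p (u : C -> R) i := `|u (f i)| + u (f i); pose n (u : C -> R) i := `|u (f i)|.
have hn u : (forall z, `|u z| <= cabs z) -> sbound (n u) B.
  by move=> hu; apply: sbound_le hB => i; apply: hu.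
have hp u : (forall z, `|u z| <= cabs z) -> sbound (p u) (B + B).
  move=> hu; apply: sboundD; first exact: hn.
  by apply: sbound_le (hn u hu) => i; apply: ler_norm.
have p0 u i : 0 <= p u i by rewrite /p addrC -lerBlDr sub0r lerNl -normrN ler_norm.
have [a ha] := has_sum_nneg (p0 _) (hp _ (@Re_le_cabs R)).
have [b hb] := has_sum_nneg (fun i => normr_ge0 _) (hn _ (@Re_le_cabs R)).
have [c hc] := has_sum_nneg (p0 _) (hp _ (@Im_le_cabs R)).
have [d hd] := has_sum_nneg (fun i => normr_ge0 _) (hn _ (@Im_le_cabs R)).
exists ((a - b) + 'i * (c - d)).
apply: eq_has_sum (has_sumD (has_sumB ha hb) (has_sumZ 'i (has_sumB hc hd))) => i.
by apply: complex_eq; rewrite !(ReD, ImD, ReN, ImN, ReM, ImM) /= /p /n /=; ring.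
Qed.

Lemma asum_le f g : (forall i, cabs (f i) <= cabs (g i)) -> asum g -> asum f.
Proof. by move=> h [B hB]; exists B; apply: sbound_le hB. Qed.

Lemma asum_ler f (g : I -> R) B : (forall i, cabs (f i) <= g i) -> sbound g B -> asum f.
Proof. by move=> h hB; exists B; apply: sbound_le hB. Qed.

Lemma asumZ c f : asum f -> asum (fun i => c * f i).
Proof.
move=> [B hB]; exists (cabs c * B); apply: sbound_le (sboundZ (cabs_ge0 c) hB) => i.
by rewrite cabsM.
Qed.

Lemma asumD f g : asum f -> asum g -> asum (fun i => f i + g i).
Proof.
move=> [A hA] [B hB]; exists (A + B); apply: sbound_le (sboundD hA hB) => i.
exact: cabsD.
Qed.

Lemma tsumZ c f : asum f -> tsum (fun i => c * f i) = c * tsum f.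
Proof. by move=> hf; apply/has_sum_tsum/has_sumZ/asum_has_sum. Qed.

Lemma tsumD f g : asum f -> asum g -> tsum (fun i => f i + g i) = tsum f + tsum g.
Proof. by move=> hf hg; apply/has_sum_tsum/has_sumD; apply/asum_has_sum. Qed.

Lemma tsumB f g : asum f -> asum g -> tsum (fun i => f i - g i) = tsum f - tsum g.
Proof. by move=> hf hg; apply/has_sum_tsum/has_sumB; apply/asum_has_sum. Qed.

Lemma tsum_sum (K : Type) (s : seq K) (P : pred K) (f : K -> I -> C) :
  (forall k, P k -> asum (f k)) ->
  tsum (fun i => \sum_(k <- s | P k) f k i) = \sum_(k <- s | P k) tsum (f k).
Proof.
by move=> h; apply/has_sum_tsum/has_sum_sum => k Pk; apply/asum_has_sum/h.
Qed.

Lemma tsum_bound f B : sbound (fun i => cabs (f i)) B -> cabs (tsum f) <= B.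
Proof.
move=> hB; apply/ler_addgt0Pr => e e0.
have af : asum f by exists B.
have [s [us hs]] := evt_ex (asum_has_sum af e0).
rewrite -[tsum f](subrK (\sum_(i <- s) f i)) addrC.
rewrite (le_trans (cabsD _ _))// lerD//.
  exact: le_trans (cabs_sum _ _) (hB s us).
by rewrite ltW// cabsBC.
Qed.

(** Dominated convergence for series. It permits the interchange of the limit of the mesh and the
    sum over frequencies in [jacobi_limit]. *)
Lemma tannery (fN : nat -> I -> C) f (g : I -> R) B :
  sbound g B -> (forall N i, cabs (fN N i) <= g i) ->
  (forall i e, 0 < e -> exists N0, forall N, (N0 <= N)%N -> cabs (fN N i - f i) < e) ->
  asum f /\
  forall e, 0 < e -> exists N0, forall N, (N0 <= N)%N ->
    cabs (tsum (fN N) - tsum f) < e.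
Proof.
move=> hg hN hf.
have fg i : cabs (f i) <= g i.
  apply/ler_addgt0Pr => e e0; have [N /(_ N (leqnn _)) h] := hf i e e0.
  rewrite -[f i](subrK (fN N i)) addrC (le_trans (cabsD _ _))// lerD//.
  by rewrite cabsBC ltW.
have af : asum f by apply: asum_ler hg.
split=> // e e0.
have g0 i : 0 <= g i by apply: le_trans (cabs_ge0 _) (fg i).
have e4 : 0 < e / 4 by rewrite divr_gt0.
have [s [us hs]] := sbound_tail g0 hg e4.
have [N0 hN0] : exists N0, forall N, (N0 <= N)%N ->
    \sum_(i <- s) cabs (fN N i - f i) < e / 4.
  elim: (s) (e / 4) e4 => [|i r IH] d d0.
    by exists 0%N => N _; rewrite big_nil.
  have d2 : 0 < d / 2 by rewrite divr_gt0.
  have [N1 h1] := hf i _ d2; have [N2 h2] := IH _ d2.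
  exists (maxn N1 N2) => N; rewrite geq_max => /andP[a b].
  by rewrite big_cons [ltRHS]splitr ltrD// ?h1 ?h2.
exists N0 => N hN1.
have aN : asum (fN N) by apply: asum_ler hg.
rewrite -tsumB//.
(* One quarter bounds the differences on the finite list [s]; outside it [fN N] and [f] are both
   dominated by [g], whose tail costs a quarter for each. *)
apply: (@le_lt_trans _ _ (e / 4 + (e / 4 + e / 4))); last by lra.
apply: tsum_bound => r ur.
rewrite (bigID (mem s)) /=; apply: lerD.
  apply: le_trans (ltW (hN0 N hN1)).
  rewrite -big_filter; apply: sbound_sub => // [i||i]; first exact: cabs_ge0.
  - exact: filter_uniq.
  by rewrite mem_filter => /andP[].
rewrite -big_filter; set r' := [seq _ <- _ | _].
have ur' : uniq r' by apply: filter_uniq.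
have hr' : forall i, i \in r' -> i \notin s by move=> i; rewrite mem_filter => /andP[].
apply: (@le_trans _ _ (\sum_(i <- r') (g i + g i))).
  by apply: ler_sum => i _; apply: le_trans (cabsB _ _) (lerD (hN _ _) (fg _)).
by rewrite big_split lerD//; apply: hs.
Qed.

End Basic.

Section Reindex.
Variables (I J : choiceType) (h : J -> I).
Hypothesis hinj : injective h.
Variable f : I -> C.
Hypothesis hsup : forall i, (forall j, h j <> i) -> f i = 0.

(** A finite list restricts to the image of [h] and pulls back along the injection. [F] takes values
    in any additive monoid, so that one list serves both real bounds and complex sums. *)
Lemma image_list (s : seq I) : uniq s -> exists t : seq J,
  [/\ uniq t, forall j, (j \in t) = (h j \in s) &
   forall (V : nmodType) (F : I -> V), (forall i, (forall j, h j <> i) -> F i = 0) ->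
   \sum_(i <- s) F i = \sum_(j <- t) F (h j)].
Proof.
move=> us; pose s' := [seq i <- s | `[< exists j, h j = i >]].
have [t e] : exists t : seq J, map h t = s'.
  have : all (fun i => `[< exists j, h j = i >]) s' by apply: filter_all.
  elim: s' => [|i s' IH] /=; first by exists [::].
  by move=> /andP[/asboolP[j <-] /IH[t <-]]; exists (j :: t).
have us' : uniq s' by apply: filter_uniq.
exists t; split=> [|j|V F F0].
- by rewrite -e in us'; apply: map_uniq us'.
- rewrite -(mem_map hinj) e mem_filter andb_idl// => _.
  by apply/asboolP; exists j.
rewrite -(big_map h predT F) e big_filter.
rewrite [LHS](bigID (fun i => `[< exists j, h j = i >])) /= [X in _ + X]big1 ?addr0//.
by move=> i /asboolP ni; apply: F0 => j hj; apply: ni; exists j.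
Qed.

Lemma asum_reindex : asum f <-> asum (fun j => f (h j)).
Proof.
split=> [] [B hB]; exists B => s us.
  by rewrite -(big_map h predT (fun i => cabs (f i))); apply: hB; rewrite map_inj_uniq.
have [t [ut _ ->]] := image_list us; first exact: hB.
by move=> i hi; rewrite hsup ?cabs0.
Qed.

Lemma has_sum_reindex l : has_sum (fun j => f (h j)) l -> has_sum f l.
Proof.
move=> H e e0; have [t0 ht0] := H e e0; exists (map h t0) => s us sub.
have [t [ut mt ->]] := image_list us; last exact: hsup.
by apply: ht0 => // j jt; rewrite mt; apply: sub; apply: map_f.
Qed.

Lemma tsum_reindex : asum f -> tsum f = tsum (fun j => f (h j)).
Proof.
by move=> /asum_reindex/asum_has_sum/has_sum_reindex/has_sum_tsum.
Qed.

End Reindex.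

Section Fubini.
Variables I J : choiceType.
Implicit Types f : I * J -> C.

Lemma asum_row f i : asum f -> asum (fun j => f (i, j)).
Proof.
move=> [B hB]; exists B => s us.
rewrite -(big_map (pair i) predT (fun x => cabs (f x))); apply: hB.
by rewrite map_inj_uniq// => a b [].
Qed.

(** Every finite set of pairs lies in the rectangle of its two projections, so rectangles suffice
    for non-negative families. *)
Lemma sbound_prod (g : I * J -> R) B :
  (forall x, 0 <= g x) -> (forall s t, uniq s -> uniq t ->
    \sum_(i <- s) \sum_(j <- t) g (i, j) <= B) -> sbound g B.
Proof.
move=> g0 H s us; pose s1 := undup (map fst s); pose s2 := undup (map snd s).
apply: le_trans (H s1 s2 (undup_uniq _) (undup_uniq _)).
rewrite -big_allpairs.
apply: sbound_sub => //; first by rewrite allpairs_uniq ?undup_uniq// => -[? ?] [].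
move=> [i j] hx; apply/allpairsP; exists (i, j); split=> //=; rewrite mem_undup.
  by apply/mapP; exists (i, j).
by apply/mapP; exists (i, j).
Qed.

Lemma sbound_pairs (g : I * J -> R) B s t : sbound g B -> uniq s -> uniq t ->
  \sum_(i <- s) \sum_(j <- t) g (i, j) <= B.
Proof.
move=> H us ut; rewrite -big_allpairs.
by apply: H; rewrite allpairs_uniq// => -[? ?] [].
Qed.

Lemma sum_row_bound f e : sbound (fun x => cabs (f x)) e ->
  forall s, uniq s -> \sum_(i <- s) cabs (tsum (fun j => f (i, j))) <= e.
Proof.
move=> he s us.
(* Unit multiples align the phases of the row sums. *)
pose u (i : I) : C := let T := tsum (fun j => f (i, j)) in
  if T == 0 then 0 else (cabs T)%:C / T.
have uT i : u i * tsum (fun j => f (i, j)) = (cabs (tsum (fun j => f (i, j))))%:C.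
  rewrite /u; case: eqP => [->|/eqP T0]; first by rewrite mul0r cabs0.
  by rewrite mulfVK.
have u1 i : cabs (u i) <= 1.
  rewrite /u; case: eqP => [_|/eqP T0]; first by rewrite cabs0.
  by rewrite cabsM cabsV cabs_real ger0_norm ?cabs_ge0// divff ?cabs_eq0.
have a i : asum (fun j => f (i, j)) by apply: asum_row; exists e.
have /has_sum_tsum : has_sum (fun j => \sum_(i <- s) u i * f (i, j))
    (\sum_(i <- s) u i * tsum (fun j => f (i, j))).
  by apply: has_sum_sum => i _; apply/has_sumZ/asum_has_sum.
move=> E; have : cabs (\sum_(i <- s) u i * tsum (fun j => f (i, j))) <= e.
  rewrite -E; apply: tsum_bound => t ut.
  apply: le_trans (sbound_pairs he us ut); rewrite exchange_big /=.
  apply: ler_sum => j _; rewrite (le_trans (cabs_sum _ _))// ler_sum// => i _.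
  by rewrite cabsM ler_piMl ?cabs_ge0.
rewrite (eq_bigr _ (fun i _ => uT i)) -rmorph_sum cabs_real; apply: le_trans.
exact: ler_norm.
Qed.

Lemma asum_rows f : asum f -> asum (fun i => tsum (fun j => f (i, j))).
Proof. by move=> [B hB]; exists B => s us; apply: sum_row_bound. Qed.

Lemma fubini f : asum f -> tsum f = tsum (fun i => tsum (fun j => f (i, j))).
Proof.
move=> af; apply/esym/has_sum_tsum => e e0.
have [B hB] := af; have e2 : 0 < e / 2 by rewrite divr_gt0.
have e4 : 0 < e / 4 by rewrite divr_gt0.
have [s0 [us0 hs0]] := sbound_tail (fun x => cabs_ge0 (f x)) hB e4.
have [s1 hs1] := asum_has_sum af e4.
(* On the finite set [r] the interchange is trivial; the remaining part [f'] has total mass at most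
   e/4, and by [sum_row_bound] so have its row sums. [s0] controls this mass and [s1] the distance
   of the partial sum to [tsum f]. *)
pose r := undup (s0 ++ s1); have ur : uniq r by apply: undup_uniq.
pose f' x := if x \in r then 0 else f x.
pose f0 x := if x \in r then f x else 0.
have ff x : f x = f' x + f0 x by rewrite /f' /f0; case: ifP; rewrite ?addr0 ?add0r.
have hf' : sbound (fun x => cabs (f' x)) (e / 4).
  move=> s us; rewrite (bigID (mem r)) /= big1 ?add0r; last first.
    by move=> x xr; rewrite /f' xr cabs0.
  rewrite (eq_bigr (fun x => cabs (f x))); last by move=> x /negbTE xr; rewrite /f' xr.
  rewrite -big_filter; apply: hs0; first exact: filter_uniq.
  by move=> x; rewrite mem_filter mem_undup mem_cat => /andP[/norP[]].
exists (undup (map fst r)) => s us sub.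
have row i : tsum (fun j => f (i, j)) =
    tsum (fun j => f' (i, j)) + \sum_(x <- r | x.1 == i) f x.
  apply: has_sum_tsum; set l := _ + _.
  suff : has_sum (fun j => f' (i, j) + f0 (i, j)) l.
    by apply: eq_has_sum => j; rewrite -ff.
  apply: has_sumD.
    by apply/asum_has_sum/asum_row; exists (e / 4).
  set t := undup [seq x.2 | x <- r & x.1 == i].
  have -> : \sum_(x <- r | x.1 == i) f x = \sum_(j <- t) f0 (i, j).
    rewrite -big_filter /t; set r' := [seq _ <- _ | _].
    have ur' : uniq r' by apply: filter_uniq.
    have : forall x, x \in r' -> x.1 = i /\ x \in r.
      by move=> x; rewrite mem_filter => /andP[/eqP].
    move=> H; rewrite undup_id; last first.
      rewrite map_inj_in_uniq// => -[a b] [c d] /H[/= -> _] /H[/= -> _] -> //.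
    rewrite big_map; apply: eq_big_seq => -[a b] /H[/= -> h].
    by rewrite /f0 h.
  apply: has_sum_fin; first exact: undup_uniq.
  move=> j; rewrite mem_undup => jt; rewrite /f0; case: ifP => // ijr.
  by case/mapP: jt; exists (i, j) => //; rewrite mem_filter /= eqxx.
rewrite (eq_bigr _ (fun i _ => row i)) big_split /=.
have -> : \sum_(i <- s) \sum_(x <- r | x.1 == i) f x = \sum_(x <- r) f x.
  rewrite (exchange_big_dep predT) //=; apply: eq_big_seq => x xr.
  rewrite -big_filter (_ : [seq _ <- _ | _] = [:: x.1]) ?big_seq1//.
  have xs : x.1 \in s by apply: sub; rewrite mem_undup map_f.
  by rewrite -(filter_pred1_uniq us xs); apply: eq_filter => i; rewrite /= eq_sym.
rewrite -addrA (le_lt_trans (cabsD _ _))//.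
apply: (@lt_le_trans _ _ (e / 2 + e / 4)); last by lra.
apply: ler_ltD.
  apply: le_trans (cabs_sum _ _) _.
  by apply: le_trans (sum_row_bound hf' us) _; lra.
by apply: hs1 => // x xs; rewrite mem_undup mem_cat xs orbT.
Qed.

Lemma asum_mul (f : I -> C) (g : J -> C) : asum f -> asum g ->
  asum (fun x : I * J => f x.1 * g x.2).
Proof.
move=> [A hA] [B hB]; exists (A * B); apply: sbound_prod => [x|s t us ut].
  exact: cabs_ge0.
under eq_bigr do under eq_bigr do rewrite cabsM /=.
under eq_bigr do rewrite -big_distrr /=.
rewrite -big_distrl /= ler_pM ?hA ?hB// sumr_ge0// => i _; exact: cabs_ge0.
Qed.

Lemma tsum_mul (f : I -> C) (g : J -> C) : asum f -> asum g ->
  tsum (fun x : I * J => f x.1 * g x.2) = tsum f * tsum g.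
Proof.
move=> af ag; rewrite fubini; last exact: asum_mul.
under eq_tsum do rewrite /= tsumZ//.
by rewrite mulrC -tsumZ//; apply: eq_tsum => i; rewrite mulrC.
Qed.

End Fubini.

Lemma asum_swap (I J : choiceType) (f : I * J -> C) :
  asum f -> asum (fun x : J * I => f (x.2, x.1)).
Proof.
move=> [B hB]; exists B => s us.
rewrite -(big_map (fun x => (x.2, x.1)) predT (fun x => cabs (f x))); apply: hB.
by rewrite map_inj_uniq// => -[a b] [c d] [-> ->].
Qed.

Lemma tsum_swap (I J : choiceType) (f : I * J -> C) : asum f ->
  tsum (fun i => tsum (fun j => f (i, j))) = tsum (fun j => tsum (fun i => f (i, j))).
Proof.
move=> af; rewrite -fubini// -(fubini (asum_swap af)).
rewrite (@tsum_reindex _ _ (fun x : J * I => (x.2, x.1)))//.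
  by move=> [a b] [c d] [-> ->].
by move=> [i j] /(_ (j, i)).
Qed.

(** Theta functions are defined by a limit over the filter of finite sets; for absolutely summable
    families it is [tsum], on which the rest of the proof works. *)
Lemma summability_sum (I : choiceType) (f : I -> C) : asum f ->
  summability.sum (f : I -> C^o) = tsum f.
Proof.
move=> /asum_has_sum h; have PF := @summability.totally_filter I.
apply: cvg_lim => //; apply/cvgrPdist_lt => e e0.
have [r r0 re] : exists2 r : R, 0 < r & e = r%:C.
  case: e e0 => a b; rewrite ltcE /= => /andP[/eqP hb ha]; exists a => //.
  exact: complex_eq.
have [s hs] := h r r0; exists [fset i in s]%fset => //= A sA.
rewrite /summability.partial_sum -(big_seq_fsetE _ _ predT f) /=.
rewrite re distrC -cabsE ltcR; apply: hs; first exact: fset_uniq.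
by move=> i si; apply: (fsubsetP sA); rewrite inE.
Qed.

End Families.

(** * Exponentials *)

Section Cexp.
Variable R : realType.
Local Notation C := R[i].
Implicit Types z w u : C.


Lemma cexpD z w : cexp (z + w) = cexp z * cexp w.
Proof.
rewrite /cexp ReD ImD expRD cosD sinD rmorphM /=.
apply: complex_eq; rewrite !(ReM, ImM) /= !(mul0r, subr0, add0r, addr0); ring.
Qed.

Lemma cexp0 : cexp 0 = 1 :> C.
Proof. by rewrite /cexp /= expR0 cos0 sin0 mul1r. Qed.

Lemma cexpN z : cexp (- z) = (cexp z)^-1.
Proof.
have h : cexp (- z) * cexp z = 1 by rewrite -cexpD addNr cexp0.
have z0 : cexp z != 0 by apply: contra_eq_neq h => ->; rewrite mulr0 eq_sym oner_eq0.
by apply: (mulIf z0); rewrite h mulVf.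
Qed.

Lemma cabs_cexp z : cabs (cexp z) = expR (complex.Re z).
Proof.
rewrite /cexp cabsM cabs_real ger0_norm ?expR_ge0// /cabs /=.
by rewrite cos2Dsin2 sqrtr1 mulr1.
Qed.

Lemma cexp_neq0 z : cexp z != 0.
Proof. by rewrite -cabs_gt0 cabs_cexp expR_gt0. Qed.

Lemma cexp_real (x : R) : cexp x%:C = (expR x)%:C.
Proof. by rewrite /cexp /= cos0 sin0 mulr1. Qed.

Lemma cexp_nat z n : cexp (n%:R * z) = cexp z ^+ n.
Proof.
elim: n => [|n IH]; first by rewrite mul0r cexp0.
by rewrite exprSr -IH -cexpD -natr1 mulrDl mul1r.
Qed.

Definition ecoef z (n : nat) : C := z ^+ n / n`!%:R.

Lemma cabs_ecoef z n : cabs (ecoef z n) = cabs z ^+ n / n`!%:R.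
Proof. by rewrite /ecoef cabsM cabsV cabsX cabs_nat. Qed.

Lemma sbound_exp (x : R) : 0 <= x -> sbound (fun n : nat => x ^+ n / n`!%:R) (expR x).
Proof.
move=> x0 s us; pose K := (\max_(i <- s) i).+1.
have g0 n : 0 <= x ^+ n / n`!%:R by rewrite divr_ge0 ?exprn_ge0.
apply: (@le_trans _ _ (\sum_(0 <= i < K) x ^+ i / i`!%:R)).
  apply: sbound_sub => //; first exact: iota_uniq.
  by move=> i si; rewrite mem_index_iota /= ltnS; apply: leq_bigmax_seq.
rewrite -[leLHS]/(series (exp_coeff x) K).
apply: (@nondecreasing_cvgn_le _ (series (exp_coeff x))); last exact: is_cvg_series_exp_coeff.
by apply: nondecreasing_series => i _ _; apply: exp_coeff_ge0.
Qed.

Lemma asum_ecoef z : asum (ecoef z).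
Proof.
by apply: asum_ler (sbound_exp (cabs_ge0 z)) => n; rewrite cabs_ecoef.
Qed.

Lemma has_sum_series (f : nat -> C) l : has_sum f l ->
  forall e, 0 < e -> exists N, forall n, (N <= n)%N -> cabs (\sum_(i < n) f i - l) < e.
Proof.
move=> h e e0; have [s hs] := h e e0; exists (\max_(i <- s) i).+1 => n hn.
rewrite -(big_mkord predT f); apply: hs; first exact: iota_uniq.
move=> i si; rewrite mem_index_iota /=; apply: leq_trans hn.
by rewrite ltnS; apply: leq_bigmax_seq.
Qed.

(** The Cauchy product: [h] sends a pair of degrees to the total degree and the first degree, and
    the sum over one total degree is the binomial formula. *)
Lemma ecoef_add z w : tsum (ecoef (z + w)) = tsum (ecoef z) * tsum (ecoef w).
Proof.
have az := asum_ecoef z; have aw := asum_ecoef w.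
pose h (x : nat * nat) := ((x.1 + x.2)%N, x.1).
pose F (x : nat * nat) : C := if (x.2 <= x.1)%N then ecoef z x.2 * ecoef w (x.1 - x.2) else 0.
have hi : injective h by move=> [a b] [c d] [] /= /[swap] <- /addnI ->.
have Fh x : F (h x) = ecoef z x.1 * ecoef w x.2.
  by rewrite /F /h /= leq_addr addKn.
have F0 x : (forall y, h y <> x) -> F x = 0.
  case: x => n i H; rewrite /F /=; case: leqP => // le; case: (H (i, n - i)%N).
  by rewrite /h /= subnKC.
have aF : asum F.
  apply/(asum_reindex hi F0); apply: asum_le (asum_mul az aw) => x.
  by rewrite Fh.
rewrite -tsum_mul// -(eq_tsum Fh) -(tsum_reindex hi F0 aF) fubini//.
apply: eq_tsum => n; apply/esym/has_sum_tsum.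
have -> : ecoef (z + w) n = \sum_(i <- iota 0 n.+1) F (n, i).
  rewrite -[iota _ _]/(index_iota 0 n.+1) big_mkord /ecoef addrC exprDn mulr_suml.
  apply: eq_bigr => -[i /= hi'] _; rewrite ltnS in hi'; rewrite /F /= hi' /ecoef.
  rewrite -[in LHS](bin_fact hi') !natrM -mulr_natr.
  have p k : k`!%:R != 0 :> C by rewrite pnatr_eq0 -lt0n fact_gt0.
  have b0 : 'C(n, i)%:R != 0 :> C by rewrite pnatr_eq0 -lt0n bin_gt0.
  by field; rewrite !p b0.
apply: has_sum_fin; first exact: iota_uniq.
by move=> i; rewrite mem_iota /= add0n ltnS /F /= => /negbTE ->.
Qed.

Lemma cvg_series_Re (f : nat -> C) (u : nat -> R) l : has_sum f l ->
  (forall n, complex.Re (f n) = u n) -> (series u @ \oo --> complex.Re l)%classic.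
Proof.
move=> h hu; apply/cvgrPdist_lt => e e0.
have [N hN] := has_sum_series h e0; near=> n.
have : (N <= n)%N by near: n; exists N.
move=> /hN; apply: le_lt_trans; rewrite distrC.
apply: le_trans (Re_le_cabs _); rewrite ReD ReN /series /= big_mkord Re_sum.
by under [in leRHS]eq_bigr do rewrite hu.
Unshelve. all: by end_near.
Qed.

Lemma cvg_series_Im (f : nat -> C) (u : nat -> R) l : has_sum f l ->
  (forall n, complex.Im (f n) = u n) -> (series u @ \oo --> complex.Im l)%classic.
Proof.
move=> h hu; apply/cvgrPdist_lt => e e0.
have [N hN] := has_sum_series h e0; near=> n.
have : (N <= n)%N by near: n; exists N.
move=> /hN; apply: le_lt_trans; rewrite distrC.
apply: le_trans (Im_le_cabs _); rewrite ImD ImN /series /= big_mkord Im_sum.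
by under [in leRHS]eq_bigr do rewrite hu.
Unshelve. all: by end_near.
Qed.

(** [cexp] is defined through the real exponential, cosine and sine. Multiplicativity of the series
    separates the real from the imaginary part of z, and each is compared with the defining real
    series. *)
Lemma cexp_tsum z : cexp z = tsum (ecoef z).
Proof.
have -> : z = (complex.Re z)%:C + 'i * (complex.Im z)%:C.
  by case: z => a b; simpc.
rewrite ecoef_add cexpD; congr (_ * _).
  set x := complex.Re z; rewrite cexp_real; have h := asum_has_sum (asum_ecoef x%:C).
  have E n : ecoef x%:C n = (exp_coeff x n)%:C.
    by rewrite /ecoef /exp_coeff /= rmorphM fmorphV rmorphXn rmorph_nat.
  apply: complex_eq => /=.
    rewrite -[LHS]/(limn (series (exp_coeff x))).
    by apply/cvg_lim => //; apply: cvg_series_Re h _ => n; rewrite E.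
  have : (series (fun=> 0 : R) @ \oo --> complex.Im (tsum (ecoef x%:C)))%classic.
    by apply: cvg_series_Im h _ => n; rewrite E.
  move=> /cvg_lim <- //; apply/esym/cvg_lim => //.
  rewrite (_ : series _ = fun=> 0); first exact: cvg_cst.
  by apply/funext => n; rewrite /series /= big1.
set y := complex.Im z; have h := asum_has_sum (asum_ecoef ('i * y%:C)).
have E n : ecoef ('i * y%:C) n = cos_coeff y n +i* sin_coeff y n.
  have -> : ecoef ('i * y%:C) n = 'i ^+ n * (y ^+ n / n`!%:R)%:C.
    by rewrite /ecoef exprMn rmorphM fmorphV rmorphXn rmorph_nat mulrA.
  have -> : ('i : C) ^+ n = if odd n then 'i * ((-1) ^+ n./2)%:C else ((-1) ^+ n./2)%:C.
    rewrite -[in LHS](odd_double_half n) exprD -mul2n exprM.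
    rewrite (_ : 'i ^+ 2 = (-1)%:C); last first.
      by rewrite expr2; apply: complex_eq; rewrite ?(ReM, ImM) /= ?mul0r ?mulr0 ?mul1r ?addr0 ?sub0r.
    by rewrite -rmorphXn; case: odd; rewrite ?expr1 ?mul1r.
  rewrite /cos_coeff /sin_coeff /=; case: ifP => on; last first.
    by rewrite -rmorphM; apply: complex_eq; rewrite /= ?mul1r ?mul0r ?mulrA.
  have -> : n.-1./2 = n./2 by rewrite -[in LHS](odd_double_half n) on /= doubleK.
  by apply: complex_eq; rewrite !(ReM, ImM) /= -?exprnP; ring.
apply: complex_eq; rewrite /cexp !(ReM, ImM) /= ?mul0r ?mul1r ?mulr0 subr0 ?addr0 ?subr0 expR0 ?mul0r ?mul1r ?addr0 ?subr0.
  rewrite add0r cos.unlock.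
  apply/cvg_lim => //; apply: cvg_series_Re h _ => n; by rewrite E.
rewrite add0r sin.unlock.
by apply/cvg_lim => //; apply: cvg_series_Im h _ => n; rewrite E.
Qed.

(** The tail of the series is z^k times a series dominated by that of exp |z|, because (k + m)! is
    at least m!. *)
Lemma cexp_taylor k z :
  cabs (cexp z - \sum_(n < k) ecoef z n) <= cabs z ^+ k * expR (cabs z).
Proof.
pose f n := if (n < k)%N then 0 else ecoef z n.
have hi : injective (addn k) by move=> a b /addnI.
have f0 n : (forall m, (k + m)%N <> n) -> f n = 0.
  move=> H; rewrite /f; case: ltnP => // kn; case: (H (n - k)%N).
  by rewrite subnKC.
have af : asum f.
  by apply: asum_le (asum_ecoef z) => n; rewrite /f; case: ifP => // _; rewrite cabs0 cabs_ge0.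
have -> : cexp z - \sum_(n < k) ecoef z n = tsum f.
  rewrite -(big_mkord predT) cexp_tsum; apply/esym/has_sum_tsum.
  pose g n := if (n < k)%N then ecoef z n else 0.
  have -> : \sum_(0 <= i < k) ecoef z i = \sum_(i <- index_iota 0 k) g i.
    by apply: eq_big_seq => i; rewrite mem_index_iota /g /= => ->.
  have : has_sum (fun n => ecoef z n - g n) (tsum (ecoef z) - \sum_(i <- index_iota 0 k) g i).
    apply: has_sumB; first exact/asum_has_sum/asum_ecoef.
    apply: has_sum_fin; first exact: iota_uniq.
    by move=> i; rewrite mem_index_iota /g /= => /negbTE ->.
  by apply: eq_has_sum => n; rewrite /g /f; case: ifP; rewrite ?subrr ?subr0.
rewrite (tsum_reindex hi f0 af); apply: tsum_bound.
apply: sbound_le (sboundZ (exprn_ge0 k (cabs_ge0 z)) (sbound_exp (cabs_ge0 z))) => m.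
rewrite /f ltnNge leq_addr /= cabs_ecoef exprD -mulrA ler_wpM2l ?exprn_ge0 ?cabs_ge0//.
rewrite ler_wpM2l ?exprn_ge0 ?cabs_ge0// lef_pV2 ?posrE ?ltr0n ?fact_gt0// ler_nat.
by rewrite leq_fact ?leq_addl.
Qed.

Lemma cexp_bound2 z : cabs (cexp z - 1 - z) <= cabs z ^+ 2 * expR (cabs z).
Proof.
have := cexp_taylor 2 z; rewrite big_ord_recr big_ord1 /= /ecoef expr0 expr1 fact0.
by rewrite !divr1 opprD addrA.
Qed.

End Cexp.

(** * A summable weight on the integers *)

Section IntSums.
Variable R : realType.
Local Notation C := R[i].

(* [1 / (1 + y)^2 <= (u y - u x) / (y - x)] for [u x = x / (1 + x)], so the
   Riemann sums of [wt] telescope. *)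
Definition wt (x : R) : R := (1 + `|x|) ^- 2.

Lemma wt_ge0 x : 0 <= wt x.
Proof. by rewrite /wt invr_ge0 exprn_ge0// addr_ge0. Qed.

(** The bound must stay finite as the mesh h tends to 0: the term n = 0 costs h, and the telescoping
    sum of differences of x / (1 + x) costs at most 1. *)
Lemma sbound_nat_wt h : 0 <= h -> sbound (fun n : nat => h * wt (h * n%:R)) (h + 1).
Proof.
move=> h0 s us; pose K := (\max_(i <- s) i).+1.
apply: (@le_trans _ _ (\sum_(0 <= n < K) h * wt (h * n%:R))).
  apply: sbound_sub => //; first by move=> i; rewrite mulr_ge0 ?wt_ge0.
    exact: iota_uniq.
  by move=> i si; rewrite mem_index_iota /= ltnS; apply: leq_bigmax_seq.
suff : \sum_(0 <= n < K) h * wt (h * n%:R) <= h + h * K.-1%:R / (1 + h * K.-1%:R).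
  move=> H; apply: le_trans H _; rewrite lerD2l ler_pdivrMr ?mul1r ?lerDr//.
  by rewrite ltr_wpDr ?mulr_ge0.
rewrite /K; elim: (\max_(i <- s) i)%N => [|k IH].
  by rewrite big_nat1 /= mulr0 mul0r addr0 /wt normr0 addr0 expr1n invr1 mulr1.
rewrite big_nat_recr//= (le_trans (lerD IH (lexx _)))// -addrA lerD2l /=.
set x := h * k%:R; have x0 : 0 <= x by rewrite mulr_ge0.
have -> : h * k.+1%:R = x + h by rewrite -natr1 mulrDr mulr1.
rewrite /wt ger0_norm ?addr_ge0//.
have a : 0 < 1 + x by lra.
have b : 0 < 1 + (x + h) by lra.
rewrite -lerBrDl.
have -> : (x + h) / (1 + (x + h)) - x / (1 + x) = h / ((1 + x) * (1 + (x + h))).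
  by field; rewrite !gt_eqF.
rewrite ler_wpM2l// lef_pV2 ?posrE ?exprn_gt0 ?mulr_gt0// expr2 ler_pM2r//; lra.
Qed.

Lemma sbound_int (g : int -> R) A B : (forall n, 0 <= g n) ->
  sbound (fun n : nat => g n%:Z) A -> sbound (fun n : nat => g (- n%:Z)) B ->
  sbound g (A + B).
Proof.
move=> g0 hA hB s us; rewrite (bigID (fun i => (0 <= i)%R)) /=; apply: lerD.
  have inj : injective Posz by move=> a b [].
  have [t [ut _ H]] := image_list inj us.
  rewrite big_mkcond /= (H _ (fun i : int => if 0 <= i then g i else 0)); last first.
    by move=> [n|n] // /(_ n).
  by apply: hA.
have inj : injective (fun n : nat => - n%:Z) by move=> a b /oppr_inj [].
have [t [ut _ H]] := image_list inj us.
rewrite big_mkcond /= (H _ (fun i : int => if ~~ (0 <= i) then g i else 0)); last first.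
  by move=> [n|n] // /(_ n.+1) [].
apply: le_trans (hB _ ut); apply: ler_sum => n _; by case: ifP.
Qed.

Lemma sbound_wt h : 0 <= h -> sbound (fun n : int => h * wt (h * n%:~R)) ((h + 1) + (h + 1)).
Proof.
move=> h0; apply: sbound_int => [n||].
- by rewrite mulr_ge0 ?wt_ge0.
- exact: sbound_nat_wt.
apply: sbound_le (sbound_nat_wt h0) => n.
by rewrite /wt rmorphN /= mulrN normrN.
Qed.

End IntSums.

(** * The additive character [ebf] *)

Section Ebf.
Variable R : realType.
Local Notation C := R[i].
Implicit Types z w : C.

Lemma ebfD z w : ebf (z + w) = ebf z * ebf w.
Proof. by rewrite /ebf mulrDr cexpD. Qed.

Lemma ebf0 : ebf 0 = 1 :> C.
Proof. by rewrite /ebf mulr0 cexp0. Qed.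

Lemma ebfN z : ebf (- z) = (ebf z)^-1.
Proof. by rewrite /ebf mulrN cexpN. Qed.

Lemma ebf_neq0 z : ebf z != 0.
Proof. exact: cexp_neq0. Qed.

Lemma ebf_nat n z : ebf (n%:R * z) = ebf z ^+ n.
Proof. by rewrite /ebf mulrCA cexp_nat. Qed.

Lemma ebfE z : ebf z = cexp (2 * (pi : R)%:C * 'i * z).
Proof.
rewrite /ebf; congr (cexp (_ * z)); apply: complex_eq; rewrite !(ReM, ImM) /=; ring.
Qed.

Lemma ebf_realE (x : R) : ebf x%:C = cos (2 * pi * x) +i* sin (2 * pi * x).
Proof.
rewrite /ebf /cexp !ReM !ImM /= !mul0r !mulr0 subr0 add0r expR0.
by rewrite mul1r.
Qed.

Lemma cabs_ebf_real (x : R) : cabs (ebf x%:C) = 1.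
Proof.
rewrite /ebf cabs_cexp ReM /= mul0r mulr0 subr0; exact: expR0.
Qed.

Lemma ebf1 : ebf 1 = 1 :> C.
Proof.
rewrite -[1 in LHS]/((1 : R)%:C) ebf_realE mulr1 mulr_natl cos2pi sin2pi.
by [].
Qed.

Lemma ebf_int (n : int) : ebf n%:~R = 1 :> C.
Proof.
have h (k : nat) : ebf k%:R = 1 :> C.
  by rewrite -[k%:R]mulr1 ebf_nat ebf1 expr1n.
case: n => n; first exact: h.
by rewrite NegzE rmorphN ebfN h invr1.
Qed.

Lemma ebfDint z (n : int) : ebf (z + n%:~R) = ebf z.
Proof. by rewrite ebfD ebf_int mulr1. Qed.

Lemma ebf_eq_int (x y : R) : x - y \is a Num.int -> ebf x%:C = ebf y%:C.
Proof.
move=> /intrP[n e]; have -> : x = y + n%:~R by rewrite -e addrC subrK.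
by rewrite rmorphD /= rmorph_int ebfDint.
Qed.

Lemma ebf_sin (x : R) : ebf x%:C + ebf (- x%:C) - 2 = (- (4 * sin (pi * x) ^+ 2))%:C.
Proof.
rewrite -rmorphN !ebf_realE mulrN cosN sinN.
have -> : 2 * pi * x = (pi * x) *+ 2 by rewrite mulr2n; ring.
apply: complex_eq; rewrite !(ReD, ImD, ReN, ImN) /=; last by ring.
rewrite cos_mulr2n cos2sin2; ring.
Qed.

(** On the fractional part y the equality forces sin (pi y) = 0, while the sine is positive strictly
    between 0 and pi. *)
Lemma ebf_eq1 (x : R) : ebf x%:C = 1 -> x \is a Num.int.
Proof.
move=> h; pose n := Num.floor x; pose y := x - n%:~R.
have hy : ebf y%:C = 1.
  by rewrite /y -h; apply: ebf_eq_int; rewrite addrAC subrr sub0r rpredN intr_int.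
have y01 : 0 <= y < 1 by rewrite subr_ge0 ltrBlDl floor_le /= -[X in _ + X]/(1%:~R) -rmorphD /= floorD1_gt.
have := ebf_sin y; rewrite ebfN hy invr1 => /(congr1 (@complex.Re R)) /=.
rewrite subrr => /esym/eqP; rewrite oppr_eq0 mulf_eq0 pnatr_eq0 /= sqrf_eq0 => /eqP s0.
have [y0|y0] := eqVneq y 0.
  by rewrite -(subrK n%:~R x) -/y y0 add0r intr_int.
have : 0 < sin (pi * y).
  apply: sin_gt0_pi; have [a b] := andP y01.
  have y1 : 0 < y by rewrite lt_def y0 a.
  by rewrite mulr_gt0 ?pi_gt0//= gtr_pMr ?pi_gt0.
by rewrite s0 ltxx.
Qed.

Lemma sin_le_id (y : R) : 0 <= y -> y * cos y <= sin y \/ pi / 2 < y.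
Proof.
move=> y0; have [le|] := leP y (pi / 2); last by right.
left; have [c cI] := @MVT_segment R sin cos 0 y y0 (fun x _ => is_derive_sin x)
  (continuous_subspaceT (@continuous_sin R)).
rewrite sin0 !subr0 => ->; rewrite mulrC ler_wpM2r//.
move: cI; rewrite in_itv /= => /andP[c0 cy].
have [->//|ne] := eqVneq c y.
have pi0 := @pi_gt0 R.
by apply/ltW; rewrite ltr_cos ?in_itv /= ?c0 ?y0 /= ?lt_neqAle ?ne//; lra.
Qed.

(** With y = pi x / 2, at most pi / 4, sin 2y = 2 sin y cos y is at least 2 y cos^2 y by the mean
    value theorem, and 2 cos^2 y = 1 + cos 2y is at least 1; finally pi / 2 is at least 1. *)
Lemma sin_lower (x : R) : 0 <= x -> x <= 2^-1 -> x <= sin (pi * x).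
Proof.
move=> x0 x1; pose y := pi * x / 2.
have p2 := @pi_ge2 R.
have y0 : 0 <= y by rewrite divr_ge0 ?mulr_ge0 ?pi_ge0.
have yp : y <= pi / 4.
  by rewrite /y -mulrA ler_wpM2l ?pi_ge0//; lra.
have [h|] := sin_le_id y0; last by lra.
have -> : pi * x = y *+ 2 by rewrite /y mulr2n; field.
rewrite sin_mulr2n.
have c0 : 0 <= cos (y *+ 2).
  apply: cos_ge0_pihalf; rewrite -mulr_natl.
  by apply/andP; split; [have := @pi_ge0 R|]; lra.
have c1 : 0 <= cos y by apply: cos_ge0_pihalf; apply/andP; split; lra.
rewrite cos_mulr2n in c0.
apply: (@le_trans _ _ (y * cos y * cos y *+ 2)); last first.
  by rewrite lerMn2r /= [leRHS]mulrC ler_wpM2r.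
rewrite -mulrA -expr2 -mulr_natr.
have : 1 <= 2 * cos y ^+ 2 by rewrite mulr_natl; lra.
move=> hc; rewrite -mulrA (mulrC _ 2).
apply: (@le_trans _ _ (y * 1)); last by rewrite ler_wpM2l.
by rewrite mulr1 /y; nra.
Qed.

(** A second difference of the Gaussian multiplies its mode of frequency m by this symbol at x = m
    h. The quadratic lower bound gives the decay of order 1 / m^2 in [mode_bound]; it is available
    for |x| at most 1/2, which is why frequencies are centred at 0. *)
Lemma ebf_second_diff (x : R) : `|x| <= 2^-1 ->
  4 * x ^+ 2 <= cabs (ebf x%:C + ebf (- x%:C) - 2).
Proof.
move=> h; rewrite ebf_sin cabs_real normrN normrM normrX (ger0_norm (ler0n R 4)).
rewrite ler_wpM2l// -real_normK ?num_real//.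
have -> : `|sin (pi * x)| = `|sin (pi * `|x|)|.
  have [x0|x0] := leP 0 x; first by rewrite (ger0_norm x0).
  by rewrite (ltr0_norm x0) mulrN sinN normrN.
rewrite lerXn2r ?nnegrE// (le_trans _ (ler_norm _))// sin_lower//.
Qed.

End Ebf.

(** * The Jacobi inversion formula in one variable *)

Section GaussEstimates.
Variable R : realType.
Local Notation C := R[i].
Local Notation piC := ((pi : R)%:C).

Lemma pi_le4 : pi <= 4 :> R.
Proof. have := @pihalf_lt2 R; lra. Qed.

Definition gs (z : C) : C := cexp (- (piC * z ^+ 2)).

Lemma cabs_gs z : cabs (gs z) = expR (- (pi * complex.Re (z ^+ 2))).
Proof. by rewrite /gs cabs_cexp ReN ReM /= mul0r subr0. Qed.

(* The second-order remainder of [gs (z + d) / gs z]. *)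
Definition gs_remainder (z d : C) : C :=
  cexp (- (piC * (2 * z * d + d ^+ 2))) - 1 + 2 * piC * z * d.

Lemma gs_shift z d : gs (z + d) = gs z * (1 - 2 * piC * z * d + gs_remainder z d).
Proof.
rewrite /gs_remainder; have -> : gs (z + d) = gs z * cexp (- (piC * (2 * z * d + d ^+ 2))).
  by rewrite /gs -cexpD; congr cexp; ring.
by congr (_ * _); ring.
Qed.

(** [X] stands for 1 + |x|. The increment of the exponent is v = O(h X^2), so exp v - 1 - v and the
    omitted pi d^2 are both of second order in h, at the price of polynomial growth and of exp (A h
    X^2). *)
Lemma gs_remainder_bound (B h X : R) z d : 1 <= B -> 0 <= h -> h <= 1 -> 1 <= X ->
  cabs z <= B * X -> cabs d <= h * (B * X) ->
  forall A, A = 12 * B ^+ 2 ->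
  cabs (gs_remainder z d) <= h ^+ 2 * ((A ^+ 2 + A) * X ^+ 4 * expR (A * h * X ^+ 2)).
Proof.
move=> B1 h0 h1 one_le_1Dnorm hz hd A AE.
set v := - (piC * (2 * z * d + d ^+ 2)).
have A0 : 0 <= A by rewrite AE mulr_ge0// exprn_ge0; lra.
have z0 := cabs_ge0 z; have d0 := cabs_ge0 d.
have p4 := pi_le4; have p0 := @pi_ge0 R.
have BX : 0 <= B * X by rewrite mulr_ge0; lra.
have dd : cabs d ^+ 2 <= h ^+ 2 * (B * X) ^+ 2.
  by rewrite -exprMn lerXn2r ?nnegrE// mulr_ge0.
have hh : h ^+ 2 <= h by rewrite expr2 ler_piMr.
(* The constant 12 is 4 times 3: pi is at most 4, and 2 |z| |d| + |d|^2 is at most 3 h (B X)^2 since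
   h^2 <= h. *)
have hv : cabs v <= A * h * X ^+ 2.
  rewrite /v cabsN cabsM cabs_real ger0_norm//.
  apply: (@le_trans _ _ (4 * (3 * h * (B * X) ^+ 2))); last first.
    by rewrite AE; have -> : 4 * (3 * h * (B * X) ^+ 2) = 12 * B ^+ 2 * h * X ^+ 2 by ring.
  apply: ler_pM => //; first exact: cabs_ge0.
  apply: le_trans (cabsD _ _) _; rewrite !cabsM cabs_nat -expr2.
  have zd : cabs z * cabs d <= h * (B * X) ^+ 2.
    apply: le_trans (ler_pM z0 d0 hz hd) _; rewrite le_eqVlt; apply/orP; left; apply/eqP; ring.
  have : h ^+ 2 * (B * X) ^+ 2 <= h * (B * X) ^+ 2 by rewrite ler_wpM2r ?sqr_ge0.
  rewrite -mulrA; lra.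
have -> : gs_remainder z d = (cexp v - 1 - v) - piC * d ^+ 2 by rewrite /gs_remainder /v; ring.
apply: le_trans (cabsB _ _) _; rewrite cabsM cabs_real ger0_norm// cabsX.
have e1 : 1 <= expR (A * h * X ^+ 2).
  by rewrite -expR0 ler_expR; exact: mulr_ge0 (mulr_ge0 A0 h0) (sqr_ge0 _).
set e := expR _ in e1 *.
have X2 : 1 <= X ^+ 2 by rewrite expr2; nra.
have -> : h ^+ 2 * ((A ^+ 2 + A) * X ^+ 4 * e) =
  (A * h * X ^+ 2) ^+ 2 * e + h ^+ 2 * (A * (X ^+ 2 * (X ^+ 2 * e))) by ring.
apply: lerD.
  apply: le_trans (cexp_bound2 v) _; apply: ler_pM; rewrite ?exprn_ge0 ?expR_ge0 ?cabs_ge0//.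
    by rewrite lerXn2r ?nnegrE ?cabs_ge0// (le_trans _ hv) ?cabs_ge0.
  by rewrite ler_expR.
apply: (@le_trans _ _ (4 * (h ^+ 2 * (B * X) ^+ 2))).
  by apply: ler_pM => //; rewrite exprn_ge0.
have -> : 4 * (h ^+ 2 * (B * X) ^+ 2) = h ^+ 2 * (4 * B ^+ 2 * X ^+ 2) by ring.
rewrite ler_wpM2l ?sqr_ge0//.
have Xe : 1 <= X ^+ 2 * e by rewrite -[1]mulr1 ler_pM.
have B2 : 0 <= B ^+ 2 by apply: sqr_ge0.
apply: (@le_trans _ _ (A * (X ^+ 2 * 1))).
  by rewrite AE mulr1 ler_wpM2r ?ler_wpM2r//; lra.
by rewrite ler_wpM2l// ler_wpM2l//; lra.
Qed.

(** Half of the Gaussian exponent absorbs exp (A h X^2) as soon as h <= k / (2 (A + 1)); the other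
    half absorbs X^8 by u^4 <= 24 exp u. The power 8 is the 6 of the statement plus the 2 of the
    weight [wt]. *)
Lemma gauss_absorb (k A E : R) : 0 < k -> 0 <= A -> 0 <= E ->
  exists K h0 : R, [/\ 0 <= K, 0 < h0, h0 <= 1 & forall h x, 0 <= h -> h <= h0 ->
   (1 + `|x|) ^+ 6 * expR (A * h * (1 + `|x|) ^+ 2) * (E * expR (- (k * (1 + `|x|) ^+ 2)))
   <= K * wt x].
Proof.
move=> k0 A0 E0; pose h0 := Num.min 1 (k / (2 * (A + 1))).
have A1 : 0 < 2 * (A + 1) by lra.
exists (E * ((2 / k) ^+ 4 * 24)), h0; split.
- by apply: mulr_ge0 => //; apply: mulr_ge0 => //; rewrite exprn_ge0// divr_ge0// ltW.
- by rewrite lt_min ltr01 divr_gt0.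
- by rewrite ge_min lexx.
move=> h x h1 h2; set X := 1 + `|x|; have one_le_1Dnorm : 1 <= X by rewrite lerDl.
have X0 : 0 < X by lra.
have hA : A * h <= k / 2.
  have : h <= k / (2 * (A + 1)) by apply: le_trans h2 _; rewrite ge_min lexx orbT.
  rewrite ler_pdivlMr// => H; nra.
set u := k / 2 * X ^+ 2.
have u0 : 0 <= u by apply: mulr_ge0; [lra|exact: sqr_ge0].
have eu : X ^+ 8 <= (2 / k) ^+ 4 * 24 * expR u.
  have := expR_ge1Dxn 3 u0.
  rewrite (_ : 4`!%:R = 24) // => H.
  have : u ^+ 4 <= 24 * expR u by rewrite -ler_pdivrMl//; lra.
  move=> H2; have -> : X ^+ 8 = (2 / k) ^+ 4 * u ^+ 4.
    by rewrite /u; field; rewrite gt_eqF.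
  by rewrite -mulrA ler_wpM2l// exprn_ge0// divr_ge0// ltW.
rewrite /wt -/X (_ : X ^+ 6 * _ * _ =
  E * (X ^+ 6 * (expR (A * h * X ^+ 2) * expR (- (k * X ^+ 2))))); last by ring.
rewrite -[leRHS]mulrA ler_wpM2l// ler_pdivlMr ?exprn_gt0// -expRD.
apply: (@le_trans _ _ (X ^+ 8 * expR (- u))).
  rewrite [leLHS](_ : _ = X ^+ 8 * expR (A * h * X ^+ 2 - k * X ^+ 2)); last by ring.
  apply: ler_wpM2l; first by rewrite exprn_ge0// ltW.
  rewrite ler_expR.
  have : (A * h) * X ^+ 2 <= (k / 2) * X ^+ 2 by rewrite ler_wpM2r// sqr_ge0.
  by rewrite /u; lra.
by rewrite expRN ler_pdivrMr ?expR_gt0.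
Qed.

(** The right side is the real part of ((a + i d) x + b1 + i b2)^2, and m measures the distance of a
    + i d from the boundary of the sector |d| < a. *)
Lemma quad_lower (B m a d b1 b2 x : R) : 1 <= B -> 0 < m -> m <= 1 ->
  `|a| <= B -> `|d| <= B -> `|b1| <= B -> `|b2| <= B -> m <= a - `|d| ->
  m ^+ 2 / 4 * (1 + `|x|) ^+ 2 - (B ^+ 2 + 1 + 13 * B ^+ 4 / m ^+ 2) <=
  (a * x + b1) ^+ 2 - (d * x + b2) ^+ 2.
Proof.
move=> B1 m0 m1 ha hd h1 h2 had; have : 0 <= `|x| by []; set t := `|x| => t0.
have xx : x ^+ 2 = t ^+ 2 by rewrite /t real_normK ?num_real.
have dd : d ^+ 2 = `|d| ^+ 2 by rewrite real_normK ?num_real.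
have e1 : m ^+ 2 * t ^+ 2 <= (a ^+ 2 - d ^+ 2) * x ^+ 2.
  rewrite xx ler_wpM2r ?sqr_ge0// dd; have := normr_ge0 d; nra.
have e2 : - (4 * B ^+ 2 * t) <= 2 * (a * b1 - d * b2) * x.
  have : `|2 * (a * b1 - d * b2) * x| <= 4 * B ^+ 2 * t.
    rewrite normrM ler_wpM2r// normrM ger0_norm//.
    have : `|a * b1 - d * b2| <= B * B + B * B.
      by rewrite (le_trans (ler_normB _ _))// !normrM lerD// ler_pM.
    by rewrite expr2; lra.
  by rewrite ler_norml => /andP[].
have e3 : - B ^+ 2 <= b1 ^+ 2 - b2 ^+ 2.
  have : b2 ^+ 2 <= B ^+ 2 by rewrite -[b2 ^+ 2]real_normK ?num_real// lerXn2r ?nnegrE//; lra.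
  have := sqr_ge0 b1; lra.
have -> : (a * x + b1) ^+ 2 - (d * x + b2) ^+ 2 = (a ^+ 2 - d ^+ 2) * x ^+ 2 +
   2 * (a * b1 - d * b2) * x + (b1 ^+ 2 - b2 ^+ 2) by ring.
(* A square that absorbs every term linear in t: 4 B^2 t from [e2], and the cross term of (1 + t)^2,
   which is below B^2 t. *)
have e4 : 5 * B ^+ 2 * t <= m ^+ 2 * t ^+ 2 / 2 + 25 / 2 * (B ^+ 4 / m ^+ 2).
  have := sqr_ge0 (m * t - 5 * B ^+ 2 / m).
  have -> : (m * t - 5 * B ^+ 2 / m) ^+ 2 =
     m ^+ 2 * t ^+ 2 - 10 * B ^+ 2 * t + 25 * (B ^+ 4 / m ^+ 2).
    by field; rewrite gt_eqF.
  lra.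
have B2 : 1 <= B ^+ 2 by rewrite expr2; nra.
have m2 : m ^+ 2 <= 1 by rewrite expr2; nra.
have m3 : 0 <= m ^+ 2 by apply: sqr_ge0.
have q0 : 0 <= B ^+ 4 / m ^+ 2 by rewrite divr_ge0// exprn_ge0//; lra.
have e5 : m ^+ 2 * t <= B ^+ 2 * t by rewrite ler_wpM2r//; lra.
have t2 : 0 <= m ^+ 2 * t ^+ 2 by rewrite mulr_ge0// sqr_ge0.
have -> : 13 * B ^+ 4 / m ^+ 2 = 13 * (B ^+ 4 / m ^+ 2) by rewrite mulrA.
have -> : m ^+ 2 / 4 * (1 + t) ^+ 2 = m ^+ 2 / 4 + m ^+ 2 * t / 2 + m ^+ 2 * t ^+ 2 / 4 by field.
set q := B ^+ 4 / _ in q0 e4 *.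
set T := m ^+ 2 * t ^+ 2 in e1 t2 e4 *.
lra.
Qed.

End GaussEstimates.

(** * Deformation of a Gaussian within its sector *)

Section GaussPath.
Variable R : realType.
Local Notation C := R[i].
Local Notation piC := ((pi : R)%:C).
Variables c b : C.
Hypothesis hc : `|complex.Im c| < complex.Re c.

(* A path in the sector from (1, 0) to (c, b), along which the normalised
   Riemann sums of the Gaussian [c * gs (c * x + b)] are almost constant. *)
Definition cpath (s : R) : C := 1 + s%:C * (c - 1).
Definition zpath (s x : R) : C := cpath s * x%:C + s%:C * b.
Definition wpath (s x : R) : C := cpath s * gs (zpath s x).
(** The flux of the deformation: the derivative of [wpath] in s equals the derivative of [upath] in
    x, so the change of a sum over hZ telescopes up to second order in h. *)
Definition upath (s x : R) : C := ((c - 1) * x%:C + b) * gs (zpath s x).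

Definition pathB : R := 2 + cabs c + cabs b.

Lemma pathB_ge1 : 1 <= pathB.
Proof. rewrite /pathB; have := cabs_ge0 c; have := cabs_ge0 b; lra. Qed.

Lemma cpath_bound s : 0 <= s -> s <= 1 -> cabs (cpath s) <= pathB.
Proof.
move=> s0 s1; have -> : cpath s = (1 - s)%:C + s%:C * c.
  by rewrite /cpath rmorphB; ring.
apply: le_trans (cabsD _ _) _; rewrite cabsM !cabs_real !ger0_norm ?subr_ge0//.
rewrite /pathB; have := cabs_ge0 c; have := cabs_ge0 b; nra.
Qed.

Lemma lin_bound (u v : C) (B x : R) : cabs u <= B -> cabs v <= B ->
  cabs (u * x%:C + v) <= B * (1 + `|x|).
Proof.
move=> hu hv; apply: le_trans (cabsD _ _) _; rewrite cabsM cabs_real mulrDr mulr1 addrC.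
by rewrite lerD// ler_wpM2r.
Qed.

Lemma cabs_cB1_le : cabs (c - 1) <= pathB.
Proof.
apply: le_trans (cabsB _ _) _; rewrite cabs1 /pathB.
have := cabs_ge0 b; lra.
Qed.

Lemma cabs_sb_le s : 0 <= s -> s <= 1 -> cabs (s%:C * b) <= pathB.
Proof.
move=> s0 s1; rewrite cabsM cabs_real ger0_norm// /pathB.
have := cabs_ge0 c; have := cabs_ge0 b; nra.
Qed.

Lemma zpath_bound s x : 0 <= s -> s <= 1 -> cabs (zpath s x) <= pathB * (1 + `|x|).
Proof. by move=> s0 s1; apply: lin_bound; rewrite ?cpath_bound ?cabs_sb_le. Qed.

(** The segment from 1 to c stays in the sector by convexity, with the margin Re - |Im| bounded
    below by [m]; [quad_lower] then gives one Gaussian bound for all s in [0, 1]. *)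
Lemma gs_decay : exists k E : R, [/\ 0 < k, 0 <= E &
  forall s x, 0 <= s -> s <= 1 ->
    cabs (gs (zpath s x)) <= E * expR (- (k * (1 + `|x|) ^+ 2))].
Proof.
pose m := Num.min 1 (complex.Re c - `|complex.Im c|).
have m0 : 0 < m by rewrite lt_min ltr01 subr_gt0.
have m1 : m <= 1 by rewrite ge_min lexx.
pose K := pathB ^+ 2 + 1 + 13 * pathB ^+ 4 / m ^+ 2.
exists (pi * (m ^+ 2 / 4)), (expR (pi * K)); split.
- by rewrite mulr_gt0 ?pi_gt0// divr_gt0// exprn_gt0.
- exact: expR_ge0.
move=> s x s0 s1; rewrite cabs_gs -expRD ler_expR.
have -> : complex.Re (zpath s x ^+ 2) =
    (complex.Re (cpath s) * x + complex.Re (s%:C * b)) ^+ 2 -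
    (complex.Im (cpath s) * x + complex.Im (s%:C * b)) ^+ 2.
  by rewrite expr2 ReM /zpath ReD ImD [complex.Re (_ * x%:C)]ReM
    [complex.Im (_ * x%:C)]ImM /=; ring.
have := @quad_lower R pathB m (complex.Re (cpath s)) (complex.Im (cpath s))
  (complex.Re (s%:C * b)) (complex.Im (s%:C * b)) x pathB_ge1 m0 m1
  (le_trans (Re_le_cabs _) (cpath_bound s0 s1)) (le_trans (Im_le_cabs _) (cpath_bound s0 s1))
  (le_trans (Re_le_cabs _) (cabs_sb_le s0 s1)) (le_trans (Im_le_cabs _) (cabs_sb_le s0 s1)).
rewrite -/K; set q := _ - _ ^+ 2; set X := (1 + `|x|) ^+ 2 => H.
have : m <= complex.Re (cpath s) - `|complex.Im (cpath s)|.
  have -> : complex.Re (cpath s) = (1 - s) + s * complex.Re c.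
    by rewrite /cpath ReD ReM ReD ReN /=; ring.
  have -> : complex.Im (cpath s) = s * complex.Im c.
    by rewrite /cpath ImD ImM ImD ImN ReD ReN /=; ring.
  rewrite normrM (ger0_norm s0).
  have : m <= complex.Re c - `|complex.Im c| by rewrite ge_min lexx orbT.
  move: m1; nra.
move=> /H {}H; rewrite -mulrN -mulrA -mulrN -mulrDr ler_wpM2l ?pi_ge0//; lra.
Qed.

Lemma gs_env : exists K h0 : R, [/\ 0 <= K, 0 < h0, h0 <= 1 &
  forall h s x, 0 <= h -> h <= h0 -> 0 <= s -> s <= 1 ->
    (1 + `|x|) ^+ 6 * expR (12 * pathB ^+ 2 * h * (1 + `|x|) ^+ 2) *
      cabs (gs (zpath s x)) <= K * wt x].
Proof.
have [k [E [k0 E0 H]]] := gs_decay.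
have A0 : 0 <= 12 * pathB ^+ 2 by rewrite mulr_ge0// sqr_ge0.
have [K [h0 [K0 h00 h01 hK]]] := gauss_absorb k0 A0 E0.
exists K, h0; split=> // h s x h1 h2 s0 s1.
by apply: le_trans (hK h x h1 h2); rewrite ler_wpM2l ?H.
Qed.

Lemma one_le_1Dnorm (x : R) : 1 <= 1 + `|x|.
Proof. by rewrite lerDl. Qed.

Lemma gs_wt : exists2 K : R, 0 <= K & forall s x, 0 <= s -> s <= 1 ->
  (1 + `|x|) * cabs (gs (zpath s x)) <= K * wt x.
Proof.
have [K [h0 [K0 h00 h01 hK]]] := gs_env.
exists K => // s x s0 s1; apply: le_trans (hK 0 s x (lexx _) (ltW h00) s0 s1).
rewrite mulr0 mul0r expR0 mulr1 ler_wpM2r ?cabs_ge0//.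
by rewrite -[leLHS]expr1 ler_weXn2l// one_le_1Dnorm.
Qed.

(** The first-order terms in h cancel because the s-derivative of [wpath] is the x-derivative of
    [upath]. Equal step sizes in s and x let the difference of [upath] telescope over hZ. *)
Lemma path_step : exists K h0 : R, [/\ 0 <= K, 0 < h0, h0 <= 1 &
  forall h s x, 0 <= h -> h <= h0 -> 0 <= s -> s + h <= 1 ->
  cabs (wpath (s + h) x - wpath s x - (upath s (x + h) - upath s x)) <= h ^+ 2 * (K * wt x)].
Proof.
have [K [h0 [K0 h00 h01 hK]]] := gs_env.
pose B := pathB; pose A := 12 * B ^+ 2.
have B1 : 1 <= B by apply: pathB_ge1.
have A0 : 0 <= A by rewrite mulr_ge0// sqr_ge0.
have A2 : 0 <= A ^+ 2 + A by rewrite addr_ge0// sqr_ge0.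
have B0 : 0 <= B by lra.
have BA : 0 <= 4 * B * (A ^+ 2 + A) by rewrite !mulr_ge0.
have B3 : 0 <= 16 * B ^+ 3 by rewrite mulr_ge0// exprn_ge0.
exists ((4 * B * (A ^+ 2 + A) + 16 * B ^+ 3) * K), h0; split=> //.
  by rewrite mulr_ge0// addr_ge0.
move=> h s x h1 h2 s0 s1; have sle1 : s <= 1 by lra.
have hle1 : h <= 1 by lra.
have X1x := one_le_1Dnorm x; set X := 1 + `|x| in X1x *.
pose z := zpath s x; pose p := (c - 1) * x%:C + b; pose cs := cpath s.
have e1 : zpath (s + h) x = z + h%:C * p.
  by rewrite /z /zpath /cpath /p rmorphD /=; ring.
have e2 : zpath s (x + h) = z + h%:C * cs.
  by rewrite /z /zpath /cs rmorphD /=; ring.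
have pB : cabs p <= B * X.
  apply: lin_bound; first exact: cabs_cB1_le.
  by rewrite /B /pathB; have := cabs_ge0 c; lra.
have zB : cabs z <= B * X by apply: zpath_bound.
have csB : cabs cs <= B by apply: cpath_bound.
have cB : cabs (c - 1) <= B by apply: cabs_cB1_le.
have BX : B <= B * X by rewrite ler_peMr//; lra.
have BX0 : 0 <= B * X by lra.
have d1 : cabs (h%:C * p) <= h * (B * X).
  by rewrite cabsM cabs_real ger0_norm// ler_wpM2l.
have d2 : cabs (h%:C * cs) <= h * (B * X).
  by rewrite cabsM cabs_real ger0_norm// ler_wpM2l//; lra.
have r1 := gs_remainder_bound B1 h1 hle1 X1x zB d1 (erefl A).
have r2 := gs_remainder_bound B1 h1 hle1 X1x zB d2 (erefl A).
(* After the factor gs z is taken out, the terms of order 0 and 1 in h cancel and [D] collects the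
   rest. *)
pose D := (cs + h%:C * (c - 1)) * gs_remainder z (h%:C * p) - (p + h%:C * (c - 1)) * gs_remainder z (h%:C * cs)
  + (h ^+ 2)%:C * (2 * piC * z * (c - 1) * (cs - p)).
have -> : wpath (s + h) x - wpath s x - (upath s (x + h) - upath s x) = gs z * D.
  rewrite /wpath /upath e1 e2 -/z !gs_shift -/cs.
  have -> : cpath (s + h) = cs + h%:C * (c - 1) by rewrite /cs /cpath rmorphD /=; ring.
  have -> : (c - 1) * (x + h)%:C + b = p + h%:C * (c - 1) by rewrite /p rmorphD /=; ring.
  by rewrite -/p /D rmorphXn /=; ring.
set e := expR _ in r1 r2.
have e10 : 1 <= e by rewrite -expR0 ler_expR; exact: mulr_ge0 (mulr_ge0 A0 h1) (sqr_ge0 _).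
have hc1 : cabs (h%:C * (c - 1)) <= B.
  rewrite cabsM cabs_real ger0_norm//; apply: le_trans cB.
  by rewrite ler_piMl ?cabs_ge0.
have p4 := @pi_le4 R; have p0 := @pi_ge0 R.
have hD : cabs D <= h ^+ 2 * ((4 * B * (A ^+ 2 + A) + 16 * B ^+ 3) * (X ^+ 6 * e)).
  have X2 (k : nat) : 1 <= X ^+ k by apply: exprn_ege1.
  have Q0 : 0 <= (A ^+ 2 + A) * X ^+ 4 * e.
    by rewrite mulr_ge0 ?expR_ge0// mulr_ge0// (le_trans ler01).
  have hh0 : 0 <= h ^+ 2 by apply: sqr_ge0.
  have t1 : cabs ((cs + h%:C * (c - 1)) * gs_remainder z (h%:C * p)) <=
      2 * (B * X) * (h ^+ 2 * ((A ^+ 2 + A) * X ^+ 4 * e)).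
    rewrite cabsM ler_pM ?cabs_ge0//; apply: le_trans (cabsD _ _) _; lra.
  have t2 : cabs ((p + h%:C * (c - 1)) * gs_remainder z (h%:C * cs)) <=
      2 * (B * X) * (h ^+ 2 * ((A ^+ 2 + A) * X ^+ 4 * e)).
    rewrite cabsM ler_pM ?cabs_ge0//; apply: le_trans (cabsD _ _) _; lra.
  have t3 : cabs ((h ^+ 2)%:C * (2 * piC * z * (c - 1) * (cs - p))) <=
      h ^+ 2 * (2 * 4 * (B * X) * B * (2 * (B * X))).
    rewrite cabsM cabs_real (ger0_norm hh0) ler_wpM2l// !cabsM cabs_nat cabs_real (ger0_norm p0).
    have cp : cabs (cs - p) <= 2 * (B * X) by apply: le_trans (cabsB _ _) _; lra.
    apply: ler_pM => //; rewrite ?mulr_ge0 ?cabs_ge0//.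
    apply: ler_pM => //; rewrite ?mulr_ge0 ?cabs_ge0//.
    apply: ler_pM => //; rewrite ?mulr_ge0 ?cabs_ge0//.
    lra.
  apply: le_trans (cabsD _ _) _; apply: le_trans (lerD (cabsB _ _) t3) _.
  apply: le_trans (lerD (lerD t1 t2) (lexx _)) _.
  have -> : 2 * (B * X) * (h ^+ 2 * ((A ^+ 2 + A) * X ^+ 4 * e)) +
    2 * (B * X) * (h ^+ 2 * ((A ^+ 2 + A) * X ^+ 4 * e)) +
    h ^+ 2 * (2 * 4 * (B * X) * B * (2 * (B * X))) =
    h ^+ 2 * (4 * B * (A ^+ 2 + A) * (X ^+ 5 * e) + 16 * B ^+ 3 * X ^+ 2) by ring.
  rewrite ler_wpM2l// [leRHS]mulrDl lerD//.
    rewrite ler_wpM2l//.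
    by rewrite ler_wpM2r ?expR_ge0// ler_weXn2l.
  rewrite ler_wpM2l//.
  rewrite -[leLHS]mulr1 ler_pM//; first by rewrite (le_trans ler01).
  by rewrite ler_weXn2l.
rewrite cabsM mulrC; apply: le_trans (ler_wpM2r (cabs_ge0 _) hD) _.
set Q := 4 * B * _ + _.
have -> : h ^+ 2 * (Q * (X ^+ 6 * e)) * cabs (gs z) =
  h ^+ 2 * (Q * (X ^+ 6 * e * cabs (gs z))) by ring.
rewrite ler_wpM2l ?sqr_ge0// -[leRHS]mulrA ler_wpM2l//; first exact: addr_ge0.
exact: hK.
Qed.

(** The two shifts have opposite first-order terms, so only the remainders survive. *)
Lemma second_diff : exists K h0 : R, [/\ 0 <= K, 0 < h0, h0 <= 1 &
  forall h x, 0 <= h -> h <= h0 ->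
  cabs (gs (zpath 1 (x + h)) + gs (zpath 1 (x - h)) - 2 * gs (zpath 1 x))
    <= h ^+ 2 * (K * wt x)].
Proof.
have [K [h0 [K0 h00 h01 hK]]] := gs_env.
pose B := pathB; pose A := 12 * B ^+ 2.
have B1 : 1 <= B by apply: pathB_ge1.
have A0 : 0 <= A by rewrite mulr_ge0// sqr_ge0.
exists (2 * (A ^+ 2 + A) * K), h0; split=> //.
  by rewrite !mulr_ge0 ?addr_ge0 ?sqr_ge0.
move=> h x h1 h2; have hle1 : h <= 1 by lra.
have X1x := one_le_1Dnorm x; set X := 1 + `|x| in X1x *.
pose z := zpath 1 x; pose cs := cpath 1.
have e1 : zpath 1 (x + h) = z + h%:C * cs.
  by rewrite /z /zpath /cs rmorphD /=; ring.
have e2 : zpath 1 (x - h) = z + - (h%:C * cs).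
  by rewrite /z /zpath /cs rmorphB /=; ring.
have zB : cabs z <= B * X by apply: zpath_bound.
have csB : cabs cs <= B by apply: cpath_bound.
have BX : B <= B * X by rewrite ler_peMr//; lra.
have d1 : cabs (h%:C * cs) <= h * (B * X).
  by rewrite cabsM cabs_real ger0_norm// ler_wpM2l//; lra.
have d2 : cabs (- (h%:C * cs)) <= h * (B * X) by rewrite cabsN.
have r1 := gs_remainder_bound B1 h1 hle1 X1x zB d1 (erefl A).
have r2 := gs_remainder_bound B1 h1 hle1 X1x zB d2 (erefl A).
rewrite e1 e2 (gs_shift z (h%:C * cs)) (gs_shift z (- (h%:C * cs))) -/z.
have -> : gs z * (1 - 2 * piC * z * (h%:C * cs) + gs_remainder z (h%:C * cs)) +
   gs z * (1 - 2 * piC * z * - (h%:C * cs) + gs_remainder z (- (h%:C * cs))) - 2 * gs z =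
   (gs_remainder z (h%:C * cs) + gs_remainder z (- (h%:C * cs))) * gs z by ring.
rewrite cabsM; apply: le_trans (ler_wpM2r (cabs_ge0 _) (le_trans (cabsD _ _) (lerD r1 r2))) _.
have hh := hK h 1 x h1 h2 ler01 (lexx _); rewrite -/X -/z -/A in hh.
set e := expR _ in hh *.
have -> : (h ^+ 2 * ((A ^+ 2 + A) * X ^+ 4 * e) + h ^+ 2 * ((A ^+ 2 + A) * X ^+ 4 * e)) *
   cabs (gs z) = h ^+ 2 * (2 * (A ^+ 2 + A) * (X ^+ 4 * e * cabs (gs z))) by ring.
rewrite ler_wpM2l ?sqr_ge0// -[leRHS]mulrA ler_wpM2l// ?mulr_ge0 ?addr_ge0 ?sqr_ge0//.
apply: le_trans hh; rewrite ler_wpM2r ?cabs_ge0// ler_wpM2r ?expR_ge0//.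
by rewrite ler_weXn2l.
Qed.

End GaussPath.

(** * Riemann sums of complex Gaussians *)

Section Jacobi.
Variable R : realType.
Local Notation C := R[i].
Local Notation piC := ((pi : R)%:C).
(** Equivalently Re (c^2) > 0, so that gs (c x) decays on the real line, and Re c > 0, which selects
    one of the two roots of c^2. *)
Definition sector (c : C) : Prop := `|complex.Im c| < complex.Re c.

Lemma sector_neq0 c : sector c -> c != 0.
Proof.
move=> hc; apply/eqP => c0; move: hc; rewrite /sector c0 /= normr0 ltxx //.
Qed.

Lemma sectorV c : sector c -> sector c^-1.
Proof.
move=> hc; have c0 := sector_neq0 hc; move: hc; rewrite /sector.
have -> : c^-1 = ((cabs c ^+ 2)^-1)%:C * conjc c.
  apply: (mulfI c0); rewrite divff// mulrCA mul_conj -rmorphM mulVf//.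
  by rewrite expf_neq0// cabs_eq0.
have p : 0 < (cabs c ^+ 2)^-1 by rewrite invr_gt0 exprn_gt0// cabs_gt0.
set r := (cabs c ^+ 2)^-1 in p *; rewrite ReM ImM; case: (c) => x y /=; rewrite !mul0r subr0 addr0 normrM normrN (gtr0_norm p).
by rewrite ltr_pM2l.
Qed.

Lemma sector1 : sector 1.
Proof. by rewrite /sector /= normr0. Qed.

Section Riemann.
Variables c b : C.
Hypothesis hc : sector c.

Lemma cpath1 : cpath c 1 = c.
Proof. by rewrite /cpath; ring. Qed.

Lemma zpath1 x : zpath c b 1 x = c * x%:C + b.
Proof. by rewrite /zpath cpath1; ring. Qed.

Lemma zpath0 x : zpath c b 0 x = x%:C.
Proof. by rewrite /zpath /cpath; ring. Qed.

Lemma asum_wt_le (h K : R) (f : int -> C) : 0 < h ->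
  (forall n, cabs (f n) <= K * wt (h * n%:~R)) -> asum f.
Proof.
move=> h0 H; case: (lerP 0 K) => K0.
  apply: (asum_ler (g := fun n => h^-1 * K * (h * wt (h * n%:~R)))).
    move=> n; apply: le_trans (H n) _; rewrite le_eqVlt; apply/orP; left; apply/eqP.
    by field; rewrite gt_eqF.
  by apply: sboundZ (sbound_wt (ltW h0)); rewrite mulr_ge0// invr_ge0 ltW.
exists 0 => s _; rewrite big1// => n _; apply/le_anti; rewrite cabs_ge0 andbT.
apply: le_trans (H n) _; rewrite mulr_le0_ge0 ?wt_ge0//; exact: ltW.
Qed.

Lemma tsum_wt_le (h K : R) (f : int -> C) : 0 < h -> 0 <= K -> h <= 1 ->
  (forall n, cabs (f n) <= h * (K * wt (h * n%:~R))) -> cabs (tsum f) <= 4 * K.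
Proof.
move=> h0 K0 h1 H; apply: (@le_trans _ _ (K * ((h + 1) + (h + 1)))).
  apply: tsum_bound; apply: sbound_le (sboundZ K0 (sbound_wt (ltW h0))) => n.
  by rewrite mulrCA.
by rewrite mulrC ler_wpM2r//; lra.
Qed.

Lemma tsum_shift (f : int -> C) : asum f -> tsum (fun n : int => f (n + 1)) = tsum f.
Proof.
move=> af; have inj : injective (fun n : int => n + 1) by apply: addIr.
have sup i : (forall j : int, j + 1 <> i) -> f i = 0.
  by move=> /(_ (i - 1)); rewrite subrK.
exact/esym/(tsum_reindex inj sup af).
Qed.

Lemma asum_gs (h s : R) : 0 < h -> 0 <= s -> s <= 1 ->
  asum (fun n : int => gs (zpath c b s (h * n%:~R))).
Proof.
move=> h0 s0 s1; have [K K0 HK] := gs_wt b hc.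
apply: (asum_wt_le (K := K) h0) => n; apply: le_trans (HK s _ s0 s1).
by rewrite ler_peMl ?cabs_ge0// one_le_1Dnorm.
Qed.

Lemma asum_upath (h s : R) : 0 < h -> 0 <= s -> s <= 1 ->
  asum (fun n : int => upath c b s (h * n%:~R)).
Proof.
move=> h0 s0 s1; have [K K0 HK] := gs_wt b hc.
apply: (asum_wt_le (K := pathB c b * K) h0) => n; rewrite -mulrA.
have B1 := pathB_ge1 c b.
apply: le_trans (ler_wpM2l (le_trans ler01 B1) (HK s _ s0 s1)).
rewrite /upath cabsM mulrA ler_wpM2r ?cabs_ge0//; apply: lin_bound.
  exact: cabs_cB1_le.
by rewrite /pathB; have := cabs_ge0 c; lra.
Qed.

Definition rsum (h s : R) : C := tsum (fun n : int => h%:C * wpath c b s (h * n%:~R)).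

Lemma asum_rsum h s : 0 < h -> 0 <= s -> s <= 1 ->
  asum (fun n : int => h%:C * wpath c b s (h * n%:~R)).
Proof. by move=> h0 s0 s1; apply/asumZ/asumZ/asum_gs. Qed.

(** The path from s = 0 to s = 1 is cut into M steps of length h = 1/M. Each step changes the sum by
    O(h^2), since the flux differences sum to zero over hZ, and the total change is O(h). This
    replaces a shift of contour. *)
Lemma rsum_const : exists K h0 : R, [/\ 0 <= K, 0 < h0 &
  forall M : nat, (0 < M)%N -> M%:R^-1 <= h0 ->
    cabs (rsum M%:R^-1 1 - rsum M%:R^-1 0) <= K * M%:R^-1].
Proof.
have [K [h0 [K0 h00 h01 HK]]] := path_step b hc.
exists (4 * K), h0; split=> //; first by rewrite mulr_ge0.
move=> M M0 Mh; set h := M%:R^-1 in Mh *.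
have MR : 0 < M%:R :> R by rewrite ltr0n.
have hp : 0 < h by rewrite invr_gt0.
have h1 : h <= 1 by lra.
have Mh1 : M%:R * h = 1 by rewrite divff ?gt_eqF.
have step (s : R) : 0 <= s -> s + h <= 1 -> cabs (rsum h (s + h) - rsum h s) <= 4 * (K * h ^+ 2).
  move=> s0 s1.
  have a1 : asum (fun n : int => h%:C * wpath c b (s + h) (h * n%:~R)).
    by apply: asum_rsum; lra.
  have a0 : asum (fun n : int => h%:C * wpath c b s (h * n%:~R)).
    by apply: asum_rsum; lra.
  have au : asum (fun n : int => h%:C * upath c b s (h * n%:~R)).
    by apply: asumZ; apply: asum_upath; lra.
  have au1 : asum (fun n : int => h%:C * upath c b s (h * (n + 1)%:~R)).
    have [B hB] := au; exists B => t ut.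
    rewrite -(big_map (fun n : int => n + 1) predT
      (fun n => cabs (h%:C * upath c b s (h * n%:~R)))); apply: hB.
    by rewrite map_inj_uniq//; apply: addIr.
  have U0 : tsum (fun n : int => h%:C * upath c b s (h * (n + 1)%:~R) -
      h%:C * upath c b s (h * n%:~R)) = 0.
    by rewrite tsumB// (tsum_shift au) subrr.
  rewrite /rsum -tsumB// -[tsum _]subr0 -U0 -tsumB; last 2 first.
  - by apply: asumD => //; apply: asum_le a0 => n; rewrite cabsN.
  - by apply: asumD => //; apply: asum_le au => n; rewrite cabsN.
  apply: (tsum_wt_le (h := h)) => //; first by rewrite mulr_ge0// sqr_ge0.
  move=> n; rewrite -!mulrBr cabsM cabs_real ger0_norm; last exact: ltW.
  rewrite ler_wpM2l//; first exact: ltW.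
  have -> : h * (n + 1)%:~R = h * n%:~R + h by rewrite rmorphD /= mulrDr mulr1.
  by apply: le_trans (HK h s _ _ _ _ _) _ => //; [exact: ltW|rewrite mulrCA mulrA].
have tot (j : nat) : (j <= M)%N -> cabs (rsum h (j%:R * h) - rsum h 0) <= j%:R * (4 * (K * h ^+ 2)).
  elim: j => [_|j IH jM]; first by rewrite mul0r subrr cabs0 mul0r.
  have s1 : j%:R * h + h <= 1.
    have : j.+1%:R * h <= M%:R * h by apply: ler_wpM2r; [exact: ltW|rewrite ler_nat].
    by rewrite -natr1 mulrDl mul1r Mh1.
  have i0 := IH (ltnW jM); have i1 := step _ (mulr_ge0 (ler0n R j) (ltW hp)) s1.
  rewrite -natr1 [X in rsum h X]mulrDl mul1r; apply: le_trans (cabs_tri (rsum h (j%:R * h)) _ _) _.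
  by rewrite [leRHS]mulrDl mul1r [leRHS]addrC; apply: lerD i1 i0.
have := tot M (leqnn _); rewrite Mh1 => H; apply: le_trans H _.
rewrite le_eqVlt; apply/orP; left; apply/eqP.
have -> : M%:R = h^-1 by rewrite /h invrK.
by field; rewrite gt_eqF.
Qed.

End Riemann.
End Jacobi.

(** * The Jacobi identity by finite Fourier inversion *)

Section Jacobi1.
Variable R : realType.
Local Notation C := R[i].
Local Notation piC := ((pi : R)%:C).

Lemma natC n : n%:R = (n%:R : R)%:C :> C.
Proof. by rewrite rmorph_nat. Qed.

Lemma ebf_realD (x y : R) : ebf (x + y)%:C = ebf x%:C * ebf y%:C.
Proof. by rewrite rmorphD ebfD. Qed.

Lemma ebf_realN (x : R) : ebf (- x)%:C = ebf (- x%:C).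
Proof. by rewrite rmorphN. Qed.

Lemma ebf_geom (M : nat) (n : int) (h := M%:R^-1 : R) : (0 < M)%N ->
  \sum_(j < M) ebf (- (h * n%:~R))%:C ^+ j =
  if (M %| n)%Z then M%:R else 0 :> C.
Proof.
move=> M0; have MR : M%:R != 0 :> R by rewrite pnatr_eq0 -lt0n.
set q := ebf _.
have qM : q ^+ M = 1.
  rewrite /q -ebf_nat natC -rmorphM /= /h mulrN mulrA mulfV// mul1r.
  by rewrite -rmorphN rmorph_int ebf_int.
have := subrX1 q M; rewrite qM subrr => /esym/eqP; rewrite mulf_eq0 subr_eq0.
have qint : (q == 1) = (M %| n)%Z.
  apply/eqP/idP => [/ebf_eq1|/dvdzP[k nk]].
    rewrite rpredN => /intrP[k hk]; apply/dvdzP; exists k.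
    apply: (@intr_inj R); rewrite rmorphM /= -hk /h mulrAC mulVf ?mul1r//.
  rewrite /q nk rmorphM /= /h mulrCA mulVf// mulr1 -rmorphN rmorph_int.
  exact: ebf_int.
rewrite -qint; case: eqP => [->|_] /=.
  by move=> _; rewrite (eq_bigr (fun=> 1)) ?sumr_const ?card_ord// => i _; rewrite expr1n.
by move=> /eqP.
Qed.

(** The mesh is 1/M with M = 2K + 1, and the frequencies j - K run through one residue system modulo
    M. Their characters sum to M at the indices n divisible by M, that is, at the integral points h
    n, and to 0 elsewhere. *)
Lemma dft_inversion (K : nat) (f : R -> C) (h := (K.*2.+1)%:R^-1 : R) :
  asum (fun n : int => f (h * n%:~R)) ->
  \sum_(j < K.*2.+1) tsum (fun n : int =>
     h%:C * (f (h * n%:~R) * ebf (- ((j%:R - K%:R) * (h * n%:~R)))%:C)) =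
  tsum (fun k : int => f k%:~R).
Proof.
move=> af; set M := K.*2.+1.
have MR : M%:R != 0 :> R by rewrite pnatr_eq0.
have a j : asum (fun n : int =>
     h%:C * (f (h * n%:~R) * ebf (- ((j%:R - K%:R) * (h * n%:~R)))%:C)).
  apply: asumZ; apply: asum_le af => n.
  by rewrite cabsM cabs_ebf_real mulr1.
pose F (n : int) := if (M %| n)%Z then f (h * n%:~R) else 0.
have aF : asum F.
  by apply: asum_le af => n; rewrite /F; case: ifP => // _; rewrite cabs0 cabs_ge0.
have inj : injective (fun k : int => k * M%:Z).
  by apply: mulIf.
have sup i : (forall k : int, k * M%:Z <> i) -> F i = 0.
  move=> H; rewrite /F; case: ifP => // /dvdzP[k hk]; case: (H k); exact: esym.
rewrite -tsum_sum//.
have -> : tsum (fun k : int => f k%:~R) = tsum F.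
  rewrite (tsum_reindex inj sup aF); apply: eq_tsum => k.
  rewrite /F dvdz_mull//; congr f.
  by rewrite rmorphM /= mulrCA /h mulVf ?mulr1.
apply: eq_tsum => n; rewrite -mulr_sumr -mulr_sumr.
have -> : \sum_(j < M) ebf (- ((j%:R - K%:R) * (h * n%:~R)))%:C =
   ebf (K%:R * (h * n%:~R))%:C * \sum_(j < M) ebf (- (h * n%:~R))%:C ^+ j.
  rewrite mulr_sumr; apply: eq_bigr => j _.
  rewrite -ebf_nat -ebfD natC -rmorphM -rmorphD /=.
  by congr (ebf _%:C); ring.
rewrite ebf_geom// /F; case: ifP => [/dvdzP[k nk]|_]; last by rewrite !mulr0.
have -> : ebf (K%:R * (h * n%:~R))%:C = 1.
  rewrite nk intrM (mulrCA h) /h mulVf// mulr1.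
  by rewrite -[K%:R]/(K%:Z%:~R) -intrM rmorph_int ebf_int.
rewrite mul1r mulrCA natC -rmorphM /= /h mulVf//.
by rewrite mulr1.
Qed.

Section OneVar.
Variables c b : C.
Hypothesis hc : sector c.
Let c0 : c != 0 := sector_neq0 hc.

Definition mode (h m : R) : C := tsum (fun n : int =>
  h%:C * (c * gs (c * (h * n%:~R)%:C + b) * ebf (- (m * (h * n%:~R)))%:C)).

(** The Fourier transform of x |-> c gs (c x + b) at m, equal to exp (- pi m^2 / c^2 + 2 pi i m b /
    c); [gs_mode] completes the square and leaves it next to a shifted Gaussian. *)
Definition ghat (m : R) : C := cexp (- (piC * b ^+ 2)) * gs (c^-1 * m%:C - 'i * b).

Lemma sqr_i : 'i ^+ 2 = -1 :> C.
Proof. by rewrite expr2; apply: complex_eq; rewrite ?(ReM, ImM) /=; ring. Qed.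

Lemma gs_mode (m x : R) : gs (c * x%:C + b) * ebf (- (m * x))%:C =
  gs (c * x%:C + (b + 'i * m%:C / c)) * ghat m.
Proof.
rewrite /gs ebfE /ghat /gs -!cexpD; congr cexp.
have i2 := sqr_i.
rewrite rmorphN rmorphM /= !sqrrD !exprMn !sqrrN !exprMn i2 exprVn; field => //.
Qed.

Lemma modeE (h m : R) : 0 < h ->
  mode h m = rsum c (b + 'i * m%:C / c) h 1 * ghat m.
Proof.
move=> h0; have a : asum (fun n : int =>
    h%:C * wpath c (b + 'i * m%:C / c) 1 (h * n%:~R)) by apply: asum_rsum.
rewrite mulrC -tsumZ//; apply: eq_tsum => n.
rewrite -mulrA gs_mode /wpath zpath1 cpath1; ring.
Qed.

Lemma asum_mode (h m : R) : 0 < h -> asum (fun n : int =>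
  h%:C * (c * gs (c * (h * n%:~R)%:C + b) * ebf (- (m * (h * n%:~R)))%:C)).
Proof.
move=> h0; apply: asumZ; apply: asum_le (asumZ c (asum_gs b hc h0 ler01 (lexx 1))) => n.
by rewrite zpath1 [leLHS]cabsM cabs_ebf_real mulr1.
Qed.

(** Summation by parts twice: the mode times [E] is a Riemann sum of second differences, of size
    h^2, while |E| is at least 4 (m h)^2. The quotient is of order 1 / m^2 uniformly in h, the
    domination that [tannery] asks for. *)
Lemma mode_bound : exists K h0 : R, [/\ 0 <= K, 0 < h0 & forall h (m : int), 0 < h -> h <= h0 ->
  `|m%:~R * h| <= 2^-1 -> cabs (mode h m%:~R) <= K * wt m%:~R].
Proof.
have [K1 K10 H1] := gs_wt b hc.
have [K2 [h0 [K20 h00 h01 H2]]] := second_diff b hc.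
have cc := cabs_ge0 c.
exists (4 * (cabs c * (K1 + K2))), h0; split=> //.
  by rewrite !mulr_ge0// addr_ge0.
move=> h m hp hh0 hm; have h1 : h <= 1 by apply: le_trans h01.
have p0 : 0 <= cabs c * (K1 + K2) by rewrite mulr_ge0// addr_ge0.
(* At m = 0 the factor [E] vanishes, and the Riemann sum is bounded directly. *)
have [m0|m0] := eqVneq m 0.
  rewrite m0 /wt normr0 addr0 expr1n invr1 mulr1.
  apply: (tsum_wt_le (h := h)) => // n.
  rewrite cabsM cabs_real (gtr0_norm hp) ler_pM2l// cabsM cabs_ebf_real mulr1 cabsM.
  rewrite -mulrA ler_wpM2l// -zpath1.
  apply: (@le_trans _ _ (K1 * wt (h * n%:~R))); last by rewrite ler_wpM2r ?wt_ge0 ?lerDl.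
  by apply: le_trans (H1 1 _ ler01 (lexx _)); rewrite ler_peMl ?cabs_ge0// one_le_1Dnorm.
set x := m%:~R * h in hm; set E := ebf x%:C + ebf (- x%:C) - 2.
have hE := ebf_second_diff hm.
pose f (n : int) := h%:C * (c * gs (c * (h * n%:~R)%:C + b) * ebf (- (m%:~R * (h * n%:~R)))%:C).
pose fp (n : int) := h%:C * (c * gs (c * (h * n%:~R + h)%:C + b) * ebf (- (m%:~R * (h * n%:~R)))%:C).
pose fm (n : int) := h%:C * (c * gs (c * (h * n%:~R - h)%:C + b) * ebf (- (m%:~R * (h * n%:~R)))%:C).
have af : asum f by apply: asum_mode.
have fpE n : fp n = ebf x%:C * f (n + 1).
  rewrite /fp; have -> : ebf (- (m%:~R * (h * n%:~R)))%:C = ebf x%:C * ebf (- (m%:~R * (h * (n + 1)%:~R)))%:C.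
    by rewrite intrD -ebf_realD; congr (ebf (_%:C)); rewrite /x; ring.
  rewrite /f; have -> : h * (n + 1)%:~R = h * n%:~R + h by rewrite intrD mulrDr mulr1.
  ring.
have fmE n : fm (n + 1) = ebf (- x%:C) * f n.
  have -> : fm (n + 1) = h%:C * (c * gs (c * (h * n%:~R)%:C + b) * ebf (- (m%:~R * (h * (n + 1)%:~R)))%:C).
    by rewrite /fm intrD mulrDr mulr1 addrK.
  have -> : ebf (- (m%:~R * (h * (n + 1)%:~R)))%:C = ebf (- x%:C) * ebf (- (m%:~R * (h * n%:~R)))%:C.
    by rewrite intrD -(ebf_realN x) -ebf_realD; congr (ebf (_%:C)); rewrite /x; ring.
  rewrite /f; ring.
have af1 : asum (fun n : int => f (n + 1)).
  have [B hB] := af; exists B => t ut.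
  rewrite -(big_map (fun n : int => n + 1) predT (fun n => cabs (f n))); apply: hB.
  by rewrite map_inj_uniq//; apply: addIr.
have afp : asum fp by rewrite (funext fpE); apply: asumZ.
have afm1 : asum (fun n : int => fm (n + 1)) by rewrite (funext fmE); apply: asumZ.
have afm : asum fm.
  apply/(@asum_reindex _ _ _ (fun n : int => n + 1)) => //; first exact: addIr.
  by move=> i /(_ (i - 1)); rewrite subrK.
(* A shift of the summation index trades a shift of the Gaussian by h for a phase at x or - x. *)
have e : E * mode h m%:~R = tsum (fun n => fp n + fm n - 2 * f n).
  have -> : tsum (fun n => fp n + fm n - 2 * f n) = tsum fp + tsum fm - 2 * tsum f.
    by rewrite -(tsumZ 2 af) -(tsumD afp afm) -(tsumB (asumD afp afm) (asumZ 2 af)).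
  rewrite -(tsum_shift afm) (eq_tsum fmE) (eq_tsum fpE) (tsumZ _ af1) (tsumZ _ af).
  by rewrite (tsum_shift af) /E -[mode _ _]/(tsum f); ring.
have : cabs (E * mode h m%:~R) <= 4 * (cabs c * (h ^+ 2 * K2)).
  rewrite e; apply: (tsum_wt_le (h := h)) => //; first by apply: mulr_ge0 => //; rewrite mulr_ge0// sqr_ge0.
  move=> n; have -> : fp n + fm n - 2 * f n = h%:C * (c * (gs (zpath c b 1 (h * n%:~R + h)) +
      gs (zpath c b 1 (h * n%:~R - h)) - 2 * gs (zpath c b 1 (h * n%:~R)))
      * ebf (- (m%:~R * (h * n%:~R)))%:C).
    by rewrite !zpath1 /fp /fm /f; ring.
  rewrite cabsM cabs_real (gtr0_norm hp) ler_pM2l// cabsM cabs_ebf_real mulr1 cabsM.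
  rewrite -mulrA ler_wpM2l// -[leRHS]mulrA; apply: H2 => //; exact: ltW.
rewrite cabsM => He.
have : 4 * x ^+ 2 * cabs (mode h m%:~R) <= 4 * (cabs c * (h ^+ 2 * K2)).
  by apply: le_trans He; rewrite ler_wpM2r ?cabs_ge0.
have -> : 4 * x ^+ 2 * cabs (mode h m%:~R) = h ^+ 2 * (4 * (m%:~R ^+ 2 * cabs (mode h m%:~R))).
  by rewrite /x; ring.
have -> : 4 * (cabs c * (h ^+ 2 * K2)) = h ^+ 2 * (4 * (cabs c * K2)) by ring.
rewrite ler_pM2l ?exprn_gt0// ler_pM2l// => Hm.
rewrite /wt ler_pdivlMr ?exprn_gt0 ?ltr_wpDr//.
have mm : (1 + `|m%:~R|) ^+ 2 <= 4 * m%:~R ^+ 2 :> R.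
  rewrite -[m%:~R ^+ 2]real_normK ?num_real//.
  have : 1 <= `|m%:~R| :> R.
    by rewrite -intr_norm -[1]/(1%:~R) ler_int -gtz0_ge1 normr_gt0.
  set t := `|m%:~R|; nra.
rewrite mulrC; apply: le_trans (ler_wpM2r (cabs_ge0 _) mm) _.
rewrite -mulrA ler_pM2l//; apply: le_trans Hm _.
by rewrite ler_wpM2l// lerDr.
Qed.

Lemma ghat_wt : exists2 K : R, 0 <= K & forall m : R, cabs (ghat m) <= K * wt m.
Proof.
have [K K0 HK] := gs_wt (- ('i * b)) (sectorV hc).
exists (cabs (cexp (- (piC * b ^+ 2))) * K); first by rewrite mulr_ge0 ?cabs_ge0.
move=> m; rewrite /ghat cabsM -mulrA ler_wpM2l ?cabs_ge0//.
apply: le_trans (HK 1 m ler01 (lexx _)); rewrite zpath1.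
by rewrite ler_peMl ?cabs_ge0// one_le_1Dnorm.
Qed.

Lemma asum_ghat : asum (fun m : int => ghat m%:~R).
Proof.
have [K K0 HK] := ghat_wt.
by apply: (asum_wt_le (K := K) (@ltr01 R)) => n; rewrite mul1r.
Qed.

Definition gauss_rsum (N : nat) : C := rsum 1 0 (N.*2.+1%:R^-1) 1.

(** At s = 0 the path starts at (1, 0) for every b', so the modes of all frequencies are compared
    with one and the same Riemann sum. *)
Lemma rsum0 b' h : rsum c b' h 0 = rsum 1 0 h 1.
Proof.
apply: eq_tsum => n; rewrite /wpath zpath0 zpath1 cpath1.
by rewrite /cpath mul0r addr0 !mul1r addr0.
Qed.

Lemma inv_small (h0 : R) : 0 < h0 -> exists N0, forall N, (N0 <= N)%N -> N.*2.+1%:R^-1 <= h0.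
Proof.
move=> h00; exists (Num.truncn h0^-1).+1 => N hN.
have : h0^-1 <= N.*2.+1%:R.
  apply: (@le_trans _ _ N%:R); last by rewrite ler_nat -addnn leqW// leq_addr.
  apply: (@le_trans _ _ (Num.truncn h0^-1).+1%:R); last by rewrite ler_nat.
  have hi : 0 <= h0^-1 by rewrite invr_ge0 ltW.
  by have /andP[_ /ltW] := truncn_itv hi.
by move=> H; rewrite -[h0]invrK lef_pV2 ?posrE ?invr_gt0 ?ltr0n.
Qed.


Lemma gauss_rsum_bound : exists2 K : R, 0 <= K & forall N, cabs (gauss_rsum N) <= K.
Proof.
have [K K0 HK] := gs_wt 0 (@sector1 R); exists (4 * K); first by rewrite mulr_ge0.
move=> N; pose h : R := N.*2.+1%:R^-1; have h0 : 0 < h by rewrite invr_gt0 ltr0n.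
have h1 : h <= 1 by rewrite invf_le1 ?ltr0n// ler1n.
apply: (tsum_wt_le (h := h)) => // n.
rewrite cabsM cabs_real (gtr0_norm h0) ler_pM2l// /wpath cpath1 mul1r.
by apply: le_trans (HK 1 _ ler01 (lexx _)); rewrite ler_peMl ?cabs_ge0// one_le_1Dnorm.
Qed.

Lemma mode_gauss_rsum (m : R) e : 0 < e -> exists N0, forall N, (N0 <= N)%N ->
  cabs (mode (N.*2.+1%:R^-1) m - gauss_rsum N * ghat m) < e.
Proof.
move=> e0; have [K [h0 [K0 h00 HK]]] := rsum_const (b + 'i * m%:C / c) hc.
pose g := cabs (ghat m); have g0 : 0 <= g by apply: cabs_ge0.
pose d := Num.min h0 (e / (K * g + 1)).
have Kg : 0 < K * g + 1 by rewrite ltr_wpDl// mulr_ge0.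
have d0 : 0 < d by rewrite lt_min h00 divr_gt0.
have [N0 hN0] := inv_small d0; exists N0 => N /hN0 hN.
set h := N.*2.+1%:R^-1 in hN *; have hp : 0 < h by rewrite invr_gt0 ltr0n.
rewrite modeE// /gauss_rsum -(rsum0 (b + 'i * m%:C / c)) -mulrBl cabsM -/g.
have hh0 : h <= h0 by apply: le_trans hN _; rewrite ge_min lexx.
apply: le_lt_trans (ler_wpM2r g0 (HK _ (ltn0Sn _) hh0)) _.
have : h <= e / (K * g + 1) by apply: le_trans hN _; rewrite ge_min lexx orbT.
rewrite ler_pdivlMr// -/h; nra.
Qed.

Definition dfreq (N j : nat) : int := j%:Z - N%:Z.

(** For each N, finite Fourier inversion expresses the first series exactly through the modes |m| <=
    N; each mode is close to [gauss_rsum N] times [ghat m], and [tannery] sums the errors. *)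
Lemma jacobi_limit e : 0 < e -> exists N0, forall N, (N0 <= N)%N ->
  cabs (tsum (fun k : int => c * gs (c * k%:~R + b)) - gauss_rsum N * tsum (fun m : int => ghat m%:~R)) < e.
Proof.
move=> e0; have [K1 [h0 [K10 h00 H1]]] := mode_bound.
have [K2 K20 H2] := ghat_wt; have [K3 K30 H3] := gauss_rsum_bound.
have [N1 hN1] := inv_small h00.
(* The offset [N1] makes the mesh small enough for [mode_bound] at every index N, as the domination
   in [tannery] requires. *)
pose hh N : R := (N + N1).*2.+1%:R^-1.
pose fN N (m : int) := (if (`|m| <= N + N1)%N then mode (hh N) m%:~R else 0) -
   gauss_rsum (N + N1) * ghat m%:~R.
pose g (m : int) := (K1 + K3 * K2) * (1 * wt (1 * m%:~R)).
have hg := sboundZ (addr_ge0 K10 (mulr_ge0 K30 K20)) (sbound_wt (@ler01 R)).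
have bnd N m : cabs (fN N m) <= g m.
  apply: le_trans (cabsB _ _) _; rewrite /g !mul1r mulrDl lerD//.
    case: leqP => hm; last by rewrite cabs0 mulr_ge0 ?wt_ge0.
    apply: H1; rewrite ?invr_gt0 ?ltr0n//; first by apply: hN1; rewrite leq_addl.
    rewrite normrM (_ : `|hh N| = hh N); last by rewrite gtr0_norm ?invr_gt0 ?ltr0n.
    rewrite /hh ler_pdivrMr ?ltr0n//.
    have -> : (N + N1).*2.+1%:R = 2 * (N + N1)%:R + 1 :> R by rewrite -natr1 -muln2 natrM mulrC.
    have -> : `|m%:~R| = (`|m|%N)%:R :> R by rewrite -intr_norm -abszE.
    have : (`|m|%N)%:R <= (N + N1)%:R :> R by rewrite ler_nat.
    lra.
  rewrite cabsM -mulrA; apply: ler_pM; rewrite ?cabs_ge0//.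
have lim m d : 0 < d -> exists N0, forall N, (N0 <= N)%N -> cabs (fN N m - 0) < d.
  move=> d0; have [N2 h2] := mode_gauss_rsum m%:~R d0.
  exists (maxn N2 `|m|) => N; rewrite geq_max => /andP[a b'].
  rewrite subr0 /fN (leq_trans b' (leq_addr _ _)).
  by apply: h2; apply: leq_trans a (leq_addr _ _).
have [_ /(_ e e0)[N0 hN0]] := tannery hg bnd lim.
exists (N0 + N1)%N => N hN.
have e1 : N = ((N - N1) + N1)%N by rewrite subnK//; apply: leq_trans hN; rewrite leq_addl.
have /hN0 : (N0 <= N - N1)%N by rewrite leq_subRL 1?addnC// (leq_trans (leq_addl _ _) hN).
have -> : tsum (fun _ : int => 0 : C) = 0 :> C by apply: has_sum_tsum; apply: has_sum0.
rewrite subr0; have as2 : asum (fun m : int => gauss_rsum N * ghat m%:~R) by apply/asumZ/asum_ghat.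
pose h : R := N.*2.+1%:R^-1; have hp : 0 < h by rewrite invr_gt0 ltr0n.
have inj : injective (dfreq N) by move=> i j /addIr [].
have hs : has_sum (fun m : int => if (`|m| <= N)%N then mode h m%:~R else 0)
    (tsum (fun k : int => c * gs (c * k%:~R + b))).
  pose s := [seq dfreq N j | j <- index_iota 0 N.*2.+1].
  have us : uniq s by rewrite map_inj_uniq ?iota_uniq.
  have memS (m : int) : (m \in s) = (`|m| <= N)%N.
    apply/mapP/idP => [[j]|hm].
      rewrite mem_index_iota ltnS /dfreq => /andP[_ hj] ->; lia.
    exists (absz (m + N%:Z)); rewrite ?mem_index_iota /dfreq; lia.
  have a : asum (fun n : int => c * gs (c * (h * n%:~R)%:C + b)).
    by apply: asumZ; apply: asum_le (asum_gs b hc hp ler01 (lexx 1)) => n; rewrite zpath1.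
  have -> : tsum (fun k : int => c * gs (c * k%:~R + b)) =
      \sum_(m <- s) (if (`|m| <= N)%N then mode h m%:~R else 0).
    rewrite big_map big_mkord.
    have := dft_inversion (f := fun x => c * gs (c * x%:C + b)) a.
    under [X in _ = X -> _]eq_tsum do rewrite rmorph_int.
    move=> <-; apply: eq_bigr => -[j /= hj] _.
    have -> : (`|dfreq N j| <= N)%N by rewrite /dfreq; lia.
    apply: eq_tsum => n; congr (_ * (_ * ebf (- _)%:C)).
    by rewrite /dfreq intrD rmorphN.
  by apply: has_sum_fin => // m; rewrite memS => /negbTE ->.
rewrite /fN -e1 /hh -e1 -/h tsumB//; first by rewrite (has_sum_tsum hs) tsumZ//; apply: asum_ghat.
have [B hB] := as2.
apply: (asum_ler _ (sboundD hg hB)).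
  move=> m; have := bnd (N - N1)%N m; rewrite /fN -e1 /hh -e1 -/h => H.
  rewrite -[X in cabs X](subrK (gauss_rsum N * ghat m%:~R)).
  by apply: le_trans (cabsD _ _) _; rewrite lerD2r.
Qed.

End OneVar.

(** The terms are positive reals, and the one at k = 0 equals 1. *)
Lemma theta_neq0 : tsum (fun k : int => gs (k%:~R : C)) != 0 :> C.
Proof.
have hc := @sector1 R.
have a : asum (fun k : int => gs (k%:~R : C)).
  apply: asum_le (asum_gs 0 hc ltr01 ler01 (lexx 1)) => n.
  by rewrite zpath1 mul1r addr0 mul1r rmorph_int.
have [||s [us [hs s0]]] := evt_ex (evtI (asum_has_sum a (_ : 0 < 2^-1)) (_ : evt (fun s => 0 \in s))).
- by rewrite invr_gt0.
- by exists [:: 0] => s _; apply; rewrite mem_head.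
apply/eqP => t0; move: hs; rewrite t0 subr0 => /(le_lt_trans (Re_le_cabs _)).
rewrite Re_sum.
have E (k : int) : complex.Re (gs (k%:~R : C)) = expR (- (pi * k%:~R ^+ 2)).
  by rewrite /gs -[k%:~R](rmorph_int (real_complex R)) -rmorphXn -rmorphM -rmorphN cexp_real.
have : 1 <= \sum_(k <- s) complex.Re (gs (k%:~R : C)).
  rewrite (eq_bigr _ (fun k _ => E k)) (bigD1_seq (0 : int))//=.
  rewrite expr0n mulr0 oppr0 expR0 lerDl sumr_ge0// => k _; exact: expR_ge0.
move=> h1 /(le_lt_trans (ler_norm _)) /(le_lt_trans h1); clear; lra.
Qed.

(** For c = 1 and b = 0 both series of [jacobi_limit] are the same nonzero T, so the convergence of
    T - gauss_rsum N * T to 0 forces the limit 1. *)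
Lemma gauss_rsum_lim e : 0 < e -> exists N0, forall N, (N0 <= N)%N -> cabs (gauss_rsum N - 1) < e.
Proof.
move=> e0; set T := tsum (fun k : int => gs (k%:~R : C)).
have T0 : 0 < cabs T by rewrite cabs_gt0 theta_neq0.
have [N0 hN0] := jacobi_limit 0 (@sector1 R) (mulr_gt0 e0 T0).
exists N0 => N /hN0.
have -> : tsum (fun k : int => 1 * gs (1 * k%:~R + 0) : C) = T.
  by apply: eq_tsum => k; rewrite !mul1r addr0.
have -> : tsum (fun m : int => ghat 1 0 m%:~R) = T.
  apply: eq_tsum => k.
  by rewrite /ghat expr0n mulr0 oppr0 cexp0 mul1r invr1 mul1r mulr0 subr0 rmorph_int.
rewrite -[X in X - _]mul1r -mulrBl cabsM cabsBC ltr_pM2r//.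
Qed.

Lemma jacobi c b : sector c ->
  tsum (fun k : int => c * gs (c * k%:~R + b)) =
  tsum (fun m : int => cexp (- (piC * b ^+ 2)) * gs (c^-1 * m%:~R - 'i * b)).
Proof.
move=> hc; set A := tsum _; set B := tsum _.
have BE : B = tsum (fun m : int => ghat c b m%:~R).
  by apply: eq_tsum => m; rewrite /ghat rmorph_int.
apply/eqP; rewrite -subr_eq0 -cabs_eq0; apply/eqP/le_anti.
rewrite cabs_ge0 andbT; apply/ler_addgt0Pr => e e0; rewrite add0r.
have b1 : 0 < cabs B + 1 by rewrite ltr_wpDl ?cabs_ge0.
have e2 : 0 < e / 2 by rewrite divr_gt0.
have [N0 h0] := jacobi_limit b hc e2.
have [N1 h1] := gauss_rsum_lim (divr_gt0 e2 b1).
have := h0 _ (leq_maxl N0 N1); have := h1 _ (leq_maxr N0 N1).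
set k := gauss_rsum _ => hk hA; rewrite -BE -/A in hA.
apply: le_trans (cabs_tri (k * B) _ _) _; rewrite [leRHS]splitr lerD//; first exact: ltW.
rewrite -[X in _ - X]mul1r -mulrBl cabsM.
apply: (@le_trans _ _ (cabs (k - 1) * (cabs B + 1))).
  by rewrite ler_wpM2l ?cabs_ge0// lerDl.
by rewrite -ler_pdivlMr// ltW.
Qed.

End Jacobi1.

(** * Theta series in several variables *)

Section BilinearForms.
Variable F : comNzRingType.

(** [form] is real; the same expression is needed for complex matrices and vectors, and over R the
    two unfold to the same term. *)
Definition bf n (A : 'M[F]_n) (x y : 'rV[F]_n) : F := (x *m A *m y^T) 0 0.

Definition dot n (x y : 'rV[F]_n) : F := (x *m y^T) 0 0.

Variable n : nat.
Implicit Types (A : 'M[F]_n) (x y z : 'rV[F]_n).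

Lemma bfDl A x y z : bf A (x + y) z = bf A x z + bf A y z.
Proof. by rewrite /bf !mulmxDl mxE. Qed.

Lemma bfZl A a x z : bf A (a *: x) z = a * bf A x z.
Proof. by rewrite /bf -!scalemxAl mxE. Qed.

Lemma bf_tr A x y : bf A x y = bf A^T y x.
Proof. by rewrite /bf (_ : (y *m _ *m _) = (x *m A *m y^T)^T) ?mxE// !trmx_mul trmxK mulmxA. Qed.

Lemma bf_sym A x y : A^T = A -> bf A x y = bf A y x.
Proof. by rewrite bf_tr => ->. Qed.

Lemma bfDr A x y z : bf A z (x + y) = bf A z x + bf A z y.
Proof. by rewrite !(bf_tr A z) bfDl. Qed.

Lemma bfZr A a x z : bf A z (a *: x) = a * bf A z x.
Proof. by rewrite !(bf_tr A z) bfZl. Qed.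

Lemma bfNl A x z : bf A (- x) z = - bf A x z.
Proof. by rewrite -scaleN1r bfZl mulN1r. Qed.

Lemma bfNr A x z : bf A z (- x) = - bf A z x.
Proof. by rewrite -scaleN1r bfZr mulN1r. Qed.

Lemma bfBl A x y z : bf A (x - y) z = bf A x z - bf A y z.
Proof. by rewrite bfDl bfNl. Qed.

Lemma bfBr A x y z : bf A z (x - y) = bf A z x - bf A z y.
Proof. by rewrite bfDr bfNr. Qed.

Lemma bf0l A x : bf A 0 x = 0.
Proof. by rewrite -(scale0r 0) bfZl mul0r. Qed.

Lemma bf_mxD A B x y : bf (A + B) x y = bf A x y + bf B x y.
Proof. by rewrite /bf mulmxDr mulmxDl mxE. Qed.

Lemma bf_mxN A x y : bf (- A) x y = - bf A x y.
Proof. by rewrite /bf mulmxN mulNmx mxE. Qed.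

Lemma bf_mxZ a A x y : bf (a *: A) x y = a * bf A x y.
Proof. by rewrite /bf -scalemxAr -scalemxAl mxE. Qed.

Lemma bf_mul A x y : bf A x y = dot (x *m A) y.
Proof. by []. Qed.

Lemma dotC x y : dot x y = dot y x.
Proof. by rewrite /dot (_ : y *m _ = (x *m y^T)^T) ?mxE// trmx_mul trmxK. Qed.

Lemma dotE x y : dot x y = \sum_i x 0 i * y 0 i.
Proof. by rewrite /dot mxE; apply: eq_bigr => i _; rewrite mxE. Qed.

Lemma dotDl x y z : dot (x + y) z = dot x z + dot y z.
Proof. by rewrite /dot mulmxDl mxE. Qed.

Lemma dotZl a x z : dot (a *: x) z = a * dot x z.
Proof. by rewrite /dot -scalemxAl mxE. Qed.

Lemma dotDr x y z : dot z (x + y) = dot z x + dot z y.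
Proof. by rewrite !(dotC z) dotDl. Qed.

Lemma dotZr a x z : dot z (a *: x) = a * dot z x.
Proof. by rewrite !(dotC z) dotZl. Qed.

Lemma dotNl x z : dot (- x) z = - dot x z.
Proof. by rewrite -scaleN1r dotZl mulN1r. Qed.

Lemma dotBl x y z : dot (x - y) z = dot x z - dot y z.
Proof. by rewrite dotDl dotNl. Qed.

Lemma dot0l x : dot 0 x = 0.
Proof. by rewrite -(scale0r 0) dotZl mul0r. Qed.

Lemma dot_mulmx m (x : 'rV[F]_m) (B : 'M[F]_(m, n)) y : dot (x *m B) y = dot x (y *m B^T).
Proof. by rewrite /dot trmx_mul trmxK mulmxA. Qed.

End BilinearForms.

Section BfUnit.
Variables (F : fieldType) (n : nat).
Implicit Types (A : 'M[F]_n) (x y : 'rV[F]_n).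

Lemma bf_inv A x y : A^T = A -> A \in unitmx -> bf (invmx A) (x *m A) (y *m A) = bf A x y.
Proof. by move=> sA uA; rewrite /bf mulmxK// trmx_mul sA mulmxA. Qed.

Lemma invmx_sym A : A^T = A -> (invmx A)^T = invmx A.
Proof. by move=> sA; rewrite trmx_inv sA. Qed.

Lemma unitmx_inj A : (forall x, x *m A = 0 -> x = 0) -> A \in unitmx.
Proof.
move=> H; rewrite -row_free_unit -kermx_eq0; apply/eqP/row_matrixP => i.
by rewrite row0; apply: H; rewrite -row_mul mulmx_ker row0.
Qed.

End BfUnit.

Section PosDef.
Variables (R : realFieldType) (n : nat).
Implicit Types (B : 'M[R]_n) (x y : 'rV[R]_n).

(** The coordinates of x are the values B (x, e i) at the dual basis [e], so Cauchy-Schwarz for B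
    bounds the standard norm; this takes the place of a compactness argument on the sphere. *)
Lemma posdef_quant B : B^T = B -> (forall x, x != 0 -> 0 < bf B x x) ->
  exists2 c, 0 < c & forall x, c * dot x x <= bf B x x.
Proof.
move=> sB pB.
have pB0 x : 0 <= bf B x x.
  have [->|x0] := eqVneq x 0; first by rewrite bf0l.
  exact/ltW/pB.
have uB : B \in unitmx.
  apply: unitmx_inj => x xB; apply/eqP; apply: contraT => /pB.
  by rewrite bf_mul xB dot0l ltxx.
have CS x y : bf B x y ^+ 2 <= bf B x x * bf B y y.
  have [->|y0] := eqVneq y 0.
    by rewrite bf_sym// !bf0l expr0n mulr0.
  have yy := pB _ y0.
  have := pB0 (bf B y y *: x - bf B x y *: y).
  rewrite !(bfBl, bfBr, bfZl, bfZr) (bf_sym y x sB).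
  rewrite (_ : _ - _ = bf B y y * (bf B x x * bf B y y - bf B x y ^+ 2)); last by ring.
  by rewrite pmulr_rge0// subr_ge0.
pose e i : 'rV[R]_n := delta_mx 0 i *m invmx B.
pose G := \sum_(i < n) bf B (e i) (e i).
have G0 : 0 <= G by apply: sumr_ge0 => i _.
exists (G + 1)^-1; first by rewrite invr_gt0 ltr_wpDl.
move=> x; rewrite mulrC ler_pdivrMr; last by rewrite ltr_wpDl.
have H : dot x x <= bf B x x * G.
  rewrite dotE /G mulr_sumr; apply: ler_sum => i _; rewrite -expr2.
  apply: le_trans (CS x (e i)); rewrite le_eqVlt; apply/orP; left; apply/eqP.
  congr (_ ^+ 2); rewrite /e /bf trmx_mul trmx_inv sB mulmxA mulmxK//.
  by rewrite trmx_delta -colE !mxE.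
by apply: le_trans H _; rewrite ler_wpM2l ?lerDl.
Qed.

End PosDef.

Section Siegel.
Variable R : realType.
Local Notation C := R[i].
Local Notation piC := ((pi : R)%:C).

Definition toC m n (x : 'M[R]_(m, n)) : 'M[C]_(m, n) := map_mx (real_complex R) x.
Definition zvec n (k : 'rV[int]_n) : 'rV[C]_n := map_mx intr k.

Local Notation zr := (@zvec _).
Lemma zrE n (k : 'rV[int]_n) : zr k = toC (map_mx intr k).
Proof. by apply/matrixP => i j; rewrite !mxE rmorph_int. Qed.

Lemma bfE n (A : 'M[C]_n) x y : bf A x y = \sum_j \sum_i x 0 i * A i j * y 0 j.
Proof.
rewrite /bf mxE; apply: eq_bigr => j _; rewrite !mxE mulr_suml.
by apply: eq_bigr => i _.
Qed.

Definition Remx n (A : 'M[C]_n) : 'M[R]_n := map_mx (@complex.Re R) A.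

Lemma Re_bf n (A : 'M[C]_n) x y : complex.Re (bf A (toC x) (toC y)) = bf (Remx A) x y.
Proof.
rewrite bfE Re_sum [RHS]mxE; apply: eq_bigr => j _; rewrite Re_sum !mxE mulr_suml.
apply: eq_bigr => i _; rewrite !mxE !(ReM, ImM) /=; ring.
Qed.

(** For symmetric A this says that i A lies in Siegel's upper half-space. *)
Definition posQ n (A : 'M[C]_n) : Prop :=
  forall x : 'rV[R]_n, x != 0 -> 0 < complex.Re (bf A (toC x) (toC x)).

Lemma posQ_quant n (A : 'M[C]_n) : A^T = A -> posQ A ->
  exists2 c : R, 0 < c & forall x, c * dot x x <= complex.Re (bf A (toC x) (toC x)).
Proof.
move=> sA pA; have [||c c0 H] := @posdef_quant R n (Remx A).
- by apply/matrixP => i j; rewrite !mxE -[in LHS]sA mxE.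
- by move=> x x0; rewrite -Re_bf; apply: pA.
by exists c => // x; rewrite Re_bf.
Qed.

(* [x A x^*] has positive real part for complex [x]. *)
Lemma posQ_herm n (A : 'M[C]_n) (x : 'rV[C]_n) : A^T = A -> posQ A -> x != 0 ->
  0 < complex.Re (bf A x (map_mx conjc x)).
Proof.
move=> sA pA x0; pose p := map_mx (@complex.Re R) x; pose q := map_mx (@complex.Im R) x.
have xE : x = toC p + 'i *: toC q.
  by apply/matrixP => i j; rewrite !mxE; apply: complex_eq; rewrite !(ReD, ImD, ReM, ImM) /=; ring.
have xcE : map_mx conjc x = toC p - 'i *: toC q.
  by apply/matrixP => i j; rewrite !mxE; case: (x i j) => a b; apply: complex_eq;
    rewrite !(ReD, ImD, ReN, ImN, ReM, ImM) /=; ring.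
rewrite xcE [in bf A x _]xE !(bfDl, bfBr, bfZl, bfZr) (bf_sym (toC q) (toC p) sA).
move: (bf A (toC p) (toC q)) => pq.
have -> : bf A (toC p) (toC p) - 'i * pq +
    ('i * pq - 'i * ('i * bf A (toC q) (toC q))) =
    bf A (toC p) (toC p) - 'i ^+ 2 * bf A (toC q) (toC q).
  by move: (bf _ _ _) (bf _ _ _) => u v; ring.
rewrite sqr_i mulN1r opprK ReD.
have nn (y : 'rV[R]_n) : 0 <= complex.Re (bf A (toC y) (toC y)).
  have [->|y0] := eqVneq y 0; last exact/ltW/pA.
  by rewrite /toC map_mx0 bf0l.
have [p0|p0] := eqVneq p 0; last by apply: ltr_wpDr => //; apply: pA.
apply: ltr_wpDl => //; apply: pA; apply: contra_neq x0 => q0.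
by rewrite xE p0 q0 /toC !map_mx0 scaler0 addr0.
Qed.

Lemma posQ_unit n (A : 'M[C]_n) : A^T = A -> posQ A -> A \in unitmx.
Proof.
move=> sA pA; apply: unitmx_inj => x xA; apply/eqP; apply: contraT => x0.
by have := posQ_herm sA pA x0; rewrite bf_mul xA dot0l ltxx.
Qed.

Lemma Re_dot n (m : 'rV[R]_n) (x : 'rV[C]_n) :
  complex.Re (dot (toC m) x) = \sum_i m 0 i * complex.Re (x 0 i).
Proof.
rewrite dotE Re_sum; apply: eq_bigr => i _.
by rewrite mxE ReM /= mul0r subr0.
Qed.

(** Write the real vector m as x A. Since m is real, the value of A^-1 at m and the Hermitian value
    of A at x, covered by [posQ_herm], have the same real part. *)
Lemma posQ_inv n (A : 'M[C]_n) : A^T = A -> posQ A -> posQ (invmx A).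
Proof.
move=> sA pA m m0; have uA := posQ_unit sA pA.
pose x := toC m *m invmx A; have mE : toC m = x *m A by rewrite mulmxKV.
have x0 : x != 0.
  apply: contra_neq m0 => x0; apply/matrixP => i j.
  have := congr1 (fun M : 'rV_n => M i j) mE; rewrite x0 mul0mx !mxE => h.
  exact: (@complexI R).
have := posQ_herm sA pA x0; rewrite bf_mul -mE.
have -> : bf (invmx A) (toC m) (toC m) = dot (toC m) x by rewrite bf_mul dotC.
rewrite !Re_dot; congr (0 < _); apply: eq_bigr => i _; congr (_ * _).
by rewrite mxE; case: (x 0 i).
Qed.

Definition row1 n (x : int * 'rV[int]_n) : 'rV[int]_(1 + n) := row_mx x.1%:M x.2.

Lemma row1_inj n : injective (@row1 n).
Proof.
move=> [a x] [b y] /eq_row_mx[] /= /matrixP/(_ 0 0); rewrite !mxE eqxx !mulr1n.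
by move=> -> ->.
Qed.

Lemma row1_surj n (k : 'rV[int]_(1 + n)) : exists x, row1 x = k.
Proof.
exists (lsubmx k 0 0, rsubmx k); rewrite /row1 /=.
by rewrite -[in RHS](hsubmxK k) -mx11_scalar.
Qed.

(** The 4 is (h + 1) + (h + 1) at h = 1, one such factor for each coordinate. *)
Lemma sbound_rV n : sbound (fun k : 'rV[int]_n => \prod_i wt (k 0 i)%:~R : R) (4 ^+ n).
Proof.
elim: n => [|n IH] s us.
  case: s us => [|x s]; first by rewrite big_nil.
  rewrite /= => /andP[xs us]; have -> : s = [::].
    case: s xs us => // y s; rewrite inE negb_or => /andP[/eqP[]] .
    by apply/matrixP => i [].
  by rewrite big_seq1 big_ord0.
have [t [ut _ ->]] := image_list (@row1_inj n) us; last first.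
  by move=> i h; case: (row1_surj i) => x /h.
apply: (sbound_prod (g := fun x => \prod_i wt (row1 x 0 i)%:~R)) ut.
  by move=> x; apply: prodr_ge0 => i _; apply: wt_ge0.
move=> s1 s2 u1 u2.
have E x : \prod_(i < n.+1) wt (row1 x 0 i)%:~R = (1 * wt (1 * x.1%:~R)) * \prod_i wt (x.2 0 i)%:~R :> R.
  rewrite big_ord_recl !mul1r; congr (wt _%:~R * _).
    have -> : ord0 = lshift n (ord0 : 'I_1) by apply: val_inj.
    by rewrite row_mxEl !mxE eqxx mulr1n.
  apply: eq_bigr => i _; have -> : lift ord0 i = rshift 1 i by apply: val_inj.
  by rewrite row_mxEr.
under eq_bigr do under eq_bigr do rewrite E /=.
under eq_bigr do rewrite -mulr_sumr /=.
rewrite -mulr_suml exprS ler_pM ?IH//.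
- by apply: sumr_ge0 => i _; rewrite mul1r wt_ge0.
- by apply: sumr_ge0 => i _; apply: prodr_ge0 => j _; apply: wt_ge0.
by apply: le_trans (sbound_wt ler01 u1) _; rewrite le_eqVlt; apply/orP; left; apply/eqP; ring.
Qed.

Lemma gauss_wt (c L : R) : 0 < c -> 0 <= L ->
  exists2 K : R, 0 <= K & forall x, expR (- (c * x ^+ 2) + L * `|x|) <= K * wt x.
Proof.
move=> c0 L0; have c4 : 0 < c / 4 by rewrite divr_gt0.
pose K0 := c / 2 + L ^+ 2 / (2 * c).
have [K [h0 [K00 h00 h01 H]]] := gauss_absorb c4 (lexx 0) (expR_ge0 K0).
exists K => // x; have := H 0 x (lexx _) (ltW h00).
rewrite !mul0r expR0 mulr1; apply: le_trans; rewrite -expRD.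
apply: (@le_trans _ _ (1 * expR (K0 - c / 4 * (1 + `|x|) ^+ 2))).
  rewrite mul1r ler_expR /K0; set t := `|x|.
  have -> : x ^+ 2 = t ^+ 2 by rewrite real_normK ?num_real.
  have h1 : 0 <= c / 2 * (t - L / c) ^+ 2 by rewrite mulr_ge0 ?sqr_ge0// divr_ge0// ltW.
  have h2 : 0 <= c / 4 * (t - 1) ^+ 2 by rewrite mulr_ge0 ?sqr_ge0// ltW.
  rewrite -subr_ge0.
  rewrite (_ : _ - _ = c / 2 * (t - L / c) ^+ 2 + c / 4 * (t - 1) ^+ 2); first exact: addr_ge0.
  by field; rewrite gt_eqF.
by rewrite ler_wpM2r ?expR_ge0// exprn_ege1// one_le_1Dnorm.
Qed.

(** The lower bound c |k|^2 from [posQ_quant] splits the Gaussian into a product over the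
    coordinates, and each factor, with its linear term, is dominated by [wt]. *)
Lemma asum_theta n (A : 'M[C]_n) (l : 'rV[C]_n) : A^T = A -> posQ A ->
  asum (fun k : 'rV[int]_n => cexp (- (piC * bf A (zr k) (zr k)) + dot l (zr k))).
Proof.
move=> sA pA; have [c c0 Hc] := posQ_quant sA pA.
pose L := \sum_i cabs (l 0 i).
have L0 : 0 <= L by apply: sumr_ge0 => i _; apply: cabs_ge0.
have [K K0 HK] := gauss_wt (mulr_gt0 (pi_gt0 R) c0) L0.
apply: (asum_ler _ (sboundZ (exprn_ge0 n K0) (sbound_rV (n := n)))) => k.
pose kr : 'rV[R]_n := map_mx intr k.
rewrite cabs_cexp ReD ReN ReM /= mul0r subr0 zrE -/kr.
have -> : K ^+ n = \prod_(i < n) K by rewrite prodr_const card_ord.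
rewrite -big_split /=.
apply: (@le_trans _ _ (\prod_i expR (- (pi * c * kr 0 i ^+ 2) + L * `|kr 0 i|))); last first.
  apply: ler_prod => i _; rewrite expR_ge0 /=.
  by have := HK (kr 0 i); rewrite [kr 0 i]mxE.
rewrite -expR_sum ler_expR big_split /= lerD//.
  rewrite sumrN lerN2 -mulr_sumr -mulrA ler_wpM2l ?pi_ge0//.
  by apply: le_trans (Hc kr); rewrite dotE.
rewrite dotE Re_sum; apply: ler_sum => i _; apply: le_trans (ler_norm _) _.
apply: le_trans (Re_le_cabs _) _; rewrite cabsM !mxE cabs_real ler_wpM2r//.
by rewrite /L (bigD1 i)//= lerDl sumr_ge0// => j _; apply: cabs_ge0.
Qed.

End Siegel.

(** * Theta inversion in several variables *)

Section ThetaInversion.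
Variable R : realType.
Local Notation C := R[i].
Local Notation zr := (@zvec R _).
Local Notation piC := ((pi : R)%:C).

Lemma Re_sqrtc_ge0 (a : C) : 0 <= complex.Re (sqrtc a).
Proof. by case: a => x y; apply: sqrtr_ge0. Qed.

Lemma sqrtc_sector (a : C) : 0 < complex.Re a -> sector (sqrtc a).
Proof.
move=> a0; have := sqr_sqrtc a; have := Re_sqrtc_ge0 a.
move: (sqrtc a) => s s0 sE; move: a0; rewrite -sE expr2 ReM /sector -!expr2 subr_gt0 => h.
by rewrite -(@ltr_pXn2r _ 2) ?nnegrE// real_normK ?num_real.
Qed.

(** This is [jacobi] for c = sqrt a and b = - w / c; Re a > 0 places the principal root in the
    sector. *)
Lemma jacobi_quad (a w : C) : 0 < complex.Re a ->
  tsum (fun k : int => cexp (- (piC * (a * k%:~R ^+ 2)) + 2 * piC * w * k%:~R)) =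
  (sqrtc a)^-1 * tsum (fun m : int => cexp (piC * (w - 'i * m%:~R) ^+ 2 / a)).
Proof.
move=> a0; have hc := sqrtc_sector a0; set c := sqrtc a in hc *.
have cc : c ^+ 2 = a by apply: sqr_sqrtc.
have c0 := sector_neq0 hc.
have := jacobi (- (w / c)) hc; have i2 := @sqr_i R.
have e1 (k : int) : c * gs (c * k%:~R + - (w / c)) = c * (cexp (- (piC * w ^+ 2 / a)) *
    cexp (- (piC * (a * k%:~R ^+ 2)) + 2 * piC * w * k%:~R)).
  rewrite /gs -cexpD; congr (_ * cexp _); rewrite -cc; by field.
have e2 (m : int) : cexp (- (piC * (- (w / c)) ^+ 2)) * gs (c^-1 * m%:~R - 'i * - (w / c)) =
   cexp (- (piC * w ^+ 2 / a)) * cexp (piC * (w - 'i * m%:~R) ^+ 2 / a).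
  rewrite /gs -!cexpD; congr cexp; rewrite -cc.
  rewrite !sqrrD !(sqrrN, exprMn, i2, mulrN, mulNr, opprK) exprVn; by field.
rewrite (eq_tsum e1) (eq_tsum e2).
have asum1 : asum (fun k : int => cexp (- (piC * (a * k%:~R ^+ 2)) + 2 * piC * w * k%:~R)).
  have := asum_gs (- (w / c)) hc ltr01 ler01 (lexx 1).
  move=> /(asumZ (cexp (- (piC * w ^+ 2 / a)))^-1); apply: asum_le => k.
  have := e1 k; rewrite zpath1 mul1r rmorph_int => /(mulfI c0) ->.
  by rewrite mulKf ?cexp_neq0.
have asum2 : asum (fun m : int => cexp (piC * (w - 'i * m%:~R) ^+ 2 / a)).
  have := asum_gs (- ('i * - (w / c))) (sectorV hc) ltr01 ler01 (lexx 1).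
  move=> /(asumZ (cexp (- (piC * (- (w / c)) ^+ 2)))) /(asumZ (cexp (- (piC * w ^+ 2 / a)))^-1).
  apply: asum_le => k; rewrite zpath1 mul1r rmorph_int (e2 k).
  by rewrite mulKf ?cexp_neq0.
rewrite !tsumZ//; last exact: asumZ.
rewrite mulrCA => /(mulfI (cexp_neq0 _)) <-.
by rewrite mulKf.
Qed.

Definition ursubv n (A : 'M[C]_(1 + n)) : 'rV[C]_n := ursubmx A.

Definition schur n (A : 'M[C]_(1 + n)) : 'M[C]_n :=
  drsubmx A - (A 0 0)^-1 *: ((ursubv A)^T *m ursubv A).

(* The square root of [\det A ^-1] that is positive for real [A]. *)
Fixpoint invsqrt_det n : 'M[C]_n -> C :=
  match n with
  | 0 => fun=> 1
  | n'.+1 => fun A : 'M[C]_(1 + n') => (sqrtc (A 0 0))^-1 * invsqrt_det (schur A)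
  end.

Section Schur.
Variables (n : nat) (A : 'M[C]_(1 + n)).
Hypothesis sA : A^T = A.
Hypothesis pA : posQ A.
Let a := A 0 0.
Let v := ursubv A.
Let D : 'M[C]_n := drsubmx A.
Let S := schur A.

Lemma schur_sym : S^T = S.
Proof.
by rewrite /S /schur linearB /= linearZ /= trmx_mul trmxK trmx_drsub sA.
Qed.

Lemma blockA : A = block_mx a%:M v v^T D.
Proof.
rewrite -[LHS]submxK; congr block_mx; last first.
  by rewrite /v /ursubv trmx_ursub sA.
rewrite [LHS]mx11_scalar; congr _%:M; rewrite !mxE; congr (A _ _); exact: val_inj.
Qed.

Lemma bf_block (x0 y0 : C) (x y : 'rV[C]_n) :
  bf A (row_mx x0%:M x) (row_mx y0%:M y) =
  a * x0 * y0 + x0 * dot v y + y0 * dot v x + bf D x y.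
Proof.
have dr (p r : 'rV[C]_1) (q s : 'rV[C]_n) : dot (row_mx p q) (row_mx r s) = dot p r + dot q s.
  by rewrite /dot tr_row_mx mul_row_col mxE.
rewrite bf_mul {1}blockA mul_row_block dr !dotDl.
have s1 (z : C) (u w : 'rV[C]_n) : dot (z%:M *m u) w = z * dot u w.
  by rewrite mul_scalar_mx dotZl.
have -> : dot (x0%:M *m a%:M) y0%:M = a * x0 * y0.
  by rewrite /dot -scalar_mxM tr_scalar_mx -scalar_mxM !mxE eqxx mulr1n; ring.
have -> : dot (x *m v^T) y0%:M = y0 * dot v x.
  by rewrite /dot tr_scalar_mx mul_mx_scalar mxE -/(dot x v) dotC.
by rewrite s1 -bf_mul; ring.
Qed.

Lemma bf_schur (x y : 'rV[C]_n) : bf S x y = bf D x y - a^-1 * (dot v x * dot v y).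
Proof.
rewrite /S /schur bf_mxD bf_mxN bf_mxZ; congr (_ - _ * _).
have -> : bf (v^T *m v) x y = dot (x *m v^T *m v) y by rewrite bf_mul mulmxA.
have -> : x *m v^T = (dot v x)%:M by rewrite [LHS]mx11_scalar dotC.
by rewrite mul_scalar_mx dotZl.
Qed.

Lemma toC_row (x0 : R) (x : 'rV[R]_n) : toC (row_mx x0%:M x) = row_mx x0%:C%:M (toC x).
Proof. by rewrite /toC map_row_mx map_scalar_mx. Qed.

Lemma pivot_pos : 0 < complex.Re a.
Proof.
have := pA (x := row_mx 1%:M 0); rewrite toC_row bf_block.
rewrite /toC map_mx0 bf0l !(dotC v) dot0l !mulr0 !addr0 !mulr1; apply.
apply/eqP => /matrixP/(_ 0 (lshift n 0)); rewrite row_mxEl !mxE eqxx.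
by move/eqP; rewrite oner_eq0.
Qed.

Lemma pivot_neq0 : a != 0.
Proof. by apply/eqP => a0; have := pivot_pos; rewrite a0 ltxx. Qed.

(* The form left after Poisson summation in the first variable only. *)
Definition mixed : 'M[C]_(1 + n) :=
  block_mx a^-1%:M (- ('i / a) *: v) (- ('i / a) *: v)^T S.

Lemma mixed_sym : mixed^T = mixed.
Proof. by rewrite /mixed tr_block_mx tr_scalar_mx trmxK schur_sym. Qed.

End Schur.

Lemma bf_mixed n (A : 'M[C]_(1 + n)) (x0 : C) (x : 'rV[C]_n) : A^T = A ->
  bf (mixed A) (row_mx x0%:M x) (row_mx x0%:M x) =
  (A 0 0)^-1 * (x0 - 'i * dot (ursubv A) x) ^+ 2 + bf (drsubmx A : 'M[C]_n) x x.
Proof.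
move=> sA; rewrite (bf_block (mixed_sym sA)).
have -> : mixed A 0 0 = (A 0 0)^-1.
  have e : (0 : 'I_(1 + n)) = lshift n (0 : 'I_1) by apply: val_inj.
  by rewrite /mixed [in LHS]e block_mxEul mxE eqxx mulr1n -e.
have -> : ursubv (mixed A) = - ('i / A 0 0) *: ursubv A by rewrite /ursubv /mixed block_mxKur.
have -> : drsubmx (mixed A) = schur A by rewrite /mixed block_mxKdr.
rewrite bf_schur !dotZl sqrrB exprMn (@sqr_i R).
by move: (A 0 0)^-1 (dot _ _) (bf _ _ _) => u w z; ring.
Qed.

(** Needed for the absolute convergence of the double series in [theta_inversion], in which only the
    first variable has been dualised. *)
Lemma mixed_pos n (A : 'M[C]_(1 + n)) : A^T = A -> posQ A -> posQ (mixed A).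
Proof.
move=> sA pA m m0; set a := A 0 0.
have a0 := pivot_pos sA pA; have an := pivot_neq0 sA pA.
have aV : 0 < complex.Re a^-1.
  have -> : a^-1 = ((cabs a ^+ 2)^-1)%:C * conjc a.
    apply: (mulfI an); rewrite divff// mulrCA mul_conj -rmorphM mulVf//.
    by rewrite expf_neq0// cabs_eq0.
  have p : 0 < (cabs a ^+ 2)^-1 by rewrite invr_gt0 exprn_gt0// cabs_gt0.
  move: a0 p; rewrite -/a ReM; move: (cabs a ^+ 2)^-1 => r; case: (a) => x y /= h1 h2.
  by rewrite mul0r subr0 mulr_gt0.
pose m1 := lsubmx m 0 0; pose k : 'rV[R]_n := rsubmx m.
have mE : m = row_mx m1%:M k by rewrite -[LHS](hsubmxK m) [lsubmx m]mx11_scalar.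
set vk := dot (ursubv A) (toC k).
(* Re a > 0 allows a real [x0] that makes [t] purely imaginary. Then t^2 = - rho^2, and the mixed
   form is the form of A at the real vector (x0, k) plus rho^2 / a plus an imaginary number. *)
have [x0 hx0] : exists x0, complex.Re a * x0 + complex.Re vk = 0.
  exists (- complex.Re vk / complex.Re a); move: a0; rewrite -/a => /gt_eqF/negbT h.
  by field.
pose t : C := a * x0%:C + vk + 'i * m1%:C.
have Ret : complex.Re t = 0.
  by rewrite /t !ReD !ReM /= !(mulr0, mul0r, subr0, addr0).
pose rho := complex.Im t.
have tE : t ^+ 2 = (- rho ^+ 2)%:C.
  by rewrite expr2; apply: complex_eq; rewrite ?(ReM, ImM) /= Ret /rho; ring.
have E : bf (mixed A) (toC m) (toC m) =
    bf A (toC (row_mx x0%:M k)) (toC (row_mx x0%:M k)) + 2 * 'i * (x0 * m1)%:C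
    + (rho ^+ 2)%:C * a^-1.
  have -> : (rho ^+ 2)%:C * a^-1 = - (t ^+ 2 / a).
    by rewrite tE rmorphN mulNr opprK.
  rewrite mE !toC_row bf_mixed// (bf_block sA) -/a -/vk (rmorphM (real_complex R) x0 m1) /t /=.
  have i2 := @sqr_i R.
  move: (bf _ _ _) => z; rewrite [(_ + _ + 'i * _) ^+ 2]sqrrD exprMn i2.
  rewrite [(m1%:C - _) ^+ 2]sqrrB exprMn i2 /=; by field.
rewrite E !ReD ReM [complex.Re (_%:C * _)]ReM /=.
have -> : (1 + 1) * 0 - (0 + 0) * 1 = 0 :> R by ring.
rewrite !mul0r !mulr0 !subr0 addr0.
have [x00|x00] := eqVneq (row_mx x0%:M k) 0.
  have k0 : k = 0 by rewrite -(row_mxKr x0%:M k) x00 linear0.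
  have x0E : x0 = 0.
    have /matrixP/(_ 0 0) : (x0%:M : 'M[R]_1) = 0 by rewrite -(row_mxKl x0%:M k) x00 linear0.
    by rewrite !mxE eqxx mulr1n.
  have m10 : m1 != 0.
    apply: contra_neq m0 => m10; rewrite mE m10 k0; apply/matrixP => i j.
    by rewrite mxE; case: splitP => q _; rewrite !mxE ?mul0rn.
  rewrite x00 /toC map_mx0 bf0l add0r mulr_gt0// exprn_even_gt0//=.
  have -> : rho = m1.
    rewrite /rho /t x0E /vk k0 /toC map_mx0 dotC dot0l mulr0 !add0r ImM /=; ring.
  exact: m10.
apply: ltr_wpDr; last exact: pA.
by rewrite mulr_ge0 ?sqr_ge0// ltW.
Qed.

(** The Schur complement is the restriction of the mixed form to vectors with first coordinate 0. *)
Lemma schur_pos n (A : 'M[C]_(1 + n)) : A^T = A -> posQ A -> posQ (schur A).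
Proof.
move=> sA pA x x0; have := mixed_pos sA pA (x := row_mx 0%:M x).
rewrite toC_row (bf_mixed _ _ sA) bf_schur.
have -> : ((A 0 0)^-1 * (0%:C - 'i * dot (ursubv A) (toC x)) ^+ 2 + bf (drsubmx A : 'M[C]_n) (toC x) (toC x)) =
   (bf (drsubmx A : 'M[C]_n) (toC x) (toC x) - (A 0 0)^-1 * (dot (ursubv A) (toC x) * dot (ursubv A) (toC x))).
  rewrite rmorph0 sub0r sqrrN exprMn (@sqr_i R).
  by move: (bf _ _ _) (dot _ _) (A 0 0)^-1 => u w z; ring.
apply; apply: contra_neq x0 => h.
by rewrite -(row_mxKr 0%:M x) h linear0.
Qed.

Lemma det_schur n (A : 'M[C]_(1 + n)) : A^T = A -> posQ A ->
  \det A = A 0 0 * \det (schur A).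
Proof.
move=> sA pA; have a0 := pivot_neq0 sA pA.
pose U : 'M[C]_(1 + n) := block_mx 1%:M (- (A 0 0)^-1 *: ursubv A) 0 1%:M.
have dU : \det U = 1 by rewrite det_ublock !det1 mulr1.
rewrite -[LHS]mulr1 -dU -det_mulmx.
rewrite {1}(blockA sA) /U mulmx_block !mulmx0 !mulmx1 !addr0.
have -> : (A 0 0)%:M *m (- (A 0 0)^-1 *: ursubv A) + ursubv A = 0.
  by rewrite mul_scalar_mx scalerA mulrN mulfV// scaleN1r addNr.
rewrite det_lblock det_scalar1; congr (_ * \det _).
by rewrite /schur -scalemxAr scaleNr addrC.
Qed.

Lemma invsqrt_detS n (A : 'M[C]_(1 + n)) : invsqrt_det A = (sqrtc (A 0 0))^-1 * invsqrt_det (schur A).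
Proof. by []. Qed.

Lemma invsqrt_det_sqr n (A : 'M[C]_n) : A^T = A -> posQ A -> invsqrt_det A ^+ 2 * \det A = 1.
Proof.
elim: n A => [|n IH] A sA pA.
  by rewrite /invsqrt_det det_mx00 expr1n mulr1.
rewrite -[n.+1]/(1 + n)%N in A sA pA *.
rewrite invsqrt_detS det_schur// exprMn exprVn sqr_sqrtc mulrACA mulVf ?mul1r; last exact: pivot_neq0.
by apply: IH; [apply: schur_sym|apply: schur_pos].
Qed.

Lemma asum_theta_inv n (A : 'M[C]_n) (b : 'rV[C]_n) : A^T = A -> posQ A ->
  asum (fun m : 'rV[int]_n => cexp (- (piC * bf (invmx A) (zr m - b) (zr m - b)))).
Proof.
move=> sA pA.
have := asum_theta (A := invmx A) (2 * piC *: (b *m invmx A)) (invmx_sym sA) (posQ_inv sA pA).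
move=> /(asumZ (cexp (- (piC * bf (invmx A) b b)))); apply: asum_le => k.
rewrite -cexpD le_eqVlt; apply/orP; left; apply/eqP; congr (cabs (cexp _)).
rewrite dotZl -bf_mul !(bfBl, bfBr) (bf_sym (zr k) b (invmx_sym sA)).
by move: (bf _ _ _) (bf _ _ _) (bf _ _ _) => u w z; ring.
Qed.

Lemma zr_row1 n (x : int * 'rV[int]_n) : zr (row1 x) = row_mx (x.1%:~R)%:M (zr x.2) :> 'rV[C]_(1 + n).
Proof. by rewrite /zr /row1 map_row_mx map_scalar_mx. Qed.

Lemma tsum_row1 n (f : 'rV[int]_(1 + n) -> C) : asum f ->
  tsum f = tsum (fun x : int * 'rV[int]_n => f (row1 x)).
Proof.
move=> af; apply: (tsum_reindex (@row1_inj n)) => // i h.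
by case: (row1_surj i) => x /h.
Qed.

Lemma asum_row1 n (f : 'rV[int]_(1 + n) -> C) :
  asum f <-> asum (fun x : int * 'rV[int]_n => f (row1 x)).
Proof.
apply: (asum_reindex (@row1_inj n)) => i h; by case: (row1_surj i) => x /h.
Qed.

(** For nonzero c the two families have a sum simultaneously; if they have none, both sides are 0 by
    the default value of [tsum]. *)
Lemma tsumZ_neq0 (I : choiceType) (c : C) (f : I -> C) : c != 0 ->
  tsum (fun i => c * f i) = c * tsum f.
Proof.
move=> c0; have [[l hl]|nl] := pselect (exists l, has_sum f l).
  by rewrite (has_sum_tsum hl); apply/has_sum_tsum/has_sumZ.
rewrite /tsum !xgetPN ?mulr0// => l hl; apply: nl; first by exists l.
exists (c^-1 * l); apply: eq_has_sum (has_sumZ c^-1 hl) => i.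
by rewrite mulKf.
Qed.

Lemma row1C n (y : 'rV[C]_(1 + n)) : exists (y0 : C) (y1 : 'rV[C]_n), y = row_mx y0%:M y1.
Proof.
by exists (lsubmx y 0 0), (rsubmx y); rewrite -mx11_scalar hsubmxK.
Qed.

Lemma schur_mulmx n (a x0 : C) (v x : 'rV[C]_n) (D : 'M[C]_n) : a != 0 ->
  x0%:M *m v + x *m D - ((x0 * a + dot v x) / a) *: v =
  x *m (D - a^-1 *: (v^T *m v)).
Proof.
move=> a0; rewrite mulmxBr -scalemxAr mulmxA.
have -> : x *m v^T = (dot v x)%:M by rewrite [LHS]mx11_scalar dotC.
rewrite !mul_scalar_mx scalerA; move: (dot v x) => d.
rewrite mulrDl mulfK// scalerDl opprD addrACA subrr add0r.
by congr (_ - _ *: _); rewrite mulrC.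
Qed.

Lemma schur_mul n (A : 'M[C]_(1 + n)) (x0 : C) (x : 'rV[C]_n) : A 0 0 != 0 ->
  x0%:M *m ursubv A + x *m drsubmx A -
    ((x0 * A 0 0 + dot (ursubv A) x) / A 0 0) *: ursubv A = x *m schur A.
Proof.
move=> an; rewrite /schur -(schur_mulmx x0 (ursubv A) x _ an).
by congr (_ - _).
Qed.

Lemma bf_inv_block n (A : 'M[C]_(1 + n)) (y0 : C) (y : 'rV[C]_n) : A^T = A -> posQ A ->
  bf (invmx A) (row_mx y0%:M y) (row_mx y0%:M y) =
  y0 ^+ 2 / A 0 0 + bf (invmx (schur A)) (y - (y0 / A 0 0) *: ursubv A) (y - (y0 / A 0 0) *: ursubv A).
Proof.
move=> sA pA; have uA := posQ_unit sA pA; have an := pivot_neq0 sA pA.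
have sS := schur_sym sA; have uS := posQ_unit sS (schur_pos sA pA).
set Y := row_mx _ _; have [x0 [x xE]] := row1C (Y *m invmx A).
have YE : Y = row_mx x0%:M x *m A by rewrite -xE mulmxKV.
rewrite {1 2}YE bf_inv// (bf_block sA).
have := YE; rewrite [in X in _ = X](blockA sA) mul_row_block => /eq_row_mx[e0 ->].
have {e0} -> : y0 = x0 * A 0 0 + dot (ursubv A) x.
  move/matrixP: e0 => /(_ 0 0); rewrite -scalar_mxM !mxE !eqxx !mulr1n => ->.
  by congr (_ + _); rewrite dotC /dot mxE.
rewrite (schur_mul x0 x an) (bf_inv _ _ sS uS) bf_schur.
move: (bf _ _ _) (dot _ _) an; move: (A 0 0) => a z d an.
by field.
Qed.

(** Jacobi's identity dualises the first variable for fixed values of the others. Completing the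
    square leaves the Schur complement in the others, with a characteristic shifted by the new
    frequency, and the induction hypothesis dualises them. *)
Lemma theta_inversion n (A : 'M[C]_n) (b : 'rV[C]_n) : A^T = A -> posQ A ->
  tsum (fun k : 'rV[int]_n =>
    cexp (- (piC * bf A (zr k) (zr k)) + 2 * piC * 'i * dot b (zr k))) =
  invsqrt_det A * tsum (fun m : 'rV[int]_n =>
    cexp (- (piC * bf (invmx A) (zr m - b) (zr m - b)))).
Proof.
elim: n A b => [|n IH] A b sA pA.
  rewrite mul1r; apply: eq_tsum => k; rewrite (_ : zr k = 0); last by apply/matrixP => ? [].
  by rewrite (_ : b = 0) ?subrr ?bf0l ?dot0l ?mulr0 ?oppr0 ?addr0//; apply/matrixP => ? [].
rewrite -[n.+1]/(1 + n)%N in A b sA pA *.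
have an := pivot_neq0 sA pA; have ap := pivot_pos sA pA.
have [b0 [b1 bE]] := row1C b.
set a : C := A 0 0 in an ap *; pose v := ursubv A; pose D : 'M[C]_n := drsubmx A.
have i2 := @sqr_i R.
have asumL : asum (fun k : 'rV[int]_(1 + n) =>
    cexp (- (piC * bf A (zr k) (zr k)) + 2 * piC * 'i * dot b (zr k))).
  apply: asum_le (asum_theta ((2 * piC * 'i) *: b) sA pA) => k.
  by rewrite dotZl.
have asumL1 := proj1 (asum_row1 _) asumL.
rewrite (tsum_row1 asumL) (fubini asumL1) (tsum_swap asumL1).
have drow (x0 y0 : C) (x y : 'rV[C]_n) : dot (row_mx x0%:M x) (row_mx y0%:M y) = x0 * y0 + dot x y.
  rewrite /dot tr_row_mx mul_row_col mxE; congr (_ + _).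
  by rewrite tr_scalar_mx -scalar_mxM mxE eqxx mulr1n.
pose E (x : int * 'rV[int]_n) := cexp (- (piC * bf D (zr x.2) (zr x.2)) +
   2 * piC * 'i * dot b1 (zr x.2) + piC * (('i * b0 - dot v (zr x.2)) - 'i * x.1%:~R) ^+ 2 / a).
have step1 k : tsum (fun k0 : int => cexp (- (piC * bf A (zr (row1 (k0, k))) (zr (row1 (k0, k)))) +
    2 * piC * 'i * dot b (zr (row1 (k0, k))))) = (sqrtc a)^-1 * tsum (fun m : int => E (m, k)).
  pose e := cexp (- (piC * bf D (zr k) (zr k)) + 2 * piC * 'i * dot b1 (zr k)).
  pose w := 'i * b0 - dot v (zr k).
  pose f (k0 : int) := cexp (- (piC * (a * k0%:~R ^+ 2)) + 2 * piC * w * k0%:~R).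
  pose g (m : int) := cexp (piC * (w - 'i * m%:~R) ^+ 2 / a).
  have fE k0 : cexp (- (piC * bf A (zr (row1 (k0, k))) (zr (row1 (k0, k)))) +
    2 * piC * 'i * dot b (zr (row1 (k0, k)))) = e * f k0.
    rewrite zr_row1 bE (bf_block sA) drow /= -cexpD /w; congr cexp.
    by rewrite -/a -/v -/D; move: (dot v _) (dot b1 _) (bf _ _ _) => d1 d2 d3; ring.
  have gE m : E (m, k) = e * g m by rewrite -cexpD /E.
  rewrite (eq_tsum fE) (eq_tsum gE) !tsumZ_neq0 ?cexp_neq0//.
  by rewrite mulrCA; congr (_ * _); apply: jacobi_quad.
(* The exponent of [E] is the mixed form plus linear and constant terms, so the order of summation
   may be exchanged. *)
have asumE : asum E.
  pose l : 'rV[C]_(1 + n) := row_mx (2 * piC * b0 / a)%:M (2 * piC * 'i *: b1 - (2 * piC * 'i * b0 / a) *: v).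
  have := asum_theta l (mixed_sym sA) (mixed_pos sA pA).
  move=> /(asumZ (cexp (- (piC * b0 ^+ 2 / a)))) /(proj1 (asum_row1 _)); apply: asum_le => -[m k].
  rewrite le_eqVlt; apply/orP; left; apply/eqP; congr cabs.
  rewrite -cexpD /E zr_row1 (bf_mixed _ _ sA) drow dotDl dotNl !dotZl -/v -/D -/a /=; congr cexp.
  move: (dot v _) (dot b1 _) (bf _ _ _) => d1 d2 d3.
  have -> : ('i * b0 - d1 - 'i * m%:~R) ^+ 2 = 'i ^+ 2 * (m%:~R - b0) ^+ 2 + 2 * 'i * (m%:~R - b0) * d1 + d1 ^+ 2 by ring.
  have -> : (m%:~R - 'i * d1) ^+ 2 = m%:~R ^+ 2 - 2 * 'i * m%:~R * d1 + 'i ^+ 2 * d1 ^+ 2 by ring.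
  by rewrite i2; field.
rewrite (eq_tsum step1) tsumZ_neq0; last first.
  by rewrite invr_eq0 sqrtc_eq0.
rewrite -(tsum_swap asumE).
(* The characteristic of the remaining variables once the frequency m of the first one is fixed. *)
pose b2 (m : int) := b1 + ((m%:~R - b0) / a) *: v.
pose p (m : int) := cexp (- (piC * (m%:~R - b0) ^+ 2 / a)).
have step2 (m : int) : tsum (fun k => E (m, k)) = invsqrt_det (schur A) *
    tsum (fun k : 'rV[int]_n => p m * cexp (- (piC * bf (invmx (schur A)) (zr k - b2 m) (zr k - b2 m)))).
  rewrite tsumZ_neq0 ?cexp_neq0// mulrCA -(IH _ (b2 m) (schur_sym sA) (schur_pos sA pA)).
  rewrite -tsumZ_neq0 ?cexp_neq0//; apply: eq_tsum => k.
  rewrite -cexpD /E bf_schur /b2 dotDl dotZl -/a -/v -/D /=; congr cexp.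
  move: (dot v _) (dot b1 _) (bf _ _ _) => d1 d2 d3.
  have -> : ('i * b0 - d1 - 'i * m%:~R) ^+ 2 = 'i ^+ 2 * (m%:~R - b0) ^+ 2 + 2 * 'i * (m%:~R - b0) * d1 + d1 ^+ 2 by ring.
  by rewrite i2; field.
have C0 : invsqrt_det (schur A) != 0.
  apply: contra_eq_neq (invsqrt_det_sqr (schur_sym sA) (schur_pos sA pA)) => ->.
  by rewrite expr0n mul0r eq_sym oner_eq0.
rewrite (eq_tsum step2) tsumZ_neq0// mulrA -invsqrt_detS; congr (_ * _).
have asumR := asum_theta_inv b sA pA.
rewrite (tsum_row1 asumR) (fubini (proj1 (asum_row1 _) asumR)).
apply: eq_tsum => m; apply: eq_tsum => k; rewrite -cexpD; congr cexp.
have -> : zr (row1 (m, k)) - b = row_mx (m%:~R - b0)%:M (zr k - b1).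
  by rewrite zr_row1 bE opp_row_mx add_row_mx -!raddfB.
rewrite (bf_inv_block _ _ sA pA) -/a -/v /b2 opprD addrA.
by move: (bf _ _ _) => z; ring.
Qed.

End ThetaInversion.

(** * Continuity and signs of square roots *)

Section Continuity.
Variable R : realType.
Local Notation C := R[i].

Definition ccont (f : R -> C) : Prop := forall s e, 0 < e ->
  exists2 d, 0 < d & forall t, `|t - s| < d -> cabs (f t - f s) < e.

Lemma ccont_cst z : ccont (fun=> z).
Proof. by move=> s e e0; exists 1 => // t _; rewrite subrr cabs0. Qed.

Lemma ccont_id : ccont (fun s => s%:C).
Proof. by move=> s e e0; exists e => // t; rewrite -rmorphB cabs_real. Qed.

Lemma ccontD f g : ccont f -> ccont g -> ccont (fun s => f s + g s).
Proof.
move=> hf hg s e e0; have e2 : 0 < e / 2 by rewrite divr_gt0.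
have [d1 d10 h1] := hf s _ e2; have [d2 d20 h2] := hg s _ e2.
exists (Num.min d1 d2); first by rewrite lt_min d10.
move=> t; rewrite lt_min => /andP[/h1 a /h2 b].
by rewrite opprD addrACA (le_lt_trans (cabsD _ _))// [ltRHS]splitr ltrD.
Qed.

Lemma ccontM f g : ccont f -> ccont g -> ccont (fun s => f s * g s).
Proof.
move=> hf hg s e e0; pose K := cabs (f s) + cabs (g s) + 1.
have K0 : 0 < K by rewrite ltr_wpDl// addr_ge0 ?cabs_ge0.
have fK : cabs (f s) <= K by rewrite /K -addrA lerDl addr_ge0 ?cabs_ge0.
have gK : cabs (g s) + 1 <= K by rewrite /K -addrA lerDr cabs_ge0.
have e2 : 0 < Num.min 1 (e / (3 * K)) by rewrite lt_min ltr01 divr_gt0// mulr_gt0.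
have [d1 d10 h1] := hf s _ e2; have [d2 d20 h2] := hg s _ e2.
exists (Num.min d1 d2); first by rewrite lt_min d10.
move=> t; rewrite lt_min => /andP[/h1 + /h2].
rewrite !lt_min => /andP[_ a] /andP[b1 b].
have -> : f t * g t - f s * g s = (f t - f s) * g t + f s * (g t - g s) by ring.
apply: le_lt_trans (cabsD _ _) _; rewrite !cabsM.
have gt : cabs (g t) <= K.
  rewrite -[g t](subrK (g s)); apply: le_trans (cabsD _ _) _; lra.
rewrite ltr_pdivlMr ?mulr_gt0// in a; rewrite ltr_pdivlMr ?mulr_gt0// in b.
have c1 : cabs (f t - f s) * cabs (g t) <= cabs (f t - f s) * K by rewrite ler_wpM2l ?cabs_ge0.
have c2 : cabs (f s) * cabs (g t - g s) <= K * cabs (g t - g s) by rewrite ler_wpM2r ?cabs_ge0.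
lra.
Qed.

Lemma ccontV f : ccont f -> (forall s, f s != 0) -> ccont (fun s => (f s)^-1).
Proof.
move=> hf f0 s e e0; have m0 : 0 < cabs (f s) by rewrite cabs_gt0.
set m := cabs (f s) in m0.
have e2 : 0 < Num.min (m / 2) (e * m ^+ 2 / 2).
  by rewrite lt_min !divr_gt0// mulr_gt0// exprn_gt0.
have [d d0 h] := hf s _ e2; exists d => // t /h; rewrite lt_min => /andP[a b].
have mt : m / 2 < cabs (f t).
  have : m <= cabs (f s - f t) + cabs (f t) by rewrite /m -{1}[f s](subrK (f t)) cabsD.
  by rewrite cabsBC; lra.
have -> : (f t)^-1 - (f s)^-1 = (f s - f t) * ((f t)^-1 * (f s)^-1).
  by field; rewrite !f0.
rewrite !cabsM !cabsV -/m cabsBC -invfM ltr_pdivrMr; last by rewrite mulr_gt0// (lt_trans _ mt)// divr_gt0.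
apply: lt_trans b _; rewrite expr2 -!mulrA ltr_pM2l//.
have : m * (m / 2) < cabs (f t) * m by rewrite mulrC ltr_pM2r.
lra.
Qed.

(** From (sqrt z - sqrt w) (sqrt z + sqrt w) = z - w, as the second factor has real part at least Re
    (sqrt w). *)
Lemma sqrtc_dist (z w : C) : 0 < complex.Re (sqrtc w) ->
  cabs (sqrtc z - sqrtc w) * complex.Re (sqrtc w) <= cabs (z - w).
Proof.
move=> hw; rewrite -[z in leRHS]sqr_sqrtc -[w in leRHS]sqr_sqrtc subr_sqr cabsM.
rewrite ler_wpM2l ?cabs_ge0//.
apply: le_trans (le_trans (ler_norm _) (Re_le_cabs _)); rewrite ReD lerDr.
exact: Re_sqrtc_ge0.
Qed.

Lemma ccont_sqrtc f : ccont f -> (forall s, 0 < complex.Re (sqrtc (f s))) ->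
  ccont (fun s => sqrtc (f s)).
Proof.
move=> hf f0 s e e0; have [d d0 h] := hf s _ (mulr_gt0 e0 (f0 s)).
exists d => // t /h H; rewrite -(ltr_pM2r (f0 s)).
by apply: le_lt_trans H; apply: sqrtc_dist.
Qed.

Lemma ccontX f n : ccont f -> ccont (fun s => f s ^+ n).
Proof.
move=> hf; elim: n => [|n IH]; first exact: ccont_cst.
by rewrite (_ : (fun s => _) = fun s => f s * f s ^+ n); [apply: ccontM|apply/funext => s; rewrite exprS].
Qed.

Lemma sqrtc_re_gt0 (a : C) : 0 < complex.Re a -> 0 < complex.Re (sqrtc a).
Proof. by move=> /sqrtc_sector; apply: le_lt_trans. Qed.

Lemma ccont_invsqrt_det n (A : R -> 'M[C]_n) :
  (forall i j, ccont (fun s => A s i j)) -> (forall s, (A s)^T = A s) ->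
  (forall s, posQ (A s)) -> ccont (fun s => invsqrt_det (A s)).
Proof.
elim: n A => [|n IH] A cA sA pA; first exact: ccont_cst.
have p0 s := @pivot_pos R n (A s) (sA s) (pA s).
have an s := @pivot_neq0 R n (A s) (sA s) (pA s).
apply: ccontM.
  apply: ccontV; last by move=> s; rewrite sqrtc_eq0; apply: an.
  by apply: ccont_sqrtc; [apply: cA|move=> s; apply/sqrtc_re_gt0/p0].
apply: IH => [i j|s|s]; last 2 first.
- exact: schur_sym.
- exact: schur_pos.
have -> : (fun s => @schur R n (A s) i j) = fun s =>
   A s (@rshift 1 n i) (@rshift 1 n j) + -1 * ((A s 0 0)^-1 *
     (A s (@lshift 1 n 0) (@rshift 1 n i) * A s (@lshift 1 n 0) (@rshift 1 n j))).
  by apply/funext => s; rewrite !mxE big_ord1 !mxE mulN1r.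
apply: ccontD; first exact: cA.
apply: ccontM; first exact: ccont_cst.
apply: ccontM; first by apply: ccontV => //; apply: cA.
by apply: ccontM; apply: cA.
Qed.

Lemma invsqrt_det_real n (A : 'M[C]_n) : A^T = A -> posQ A ->
  (forall i j, complex.Im (A i j) = 0) -> exists2 r : R, 0 < r & invsqrt_det A = r%:C.
Proof.
elim: n A => [|n IH] A sA pA rA; first by exists 1.
have p0 := @pivot_pos R n A sA pA.
have aE i j : A i j = (complex.Re (A i j))%:C by apply: complex_eq => //=; apply: rA.
have [||i j|r r0 E] := IH (@schur R n A).
- exact: schur_sym.
- exact: schur_pos.
- by rewrite !mxE big_ord1 !mxE [A 0 0]aE -fmorphV !(ImD, ImN, ImM, ReM) !rA /=; ring.
rewrite (@invsqrt_detS R n A) E [A 0 0]aE sqrtc_sqrtr; last by rewrite lecR ltW.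
exists ((Num.sqrt (complex.Re (A 0 0)))^-1 * r); first by rewrite mulr_gt0// invr_gt0 sqrtr_gt0.
by rewrite rmorphM fmorphV.
Qed.

(** A continuous function with values 1 and -1 is constant by the intermediate value theorem. This
    settles the sign of square roots both in [invsqrt_det_At] and in [Mp2Z_word]. *)
Lemma sqr1_path_const (f : R -> C) : ccont f -> (forall s, f s ^+ 2 = 1) -> f 0 = 1 -> f 1 = 1.
Proof.
move=> cf f2 f0; apply/eqP; apply: contraT => f1.
have pm s : f s = 1 \/ f s = -1.
  have /eqP := f2 s; rewrite sqrf_eq1 => /orP[]/eqP ->; by [left|right].
have f1E : f 1 = -1 by case: (pm 1) f1 => // ->; rewrite eqxx.
pose g s := complex.Re (f s).
have cg : (continuous g)%classic.
  move=> s; apply/cvgrPdist_lt => e e0; have [d d0 h] := cf s e e0.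
  exists d => //= t /= ht; have H : cabs (f t - f s) < e by apply: h; rewrite distrC.
  by rewrite distrC /g -ReN -ReD; apply: le_lt_trans (Re_le_cabs _) H.
have m0 : Num.min (g 0) (g 1) <= 0 <= Num.max (g 0) (g 1).
  by rewrite /g f0 f1E ge_min le_max /=; apply/andP; split; apply/orP; [right|left]; clear; lra.
have [c _] := @IVT R g 0 1 0 ler01 (continuous_subspaceT cg) m0.
by rewrite /g; case: (pm c) => -> /= h; clear -h; lra.
Qed.

End Continuity.

(** * Polynomial coefficients *)

Section Hermite.
Variable R : realType.
Local Notation C := R[i].

(* The coefficient of [s ^ j] in [exp (s * l + s ^ 2 * q)]. *)
Definition herm (l q : C) (j : nat) : C :=
  \sum_(k <- iota 0 j.+1 | (k.*2 <= j)%N) ecoef l (j - k.*2) * ecoef q k.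

Lemma herm_scale (s l q : C) j : herm (s * l) (s ^+ 2 * q) j = s ^+ j * herm l q j.
Proof.
rewrite /herm mulr_sumr; apply: eq_bigr => k kj.
have -> : s ^+ j = s ^+ (j - k.*2) * (s ^+ 2) ^+ k by rewrite -exprM -exprD mul2n subnK.
rewrite /ecoef (exprMn _ s l) (exprMn _ (s ^+ 2) q).
by move: (s ^+ _) ((s ^+ 2) ^+ _) => u v; ring.
Qed.

Let F (l q : C) (x : nat * nat) : C :=
  if (x.2.*2 <= x.1)%N then ecoef l (x.1 - x.2.*2) * ecoef q x.2 else 0.

(** The product of the series of exp l and exp q, arranged by degree with q in degree 2; the bound
    justifies the rearrangement. *)
Lemma herm_pairs l q : sbound (fun x => cabs (F l q x)) (expR (cabs l) * expR (cabs q)) /\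
  tsum (F l q) = cexp (l + q).
Proof.
pose h (x : nat * nat) := ((x.1 + x.2.*2)%N, x.2).
have hi : injective h by move=> [a b] [c d] [] /= /[swap] <- /addIn ->.
have Fh x : F l q (h x) = ecoef l x.1 * ecoef q x.2.
  by rewrite /F /h /= leq_addl addnK.
have F0 x : (forall y, h y <> x) -> F l q x = 0.
  case: x => j k H; rewrite /F /=; case: leqP => // le; case: (H (j - k.*2, k)%N).
  by rewrite /h /= subnK.
have sb : sbound (fun x => cabs (F l q x)) (expR (cabs l) * expR (cabs q)).
  move=> s us; have [t [ut _ ->]] := image_list hi us; last first.
    by move=> x hx; rewrite F0 ?cabs0.
  apply: (sbound_prod (g := fun x => cabs (F l q (h x)))) ut => [x|s1 s2 u1 u2].
    exact: cabs_ge0.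
  under eq_bigr do under eq_bigr do rewrite Fh /= cabsM !cabs_ecoef.
  under eq_bigr do rewrite -mulr_sumr.
  rewrite -mulr_suml ler_pM ?sumr_ge0//.
  - by move=> i _; rewrite divr_ge0 ?exprn_ge0 ?cabs_ge0.
  - by move=> i _; rewrite divr_ge0 ?exprn_ge0 ?cabs_ge0.
  - by apply: sbound_exp; rewrite ?cabs_ge0.
  - by apply: sbound_exp; rewrite ?cabs_ge0.
split=> //; have aF : asum (F l q) by exists (expR (cabs l) * expR (cabs q)).
rewrite (tsum_reindex hi F0 aF) (eq_tsum Fh) tsum_mul; try exact: asum_ecoef.
by rewrite -!cexp_tsum cexpD.
Qed.

Lemma herm_row l q j : tsum (fun k => F l q (j, k)) = herm l q j.
Proof.
apply: has_sum_tsum; rewrite /herm big_mkcond.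
apply: has_sum_fin => [|i]; first exact: iota_uniq.
rewrite mem_iota /= add0n ltnS /F /= -ltnNge => ji.
by rewrite leqNgt (leq_trans ji)// -addnn leq_addr.
Qed.

Lemma herm_sbound l q :
  sbound (fun j => cabs (herm l q j)) (expR (cabs l) * expR (cabs q)).
Proof.
have [sb _] := herm_pairs l q; move=> s us.
by under eq_bigr do rewrite -herm_row; apply: sum_row_bound.
Qed.

Lemma herm_sum l q : tsum (herm l q) = cexp (l + q).
Proof.
have [sb <-] := herm_pairs l q; rewrite fubini; last by exists (expR (cabs l) * expR (cabs q)).
by apply: eq_tsum => j; rewrite herm_row.
Qed.

(** Once the coefficients below J vanish, a small real r gives r^J |a J| <= r^(J+1) B, hence |a J|
    <= r B. *)
Lemma power_series_unique (a : nat -> C) : asum a ->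
  (forall s, cabs s <= 1 -> tsum (fun j => s ^+ j * a j) = 0) -> forall j, a j = 0.
Proof.
move=> [B hB] H J; elim/ltn_ind: J => J IH.
have B0 : 0 <= B by apply: sbound_ge0 hB.
apply/eqP; rewrite -cabs_eq0; apply/eqP/le_anti; rewrite cabs_ge0 andbT.
apply/ler_addgt0Pr => e e0; rewrite add0r.
pose r := Num.min 1 (e / (B + 1)).
have B1 : 0 < B + 1 by rewrite ltr_wpDl.
have r0 : 0 < r by rewrite lt_min ltr01 divr_gt0.
have r1 : r <= 1 by rewrite ge_min lexx.
have rC : cabs r%:C = r by rewrite cabs_real gtr0_norm.
have rn : r%:C != 0 :> C by rewrite -cabs_gt0 rC.
pose g j := if j == J then 0 else r%:C ^+ j * a j.
have gle j : cabs (g j) <= r ^+ J * (r * cabs (a j)).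
  have g0 : 0 <= r ^+ J * (r * cabs (a j)).
    by rewrite mulr_ge0 ?(exprn_ge0 J (ltW r0))// mulr_ge0 ?cabs_ge0//; apply: ltW.
  rewrite /g; case: eqP => [_|/eqP jJ]; first by rewrite cabs0.
  have [jlt|Jj] := ltnP j J.
    by rewrite (IH j jlt) mulr0 cabs0 !mulr0.
  rewrite cabsM cabsX rC mulrA -exprSr ler_wpM2r ?cabs_ge0//.
  by apply: ler_wiXn2l => //; [exact: ltW|rewrite ltn_neqAle eq_sym jJ].
have hg : sbound (fun j => cabs (g j)) (r ^+ J * (r * B)).
  have h := sboundZ (exprn_ge0 J (ltW r0)) (sboundZ (ltW r0) hB).
  exact: sbound_le gle h.
have E : tsum g = - (r%:C ^+ J * a J).
  have := H r%:C; rewrite rC => /(_ r1) H0.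
  rewrite -[RHS]add0r -H0; apply: has_sum_tsum.
  have hs : has_sum (fun j => if j == J then r%:C ^+ J * a J else 0) (r%:C ^+ J * a J).
    rewrite [X in has_sum _ X](_ : _ = \sum_(j <- [:: J]) (if j == J then r%:C ^+ J * a J else 0)); last first.
      by rewrite big_seq1 eqxx.
    by apply: has_sum_fin => // i; rewrite inE => /negbTE ->.
  have as0 : asum (fun j => r%:C ^+ j * a j).
    exists B; apply: sbound_le hB => j; rewrite cabsM cabsX rC ler_piMl ?cabs_ge0//.
    by rewrite exprn_ile1// ltW.
  have := has_sumB (asum_has_sum as0) hs; apply: eq_has_sum => j.
  by rewrite /g; case: eqP => [->|_]; rewrite ?subrr ?subr0.
have := tsum_bound hg; rewrite E cabsN cabsM cabsX rC ler_pM2l ?exprn_gt0// => h.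
apply: le_trans h _.
have : r <= e / (B + 1) by rewrite ge_min lexx orbT.
by rewrite ler_pdivlMr//; nra.
Qed.

(** |z| is at most |Re z| + |Im z|, which for a suitable choice of signs is the real part of (+-1 +-
    i) z. Four ordinary exponentials thus dominate exp (r |z|), and summability against exponentials
    controls all Taylor terms at once. *)
Lemma exp_cabs_le (r : R) (z : C) : 0 <= r -> expR (r * cabs z) <=
  cabs (cexp ((r%:C * (1 - 'i)) * z)) + cabs (cexp ((r%:C * (1 + 'i)) * z)) +
  (cabs (cexp ((r%:C * (- 1 - 'i)) * z)) + cabs (cexp ((r%:C * (- 1 + 'i)) * z))).
Proof.
move=> r0; rewrite !cabs_cexp !ReM !ImM /=.
set x := complex.Re z; set y := complex.Im z.
have h : r * cabs z <= r * `|x| + r * `|y| by rewrite -mulrDr ler_wpM2l// cabs_le_ReIm.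
apply: (@le_trans _ _ (expR (r * `|x| + r * `|y|))); first by rewrite ler_expR.
set e1 := expR (_ - _); set e2 := expR (_ - _); set e3 := expR (_ - _); set e4 := expR (_ - _).
have p1 : 0 <= e1 := expR_ge0 _. have p2 : 0 <= e2 := expR_ge0 _.
have p3 : 0 <= e3 := expR_ge0 _. have p4 : 0 <= e4 := expR_ge0 _.
have [x0|x0] := leP 0 x; have [y0|y0] := leP 0 y;
  rewrite ?(ger0_norm x0) ?(ger0_norm y0) ?(ltr0_norm x0) ?(ltr0_norm y0).
- have -> : expR (r * x + r * y) = e1 by congr expR; ring.
  by lra.
- have -> : expR (r * x + r * - y) = e2 by congr expR; ring.
  by lra.
- have -> : expR (r * - x + r * y) = e3 by congr expR; ring.
  by lra.
have -> : expR (r * - x + r * - y) = e4 by congr expR; ring.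
by lra.
Qed.

Section Extract.
Variables (K : choiceType) (G l : K -> C) (q : C).
Hypothesis aG : forall c, asum (fun k => G k * cexp (c * l k)).

Lemma herm_sbound_weight s : exists B, sbound (fun x : K * nat =>
  cabs (G x.1 * (s ^+ x.2 * herm (l x.1) q x.2))) B.
Proof.
pose r := cabs s; have r0 : 0 <= r by apply: cabs_ge0.
have [B1 h1] := aG (r%:C * (1 - 'i)); have [B2 h2] := aG (r%:C * (1 + 'i)).
have [B3 h3] := aG (r%:C * (- 1 - 'i)); have [B4 h4] := aG (r%:C * (- 1 + 'i)).
have hB := sboundD (sboundD h1 h2) (sboundD h3 h4).
exists (((B1 + B2) + (B3 + B4)) * expR (cabs (s ^+ 2 * q))).
apply: sbound_prod => [x|s1 s2 u1 u2]; first exact: cabs_ge0.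
under eq_bigr do under eq_bigr do rewrite cabsM /= -herm_scale.
under eq_bigr do rewrite -mulr_sumr.
apply: (@le_trans _ _ (\sum_(k <- s1) (cabs (G k) * expR (r * cabs (l k))) * expR (cabs (s ^+ 2 * q)))).
  apply: ler_sum => k _; rewrite -mulrA ler_wpM2l ?cabs_ge0//.
  by rewrite /r -cabsM; apply: herm_sbound.
rewrite -mulr_suml ler_wpM2r ?expR_ge0//; apply: le_trans (hB _ u1).
have e c k : cabs (G k * cexp (c * l k)) = cabs (G k) * cabs (cexp (c * l k)) by exact: cabsM.
apply: ler_sum => k _; rewrite !e -!mulrDr ler_wpM2l ?cabs_ge0//.
exact: exp_cabs_le.
Qed.

Lemma asum_herm j : asum (fun k => G k * herm (l k) q j).
Proof.
have [B hB] := herm_sbound_weight 1.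
have := asum_row j (asum_swap (f := fun x : K * nat => G x.1 * (1 ^+ x.2 * herm (l x.1) q x.2)) (ex_intro _ B hB)).
by apply: asum_le => k /=; rewrite expr1n mul1r.
Qed.

Lemma herm_series s : asum (fun j => s ^+ j * tsum (fun k => G k * herm (l k) q j)) /\
  tsum (fun k => G k * cexp (s * l k + s ^+ 2 * q)) =
  tsum (fun j => s ^+ j * tsum (fun k => G k * herm (l k) q j)).
Proof.
have [B hB] := herm_sbound_weight s.
pose f (x : K * nat) := G x.1 * (s ^+ x.2 * herm (l x.1) q x.2).
have af : asum f by exists B.
have row j : tsum (fun k => f (k, j)) = s ^+ j * tsum (fun k => G k * herm (l k) q j).
  rewrite -(tsumZ _ (asum_herm j)); apply: eq_tsum => k; rewrite /f /=; ring.
have E : tsum (fun k => G k * cexp (s * l k + s ^+ 2 * q)) = tsum (fun k => tsum (fun j => f (k, j))).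
  apply: eq_tsum => k; rewrite -herm_sum -tsumZ.
    by apply: eq_tsum => j; rewrite herm_scale.
  by exists (expR (cabs (s * l k)) * expR (cabs (s ^+ 2 * q))); apply: herm_sbound.
split; last by rewrite E (tsum_swap af); apply: eq_tsum => j; rewrite row.
have := asum_rows (asum_swap af); apply: asum_le => j.
by rewrite -row.
Qed.

End Extract.

(** Equality of the generating functions in s gives equality of their coefficients. Identities
    between exponential series thereby pass to series with polynomial factors. *)
Lemma hermite_extract (K M : choiceType) (G l : K -> C) (G' l' : M -> C) (q q' : C) :
  (forall c, asum (fun k => G k * cexp (c * l k))) ->
  (forall c, asum (fun m => G' m * cexp (c * l' m))) ->
  (forall s, tsum (fun k => G k * cexp (s * l k + s ^+ 2 * q)) =
             tsum (fun m => G' m * cexp (s * l' m + s ^+ 2 * q'))) ->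
  forall j, tsum (fun k => G k * herm (l k) q j) = tsum (fun m => G' m * herm (l' m) q' j).
Proof.
move=> a a' E j; apply/eqP; rewrite -subr_eq0; apply/eqP.
pose d j := tsum (fun k => G k * herm (l k) q j) - tsum (fun m => G' m * herm (l' m) q' j).
rewrite -[LHS]/(d j); apply: power_series_unique => [|s s1].
  have [h _] := herm_series q a 1; have [h' _] := herm_series q' a' 1.
  have := asumD h (asumZ (-1) h'); apply: asum_le => i.
  by rewrite !expr1n !mul1r mulN1r.
have [h e] := herm_series q a s; have [h' e'] := herm_series q' a' s.
transitivity (tsum (fun j => s ^+ j * tsum (fun k => G k * herm (l k) q j)) -
   tsum (fun j => s ^+ j * tsum (fun m => G' m * herm (l' m) q' j))).
  by rewrite -tsumB//; apply: eq_tsum => i; rewrite mulrBr.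
by rewrite -e -e' E subrr.
Qed.

End Hermite.

(** * Powers of linear forms span the polynomials *)

Section Interpolation.
Variables (R : realType) (V : lmodType R[i]) (P : V -> Prop).
Hypothesis PD : forall u v, P u -> P v -> P (u + v).
Hypothesis PZ : forall c u, P u -> P (c *: u).

Lemma coef_of_values d (v : nat -> V) : (forall s : R[i], P (\sum_(i < d) s ^+ i *: v i)) ->
  forall i, (i < d)%N -> P (v i).
Proof.
elim: d v => [|d IH] v H i //.
have lo j : (j < d)%N -> P (v j).
  move=> jd; have ne : (2 ^+ j - 2 ^+ d : R[i]) != 0.
    rewrite subr_eq0 -!natrX eqr_nat eqn_exp2l//.
    by rewrite neq_ltn jd.
  suff h : P ((2 ^+ j - 2 ^+ d) *: v j).
    by rewrite -[v j]scale1r -(mulVf ne) -scalerA; apply: PZ.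
  apply: (IH (fun j => (2 ^+ j - 2 ^+ d) *: v j)) => // s.
  (* The value at 2 s minus 2^d times the value at s kills the top coefficient and multiplies the
     j-th one by the nonzero 2^j - 2^d. *)
  have := PD (H (2 * s)) (PZ (- 2 ^+ d) (H s)).
  congr P; rewrite !big_ord_recr /= scalerDr addrACA scaler_sumr -big_split /=.
  rewrite !scalerA exprMn mulNr scaleNr subrr addr0.
  apply: eq_bigr => k _; rewrite !scalerA -scalerDl; congr (_ *: _).
  by rewrite exprMn; ring.
rewrite ltnS leq_eqVlt => /orP[/eqP->|]; last exact: lo.
have P0 : P 0 by rewrite -(scale0r (\sum_(i < d.+1) 0 ^+ i *: v i)); apply: PZ.
have := PD (H 1) (PZ (-1) (_ : P (\sum_(i < d) v i))).
rewrite big_ord_recr /= expr1n scale1r addrAC scaleN1r.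
under [X in P (X - _ + _)]eq_bigr do rewrite expr1n scale1r.
rewrite subrr add0r; apply.
by elim/big_ind: _ => //= k _; apply: lo.
Qed.
End Interpolation.

Section LinearForms.
Variables (R : realType) (n : nat).
Local Notation C := R[i].
Local Notation polyn := (mpoly.mpoly n C).
Local Notation X_ i := (mpoly.mpolyX C (mpoly.mnm1 i)).
Implicit Types (b : 'rV[C]_n) (p : polyn).

Definition lform b : polyn := \sum_i b 0 i *: X_ i.

Lemma lformD b b' : lform (b + b') = lform b + lform b'.
Proof. by rewrite /lform -big_split; apply: eq_bigr => i _; rewrite mxE scalerDl. Qed.

Lemma lformZ c b : lform (c *: b) = c *: lform b.
Proof. by rewrite /lform scaler_sumr; apply: eq_bigr => i _; rewrite mxE scalerA. Qed.

Lemma lform_delta i : lform (delta_mx 0 i) = X_ i.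
Proof.
rewrite /lform (bigD1 i)//= mxE !eqxx scale1r big1 ?addr0// => j ji.
by rewrite mxE eqxx (negbTE ji) scale0r.
Qed.

Section Span.
Variable P : polyn -> Prop.
Hypothesis PD : forall u v, P u -> P v -> P (u + v).
Hypothesis PZ : forall c u, P u -> P (c *: u).
Hypothesis Ppow : forall b j, P (lform b ^+ j).

(* The coefficient of [s] in [(l + s l') ^ (j + 1)] is [(j + 1) l ^ j l']. *)
Lemma span_prod (r : seq 'rV[C]_n) b j : P ((\prod_(c <- r) lform c) * lform b ^+ j).
Proof.
elim: r b j => [|c r IH] b j; first by rewrite big_nil mul1r.
rewrite big_cons; set q := \prod_(_ <- _) _ in IH *.
pose v i := (q * (lform b ^+ (j.+1 - i) * lform c ^+ i)) *+ 'C(j.+1, i).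
have := @coef_of_values R polyn P PD PZ j.+2 v _ 1%N isT.
rewrite /v bin1 subSS subn0 expr1 -mulr_natl => h.
have -> : lform c * q * lform b ^+ j = (j.+1%:R^-1 : C) *: (j.+1%:R * (q * (lform b ^+ j * lform c))).
  rewrite mulr_natl -[X in _ *: X]scaler_nat scalerA mulVf ?pnatr_eq0// scale1r.
  by rewrite mulrA [RHS]mulrC mulrA.
apply: PZ; apply: h => s.
have := IH (b + s *: c) j.+1; congr P.
rewrite lformD lformZ exprDn mulr_sumr; apply: eq_bigr => i _.
by rewrite exprZn -scalerAr mulrnAr -scalerAr scalerMnr.
Qed.

(** An induction principle: linear statements about polynomials need only be checked on powers of
    linear forms, where Laplacians and generating functions are explicit. *)
Lemma poly_span p : P p.
Proof.
have P0 : P 0 by rewrite -(scale0r (lform 0 ^+ 0)); apply: PZ.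
elim/mpoly.mpolyind: p => [//|c m p _ _ hp]; apply: PD => //; apply: PZ.
suff [r ->] : exists r : seq 'rV[C]_n, mpoly.mpolyX C m = \prod_(c <- r) lform c.
  by have := span_prod r 0 0; rewrite expr0 mulr1.
rewrite (mpoly.mpolyXE_id C m).
elim/big_ind: _ => [|_ _ [r1 ->] [r2 ->]|i _]; first by exists [::]; rewrite big_nil.
  by exists (r1 ++ r2); rewrite big_cat.
exists (nseq (m i) (delta_mx 0 i)); elim: (m i) => [|k IH]; first by rewrite big_nil.
by rewrite exprS big_cons -IH lform_delta.
Qed.
End Span.

Definition evalC p (z : 'rV[C]_n) : C := mpoly.meval (fun i => z 0 i) p.

Lemma pevalE p (x : 'rV[R]_n) : peval p x = evalC p (toC x).
Proof. by apply: mpoly.meval_eq => i; rewrite mxE. Qed.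

Lemma evalC_lform b z : evalC (lform b) z = dot b z.
Proof.
rewrite /evalC /lform raddf_sum /= dotE; apply: eq_bigr => i _.
by rewrite mpoly.mevalZ mpoly.mevalXU.
Qed.

Lemma evalCE p z : evalC p z = \sum_(m <- mpoly.msupp p) mpoly.mcoeff m p * \prod_i z 0 i ^+ (m i).
Proof. by rewrite /evalC mpoly.mevalE. Qed.

Lemma evalCD p q z : evalC (p + q) z = evalC p z + evalC q z.
Proof. exact: mpoly.mevalD. Qed.
Lemma evalCB p q z : evalC (p - q) z = evalC p z - evalC q z.
Proof. exact: mpoly.mevalB. Qed.
Lemma evalCZ c p z : evalC (c *: p) z = c * evalC p z.
Proof. exact: mpoly.mevalZ. Qed.
Lemma evalCM p q z : evalC (p * q) z = evalC p z * evalC q z.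
Proof. exact: mpoly.mevalM. Qed.
Lemma evalCX p z j : evalC (p ^+ j) z = evalC p z ^+ j.
Proof. exact: rmorphXn. Qed.
Lemma evalC_sum I (r : seq I) (Q : pred I) (p : I -> polyn) z :
  evalC (\sum_(i <- r | Q i) p i) z = \sum_(i <- r | Q i) evalC (p i) z.
Proof. exact: raddf_sum. Qed.

End LinearForms.

Section Evaluation.
Variables (R : realType) (n : nat).
Local Notation C := R[i].
Local Notation polyn := (mpoly.mpoly n C).
Implicit Types (b : 'rV[C]_n) (p : polyn).

Lemma poly_eq_nat (f g : {poly C}) : (forall k : nat, f.[k%:R] = g.[k%:R]) -> f = g.
Proof.
move=> h; apply/eqP; rewrite -subr_eq0; apply: contraT => ne.
have := max_poly_roots (rs := [seq k%:R | k <- iota 0 (size (f - g))]) ne.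
rewrite size_map size_iota ltnn; apply.
  by apply/allP => _ /mapP[k _ ->]; rewrite /root hornerD hornerN h subrr.
by rewrite map_inj_uniq ?iota_uniq// => i j /eqP; rewrite eqr_nat => /eqP.
Qed.

Lemma evalC_line p (u v : 'rV[C]_n) : exists f : {poly C}, forall a, f.[a] = evalC p (a *: u + v).
Proof.
exists (\sum_(m <- mpoly.msupp p) (mpoly.mcoeff m p)%:P * \prod_i ((u 0 i)%:P * 'X + (v 0 i)%:P) ^+ (m i)).
move=> a; rewrite evalCE horner_sum; apply: eq_bigr => m _.
rewrite hornerM hornerC horner_prod; congr (_ * _); apply: eq_bigr => i _.
by rewrite horner_exp hornerD hornerM !hornerC hornerX !mxE mulrC.
Qed.

(** Homogeneity is assumed for real scalars, whereas inversion substitutes t and its conjugate. Both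
    sides are polynomial in each scalar and agree at all natural numbers. *)
Lemma homog_complex (v : decomp R n) mp mm p : homogeneous v mp mm p ->
  forall (x : 'rV[R]_n) (cp cm : C),
  evalC p (cp *: toC (projp v x) + cm *: toC (projm v x)) = cp ^+ mp * cm ^+ mm * evalC p (toC x).
Proof.
move=> hom x cp cm.
have h1 (k : nat) (c : nat) : evalC p (k%:R *: toC (projp v x) + c%:R *: toC (projm v x)) =
    k%:R ^+ mp * c%:R ^+ mm * evalC p (toC x).
  have := hom x k%:R c%:R; rewrite !pevalE.
  rewrite (_ : toC (_ + _) = k%:R *: toC (projp v x) + c%:R *: toC (projm v x)); last first.
    by apply/matrixP => i j; rewrite !mxE !natC rmorphD !rmorphM.
  by rewrite (rmorphM (real_complex R)) !(rmorphXn (real_complex R)) /= !natC.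
have h2 (k : nat) : evalC p (k%:R *: toC (projp v x) + cm *: toC (projm v x)) =
    k%:R ^+ mp * cm ^+ mm * evalC p (toC x).
  have [f hf] := evalC_line p (toC (projm v x)) (k%:R *: toC (projp v x)).
  suff e : f = (k%:R ^+ mp * evalC p (toC x))%:P * 'X^mm.
    by rewrite addrC -hf e hornerM hornerC hornerXn; ring.
  apply: poly_eq_nat => c; rewrite hf addrC h1 hornerM hornerC hornerXn; ring.
have [f hf] := evalC_line p (toC (projp v x)) (cm *: toC (projm v x)).
suff e : f = (cm ^+ mm * evalC p (toC x))%:P * 'X^mp.
  by rewrite -hf e hornerM hornerC hornerXn; ring.
apply: poly_eq_nat => c; rewrite hf h2 hornerM hornerC hornerXn; ring.
Qed.

(* Scaling one coordinate at a time separates the monomials. *)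
Lemma peval_eq0 p : (forall x : 'rV[R]_n, peval p x = 0) -> p = 0.
Proof.
move=> H; apply/mpoly.mpolyP => d; rewrite mpoly.mcoeff0.
pose S (r : seq 'I_n) (z : 'rV[R]_n) : C :=
  \sum_(m <- mpoly.msupp p | all (fun i => m i == d i) r) mpoly.mcoeff m p * \prod_i (z 0 i)%:C ^+ (m i).
have Sr r z : S r z = 0.
  elim: r z => [|i r IH] z.
    transitivity (peval p z); last exact: H.
    rewrite /S /= pevalE evalCE; apply: eq_bigr => m _; congr (_ * _).
    by apply: eq_bigr => i _; rewrite mxE.
  pose B := (\max_(m <- mpoly.msupp p) m i).+1.
  pose z' := \row_j (if j == i then 1 else z 0 j).
  pose w e := \sum_(m <- mpoly.msupp p | all (fun i => m i == d i) r && (m i == e)) mpoly.mcoeff m p * \prod_j (z' 0 j)%:C ^+ (m j).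
  have wE (a : C) : \sum_(e < B) a ^+ e * w e = \sum_(m <- mpoly.msupp p | all (fun i => m i == d i) r)
      a ^+ (m i) * (mpoly.mcoeff m p * \prod_j (z' 0 j)%:C ^+ (m j)).
    rewrite [RHS]big_seq_cond /w.
    under [LHS]eq_bigr do rewrite mulr_sumr [\sum_(_ <- mpoly.msupp _ | _) _]big_seq_cond big_mkcond.
    rewrite exchange_big [RHS]big_mkcond /=; apply: eq_bigr => m _.
    case: ifPn => [/andP[mp mr]|hn]; last first.
      rewrite big1// => e _; case: ifP => // /andP[mp /andP[mr _]].
      by rewrite mp mr in hn.
    have mB : (m i < B)%N by rewrite ltnS (big_rem m)//= leq_maxl.
    move: (mpoly.mcoeff m p * _) => X.
    rewrite (bigD1 (Ordinal mB))//= mp mr eqxx /= big1 ?addr0// => e ne.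
    case: ifP => // /eqP h; case/eqP: ne; apply: val_inj; exact: esym.
  have w0 (e : nat) : (e < B)%N -> w e = 0.
    pose f : {poly C} := \poly_(e < B) w e.
    suff f0 : f = 0 by move=> eB; have := coef_poly B w e; rewrite -/f f0 coef0 eB.
    apply: poly_eq_nat => k; rewrite horner0 /f horner_poly.
    under eq_bigr do rewrite mulrC.
    rewrite wE; transitivity (S r (\row_j (if j == i then k%:R else z 0 j))); last exact: IH.
    rewrite /S.
    apply: eq_bigr => m _; rewrite mulrCA; congr (_ * _).
    rewrite (bigD1 i)//= [RHS](bigD1 i)//= !mxE !eqxx expr1n mul1r natC; congr (_ * _).
    by apply: eq_bigr => j ji; rewrite !mxE (negbTE ji).
  have -> : S (i :: r) z = (z 0 i)%:C ^+ (d i) * w (d i).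
    rewrite /S /w mulr_sumr; apply: eq_big => [m|m /= /andP[/eqP mi _]]; first by rewrite /= andbC.
    rewrite mulrCA; congr (_ * _).
    rewrite (bigD1 i)//= [in RHS](bigD1 i)//= !mxE !eqxx expr1n mul1r mi; congr (_ * _).
    by apply: eq_bigr => j ji; rewrite !mxE (negbTE ji).
  have [dB|Bd] := ltnP (d i) B; first by rewrite w0 ?mulr0.
  rewrite /w big1_seq ?mulr0// => m /andP[/andP[_ /eqP mi] mp].
  by move: Bd; rewrite -mi ltnNge (big_rem m)//= leq_maxl.
have := Sr (enum 'I_n) (\row_i 1); rewrite /S.
have e (m : mpoly.multinom n) : all (fun i => m i == d i) (enum 'I_n) = (m == d).
  apply/allP/eqP => [h|-> //]; apply/mpoly.mnmP => i; apply/eqP/h; exact: mem_enum.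
under eq_bigl do rewrite e.
have [dp|dp] := boolP (d \in mpoly.msupp p); last first.
  by move=> _; apply/eqP; rewrite mpoly.mcoeff_eq0.
rewrite -big_filter filter_pred1_uniq ?mpoly.msupp_uniq// big_seq1 big1 ?mulr1// => i _.
by rewrite mxE expr1n.
Qed.

Lemma peval_inj p q : (forall x : 'rV[R]_n, peval p x = peval q x) -> p = q.
Proof.
move=> h; apply/eqP; rewrite -subr_eq0; apply/eqP/peval_eq0 => x.
by rewrite pevalE evalCB -!pevalE h subrr.
Qed.

End Evaluation.

(** * Laplacians on powers of linear forms *)

Section Derivatives.
Variables (R : realType) (n : nat).
Local Notation C := R[i].
Local Notation polyn := (mpoly.mpoly n C).
Implicit Types (b : 'rV[C]_n) (p : polyn).

Lemma mderiv_lform i b : mpoly.mderiv i (lform b) = mpoly.mpolyC n (b 0 i).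
Proof.
rewrite /lform raddf_sum /= (bigD1 i)//= big1 => [|j ji].
  rewrite mpoly.mderivZ mpoly.mderivX mpoly.mnm1E eqxx scale1r addr0.
  rewrite (_ : mpoly.mnm_sub _ _ = @mpoly.mnm0 n); last first.
    by apply/mpoly.mnmP => k; rewrite mpoly.mnmBE subnn mpoly.mnm0E.
  by rewrite mpoly.mpolyX0 -mpoly.mul_mpolyC mulr1.
by rewrite mpoly.mderivZ mpoly.mderivX mpoly.mnm1E (negbTE ji) scale0r scaler0.
Qed.

Lemma mderiv_lformX i b j :
  mpoly.mderiv i (lform b ^+ j) = (j%:R * b 0 i) *: lform b ^+ j.-1.
Proof.
elim: j => [|j IH]; first by rewrite expr0 -mpoly.mpolyC1 mpoly.mderivC mul0r scale0r.
rewrite exprS mpoly.mderivM IH mderiv_lform mpoly.mul_mpolyC /=.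
case: j {IH} => [|j]; first by rewrite mul0r scale0r mulr0 addr0 !mul1r.
by rewrite -scalerAr -exprS -scalerDl -[in RHS]natr1 mulrDl mul1r addrC.
Qed.

Lemma mderiv_sum i I (r : seq I) (P : pred I) (f : I -> polyn) :
  mpoly.mderiv i (\sum_(k <- r | P k) f k) = \sum_(k <- r | P k) mpoly.mderiv i (f k).
Proof. exact: raddf_sum. Qed.

Variable K : 'M[R]_n.

Definition lapl p : polyn :=
  \sum_(i < n) \sum_(j < n) (K i j)%:C *: mpoly.mderiv i (mpoly.mderiv j p).

Lemma laplD p q : lapl (p + q) = lapl p + lapl q.
Proof.
rewrite /lapl -big_split; apply: eq_bigr => i _; rewrite -big_split; apply: eq_bigr => j _ /=.
by rewrite !mpoly.mderivD scalerDr.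
Qed.

Lemma laplZ c p : lapl (c *: p) = c *: lapl p.
Proof.
rewrite /lapl scaler_sumr; apply: eq_bigr => i _; rewrite scaler_sumr; apply: eq_bigr => j _ /=.
by rewrite !mpoly.mderivZ !scalerA mulrC.
Qed.

Lemma iter_laplD k p q : iter k lapl (p + q) = iter k lapl p + iter k lapl q.
Proof. by elim: k => //= k ->; rewrite laplD. Qed.

Lemma iter_laplZ k c p : iter k lapl (c *: p) = c *: iter k lapl p.
Proof. by elim: k => //= k ->; rewrite laplZ. Qed.

Definition explap (c : R) (d : nat) p : polyn :=
  \sum_(j < d) (c ^+ j / j`!%:R)%:C *: iter j lapl p.

Lemma explapD c d p q : explap c d (p + q) = explap c d p + explap c d q.
Proof.
by rewrite /explap -big_split; apply: eq_bigr => i _ /=; rewrite iter_laplD scalerDr.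
Qed.

Lemma explapZ c d a p : explap c d (a *: p) = a *: explap c d p.
Proof.
rewrite /explap scaler_sumr; apply: eq_bigr => i _ /=.
by rewrite iter_laplZ !scalerA mulrC.
Qed.

Definition deglt (d : nat) p := forall m, (d <= mpoly.mdeg m)%N -> mpoly.mcoeff m p = 0.

Lemma deglt_msize p : deglt (mpoly.msize p) p.
Proof. by move=> m /mpoly.msize_mdeg_ge h; apply/eqP; rewrite mpoly.mcoeff_eq0. Qed.

Lemma deglt_deriv d i p : deglt d p -> deglt d.-1 (mpoly.mderiv i p).
Proof.
move=> h m dm; rewrite mpoly.mcoeff_mderiv h ?mul0rn//.
by rewrite mpoly.mdegD mpoly.mdeg1 addn1; case: d dm {h}.
Qed.

Lemma deglt_le d e p : (d <= e)%N -> deglt d p -> deglt e p.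
Proof. by move=> de h m em; apply: h; apply: leq_trans em. Qed.

Lemma deglt_lapl d p : deglt d p -> deglt d.-1 (lapl p).
Proof.
move=> h m dm; rewrite /lapl raddf_sum big1// => i _ /=; rewrite raddf_sum big1// => j _ /=.
have h2 := deglt_le (leq_pred _) (deglt_deriv i (deglt_deriv j h)).
by rewrite mpoly.mcoeffZ h2 ?mulr0.
Qed.

Lemma iter_lapl_eq0 d p k : deglt d p -> (d <= k)%N -> iter k lapl p = 0.
Proof.
elim: k d p => [|k IH] d p h dk.
  by apply/mpoly.mpolyP => m; rewrite mpoly.mcoeff0 h// (leq_trans dk).
rewrite iterSr (IH d.-1)//; first exact: deglt_lapl.
by case: d dk {h}.
Qed.

(** Terms beyond the degree vanish. This makes the exponential additive although its length depends
    on the polynomial. *)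
Lemma explap_widen c d e p : deglt d p -> (d <= e)%N -> explap c e p = explap c d p.
Proof.
move=> h de; rewrite /explap -!(big_mkord xpredT (fun j => (c ^+ j / j`!%:R)%:C *: iter j lapl p)).
rewrite (big_cat_nat (n := d))//= [X in _ + X]big_nat_cond [X in _ + X]big1 ?addr0// => i /andP[/andP[di _] _].
by rewrite (iter_lapl_eq0 h di) scaler0.
Qed.

Local Notation g b := (bf (toC K) b b).

Lemma lapl_lformX b j : lapl (lform b ^+ j) = ((j ^_ 2)%:R * g b) *: lform b ^+ (j - 2).
Proof.
rewrite /lapl; transitivity (\sum_i \sum_k ((j ^_ 2)%:R * ((K i k)%:C * b 0 i * b 0 k)) *: lform b ^+ (j - 2)).
  apply: eq_bigr => i _; apply: eq_bigr => k _.
  rewrite mderiv_lformX mpoly.mderivZ mderiv_lformX !scalerA -subn2 ffactnS ffactn1 natrM subn2.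
  by congr (_ *: _); ring.
rewrite /bf mxE mulr_sumr scaler_suml exchange_big; apply: eq_bigr => k _ /=.
rewrite !mxE !mulr_suml mulr_sumr scaler_suml; apply: eq_bigr => i _.
by rewrite !mxE; congr (_ *: _); ring.
Qed.

Lemma iter_lapl_lformX k b j :
  iter k lapl (lform b ^+ j) = ((j ^_ k.*2)%:R * g b ^+ k) *: lform b ^+ (j - k.*2).
Proof.
elim: k => [|k IH]; first by rewrite /= ffactn0 mulr1 scale1r subn0.
rewrite iterS IH laplZ lapl_lformX scalerA doubleS -subnDA addn2; congr (_ *: _).
rewrite !ffactnSr ffactn0 mul1n subn0 -subnDA addn1 !natrM exprSr.
by move: ((j ^_ _)%:R : C) ((j - _)%:R : C) ((j - _)%:R : C) (g b ^+ k) (g b) => u v w x y; ring.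
Qed.

(** Formally exp (c Laplacian) exp (s l) = exp (s l + s^2 c g), where g is the value of the inverse
    metric at b; the coefficient of s^j on the left is the image of l^j / j!. *)
Lemma evalC_explap_lformX c d b j z : (j < d)%N ->
  evalC (explap c d (lform b ^+ j)) z = j`!%:R * herm (dot b z) (c%:C * g b) j.
Proof.
move=> jd; rewrite /explap evalC_sum /herm mulr_sumr.
pose t k : C := (c ^+ k / k`!%:R)%:C * ((j ^_ k.*2)%:R * g b ^+ k * dot b z ^+ (j - k.*2)).
transitivity (\sum_(k < d) t k).
  by apply: eq_bigr => k _; rewrite iter_lapl_lformX !evalCZ evalCX evalC_lform.
rewrite -(big_mkord xpredT t) (big_cat_nat (n := j.+1))//= [X in _ + X]big_nat_cond.
rewrite [X in _ + X]big1 ?addr0 => [|i /andP[/andP[ji _] _]]; last first.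
  rewrite /t ffact_small ?mul0r ?mulr0//.
  by rewrite (leq_trans ji)// -addnn leq_addr.
rewrite /index_iota subn0 [RHS]big_mkcond; apply: eq_bigr => k _.
rewrite /t; case: leqP => [kj|jk]; last by rewrite ffact_small ?mul0r ?mulr0.
have e : (j`!%:R : C) = (j ^_ k.*2)%:R * (j - k.*2)`!%:R by rewrite -natrM ffact_fact.
have n1 : ((j - k.*2)`!%:R : C) != 0 by rewrite pnatr_eq0 -lt0n fact_gt0.
have n2 : (k`!%:R : C) != 0 by rewrite pnatr_eq0 -lt0n fact_gt0.
rewrite /ecoef e (rmorphM (real_complex R)) fmorphV (rmorphXn (real_complex R)) /= -natC exprMn.
by move: (dot b z ^+ _) (g b ^+ k) (c%:C ^+ k) ((j ^_ _)%:R : C) => u v w x; field; rewrite n1 n2.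
Qed.

End Derivatives.

Section Composition.
Variables (R : realType) (m n : nat).
Local Notation C := R[i].
Variable A : 'M[C]_(m, n).

(* [p] at the row vector [x *m A] *)
Definition mxcomp (p : mpoly.mpoly n C) : mpoly.mpoly m C :=
  mpoly.comp_mpoly [tuple lform (col i A)^T | i < n] p.

Lemma evalC_mxcomp p z : evalC (mxcomp p) z = evalC p (z *m A).
Proof.
rewrite /evalC mpoly.comp_mpoly_meval; apply: mpoly.meval_eq => i.
rewrite tnth_mktuple -[LHS]/(evalC _ _) evalC_lform dotE mxE; apply: eq_bigr => j _.
by rewrite !mxE mulrC.
Qed.

Lemma mxcompD p q : mxcomp (p + q) = mxcomp p + mxcomp q.
Proof. exact: mpoly.comp_mpolyD. Qed.
Lemma mxcompZ c p : mxcomp (c *: p) = c *: mxcomp p.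
Proof. exact: mpoly.comp_mpolyZ. Qed.
Lemma mxcompX p j : mxcomp (p ^+ j) = mxcomp p ^+ j.
Proof. exact: (rmorphXn (mpoly.comp_mpoly _)). Qed.
Lemma mxcomp_sum I (r : seq I) (P : pred I) f :
  mxcomp (\sum_(i <- r | P i) f i) = \sum_(i <- r | P i) mxcomp (f i).
Proof. exact: (raddf_sum (mpoly.comp_mpoly _)). Qed.

Lemma mxcomp_lform b : mxcomp (lform b) = lform (b *m A^T).
Proof.
rewrite /lform mxcomp_sum.
transitivity (\sum_i \sum_j (b 0 i * A j i) *: mpoly.mpolyX C (mpoly.mnm1 j) : mpoly.mpoly m C).
  apply: eq_bigr => i _; rewrite mxcompZ /mxcomp mpoly.comp_mpolyXU -tnth_nth tnth_mktuple.
  by rewrite scaler_sumr; apply: eq_bigr => j _; rewrite scalerA !mxE.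
rewrite exchange_big; apply: eq_bigr => j _ /=; rewrite mxE scaler_suml.
by apply: eq_bigr => i _; rewrite !mxE.
Qed.

(** The chain rule, checked on powers of linear forms. *)
Lemma mderiv_mxcomp i p :
  mpoly.mderiv i (mxcomp p) = \sum_a A i a *: mxcomp (mpoly.mderiv a p).
Proof.
elim/poly_span: p => [p q hp hq|c p hp|b j].
- rewrite mxcompD.
  rewrite (mpoly.mderivD i (mxcomp p) (mxcomp q)).
  apply: etrans (congr2 +%R hp hq) _.
  rewrite -big_split /=.
  apply: eq_bigr => a _.
  by rewrite (mpoly.mderivD a p q) mxcompD scalerDr.
- rewrite mxcompZ mpoly.mderivZ hp scaler_sumr; apply: eq_bigr => a _ /=.
  by rewrite mpoly.mderivZ mxcompZ !scalerA mulrC.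
rewrite mxcompX mxcomp_lform mderiv_lformX mxE mulr_sumr scaler_suml; apply: eq_bigr => a _.
rewrite mderiv_lformX mxcompZ mxcompX mxcomp_lform scalerA !mxE; congr (_ *: _); ring.
Qed.

End Composition.

Section PolynomialInversion.
Variable R : realType.
Local Notation C := R[i].
Local Notation piC := ((pi : R)%:C).
Local Notation zr := (@zvec R _).

Lemma herm0r (l : C) j : herm l 0 j = ecoef l j.
Proof.
rewrite /herm big_cons leq0n subn0 big_seq_cond big1 ?addr0 => [|k].
  by rewrite /ecoef !expr0 fact0 divr1 mulr1.
by rewrite mem_iota => /andP[/andP[k0 _] _]; rewrite /ecoef expr0n gtn_eqF// mul0r mulr0.
Qed.

Lemma piC_neq0 : piC != 0 :> C.
Proof. by rewrite -cabs_gt0 cabs_real normr_gt0 gt_eqF// pi_gt0. Qed.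

Section PolynomialSeries.
Variables (n : nat).

Lemma asum_poly_theta m (A : 'M[C]_n) (l : 'rV[C]_n) (B : 'M[C]_(n, m)) (g : 'rV[C]_m) p :
  A^T = A -> posQ A ->
  asum (fun k : 'rV[int]_n => evalC p (zr k *m B + g) *
    cexp (- (piC * bf A (zr k) (zr k)) + dot l (zr k))).
Proof.
move=> sA pA; elim/poly_span: p => [p q hp hq|c p hp|b j].
- have := asumD hp hq; apply: asum_le => k.
  by rewrite -mulrDl -evalCD.
- have := asumZ c hp; apply: asum_le => k.
  by rewrite evalCZ mulrA.
pose G (k : 'rV[int]_n) := cexp (- (piC * bf A (zr k) (zr k)) + dot l (zr k)).
pose L (k : 'rV[int]_n) := dot b (zr k *m B + g).
have LE k : L k = dot (b *m B^T) (zr k) + dot b g by rewrite /L dotDr dot_mulmx trmxK.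
have aG (c : C) : asum (fun k => G k * cexp (c * L k)).
  have := asumZ (cexp (c * dot b g)) (asum_theta (l + c *: (b *m B^T)) sA pA).
  apply: asum_le => k; rewrite /G -!cexpD LE dotDl dotZl.
  by rewrite le_eqVlt; apply/orP; left; apply/eqP; congr (cabs (cexp _)); ring.
have := asumZ (j`!%:R) (asum_herm 0 aG j); apply: asum_le => k.
rewrite evalCX evalC_lform -/(L k) -/(G k) herm0r /ecoef.
rewrite le_eqVlt; apply/orP; left; apply/eqP; congr (cabs _).
have n1 : (j`!%:R : C) != 0 by rewrite pnatr_eq0 -lt0n fact_gt0.
by move: (G k) (L k ^+ j) => u v; field.
Qed.

(** The factor exp (b, k + g) generates the polynomial coefficients. After inversion it becomes a
    linear term in m and the quadratic term A^-1 (b, b) / (4 pi), which the Laplacian has to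
    compensate. *)
Lemma theta_char (A : 'M[C]_n) (g b : 'rV[C]_n) : A^T = A -> posQ A ->
  tsum (fun k : 'rV[int]_n => cexp (- (piC * bf A (zr k + g) (zr k + g))) * cexp (dot b (zr k + g))) =
  invsqrt_det A * tsum (fun m : 'rV[int]_n =>
    cexp (- (piC * bf (invmx A) (zr m) (zr m)) + 2 * piC * 'i * dot g (zr m)) *
    cexp (- 'i * bf (invmx A) (zr m) b + bf (invmx A) b b / (4 * piC))).
Proof.
move=> sA pA; have uA := posQ_unit sA pA; have sI := invmx_sym sA.
have pi0 := piC_neq0.
have i2 := sqr_i R.
(* Chosen with 2 pi i be = b - 2 pi g A, so that it gathers all terms linear in k. *)
pose be : 'rV[C]_n := 'i *: (g *m A) - ('i / (2 * piC)) *: b.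
pose P := cexp (- (piC * bf A g g) + dot b g).
have ne : P != 0 by apply: cexp_neq0.
transitivity (P * tsum (fun k : 'rV[int]_n =>
    cexp (- (piC * bf A (zr k) (zr k)) + 2 * piC * 'i * dot be (zr k)))).
  rewrite -tsumZ_neq0//; apply: eq_tsum => k; rewrite /P -!cexpD; congr cexp.
  rewrite !(bfDl, bfDr) (bf_sym g (zr k) sA) dotDr /be dotBl !dotZl -bf_mul.
  rewrite (bf_sym g (zr k) sA).
  move: (bf _ _ _ : C) (bf _ _ _ : C) (bf _ _ _ : C) (dot _ _ : C) (dot _ _ : C) => u v w x y.
  have := i2; set i := (X in X ^+ 2 = _); rewrite -?[Num.imaginary]/i; move: i piC pi0 => i c c0 ii.
  have e : 2 * c * i * (i * v - i / (2 * c) * y) = i ^+ 2 * (2 * c * v - y).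
    by field; rewrite c0.
  by rewrite e ii; ring.
rewrite theta_inversion// mulrCA; congr (_ * _); rewrite -tsumZ_neq0//.
apply: eq_tsum => m; rewrite /P -!cexpD; congr cexp.
have e1 x : bf (invmx A) (g *m A) x = dot g x by rewrite bf_mul mulmxK.
rewrite !(bfBl, bfBr) /be !(bfBl, bfBr, bfZl, bfZr) !(bf_sym _ (g *m A) sI) !e1.
rewrite (dotC g (g *m A)) -bf_mul (bf_sym b (zr m) sI) (dotC g b).
move: (bf A g g : C) (dot b g : C) (bf _ (zr m) (zr m) : C) (dot g _ : C) (bf _ (zr m) b : C) (bf _ b b : C) => u v w x y z.
have := i2; set i := (X in X ^+ 2 = _); rewrite -?[Num.imaginary]/i; move: i piC pi0 => i c c0 ii.
set t := (X in _ = X).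
transitivity (- (c * u) + v - c * w + 2 * c * i * x - i * y + - (c * (i ^+ 2) * u) + i ^+ 2 * v - i ^+ 2 / (4 * c) * z).
  by field.
by rewrite ii /t; ring.
Qed.

End PolynomialSeries.
End PolynomialInversion.

Section ExpLaplacian.
Variables (R : realType) (n : nat) (K : 'M[R]_n).
Local Notation C := R[i].
Local Notation polyn := (mpoly.mpoly n C).
Implicit Types (p q : polyn).

Definition explp (c : R) p : polyn := explap K c (mpoly.msize p) p.

Lemma explpE c d p : deglt d p -> explp c p = explap K c d p.
Proof.
move=> h; have hm := @deglt_msize R n p.
rewrite /explp -(explap_widen K c hm (leq_maxl _ d)).
by rewrite -(explap_widen K c h (leq_maxr (mpoly.msize p) _)).
Qed.

Lemma degltD d p q : deglt d p -> deglt d q -> deglt d (p + q).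
Proof. by move=> hp hq m dm; rewrite mpoly.mcoeffD hp ?hq ?addr0. Qed.

Lemma degltZ d c p : deglt d p -> deglt d (c *: p).
Proof. by move=> hp m dm; rewrite mpoly.mcoeffZ hp ?mulr0. Qed.

Lemma explpD c p q : explp c (p + q) = explp c p + explp c q.
Proof.
have hp := deglt_le (leq_maxl _ (mpoly.msize q)) (@deglt_msize R n p).
have hq := deglt_le (leq_maxr (mpoly.msize p) _) (@deglt_msize R n q).
by rewrite (explpE c hp) (explpE c hq) (explpE c (degltD hp hq)) explapD.
Qed.

Lemma explpZ c a p : explp c (a *: p) = a *: explp c p.
Proof. by rewrite (explpE c (degltZ a (@deglt_msize R n p))) explapZ. Qed.

Lemma evalC_explp_lformX c b j z :
  evalC (explp c (lform b ^+ j)) z = j`!%:R * herm (dot b z) (c%:C * bf (toC K) b b) j.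
Proof.
have h := deglt_le (leq_maxl _ j.+1) (@deglt_msize R n (lform b ^+ j)).
by rewrite (explpE c h) evalC_explap_lformX ?leq_maxr.
Qed.

End ExpLaplacian.

Section Inversion.
Variables (R : realType) (n : nat).
Local Notation C := R[i].
Local Notation piC := ((pi : R)%:C).
Local Notation zr := (@zvec R _).
Variables (A Qi B : 'M[C]_n) (K : 'M[R]_n) (c c' : R) (g : 'rV[C]_n).
Hypotheses (sA : A^T = A) (pA : posQ A).
Hypothesis QB : Qi *m B = - 'i *: invmx A.
Hypothesis KB : forall b, c'%:C * bf (toC K) b b + bf (invmx A) b b / (4 * piC) =
  c%:C * bf (toC K) (b *m B^T) (b *m B^T).

Let gl (k : 'rV[int]_n) := cexp (- (piC * bf A (zr k + g) (zr k + g))).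
Let gr (m : 'rV[int]_n) := cexp (- (piC * bf (invmx A) (zr m) (zr m)) + 2 * piC * 'i * dot g (zr m)).

Lemma asum_inv_l p : asum (fun k => evalC p (zr k + g) * gl k).
Proof.
have := asumZ (cexp (- (piC * bf A g g))) (asum_poly_theta (- (2 * piC) *: (g *m A)) 1%:M g p sA pA).
apply: asum_le => k; rewrite mulmx1 [in leRHS]mulrCA -cexpD le_eqVlt; apply/orP; left; apply/eqP.
congr (cabs (_ * cexp _)).
rewrite dotZl -bf_mul !(bfDl, bfDr) (bf_sym (zr k) g sA).
by move: (bf _ _ _) (bf _ _ _) (bf _ _ _) => u v w; ring.
Qed.

Lemma asum_inv_r p : asum (fun m => evalC p (zr m *m Qi) * gr m).
Proof.
have := asum_poly_theta (2 * piC * 'i *: g) Qi 0 p (invmx_sym sA) (posQ_inv sA pA).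
by apply: asum_le => m; rewrite addr0 dotZl.
Qed.

(** Both sides are linear in p, so p may be a power of a linear form, and [theta_char] is compared
    coefficientwise in s. [QB] matches the linear parts of the exponents and [KB] the quadratic
    ones. *)
Lemma poly_inversion p :
  tsum (fun k => evalC (explp K c' p) (zr k + g) * gl k) =
  invsqrt_det A * tsum (fun m => evalC (explp K c (mxcomp B p)) (zr m *m Qi) * gr m).
Proof.
elim/poly_span: p => [p q hp hq|a p hp|b j].
- rewrite (eq_tsum (g := fun k => evalC (explp K c' p) (zr k + g) * gl k + evalC (explp K c' q) (zr k + g) * gl k)); last first.
    by move=> k; rewrite explpD evalCD mulrDl.
  rewrite tsumD; [|exact: asum_inv_l..].
  apply: etrans (congr2 +%R hp hq) _; rewrite -mulrDr; congr (_ * _).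
  rewrite -tsumD; [|exact: asum_inv_r..].
  by apply: eq_tsum => k; rewrite mxcompD explpD evalCD mulrDl.
- rewrite (eq_tsum (g := fun k => a * (evalC (explp K c' p) (zr k + g) * gl k))); last first.
    by move=> k; rewrite explpZ evalCZ -[LHS]mulrA.
  rewrite tsumZ; last exact: asum_inv_l.
  rewrite hp mulrCA; congr (_ * _); rewrite -tsumZ; last exact: asum_inv_r.
  by apply: eq_tsum => k; rewrite mxcompZ explpZ evalCZ -[RHS]mulrA.
have jf : (j`!%:R : C) != 0 by rewrite pnatr_eq0 -lt0n fact_gt0.
rewrite (eq_tsum (g := fun k => j`!%:R * (gl k * herm (dot b (zr k + g)) (c'%:C * bf (toC K) b b) j))); last first.
  by move=> k; rewrite evalC_explp_lformX -[LHS]mulrA [_ * gl k]mulrC.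
rewrite tsumZ_neq0//.
set b' := b *m B^T.
have lE m : dot b' (zr m *m Qi) = - 'i * bf (invmx A) (zr m) b.
  by rewrite /b' dot_mulmx trmxK -mulmxA QB -scalemxAr dotZr bf_mul dotC.
have aL (s : C) : asum (fun k => gl k * cexp (s * dot b (zr k + g))).
  have := asumZ (cexp (- (piC * bf A g g) + s * dot b g)) (asum_theta (- (2 * piC) *: (g *m A) + s *: b) sA pA).
  apply: asum_le => k; rewrite /gl -!cexpD le_eqVlt; apply/orP; left; apply/eqP.
  congr (cabs (cexp _)).
  rewrite dotDl !dotZl -bf_mul !(bfDl, bfDr) (bf_sym (zr k) g sA) dotDr.
  by move: (bf _ _ _) (bf _ _ _) (bf _ _ _) (dot _ _) (dot _ _) => u v w x y; ring.
have aR (s : C) : asum (fun m => gr m * cexp (s * dot b' (zr m *m Qi))).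
  have := asum_theta (2 * piC * 'i *: g + s *: (b' *m Qi^T)) (invmx_sym sA) (posQ_inv sA pA).
  apply: asum_le => m; rewrite /gr -!cexpD le_eqVlt; apply/orP; left; apply/eqP.
  congr (cabs (cexp _)); rewrite dotDl !dotZl -addrA; congr (_ + (_ + _ * _)).
  by rewrite dotC dot_mulmx dotC.
have C0 : invsqrt_det A != 0.
  by have := invsqrt_det_sqr sA pA; apply: contra_eq_neq => ->; rewrite expr0n mul0r eq_sym oner_eq0.
have aR' (s : C) : asum (fun m => (invsqrt_det A * gr m) * cexp (s * dot b' (zr m *m Qi))).
  by have := asumZ (invsqrt_det A) (aR s); apply: asum_le => m; rewrite -[(invsqrt_det A * _) * _]mulrA.
rewrite (hermite_extract (q' := c%:C * bf (toC K) b' b') aL aR'); last first.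
  move=> s.
  rewrite (eq_tsum (g := fun k => cexp (s ^+ 2 * (c'%:C * bf (toC K) b b)) * (gl k * cexp (dot (s *: b) (zr k + g))))); last first.
    by move=> k; rewrite cexpD dotZl mulrA mulrC.
  rewrite tsumZ_neq0 ?cexp_neq0// theta_char// mulrCA -!tsumZ_neq0 ?cexp_neq0//.
  apply: eq_tsum => m; rewrite -/(gr m) -mulrA; congr (_ * _); rewrite mulrCA; congr (_ * _).
  rewrite -cexpD; congr cexp; rewrite lE -KB !(bfZl, bfZr).
  by move: (bf _ _ _) (bf _ _ _) (bf _ _ _) => u v w; ring.
rewrite -!tsumZ_neq0//; apply: eq_tsum => m.
rewrite mxcompX mxcomp_lform -/b' evalC_explp_lformX.
by move: (herm _ _ _) => h; ring.
Qed.

End Inversion.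

(** * Theta functions of indefinite lattices *)

Section ToC.
Variable R : realType.
Local Notation C := R[i].

Lemma toCM m n k (A : 'M[R]_(m, n)) (B : 'M[R]_(n, k)) : toC (A *m B) = toC A *m toC B.
Proof. exact: map_mxM. Qed.
Lemma toCD m n (A B : 'M[R]_(m, n)) : toC (A + B) = toC A + toC B.
Proof. exact: map_mxD. Qed.
Lemma toCB m n (A B : 'M[R]_(m, n)) : toC (A - B) = toC A - toC B.
Proof. exact: map_mxB. Qed.
Lemma toC_tr m n (A : 'M[R]_(m, n)) : (toC A)^T = toC A^T.
Proof. exact: map_trmx. Qed.
Lemma toC1 n : toC (1%:M : 'M[R]_n) = 1%:M.
Proof. exact: map_mx1. Qed.
Lemma toC0 m n : toC (0 : 'M[R]_(m, n)) = 0.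
Proof. exact: map_mx0. Qed.
Lemma toC_inv n (A : 'M[R]_n) : toC (invmx A) = invmx (toC A).
Proof. exact: map_invmx. Qed.
Lemma bf_toC n (A : 'M[R]_n) x y : bf (toC A) (toC x) (toC y) = (bf A x y)%:C.
Proof. by rewrite /bf toC_tr -!toCM mxE. Qed.
Lemma dot_toC n (x y : 'rV[R]_n) : dot (toC x) (toC y) = (dot x y)%:C.
Proof. by rewrite /dot toC_tr -!toCM mxE. Qed.

End ToC.

Section Decomposition.
Variables (R : realType) (n : nat) (Q : 'M[R]_n) (v : decomp R n).
Hypotheses (sQ : Q^T = Q) (vP : Gr Q v).

Definition Pp : 'M[R]_n := lin1_mx (daddv_pi v.1 v.2).
Definition Pm : 'M[R]_n := lin1_mx (daddv_pi v.2 v.1).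

Lemma projpE x : projp v x = x *m Pp.
Proof. by rewrite mul_rV_lin1. Qed.
Lemma projmE x : projm v x = x *m Pm.
Proof. by rewrite mul_rV_lin1. Qed.

Lemma projp_in x : projp v x \in v.1. Proof. exact: memv_pi. Qed.
Lemma projm_in x : projm v x \in v.2. Proof. exact: memv_pi. Qed.

Lemma proj_add x : projp v x + projm v x = x.
Proof. by case: vP => h0 h1 _ _ _; apply: daddv_pi_add; rewrite ?h0 ?memvf. Qed.

Lemma mx_eqP m k (A B : 'M[R]_(m, k)) : (forall x : 'rV_m, x *m A = x *m B) -> A = B.
Proof. by move=> h; apply/row_matrixP => i; rewrite !rowE h. Qed.

Lemma mx_entry m k (A : 'M[R]_(m, k)) i j : A i j = ((delta_mx 0 i : 'rV_m) *m A *m (delta_mx 0 j : 'rV_k)^T) 0 0.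
Proof. by rewrite trmx_delta -rowE -colE !mxE. Qed.

Lemma PpPm_add : Pp + Pm = 1%:M.
Proof. by apply: mx_eqP => x; rewrite mulmxDr -projpE -projmE proj_add mulmx1. Qed.

Lemma PpPp : Pp *m Pp = Pp.
Proof.
apply: mx_eqP => x; rewrite mulmxA -!projpE; case: vP => _ h1 _ _ _.
exact: daddv_pi_proj.
Qed.

Lemma PmE : Pm = 1%:M - Pp. Proof. by rewrite -PpPm_add addrAC subrr add0r. Qed.
Lemma PpPm : Pp *m Pm = 0.
Proof. by rewrite PmE mulmxBr mulmx1 PpPp subrr. Qed.
Lemma PmPp : Pm *m Pp = 0.
Proof. by rewrite PmE mulmxBl mul1mx PpPp subrr. Qed.
Lemma PmPm : Pm *m Pm = Pm.
Proof. by rewrite {2}PmE mulmxBr mulmx1 PmPp subr0. Qed.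

Lemma PpQPm : Pp *m Q *m Pm^T = 0.
Proof.
case: vP => _ _ _ _ h; apply/matrixP => i j; rewrite [RHS]mxE.
have := h (projp v (delta_mx 0 i)) (projm v (delta_mx 0 j)) (projp_in _) (projm_in _).
by rewrite /form projpE projmE trmx_mul (mx_entry (Pp *m Q *m Pm^T)) !mulmxA.
Qed.

(** Orthogonality of v_+ and v_- makes the projection self-adjoint for Q. *)
Lemma PpQ_tr : Q *m Pp^T = Pp *m Q.
Proof.
have h : Pp *m Q = Pp *m Q *m Pp^T.
  by rewrite -[LHS]mulmx1 -trmx1 -PpPm_add linearD /= mulmxDr PpQPm addr0.
have := congr1 trmx h; rewrite !trmx_mul trmxK sQ mulmxA => ->.
by rewrite -h.
Qed.

Lemma PmQ_tr : Q *m Pm^T = Pm *m Q.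
Proof. by rewrite PmE linearB /= trmx1 mulmxBr mulmx1 PpQ_tr mulmxBl mul1mx. Qed.

Lemma majorantE : majorant Q v = (Pp - Pm) *m Q.
Proof.
have e (P : 'M[R]_n) i j : (P *m Q *m P^T) i j = form Q (delta_mx 0 i *m P) (delta_mx 0 j *m P).
  by rewrite /form trmx_mul (mx_entry (P *m Q *m P^T)) !mulmxA.
apply/matrixP => i j; rewrite mxE !projpE !projmE -!e.
by rewrite -!mulmxA PpQ_tr PmQ_tr !mulmxA PpPp PmPm mulmxBl !mxE.
Qed.

End Decomposition.

Section ThetaTerm.
Variables (R : realType) (n : nat) (Q : 'M[R]_n) (v : decomp R n).
Hypotheses (sQ : Q^T = Q) (uQ : Q \in unitmx) (vP : Gr Q v).
Local Notation C := R[i].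
Local Notation piC := ((pi : R)%:C).
Local Notation zr := (@zvec R _).
Local Notation Pp := (Pp v).
Local Notation Pm := (Pm v).
Implicit Types (t : C) (x : 'rV[R]_n).

Lemma form_projp x : form Q (projp v x) (projp v x) = bf (Pp *m Q) x x.
Proof.
by rewrite projpE /form /bf trmx_mul -!mulmxA (mulmxA Q) (PpQ_tr sQ vP) !mulmxA -(mulmxA x) (PpPp vP).
Qed.

Lemma form_projm x : form Q (projm v x) (projm v x) = bf (Pm *m Q) x x.
Proof.
by rewrite projmE /form /bf trmx_mul -!mulmxA (mulmxA Q) (PmQ_tr sQ vP) !mulmxA -(mulmxA x) (PmPm vP).
Qed.

Lemma form_split x : form Q x x = form Q (projp v x) (projp v x) + form Q (projm v x) (projm v x).
Proof. by rewrite form_projp form_projm -bf_mxD -mulmxDl (PpPm_add vP) mul1mx. Qed.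

Lemma majorant_pos x : x != 0 -> 0 < bf (Pp *m Q) x x - bf (Pm *m Q) x x.
Proof.
case: (vP) => _ _ hp hm _ x0; rewrite -form_projp -form_projm.
have [p0|p0] := eqVneq (projp v x) 0.
  have m0 : projm v x != 0 by apply: contra_neq x0 => m0; rewrite -(proj_add vP x) p0 m0 addr0.
  rewrite p0 {1}/form !mul0mx mxE sub0r oppr_gt0; apply: hm => //; exact: projm_in.
have h1 := hp _ (projp_in _ _) p0; rewrite ltr_wpDr// oppr_ge0.
have [->|m0] := eqVneq (projm v x) 0; first by rewrite /form !mul0mx mxE.
by apply/ltW/hm => //; exact: projm_in.
Qed.

(** Multiplication by t on v_+ and by its conjugate on v_-. It is multiplicative in t, which turns
    the inversion of t into an inversion of matrices. *)
Definition Wt t : 'M[C]_n := t *: toC Pp + conjc t *: toC Pm.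

Lemma WtM s t : Wt s *m Wt t = Wt (s * t).
Proof.
rewrite /Wt mulmxDl !mulmxDr -!scalemxAl -!scalemxAr -!toCM (PpPp vP) (PmPm vP) (PpPm vP) (PmPp vP).
by rewrite toC0 !scaler0 addr0 add0r !scalerA rmorphM.
Qed.

Lemma Wt1 : Wt 1 = 1%:M.
Proof. by rewrite /Wt rmorph1 !scale1r -toCD (PpPm_add vP) toC1. Qed.

Lemma WtN t : Wt (- t) = - Wt t.
Proof. by rewrite /Wt rmorphN !scaleNr opprD. Qed.

(** Normalised so that the exponential in [theta_term] becomes exp (- pi At (x, x)); its real part
    on real vectors is Im t times the majorant. *)
Definition At t : 'M[C]_n := - 'i *: (Wt t *m toC Q).

Lemma At_sym t : (At t)^T = At t.
Proof.
rewrite /At linearZ /= trmx_mul toC_tr sQ; congr (_ *: _).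
rewrite /Wt linearD /= !linearZ /= !toC_tr mulmxDr mulmxDl -!scalemxAr -!scalemxAl -!toCM.
by rewrite (PpQ_tr sQ vP) (PmQ_tr sQ vP).
Qed.

Lemma bf_At t x y : bf (At t) (toC x) (toC y) =
  - 'i * (t * (bf (Pp *m Q) x y)%:C + conjc t * (bf (Pm *m Q) x y)%:C).
Proof.
by rewrite /At bf_mxZ /Wt mulmxDl -!scalemxAl bf_mxD !bf_mxZ -!toCM !bf_toC.
Qed.

Lemma At_pos t : 0 < complex.Im t -> posQ (At t).
Proof.
move=> t0 x x0; rewrite bf_At; have := majorant_pos x0.
move: (bf _ _ _) (bf _ _ _) => b a; case: t t0 => t1 t2 /= t0 ab.
rewrite [X in 0 < X](_ : _ = t2 * (a - b)); last by ring.
exact: mulr_gt0.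
Qed.

Lemma invmx_At t : t != 0 -> invmx (At (- t^-1)) = - 'i *: (toC (invmx Q) *m Wt t).
Proof.
move=> t0; have uC : toC Q \in unitmx by rewrite map_unitmx.
have e : At (- t^-1) *m (- 'i *: (toC (invmx Q) *m Wt t)) = 1%:M.
  rewrite /At -scalemxAl -scalemxAr scalerA -mulmxA (mulmxA (toC Q)) toC_inv mulmxV// mul1mx.
  by rewrite WtM (mulNr t^-1 t) (mulVf t0) WtN Wt1 scalerN mulrNN -expr2 sqr_i scaleN1r opprK.
have [u _] := mulmx1_unit e.
by rewrite -[LHS]mulmx1 -e mulmxA mulVmx// mul1mx.
Qed.

Lemma Im_oppV t : complex.Im (- t^-1) = complex.Im t / (complex.Re t ^+ 2 + complex.Im t ^+ 2).
Proof. by case: t => a b /=; rewrite opprK. Qed.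

Lemma theta_termE p t x : theta_term Q v p t x =
  evalC (explp (invmx (majorant Q v)) (- (8 * pi * complex.Im t)^-1) p) (toC x) *
  cexp (- (piC * bf (At t) (toC x) (toC x))).
Proof.
rewrite /theta_term pevalE; congr (_ * _); rewrite ebfE; congr cexp.
rewrite form_projp form_projm bf_At.
move: (bf _ _ _) (bf _ _ _) => b a.
have h (r : R) : (r / 2)%:C = r%:C / 2 :> C by rewrite natC -fmorphV -rmorphM.
rewrite !h.
by move: ('i : C) (piC) (a%:C) (b%:C) => i c x1 x2; field.
Qed.

End ThetaTerm.

(** * Inversion and the heat operator *)

Section HeatEquation.
Variables (R : realType) (n : nat) (Q : 'M[R]_n) (v : decomp R n).
Hypotheses (sQ : Q^T = Q) (uQ : Q \in unitmx) (vP : Gr Q v).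
Local Notation C := R[i].
Local Notation piC := ((pi : R)%:C).
Local Notation zr := (@zvec R _).
Local Notation Pp := (Pp v).
Local Notation Pm := (Pm v).
Local Notation Wt := (Wt v).
Local Notation At := (At Q v).
Local Notation K := (invmx (majorant Q v)).
Implicit Types (t : C) (x : 'rV[R]_n).

Lemma toC_majV : toC K = - 'i *: (toC (invmx Q) *m Wt 'i).
Proof.
have -> : Wt 'i = 'i *: toC (Pp - Pm).
  rewrite /Wt toCB scalerBr -scaleNr; congr (_ + _ *: _).
  by apply: complex_eq; rewrite /= ?oppr0.
rewrite -scalemxAr scalerA mulNr -expr2 sqr_i opprK scale1r -toCM; congr toC.
have e : majorant Q v *m (invmx Q *m (Pp - Pm)) = 1%:M.
  rewrite (majorantE sQ vP) -mulmxA mulmxA mulmxA mulmxK// mulmxBl !mulmxBr.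
  by rewrite (PpPp vP) (PpPm vP) (PmPp vP) (PmPm vP) subr0 sub0r opprK (PpPm_add vP).
have [u _] := mulmx1_unit e.
by rewrite -[LHS]mulmx1 -e mulmxA mulVmx// mul1mx.
Qed.

Lemma Wt_trQ t : (Wt t)^T *m toC (invmx Q) = toC (invmx Q) *m Wt t.
Proof.
have h (P : 'M[R]_n) : Q *m P^T = P *m Q -> P^T *m invmx Q = invmx Q *m P.
  by move=> e; rewrite -[P^T](mulKmx uQ) e mulmxA mulmxK.
rewrite /Wt linearD /= !linearZ /= !toC_tr mulmxDl mulmxDr -!scalemxAl -!scalemxAr -!toCM.
by rewrite (h _ (PpQ_tr sQ vP)) (h _ (PmQ_tr sQ vP)).
Qed.

(** Since Im (-1/t) = y / |t|^2, the left side is - (|t|^2 + 2 i t y) / (8 pi y), and the conjugate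
    of t plus 2 i y is t. *)
Lemma heat_coef t (y := complex.Im t) : 0 < y ->
  (- (8 * pi * complex.Im (- t^-1))^-1)%:C - 'i * t / (4 * piC) = (- (8 * pi * y)^-1)%:C * t ^+ 2.
Proof.
move=> y0; rewrite Im_oppV; case: t @y y0 => a b /= b0.
have p0 : (pi : R) != 0 by rewrite gt_eqF// pi_gt0.
have n0 : a ^+ 2 + b ^+ 2 != 0 by rewrite gt_eqF// ltr_wpDl ?sqr_ge0// exprn_gt0.
have b1 : b != 0 by rewrite gt_eqF.
have -> : (4 * piC)^-1 = ((4 * pi)^-1)%:C by rewrite natC -rmorphM -fmorphV.
rewrite (expr2 (a +i* b)); move: (pi : R) p0 => p p0.
apply: complex_eq; rewrite !(ReM, ImM, ReD, ImD, ReN, ImN) /=; field; by rewrite ?p0 ?n0 ?b1.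
Qed.

Lemma heat_coef_conj t (y := complex.Im t) : 0 < y ->
  (- (8 * pi * complex.Im (- t^-1))^-1)%:C + 'i * conjc t / (4 * piC) = (- (8 * pi * y)^-1)%:C * conjc t ^+ 2.
Proof.
move=> y0; rewrite Im_oppV; case: t @y y0 => a b /= b0.
have p0 : (pi : R) != 0 by rewrite gt_eqF// pi_gt0.
have n0 : a ^+ 2 + b ^+ 2 != 0 by rewrite gt_eqF// ltr_wpDl ?sqr_ge0// exprn_gt0.
have b1 : b != 0 by rewrite gt_eqF.
have -> : (4 * piC)^-1 = ((4 * pi)^-1)%:C by rewrite natC -rmorphM -fmorphV.
rewrite (expr2 (a +i* - b)); move: (pi : R) p0 => p p0.
apply: complex_eq; rewrite !(ReM, ImM, ReD, ImD, ReN, ImN) /=; field; by rewrite ?p0 ?n0 ?b1.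
Qed.

Lemma im_neq0 t : 0 < complex.Im t -> t != 0.
Proof. by apply: contraTneq => ->; rewrite /= ltxx. Qed.

(** On v_+ and v_- this reduces to the two scalar identities above. It supplies the condition [KB]
    of [poly_inversion] and accounts for the coefficient - 1 / (8 pi y) in the theta function. *)
Lemma heat_eq t (y := complex.Im t) b : 0 < y ->
  (- (8 * pi * complex.Im (- t^-1))^-1)%:C * bf (toC K) b b + bf (invmx (At (- t^-1))) b b / (4 * piC) =
  (- (8 * pi * y)^-1)%:C * bf (toC K) (b *m (- Wt t)^T) (b *m (- Wt t)^T).
Proof.
move=> y0; have t0 := im_neq0 y0.
have e s : bf (toC (invmx Q) *m Wt s) b b =
    s * bf (toC (invmx Q) *m toC Pp) b b + conjc s * bf (toC (invmx Q) *m toC Pm) b b.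
  by rewrite {1}/Wt mulmxDr -!scalemxAr bf_mxD !bf_mxZ.
have -> : bf (toC K) (b *m (- Wt t)^T) (b *m (- Wt t)^T) =
    - 'i * bf (toC (invmx Q) *m Wt (t * 'i * t)) b b.
  rewrite -bf_mxZ /bf trmx_mul trmxK linearN /= mulmxN mulNmx; congr (fun_of_matrix _ 0 0).
  rewrite !mulNmx mulmxN opprK !mulmxA; congr (_ *m _).
  rewrite -(mulmxA b) -!(mulmxA b); congr (b *m _).
  rewrite toC_majV -!scalemxAr -!scalemxAl; congr (_ *: _).
  by rewrite mulmxA (Wt_trQ t) -!mulmxA (WtM vP) (WtM vP) mulrA.
rewrite (invmx_At uQ vP t0) toC_majV !bf_mxZ !e.
have isq := sqr_i R.
have ci : ('i%C : C)^*%C = - 'i by apply: complex_eq; rewrite /= ?oppr0.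
have h1 := heat_coef y0; have h2 := heat_coef_conj y0; rewrite -/y in h1 h2 *.
have cM (a d : C) : (a * d)^*%C = a^*%C * d^*%C.
  by apply: complex_eq; case: a => ? ?; case: d => ? ?; rewrite /= ?(ReM, ImM) /=; ring.
have gen1 (i z : C) : i^*%C = - i -> (z * i * z)^*%C = - i * z^*%C ^+ 2.
  by move=> ie; rewrite !cM ie; ring.
have gen2 (i i1 i2 i3 i4 i5 i6 c' c z zb k u w ze : C) : i ^+ 2 = -1 -> c' - i * z / k = c * z ^+ 2 ->
    c' + i * zb / k = c * zb ^+ 2 -> i1 = i -> i2 = i -> i3 = - i -> i4 = i -> i5 = i -> i6 = i ->
    ze = - i * zb ^+ 2 ->
    c' * (- i1 * (i2 * u + i3 * w)) + (- i4 * (z * u + zb * w)) / k =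
    c * (- i5 * ((z * i6 * z) * u + ze * w)).
  move=> ii e1 e2 -> -> -> -> -> -> ->.
  transitivity (u * (- i ^+ 2 * c' - i * z / k) - w * (- i ^+ 2 * c' + i * zb / k)); first ring.
  rewrite ii opprK !mul1r e1 e2.
  transitivity (- i ^+ 2 * (u * (c * z ^+ 2) - w * (c * zb ^+ 2))); last ring.
  by rewrite ii; ring.
exact: (gen2 'i _ _ _ _ _ _ _ _ _ _ _ _ _ _ isq h1 h2 erefl erefl ci erefl erefl erefl (gen1 _ _ ci)).
Qed.

End HeatEquation.

Section ThetaCoset.
Variables (R : realType) (n : nat) (Q : 'M[R]_n) (v : decomp R n).
Hypotheses (sQ : Q^T = Q) (uQ : Q \in unitmx) (vP : Gr Q v).
Local Notation C := R[i].
Local Notation piC := ((pi : R)%:C).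
Local Notation zr := (@zvec R _).
Local Notation Pp := (Pp v).
Local Notation Pm := (Pm v).
Local Notation Wt := (Wt v).
Local Notation At := (At Q v).
Local Notation K := (invmx (majorant Q v)).
Implicit Types (t : C) (x : 'rV[R]_n).

(** The point where homogeneity enters: the substitution left by inversion acts on p by a scalar. *)
Lemma mxcomp_homog mp mm p t : homogeneous v mp mm p ->
  mxcomp (Wt t) p = (t ^+ mp * t^*%C ^+ mm) *: p.
Proof.
move=> hom; apply: peval_inj => x; rewrite !pevalE evalCZ evalC_mxcomp.
rewrite -(homog_complex hom x t t^*%C); congr (evalC p _).
by rewrite projpE projmE !toCM mulmxDr -!scalemxAr.
Qed.

Lemma bf_congr (A P : 'M[C]_n) z : bf A (z *m P) (z *m P) = bf (P *m A *m P^T) z z.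
Proof. by rewrite /bf (trmx_mul z P) !(mulmxA z) !mulmxA. Qed.

Lemma zr_toC (k : 'rV[int]_n) x : zr k + toC x = toC (map_mx intr k + x).
Proof. by rewrite toCD zrE. Qed.

Lemma At_inv_sub t (m : 'rV[int]_n) : t != 0 ->
  bf (invmx (At (- t^-1))) (zr m) (zr m) =
  bf (At t) (toC (map_mx intr m *m invmx Q)) (toC (map_mx intr m *m invmx Q)).
Proof.
move=> t0; rewrite (invmx_At uQ vP t0) toCM -zrE.
rewrite /At (bf_mxZ _ (toC (invmx Q) *m Wt t)) (bf_mxZ _ (Wt t *m toC Q)).
rewrite (bf_congr (Wt t *m toC Q) (toC (invmx Q)) (zr m)).
have uC : toC Q \in unitmx by rewrite map_unitmx.
have e : toC (invmx Q) *m (Wt t *m toC Q) *m (toC (invmx Q))^T = toC (invmx Q) *m Wt t.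
  rewrite (toC_tr (invmx Q)) (invmx_sym sQ) -(mulmxA (toC (invmx Q))).
  by rewrite [in X in _ *m X](toC_inv Q) (mulmxK uC).
by rewrite e.
Qed.

Lemma asum_theta_term t p (g : 'rV[R]_n) : 0 < complex.Im t ->
  asum (fun k : 'rV[int]_n => theta_term Q v p t (map_mx intr k + g)).
Proof.
move=> t0; have := asum_inv_l (toC g) (At_sym sQ vP t) (At_pos sQ vP t0)
  (explp K (- (8 * pi * complex.Im t)^-1) p).
by apply: asum_le => k; rewrite zr_toC theta_termE.
Qed.

(** An instance of [poly_inversion] at the matrix of -1/t, with Qi = - Q^-1 and B = Wt t. The
    vectors m Q^-1 run through the dual lattice when Q is a Gram matrix. *)
Lemma theta_coset mp mm p t (g : 'rV[R]_n) : 0 < complex.Im t -> homogeneous v mp mm p ->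
  tsum (fun k : 'rV[int]_n => theta_term Q v p (- t^-1) (map_mx intr k + g)) =
  invsqrt_det (At (- t^-1)) * (t ^+ mp * t^*%C ^+ mm) *
  tsum (fun m : 'rV[int]_n => theta_term Q v p t (map_mx intr m *m invmx Q) *
     ebf (- dot (map_mx intr m) g)%:C).
Proof.
move=> t0 hom; have tn0 := im_neq0 t0.
have t'0 : 0 < complex.Im (- t^-1).
  by rewrite Im_oppV divr_gt0// ltr_wpDl ?sqr_ge0// exprn_gt0.
have QB : (- toC (invmx Q)) *m Wt t = - 'i *: invmx (At (- t^-1)).
  by rewrite (invmx_At uQ vP tn0) scalerA mulrNN -expr2 sqr_i scaleN1r mulNmx.
have KB (b : 'rV[C]_n) : (- (8 * pi * complex.Im (- t^-1))^-1)%:C * bf (toC K) b b +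
    bf (invmx (At (- t^-1))) b b / (4 * piC) =
  (- (8 * pi * complex.Im t)^-1)%:C * bf (toC K) (b *m (Wt t)^T) (b *m (Wt t)^T).
  rewrite (heat_eq sQ uQ vP b t0) linearN /= (mulmxN b).
  by rewrite (bfNl (toC K)) (bfNr (toC K)) opprK.
have := poly_inversion (toC g) (At_sym sQ vP _) (At_pos sQ vP t'0) QB KB p.
rewrite (mxcomp_homog _ hom) => E.
pose T (m : 'rV[int]_n) := theta_term Q v p t (map_mx intr m *m invmx Q) * ebf (- dot (map_mx intr m) g)%:C.
(* The sign in Qi produces a sum over - m; reflecting the index restores m. *)
have TN : tsum (fun m => T (- m)) = tsum T.
  have aT : asum T.
    have := asum_inv_r (toC (invmx Q)) (toC (- g)) (At_sym sQ vP (- t^-1)) (At_pos sQ vP t'0)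
      (explp K (- (8 * pi * complex.Im t)^-1) p).
    apply: asum_le => m; rewrite le_eqVlt; apply/orP; left; apply/eqP; congr cabs.
    rewrite /T theta_termE// At_inv_sub// cexpD ebfE zrE -toCM -mulrA; congr (_ * (_ * cexp _)).
    have -> : - dot (map_mx intr m) g = dot (- g) (map_mx intr m) :> R by rewrite dotNl dotC.
    by rewrite -dot_toC.
  have hi : injective (fun m : 'rV[int]_n => - m) by exact: oppr_inj.
  rewrite [RHS](tsum_reindex hi)// => x h.
  by case: (h (- x)); rewrite opprK.
transitivity (invsqrt_det (At (- t^-1)) * tsum (fun m : 'rV[int]_n => (t ^+ mp * t^*%C ^+ mm) * T (- m))).
  apply: etrans (etrans E _).
    by apply: eq_tsum => k; rewrite zr_toC theta_termE.
  congr (_ * _); apply: eq_tsum => m.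
  have mN : map_mx intr (- m) = - map_mx intr m :> 'rV[R]_n by rewrite map_mxN.
  rewrite /T theta_termE// explpZ evalCZ -At_inv_sub// mN.
  have -> : zr m *m - toC (invmx Q) = toC (- map_mx intr m *m invmx Q).
    by rewrite zrE toCM mulmxN /toC map_mxN mulNmx.
  have -> : zr (- m) = - zr m by rewrite /zvec map_mxN.
  rewrite (bfNl (invmx _)) (bfNr (invmx _)) opprK dotNl opprK cexpD ebfE (dotC (map_mx intr m) g).
  rewrite -dot_toC -zrE.
  move: (evalC _ _ : C) (cexp _ : C) (cexp _ : C) (t ^+ mp * _) => a b c d; ring.
rewrite -mulrA -TN; congr (_ * _); apply: tsumZ_neq0.
by apply: mulf_neq0; apply: expf_neq0; [exact: tn0|by rewrite conjc_eq0].
Qed.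

End ThetaCoset.

(** * The multiplier of the inversion law *)

Section Determinant.
Variable F : fieldType.

Lemma det_1mx_mulC n r (L : 'M[F]_(n, r)) (M : 'M[F]_(r, n)) :
  \det (1%:M + L *m M) = \det (1%:M + M *m L).
Proof.
have e1 : block_mx 1%:M 0 (- M) 1%:M *m block_mx 1%:M (- L) M 1%:M =
    block_mx 1%:M (- L) 0 (1%:M + M *m L).
  rewrite mulmx_block !mul1mx !mul0mx !addr0 mulmx1 addNr mulNmx mulmxN opprK.
  by rewrite [X in block_mx _ _ _ X]addrC.
have e2 : block_mx 1%:M (- L) M 1%:M *m block_mx 1%:M 0 (- M) 1%:M =
    block_mx (1%:M + L *m M) (- L) 0 1%:M.
  by rewrite mulmx_block !mul1mx !mulmx1 !mulmx0 !add0r mulNmx mulmxN opprK subrr.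
have := congr1 determinant e1; rewrite det_mulmx mulrC -det_mulmx e2 !det_ublock !det1.
by rewrite mulr1 mul1r.
Qed.

(** A rank factorisation P = L M of an idempotent has M L = 1, and det (1 + L M) = det (1 + M L)
    reduces the determinant to that of a scalar matrix of size the rank of P. *)
Lemma det_idem n (P : 'M[F]_n) (a b : F) : P *m P = P -> b != 0 ->
  \det (a *: P + b *: (1%:M - P)) = a ^+ \rank P * b ^+ (n - \rank P).
Proof.
move=> PP b0.
have [L [M [pL [pM [PE fL fM]]]]] : exists (L : 'M[F]_(n, \rank P)) (M : 'M[F]_(\rank P, n)) pL pM,
    [/\ P = L *m M, pL *m L = 1%:M & M *m pM = 1%:M].
  exists (col_base P), (row_base P), (pinvmx (col_base P)), (pinvmx (row_base P)); split.
  - by rewrite mulmx_base.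
  - exact: mulVpmx (col_base_full P).
  - exact: mulmxVp (row_base_free P).
have ML : M *m L = 1%:M.
  have h : L *m (M *m L) *m M = L *m M by rewrite mulmxA -mulmxA -PE.
  have e1 : pL *m (L *m (M *m L) *m M) *m pM = M *m L.
    by rewrite !mulmxA fL mul1mx -mulmxA fM mulmx1.
  by rewrite -e1 h mulmxA fL mul1mx fM.
have -> : a *: P + b *: (1%:M - P) = b *: (1%:M + ((a - b) / b) *: (L *m M)).
  rewrite -PE [RHS]scalerDr scalerA mulrC divfK// scalerBl scalerBr.
  by rewrite addrC -!addrA; congr (_ + _); rewrite addrC.
rewrite detZ scalemxAl det_1mx_mulC -scalemxAr ML -[X in X + _]scale1r -scalerDl detZ det1 mulr1.
have -> : 1 + (a - b) / b = a / b by field.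
by rewrite expr_div_n -{1}(subnK (rank_leq_row P)) exprD -mulrA [_ * (_ / _)]mulrCA mulfV ?mulr1 1?mulrC// expf_neq0.
Qed.

End Determinant.

Section ThetaConstant.
Variables (R : realType) (n : nat) (Q : 'M[R]_n) (v : decomp R n).
Hypotheses (sQ : Q^T = Q) (uQ : Q \in unitmx) (vP : Gr Q v).
Local Notation C := R[i].
Local Notation r := (\rank (Pp v)).
Local Notation At := (At Q v).
Implicit Types (t : C).

Lemma conjcM (a d : C) : (a * d)^*%C = a^*%C * d^*%C.
Proof. by apply: complex_eq; case: a => ? ?; case: d => ? ?; rewrite /= ?(ReM, ImM) /=; ring. Qed.

Lemma conjc_eq0' (a : C) : (a^*%C == 0) = (a == 0).
Proof. by rewrite -!cabs_eq0 cabs_conj. Qed.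

Lemma conjcX (a : C) k : (a ^+ k)^*%C = a^*%C ^+ k.
Proof.
elim: k => [|k IH]; first by rewrite !expr0; apply: complex_eq; rewrite /= ?oppr0.
by rewrite !exprS conjcM IH.
Qed.

Lemma det_Wt t : t != 0 -> \det (Wt v t) = t ^+ r * t^*%C ^+ (n - r).
Proof.
move=> t0; have PP : toC (Pp v) *m toC (Pp v) = toC (Pp v) by rewrite -toCM (PpPp vP).
have cn : t^*%C != 0 by rewrite conjc_eq0'.
have := det_idem t PP cn; rewrite mxrank_map => <-; congr (\det (_ + _ *: _)).
by rewrite (PmE vP) toCB toC1.
Qed.

Lemma Re_mulNi t : complex.Re (- 'i * t) = complex.Im t.
Proof. by case: t => a b; rewrite ReM /=; ring. Qed.

Lemma ccont_conj (f : R -> C) : ccont f -> ccont (fun s => (f s)^*%C).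
Proof.
move=> hf s e e0; have [d d0 h] := hf s e e0; exists d => // t /h.
have -> : (f t)^*%C - (f s)^*%C = (f t - f s)^*%C by case: (f t) (f s) => ? ? [? ?]; apply: complex_eq; rewrite /= ?opprD ?opprK.
by rewrite cabs_conj.
Qed.

Lemma upper_oppV t : 0 < complex.Im t -> 0 < complex.Im (- t^-1).
Proof. by move=> t0; rewrite Im_oppV divr_gt0// ltr_wpDl ?sqr_ge0// exprn_gt0. Qed.

Lemma invsqrt_det_neq0 (A : 'M[C]_n) : A^T = A -> posQ A -> invsqrt_det A != 0.
Proof. by move=> sA pA; have := invsqrt_det_sqr sA pA; apply: contra_eq_neq => ->; rewrite expr0n mul0r eq_sym oner_eq0. Qed.

Lemma det_At t : t != 0 -> \det (At t) = (- 'i) ^+ n * (t ^+ r * t^*%C ^+ (n - r)) * \det (toC Q).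
Proof. by move=> t0; rewrite /At detZ det_mulmx (det_Wt t0) mulrA. Qed.

Lemma conj_oppV t : (- t^-1)^*%C = - (t^*%C)^-1.
Proof.
have [->|t0] := eqVneq t 0; first by apply: complex_eq; rewrite /= !(mulr0, mul0r, oppr0, expr0n).
have h : t^*%C * (- t^-1)^*%C = -1.
  rewrite -conjcM mulrN mulfV//; apply: complex_eq; rewrite /= ?oppr0//.
have cn : t^*%C != 0 by rewrite conjc_eq0'.
by apply: (mulfI cn); rewrite h mulrN mulfV.
Qed.

Lemma sqr_inv (c d : C) : c ^+ 2 * d = 1 -> d != 0 /\ c ^+ 2 = d^-1.
Proof.
move=> h; have d0 : d != 0 by apply: contra_eq_neq h => ->; rewrite mulr0 eq_sym oner_eq0.
by split=> //; apply: (mulIf d0); rewrite h mulVf.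
Qed.

Lemma i_upper : 0 < complex.Im ('i%C : C).
Proof. exact: ltr01. Qed.

(** Both sides are computed from determinants, where the branch of the square root is invisible. The
    sign is settled in [invsqrt_det_At]. *)
Lemma invsqrt_det_ratio_sqr t : 0 < complex.Im t ->
  invsqrt_det (At (- t^-1)) ^+ 2 =
  (invsqrt_det (At 'i%C) * (sqrtc (- 'i * t) ^+ r * (sqrtc (- 'i * t))^*%C ^+ (n - r))) ^+ 2.
Proof.
move=> t0; have tn := im_neq0 t0; have t'0 := upper_oppV t0; have t'n := im_neq0 t'0.
have e1 := invsqrt_det_sqr (At_sym sQ vP (- t^-1)) (At_pos sQ vP t'0).
have e2 := invsqrt_det_sqr (At_sym sQ vP 'i%C) (At_pos sQ vP i_upper).
have i0 : ('i%C : C) != 0 := im_neq0 i_upper.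
have := sqr_inv e2; have := sqr_inv e1.
have : \det (At 'i%C) = \det (At (- t^-1)) *
    ((- 'i * t) ^+ r * (- 'i * t)^*%C ^+ (n - r)).
  rewrite (det_At i0) (det_At t'n) conj_oppV.
  have -> : (- 'i * t)^*%C = 'i * t^*%C.
    by rewrite conjcM; congr (_ * _); apply: complex_eq; rewrite /= ?oppr0 ?opprK.
  have -> : ('i%C : C)^*%C = - 'i by apply: complex_eq; rewrite /= ?oppr0.
  have tc0 : t^*%C != 0 by rewrite conjc_eq0'.
  move: (\det _) => dQ.
  transitivity ((- 'i) ^+ n * ((- t^-1 * (- 'i * t)) ^+ r * (- t^*%C^-1 * ('i * t^*%C)) ^+ (n - r)) * dQ).
    have g1 (i z u : C) : z * u = 1 -> - z * (- i * u) = i.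
      by move=> h; transitivity (i * (z * u)); [ring|rewrite h mulr1].
    have g2 (i z u : C) : z * u = 1 -> - z * (i * u) = - i.
      by move=> h; transitivity (- i * (z * u)); [ring|rewrite h mulr1].
    by rewrite (g1 _ _ _ (mulVf tn)) (g2 _ _ _ (mulVf tc0)).
  rewrite !(exprMn _ (- t^-1)) !(exprMn _ (- t^*%C^-1)).
  move: ((- 'i) ^+ n) ((- t^-1) ^+ r) ((- 'i * t) ^+ r) ((- t^*%C^-1) ^+ _) (('i * t^*%C) ^+ _) => a b c d e.
  ring.
clear e1 e2; move: (\det (At 'i%C)) (\det (At (- t^-1))) (invsqrt_det (At 'i%C)) (invsqrt_det (At (- t^-1))) => D2 D1 c2 c1.
set W := (_ ^+ r * _) => e [d1 ->] [d2 h2].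
rewrite exprMn h2 e (_ : (_ * _) ^+ 2 = W); last first.
  by rewrite exprMn -!exprM !(mulnC _ 2) !exprM -conjcX sqr_sqrtc.
have W0 : W != 0 by apply: contraNneq d2 => W0; rewrite e W0 mulr0.
by rewrite invfM -mulrA mulVf ?mulr1.
Qed.

Lemma At_i_real i j : complex.Im (At 'i%C i j) = 0.
Proof.
have -> : At 'i%C = toC ((Pp v - Pm v) *m Q).
  rewrite /At toCM scalemxAl; congr (_ *m _); rewrite /Wt.
  have -> : ('i%C : C)^*%C = - 'i by apply: complex_eq; rewrite /= ?oppr0.
  rewrite scalerDr !scalerA toCB; congr (_ + _).
    by rewrite mulNr -expr2 sqr_i opprK scale1r.
  by rewrite mulrNN -expr2 sqr_i scaleN1r.
by rewrite mxE.
Qed.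

End ThetaConstant.

Section ThetaConstantValue.
Variables (R : realType) (n : nat) (Q : 'M[R]_n) (v : decomp R n).
Hypotheses (sQ : Q^T = Q) (uQ : Q \in unitmx) (vP : Gr Q v).
Local Notation C := R[i].
Local Notation r := (\rank (Pp v)).
Local Notation At := (At Q v).
Implicit Types (t : C).

Lemma invsqrt_det_At t : 0 < complex.Im t -> invsqrt_det (At (- t^-1)) =
  invsqrt_det (At 'i%C) * (sqrtc (- 'i * t) ^+ r * (sqrtc (- 'i * t))^*%C ^+ (n - r)).
Proof.
(* A path from i to t whose imaginary part (1 - s)^2 + s^2 Im t is positive for every real s, not
   only on [0, 1], since [ccont] and [sqr1_path_const] quantify over the whole line. *)
move=> t0; pose tt (s : R) : C := (s * complex.Re t) +i* ((1 - s) ^+ 2 + s ^+ 2 * complex.Im t).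
have ttE s : tt s = s%:C * (complex.Re t)%:C + 'i * ((1 - s%:C) ^+ 2 + s%:C ^+ 2 * (complex.Im t)%:C).
  apply: complex_eq; rewrite /tt !expr2 !(ReM, ImM, ReD, ImD, ReN, ImN) /=; ring.
have tt0 s : 0 < complex.Im (tt s).
  rewrite /tt /=; have [->|s0] := eqVneq s 0; first by rewrite subr0 expr1n expr0n mul0r addr0.
  by rewrite ltr_wpDl ?sqr_ge0// mulr_gt0// exprn_even_gt0.
have ctt : ccont tt.
  rewrite (_ : tt = fun s => s%:C * (complex.Re t)%:C + 'i * ((1 + (-1) * s%:C) ^+ 2 + s%:C ^+ 2 * (complex.Im t)%:C)).
    have c0 : ccont (fun s => (-1) * s%:C : C).
      by apply: (@ccontM R (fun=> -1) (fun s => s%:C)); [exact: ccont_cst|exact: ccont_id].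
    have c1 : ccont (fun s => 1 + (-1) * s%:C : C).
      by apply: (@ccontD R (fun=> 1) (fun s => (-1) * s%:C)) => //; exact: ccont_cst.
    have c2 : ccont (fun s => s%:C ^+ 2 * (complex.Im t)%:C).
      apply: (@ccontM R (fun s => s%:C ^+ 2)); last exact: ccont_cst.
      by apply: (@ccontX R (fun s => s%:C) 2); exact: ccont_id.
    have c3 : ccont (fun s => (1 + (-1) * s%:C) ^+ 2 + s%:C ^+ 2 * (complex.Im t)%:C).
      apply: (@ccontD R (fun s => (1 + (-1) * s%:C) ^+ 2)) => //.
      by apply: (@ccontX R (fun s => 1 + (-1) * s%:C) 2).
    apply: (@ccontD R (fun s => s%:C * (complex.Re t)%:C)).
      by apply: (@ccontM R (fun s => s%:C)); [exact: ccont_id|exact: ccont_cst].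
    by apply: (@ccontM R (fun=> 'i)) => //; exact: ccont_cst.
  by apply/funext => s; rewrite ttE mulN1r.
have ttn s := im_neq0 (tt0 s).
pose w s := sqrtc (- 'i * tt s).
have wre s : 0 < complex.Re (w s) by apply: sqrtc_re_gt0; rewrite Re_mulNi.
have w0 s : w s != 0 by apply: contraTneq (wre s) => ->; rewrite ltxx.
have cw : ccont w by apply: ccont_sqrtc => //; apply: ccontM => //; exact: ccont_cst.
pose den s := invsqrt_det (At 'i%C) * (w s ^+ r * (w s)^*%C ^+ (n - r)).
have ci : invsqrt_det (At 'i%C) != 0.
  by apply: invsqrt_det_neq0; [exact: At_sym|exact: (At_pos sQ vP (i_upper R))].
have den0 s : den s != 0.
  by rewrite /den !mulf_neq0// expf_neq0// conjc_eq0'.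
have cden : ccont den.
  apply: ccontM; first exact: ccont_cst.
  by apply: ccontM; apply: ccontX => //; apply: ccont_conj.
pose f s := invsqrt_det (At (- (tt s)^-1)) * (den s)^-1.
have f1 : f 1 = 1.
  apply: sqr1_path_const.
  - apply: ccontM; last exact: ccontV.
    apply: ccont_invsqrt_det => [i j|s|s]; [|exact: At_sym|exact: (At_pos sQ vP (upper_oppV (tt0 s)))].
    have cu : ccont (fun s => - (tt s)^-1).
      rewrite (_ : (fun s => _) = fun s => (-1) * (tt s)^-1); last by apply/funext => s; rewrite mulN1r.
      by apply: (@ccontM R (fun=> -1)); [exact: ccont_cst|exact: ccontV].
    have cv := ccont_conj cu.
    rewrite (_ : (fun s => _) = fun s => (- 'i) * (- (tt s)^-1 * (toC (Pp v *m Q)) i j + (- (tt s)^-1)^*%C * (toC (Pm v *m Q)) i j)).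
      apply: (@ccontM R (fun=> - 'i)); first exact: ccont_cst.
      apply: (@ccontD R (fun s => - (tt s)^-1 * (toC (Pp v *m Q)) i j)).
        by apply: (@ccontM R (fun s => - (tt s)^-1)) => //; exact: ccont_cst.
      by apply: (@ccontM R (fun s => (- (tt s)^-1)^*%C)) => //; exact: ccont_cst.
    by apply/funext => s; rewrite /At /Wt mulmxDl -!scalemxAl -!toCM !mxE.
  - move=> s; rewrite /f exprMn exprVn (invsqrt_det_ratio_sqr sQ vP (tt0 s)) -/(w s) -/(den s) mulfV//.
    by rewrite expf_neq0.
  have e0 : tt 0 = 'i%C by apply: complex_eq; rewrite /tt /= ?mul0r// subr0 expr1n expr0n mul0r addr0.
  have ei : - ('i%C : C)^-1 = 'i%C by apply: complex_eq; rewrite /= ?oppr0 ?opprK ?(expr0n, expr1n, add0r, divr1, mul0r, oppr0).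
  have ew : w 0 = 1.
    rewrite /w e0 (_ : - 'i * 'i%C = 1) ?sqrtc1//.
    by apply: complex_eq; rewrite !(ReM, ImM) /=; ring.
  have c1 : (1 : C)^*%C = 1 by apply: complex_eq; rewrite /= ?oppr0.
  by rewrite /f e0 ei /den ew c1 !expr1n !mulr1 mulfV.
have e1 : tt 1 = t by rewrite /tt; case: (t) => a b /=; rewrite !mul1r subrr expr0n expr1n add0r mul1r.
have e2 : invsqrt_det (At (- (tt 1)^-1)) = den 1.
  have := congr1 (fun z => z * den 1) f1; rewrite mul1r => <-.
  by rewrite /f -mulrA mulVf ?mulr1.
by move: e2; rewrite /den /w e1.
Qed.

End ThetaConstantValue.

(** * Eighth roots of unity and powers of y *)

Section EighthRoot.
Variable R : realType.
Local Notation C := R[i].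
Implicit Types t : C.

Lemma sqr_inj_Re (a b : C) : a ^+ 2 = b ^+ 2 -> 0 < complex.Re a -> 0 < complex.Re b -> a = b.
Proof.
move=> /eqP; rewrite eqf_sqr => /orP[/eqP//|/eqP ->]; rewrite ReN oppr_gt0 => h1 h2.
by have := lt_trans h1 h2; rewrite ltxx.
Qed.

Definition zeta8 : C := ebf (- 8^-1 : R)%:C.

Lemma zeta8_cos : zeta8 = cos (pi / 4) +i* - sin (pi / 4) :> C.
Proof.
rewrite /zeta8 ebf_realE.
have -> : 2 * pi * - 8^-1 = - (pi / 4) :> R by field.
by rewrite cosN sinN.
Qed.

Lemma sqr_zeta8 : zeta8 ^+ 2 = - 'i :> C.
Proof.
rewrite /zeta8 expr2 -ebfD -rmorphD /= ebf_realE.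
have -> : 2 * pi * (- 8^-1 - 8^-1) = - (pi / 2) :> R by field.
by rewrite cosN sinN cos_pihalf sin_pihalf; apply: complex_eq; rewrite /= ?oppr0.
Qed.

Lemma sqrtc_upper t : 0 < complex.Im t ->
  0 < complex.Re (sqrtc t) /\ 0 < complex.Im (sqrtc t).
Proof.
move=> t0; have := Re_sqrtc_ge0 t; have := sqr_sqrtc t; set s := sqrtc t.
case: s => a b /= e a0; move: t0; rewrite -e expr2 ImM /= => h.
have ab : 0 < a * b by lra.
have a1 : 0 < a by rewrite lt_neqAle a0 andbT; apply: contraTneq ab => <-; rewrite mul0r ltxx.
by split=> //; rewrite -(pmulr_rgt0 _ a1).
Qed.

(** Both sides are square roots of - i t with positive real part. The determinant yields sqrt (- i
    t) and the metaplectic group uses sqrt t; their ratio is the source of the eighth root of unity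
    in the Weil representation. *)
Lemma sqrtc_mi t : 0 < complex.Im t -> sqrtc (- 'i * t) = zeta8 * sqrtc t.
Proof.
move=> t0; apply: sqr_inj_Re; first by rewrite exprMn sqr_zeta8 !sqr_sqrtc.
  by apply: sqrtc_re_gt0; rewrite Re_mulNi.
have [h1 h2] := sqrtc_upper t0; rewrite ReM zeta8_cos.
have p4 : 0 < (pi : R) / 4 by rewrite divr_gt0// pi_gt0.
have c0 : 0 < cos (pi / 4 : R).
  by apply: cos_gt0_pihalf; rewrite (lt_trans _ p4) ?oppr_lt0 ?divr_gt0 ?pi_gt0//= ltr_pM2l ?pi_gt0// ltf_pV2 ?posrE// ltr_nat.
have s0 : 0 < sin (pi / 4 : R).
  by have := pi_gt0 R => p0; apply: sin_gt0_pi; rewrite p4 /=; move: (pi : R) p0 => p p0; lra.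
by rewrite /= mulNr opprK addr_gt0// mulr_gt0.
Qed.

Lemma zeta8_conj : zeta8^*%C = zeta8^-1 :> C.
Proof.
have h : zeta8 * zeta8^*%C = 1 :> C.
  by rewrite mul_conj /zeta8 cabs_ebf_real expr1n.
have z0 : zeta8 != 0 :> C by apply: contra_eq_neq h => ->; rewrite mul0r eq_sym oner_eq0.
by apply: (mulfI z0); rewrite h mulfV.
Qed.

Lemma zeta8_pow (k l : nat) : zeta8 ^+ k * (zeta8^*%C) ^+ l = ebf ((l%:R - k%:R) / 8 : R)%:C :> C.
Proof.
have e (j : nat) (x : R) : ebf (x%:C) ^+ j = ebf (j%:R * x)%:C :> C.
  elim: j => [|j IH]; first by rewrite mul0r ebf0.
  by rewrite exprS IH -ebfD -rmorphD -natr1 /=; congr (ebf _%:C); ring.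
rewrite zeta8_conj /zeta8 -ebfN -rmorphN /= opprK !e -ebfD -rmorphD /=; congr (ebf _%:C).
by field.
Qed.

(** Since Im (-1/t) = Im t / |t|^2 and 2 e = k, the power of y turns k factors conj (sqrt t) into k
    factors 1 / sqrt t, which makes the automorphy factor holomorphic. *)
Lemma powR_conj t (e : R) (k : nat) : 0 < complex.Im t -> e *+ 2 = k%:R ->
  ((complex.Im (- t^-1)) `^ e)%:C * (sqrtc t * (sqrtc t)^*%C) ^+ k = ((complex.Im t) `^ e)%:C.
Proof.
move=> t0 ek; rewrite Im_oppV; have tn := im_neq0 t0.
set y := complex.Im t in t0 *; set d := _ + _.
have d0 : 0 < d by rewrite ltr_wpDl ?sqr_ge0// exprn_gt0.
pose c := cabs (sqrtc t); have c0 : 0 < c by rewrite cabs_gt0 sqrtc_eq0.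
have -> : sqrtc t * (sqrtc t)^*%C = (c ^+ 2)%:C by rewrite /c mul_conj.
have dc : d = c ^+ 4.
  have h : c ^+ 2 = cabs t by rewrite /c -cabsX sqr_sqrtc.
  have h2 : (cabs t) ^+ 2 = d.
    apply: (@complexI R); rewrite -mul_conj /d /y; case: (t) => a b; apply: complex_eq; rewrite !(ReM, ImM) /=; ring.
  by rewrite -h2 -h -exprM.
have h : (c ^+ 2) ^+ k = d `^ e.
  have -> : d = (c ^+ 2) `^ 2 by rewrite powR_mulrn ?sqr_ge0// dc -exprM.
  rewrite -powRrM (_ : 2 * e = k%:R); last by rewrite -ek mulr2n; ring.
  by rewrite powR_mulrn ?sqr_ge0.
rewrite -rmorphXn -rmorphM /= h -powRM ?divr_ge0 ?ltW//.
by rewrite divfK// gt_eqF.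
Qed.

End EighthRoot.

Section ThetaLaw.
Variables (R : realType) (n : nat) (Q : 'M[R]_n) (v : decomp R n).
Hypotheses (sQ : Q^T = Q) (uQ : Q \in unitmx) (vP : Gr Q v).
Local Notation C := R[i].
Local Notation r := (\rank (Pp v)).
Local Notation At := (At Q v).
Implicit Types (t : C).

(** The exponent of sqrt t is twice the weight, with r and n - r the dimensions of v_+ and v_-. *)
Lemma theta_law mp mm p t (g : 'rV[R]_n) (e := (n - r)%:R / 2 + mm%:R : R) :
  0 < complex.Im t -> homogeneous v mp mm p ->
  (complex.Im (- t^-1) `^ e)%:C *
  tsum (fun k : 'rV[int]_n => theta_term Q v p (- t^-1) (map_mx intr k + g)) =
  invsqrt_det (At 'i%C) * ebf (((n - r)%:R - r%:R) / 8)%:C *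
  sqrtc t ^ (r%:Z - (n - r)%N%:Z + 2 * (mp%:Z - mm%:Z)) *
  ((complex.Im t `^ e)%:C *
   tsum (fun m : 'rV[int]_n => theta_term Q v p t (map_mx intr m *m invmx Q) *
     ebf (- dot (map_mx intr m) g)%:C)).
Proof.
move=> t0 hom; rewrite (theta_coset sQ uQ vP _ t0 hom) (invsqrt_det_At sQ vP t0) (sqrtc_mi t0).
set S := tsum _; set s := sqrtc t.
have s0 : s != 0 by rewrite sqrtc_eq0 im_neq0.
have sc0 : s^*%C != 0 by rewrite conjc_eq0'.
have tE : t = s ^+ 2 by rewrite sqr_sqrtc.
have tcE : t^*%C = s^*%C ^+ 2 by rewrite -conjcX -tE.
rewrite -(powR_conj (e := e) (k := (n - r) + 2 * mm) t0); last first.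
  by rewrite /e natrD natrM mulr2n; field.
rewrite -zeta8_pow conjcM -/s tcE {2}tE.
move: (invsqrt_det _) (_ `^ _)%:C => K Y.
have -> : s ^ (r%:Z - (n - r)%N%:Z + 2 * (mp%:Z - mm%:Z)) =
    s ^+ (r + 2 * mp) / s ^+ ((n - r) + 2 * mm).
  have h0 : s ^+ ((n - r) + 2 * mm) != 0 by rewrite expf_neq0.
  apply: (mulIf h0); rewrite divfK// !exprnP -expfzDr//; congr (_ ^ _).
  by move: (n - r)%N => k; move: (\rank _) => l; lia.
rewrite (exprMn _ (zeta8 R)) (exprMn _ (zeta8 R)^*%C) (exprMn _ s s^*%C) -!exprM.
have eD (x : C) (k l : nat) : x ^+ (k + 2 * l)%N = x ^+ k * x ^+ (l * 2)%N by rewrite mulnC exprD.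
rewrite !eD ![in _ ^+ (2 * _)%N]mulnC.
have s1 : s ^+ (n - r) != 0 by rewrite expf_neq0.
have s2 : s ^+ (mm * 2) != 0 by rewrite expf_neq0.
move: (s ^+ r) (s^*%C ^+ (n - r)) (s ^+ (mp * 2)) (s^*%C ^+ (mm * 2)) (s ^+ (n - r)) (s ^+ (mm * 2)) s1 s2.
move: (_ ^+ _) (_ ^+ _) => z1 z2 a b c d a1 a2 h1 h2; field; by rewrite h1 h2.
Qed.

End ThetaLaw.

(** * Discriminant groups and gluing *)

Section FiniteFamilies.
Variable R : realType.
Local Notation C := R[i].

Lemma tsum_finType (I : finType) (f : I -> C) : tsum f = \sum_i f i.
Proof.
apply: has_sum_tsum; rewrite -big_enum; apply: has_sum_fin; first exact: enum_uniq.
by move=> i; rewrite mem_enum.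
Qed.

Lemma asum_finpair (I : finType) (J : choiceType) (f : I * J -> C) :
  (forall i, asum (fun j => f (i, j))) -> asum f.
Proof.
move=> /boolp.choice[B hB]; exists (\sum_i B i) => s us.
rewrite (partition_big (fun x : I * J => x.1) xpredT)//=; apply: ler_sum => i _.
have := hB i [seq x.2 | x <- s & x.1 == i]; rewrite big_map big_filter => h.
apply: le_trans (h _); last first.
  rewrite map_inj_in_uniq ?filter_uniq// => -[a b] [c d]; rewrite !mem_filter /=.
  by move=> /andP[/eqP-> _] /andP[/eqP-> _] ->.
by rewrite le_eqVlt; apply/orP; left; apply/eqP; apply: eq_bigr => -[a b] /= /eqP->.
Qed.

Lemma tsum_finpair (I : finType) (J : choiceType) (f : I * J -> C) :
  (forall i, asum (fun j => f (i, j))) -> tsum f = \sum_i tsum (fun j => f (i, j)).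
Proof. by move=> h; rewrite (fubini (asum_finpair h)) tsum_finType. Qed.

Lemma Re_tsum_ge (I : choiceType) (f : I -> C) i : asum f ->
  (forall j, 0 <= complex.Re (f j)) -> complex.Re (f i) <= complex.Re (tsum f).
Proof.
move=> af f0; apply/ler_addgt0Pl => e e0; have [s0 hs] := asum_has_sum af e0.
have := hs (undup (i :: s0)) (undup_uniq _) => /(_ _)/wrap[].
  by move=> j js; rewrite mem_undup inE js orbT.
have iin : i \in undup (i :: s0) by rewrite mem_undup mem_head.
rewrite (bigD1_seq i)//= ?undup_uniq//.
set S := \sum_(_ <- _ | _) _ => h.
have S0 : 0 <= complex.Re S.
  by rewrite /S; elim/big_ind: _ => [|a b a0 b0|j _] //; rewrite ReD; apply: addr_ge0.
have := le_lt_trans (Re_le_cabs _) h; rewrite ReD ReN ReD => h2.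
have h3 := le_lt_trans (ler_norm _) h2.
by rewrite -lerBlDr; apply: le_trans (ltW h3); rewrite lerD2r lerDl.
exact: (undup_uniq (i :: s0)).
Qed.

End FiniteFamilies.

Section IntegralVectors.
Variable R : realType.
Implicit Types (n : nat).

Definition iv n (k : 'rV[int]_n) : 'rV[R]_n := map_mx intr k.

Lemma iv_int n (k : 'rV[int]_n) : iv k \is a mxOver Num.int.
Proof. by apply/mxOverP => i j; rewrite mxE intr_int. Qed.

Lemma iv_inj n : injective (@iv n).
Proof.
move=> x y h; apply/matrixP => i j; have := congr1 (fun M : 'M[R]_(1, n) => M i j) h.
by rewrite !mxE => /intr_inj.
Qed.

Lemma ivP n (x : 'rV[R]_n) : x \is a mxOver Num.int -> exists k, x = iv k.
Proof.
move=> /mxOverP h; exists (\row_j Num.floor (x 0 j)); apply/rowP => j.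
by rewrite !mxE floorK.
Qed.

Lemma mulmx_int m n k (A : 'M[R]_(m, n)) (B : 'M[R]_(n, k)) :
  A \is a mxOver Num.int -> B \is a mxOver Num.int -> A *m B \is a mxOver Num.int.
Proof.
move=> /mxOverP a /mxOverP b; apply/mxOverP => i j.
by rewrite mxE rpred_sum// => l _; rewrite rpredM.
Qed.

Lemma int_entry m n (A : 'M[R]_(m, n)) i j : A \is a mxOver Num.int -> A i j \is a Num.int.
Proof. by move=> /mxOverP. Qed.

Lemma trmx_int m n (A : 'M[R]_(m, n)) : A \is a mxOver Num.int -> A^T \is a mxOver Num.int.
Proof. by move=> /mxOverP h; apply/mxOverP => i j; rewrite mxE. Qed.

Lemma map_intr_int m n (A : 'M[int]_(m, n)) : (map_mx intr A : 'M[R]_(m, n)) \is a mxOver Num.int.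
Proof. by apply/mxOverP => i j; rewrite mxE intr_int. Qed.

Lemma intD m n (A B : 'M[R]_(m, n)) : A \is a mxOver Num.int -> B \is a mxOver Num.int ->
  A + B \is a mxOver Num.int.
Proof. by move=> /mxOverP a /mxOverP b; apply/mxOverP => i j; rewrite mxE rpredD. Qed.

Lemma intN m n (A : 'M[R]_(m, n)) : A \is a mxOver Num.int -> - A \is a mxOver Num.int.
Proof. by move=> /mxOverP a; apply/mxOverP => i j; rewrite mxE rpredN. Qed.

Lemma intB m n (A B : 'M[R]_(m, n)) : A \is a mxOver Num.int -> B \is a mxOver Num.int ->
  A - B \is a mxOver Num.int.
Proof. by move=> a b; apply: intD => //; apply: intN. Qed.

Lemma int_congr m n (A B : 'M[R]_(m, n)) : A - B \is a mxOver Num.int ->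
  (A \is a mxOver Num.int) = (B \is a mxOver Num.int).
Proof.
move=> h; apply/idP/idP => k; first by rewrite -[B](subKr A); apply: intB.
by rewrite -[A](subrK B); apply: intD.
Qed.

End IntegralVectors.

(** * Dual lattices and characters of discriminant groups *)

Section DiscriminantGroup.
Variables (R : realType) (L : lattice).
Local Notation C := R[i].
Local Notation G := (gramR R L).
Local Notation D := (discr R L).
Local Notation iv := (@iv R _).
Local Notation form := (form G).
Implicit Types (x y z : 'rV[R]_(rank L)) (g h : D).

Lemma gramR_sym : G^T = G.
Proof. by rewrite /gramR map_trmx gram_sym. Qed.

Lemma gramR_int : G \is a mxOver Num.int. Proof. exact: map_intr_int. Qed.

Lemma formC x y : form x y = form y x.
Proof. exact: (bf_sym x y gramR_sym). Qed.

Lemma dualP x : (x \in @dual_pred R L) = (x *m G \is a mxOver Num.int).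
Proof. by []. Qed.

Lemma int_dual x : x \is a mxOver Num.int -> x \in @dual_pred R L.
Proof. by move=> h; rewrite dualP mulmx_int// gramR_int. Qed.

Lemma dual_form_int x y : x \in @dual_pred R L -> y \is a mxOver Num.int ->
  form x y \is a Num.int.
Proof. by rewrite dualP => h k; apply: int_entry; apply: mulmx_int => //; apply: trmx_int. Qed.

Lemma dual_valP (x : dual R L) : dual_val x \in @dual_pred R L.
Proof. by case: x. Qed.

Lemma dual_congr x y : x - y \is a mxOver Num.int ->
  (x \in @dual_pred R L) = (y \in @dual_pred R L).
Proof.
by move=> h; rewrite !dualP; apply: int_congr; rewrite -mulmxBl mulmx_int// gramR_int.
Qed.

Definition todual x : dual R L := insubd (0 : dual R L) x.

Lemma todualK x : x \in @dual_pred R L -> dual_val (todual x) = x.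
Proof. by move=> h; rewrite /todual; apply: (insubdK (0 : dual R L) h). Qed.

Lemma dual_inj (x y : dual R L) : dual_val x = dual_val y -> x = y.
Proof. exact: val_inj. Qed.

Lemma dclass_repr (x : dual R L) : dual_val x - drepr (dclass x) \is a mxOver Num.int.
Proof. by rewrite -dclass_eq dreprK. Qed.

Lemma drepr_eq g h : (drepr g : 'rV_(rank L)) - drepr h \is a mxOver Num.int -> g = h.
Proof. by rewrite -dclass_eq !dreprK => /eqP. Qed.

Lemma dclassD (x y : dual R L) : dclass (x + y) = dclass x + dclass y.
Proof. by rewrite /dclass !piE. Qed.

Lemma dual_valD (x y : dual R L) : dual_val (x + y) = dual_val x + dual_val y.
Proof. by []. Qed.

Lemma dreprD g (y : dual R L) :
  (drepr (g + dclass y) : 'rV_(rank L)) - (dual_val (drepr g) + dual_val y) \is a mxOver Num.int.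
Proof. by rewrite -dual_valD -dclass_eq dreprK dclassD dreprK. Qed.

(* L^** = L, tested on the dual basis. *)
Lemma dual_dual x : (forall y, y \in @dual_pred R L -> form x y \is a Num.int) ->
  x \is a mxOver Num.int.
Proof.
move=> H; apply/mxOverP => i j; rewrite ord1.
have := H (row j (invmx G)); rewrite dualP -row_mul mulVmx ?gramR_unit//.
have -> : form x (row j (invmx G)) = x 0 j.
  rewrite /Defs.form rowE trmx_mul (invmx_sym gramR_sym) -!mulmxA mulmxA mulmxA mulmxK ?gramR_unit//.
  by rewrite trmx_delta -colE mxE.
by apply; apply/mxOverP => a b; rewrite !mxE; case: eqP => _; rewrite ?rpred1 ?rpred0.
Qed.

Lemma ebf_form_congr x y z : x \in @dual_pred R L -> y - z \is a mxOver Num.int ->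
  ebf (- form x y)%:C = ebf (- form x z)%:C :> C.
Proof.
move=> hx h; apply: ebf_eq_int; have -> : - form x y - - form x z = - form x (y - z).
  by rewrite /Defs.form -!/(bf _ _ _) bfBr; ring.
by rewrite rpredN dual_form_int.
Qed.

(** If g is nonzero, some y in the dual lattice pairs non-integrally with it, by [dual_dual];
    translating the summation by y multiplies the sum by a factor different from 1. *)
Lemma char_sum g : \sum_h ebf (- dbil h g)%:C =
  if (dual_val (drepr g)) \is a mxOver Num.int then #|{: D}|%:R else 0 :> C.
Proof.
case: ifPn => hg.
  rewrite (eq_bigr (fun=> 1)) ?sumr_const// => h _.
  have e : ebf (- dbil h g)%:C = ebf (0 : R)%:C :> C.
    by apply: ebf_eq_int; rewrite subr0 rpredN dual_form_int// dual_valP.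
  exact: etrans e (ebf0 R).
have [y yd yn] : exists2 y, y \in @dual_pred R L & ~ form (drepr g) y \is a Num.int.
  apply: contrapT => H; case/negP: hg; apply: dual_dual => y yd.
  by apply: contrapT => yn; apply: H; exists y.
set S := \sum_h _; have E : S = ebf (- form y (drepr g))%:C * S.
  rewrite /S [LHS](reindex_inj (addIr (dclass (todual y)))) mulr_sumr; apply: eq_bigr => h _.
  have := dreprD h (todual y); rewrite todualK// => hh.
  rewrite /dbil -ebfD -rmorphD /=.
  rewrite formC (ebf_form_congr (dual_valP _) hh); congr (ebf _%:C).
  rewrite (formC (drepr h)) (formC y) /Defs.form -!/(bf _ _ _) bfDr; ring.
apply/eqP; apply: contraT => S0; case: yn.
have := congr1 (fun z : C => z * S^-1) E; rewrite -mulrA mulfV// mulr1 => /esym/ebf_eq1.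
by rewrite rpredN formC.
Qed.

Lemma tsum_dual (f : 'rV[R]_(rank L) -> C) :
  (forall g, asum (fun k : 'rV[int]_(rank L) => f (iv k + drepr g))) ->
  asum (fun x : dual R L => f x) /\
  tsum (fun x : dual R L => f x) = \sum_g tsum (fun k : 'rV[int]_(rank L) => f (iv k + drepr g)).
Proof.
move=> af; pose h (u : D * 'rV[int]_(rank L)) := todual (iv u.2 + drepr u.1).
have hm (u : D * 'rV[int]_(rank L)) : iv u.2 + drepr u.1 \in @dual_pred R L.
  rewrite (dual_congr (y := drepr u.1)) ?dual_valP//.
  by rewrite addrK iv_int.
have hK u : dual_val (h u) = iv u.2 + drepr u.1 by rewrite /h todualK.
have hi : injective h.
  move=> [g k] [g' k'] e; have := congr1 (@dual_val R L) e; rewrite !hK /= => e1.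
  have gg : g = g'.
    apply: drepr_eq; have -> : (drepr g : 'rV_(rank L)) - drepr g' = iv k' - iv k.
      by rewrite -(addrK (iv k) (drepr g : 'rV__)) [_ + iv k]addrC e1; rewrite addrAC addrK.
    by rewrite intB// iv_int.
  by rewrite gg in e1 *; move/addIr/iv_inj: e1 => ->.
have hs (x : dual R L) : (forall u, h u <> x) -> f x = 0.
  move=> H; have [k e] := ivP (dclass_repr x); case: (H (dclass x, k)); apply: dual_inj.
  by rewrite hK /= -e subrK.
have ah : asum (fun u => f (h u)).
  by apply: asum_finpair => g; have := af g; apply: asum_le => k; rewrite hK.
have a0 := (asum_reindex hi hs).2 ah.
split=> //; rewrite (tsum_reindex hi hs a0) tsum_finpair.
  by apply: eq_bigr => g _; apply: eq_tsum => k; rewrite hK.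
by move=> g; have := af g; apply: asum_le => k; rewrite hK.
Qed.

(** The rows of the inverse Gram matrix form a Z-basis of the dual lattice. *)
Lemma tsum_dual_inv (f : 'rV[R]_(rank L) -> C) : asum (fun x : dual R L => f x) ->
  tsum (fun m : 'rV[int]_(rank L) => f (iv m *m invmx G)) = tsum (fun x : dual R L => f x).
Proof.
move=> af; pose h (m : 'rV[int]_(rank L)) := todual (iv m *m invmx G).
have hK m : dual_val (h m) = iv m *m invmx G.
  by rewrite /h todualK// dualP mulmxKV ?gramR_unit// iv_int.
have hi : injective h.
  move=> m m' e; have := congr1 (@dual_val R L) e; rewrite !hK => /(congr1 (mulmx^~ G)).
  by rewrite !mulmxKV ?gramR_unit// => /iv_inj.
have hs (x : dual R L) : (forall u, h u <> x) -> f x = 0.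
  move=> H; have [m e] : exists m, dual_val x *m G = iv m by apply: ivP; exact: dual_valP.
  by case: (H m); apply: dual_inj; rewrite hK -e mulmxK ?gramR_unit.
by rewrite (tsum_reindex hi hs af); apply: eq_tsum => m; rewrite hK.
Qed.

End DiscriminantGroup.

Lemma clear_den n (q : 'rV[rat]_n) : exists2 d : int, d != 0 &
  exists z : 'rV[int]_n, d%:~R *: q = map_mx intr z.
Proof.
exists (\prod_j denq (q 0 j)); first by apply/prodf_neq0 => j _; apply: denq_neq0.
exists (\row_j (numq (q 0 j) * \prod_(k | k != j) denq (q 0 k))); apply/rowP => j.
rewrite !mxE (bigD1 j)//= !intrM numqE; ring.
Qed.

Lemma addr_regroup6 (V : zmodType) (A B p q l1 l2 : V) :
  A + B = p + q + (l1 + l2) + (A - (p + l1) + (B - (q + l2))).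
Proof.
rewrite [p + q + _]addrACA [RHS]addrACA.
by rewrite [p + l1 + _]addrC [q + l2 + _]addrC !subrK.
Qed.

Lemma addr_cancel4 (V : zmodType) (u v w s : V) : v + w + u - w - (v - s) = u + s.
Proof. by rewrite [v + w + u - w]addrAC addrK opprB [v + u]addrC -addrA [v + _]addrC subrK. Qed.

Lemma addr_cancel3 (V : zmodType) (g l c r : V) : g + l + c - r - (g - r) = l + c.
Proof. by rewrite opprB addrA subrK -[g + l + c]addrA [g + _]addrC addrK. Qed.

Lemma dclass0 (R : realType) (P : lattice) : dclass (0 : dual R P) = 0.
Proof. by have := dclassD (0 : dual R P) 0; rewrite addr0 => /eqP; rewrite -subr_eq0 opprD addNKr oppr_eq0 => /eqP. Qed.

(** * Gluing along M and its orthogonal complement *)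

Section Glue.
Variables (R : realType) (L : lattice) (M N : sublattice L).
Hypothesis perpN : is_orth_complement M N.
Local Notation C := R[i].
Local Notation G := (gramR R L).
Local Notation GM := (gramR R M).
Local Notation GN := (gramR R N).
Local Notation EM := (embR R M).
Local Notation EN := (embR R N).
Local Notation iv := (@iv R _).
Local Notation DM := (discr R M).
Local Notation DN := (discr R N).
Local Notation DL := (discr R L).
Implicit Types (x y : (DM * DN)%type) (l z : 'rV[R]_(rank L)).

Lemma EN_perp_EM : EN *m G *m EM^T = 0.
Proof.
have h : sub_emb N *m gram L *m (sub_emb M)^T = 0.
  apply/row_matrixP => i; rewrite row0 !row_mul.
  have : in_sublattice N (row i (sub_emb N)) by exists (delta_mx 0 i); rewrite rowE.
  by move=> /perpN.
by rewrite /embR /gramR map_trmx -!map_mxM h map_mx0.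
Qed.

Lemma EM_perp_EN : EM *m G *m EN^T = 0.
Proof.
have := congr1 trmx EN_perp_EM; rewrite !trmx_mul trmxK gramR_sym trmx0.
by rewrite mulmxA.
Qed.

(** The hypothesis on N concerns integral vectors. Over Q denominators are cleared, and a kernel
    defined over Q has the same generators over R. *)
Lemma perp_span z : z *m G *m EM^T = 0 -> exists c, z = c *m EN.
Proof.
move=> zM; pose B : 'M[int]_(rank L, rank M) := gram L *m (sub_emb M)^T.
pose BQ : 'M[rat]_(rank L, rank M) := map_mx intr B.
pose EQ : 'M[rat]_(rank N, rank L) := map_mx intr (sub_emb N).
have hQ : (kermx BQ <= EQ)%MS.
  apply/row_subP => i; set q := row i _.
  have qB : q *m BQ = 0 by apply/sub_kermxP; exact: row_sub.
  have [d d0 [w hw]] := clear_den q.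
  have wB : w *m B = 0.
    have : map_mx intr (w *m B) = 0 :> 'M[rat]_(1, rank M).
      by rewrite map_mxM -hw -scalemxAl -/BQ qB scaler0.
    move=> h; apply/rowP => j; have := congr1 (fun A : 'M[rat]_(1, rank M) => A 0 j) h.
    by rewrite !mxE => /eqP; rewrite intr_eq0 => /eqP.
  have [c hc] : in_sublattice N w by apply/perpN; rewrite -mulmxA.
  have dq : (d%:~R : rat) != 0 by rewrite intr_eq0.
  have -> : q = (d%:~R^-1 *: map_mx intr c) *m EQ.
    by rewrite -scalemxAl -map_mxM -hc -hw scalerA mulVf// scale1r.
  exact: submxMl.
have rE m n (A : 'M[int]_(m, n)) : map_mx (ratr : rat -> R) (map_mx intr A) = map_mx intr A.
  by apply/matrixP => i j; rewrite !mxE ratr_int.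
have hR : (kermx (map_mx (ratr : rat -> R) BQ) <= map_mx (ratr : rat -> R) EQ)%MS.
  by rewrite -map_kermx map_submx.
have : (z <= kermx (map_mx (ratr : rat -> R) BQ))%MS.
  apply/sub_kermxP; rewrite /BQ rE /B map_mxM mulmxA -zM.
  by rewrite /embR map_trmx.
by move=> /submx_trans/(_ hR); rewrite /EQ rE => /submxP[c ->]; exists c.
Qed.

Lemma proj_M a b : orth_proj M (a *m EM + b *m EN) = a.
Proof.
have e : b *m EN *m G *m EM^T = 0 by rewrite -!mulmxA (mulmxA EN) EN_perp_EM mulmx0.
by rewrite /orth_proj !mulmxDl e mul0mx addr0 -!(mulmxA a) -gramR_sub mulmxV ?gramR_unit ?mulmx1.
Qed.

Lemma proj_N a b : orth_proj N (a *m EM + b *m EN) = b.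
Proof.
have e : a *m EM *m G *m EN^T = 0 by rewrite -!mulmxA (mulmxA EM) EM_perp_EN mulmx0.
by rewrite /orth_proj !mulmxDl e mul0mx add0r -!(mulmxA b) -gramR_sub mulmxV ?gramR_unit ?mulmx1.
Qed.

Lemma proj_split z : z = orth_proj M z *m EM + orth_proj N z *m EN.
Proof.
have hM : (z - orth_proj M z *m EM) *m G *m EM^T = 0.
  rewrite !mulmxBl -!(mulmxA (orth_proj M z)) -gramR_sub /orth_proj.
  by rewrite mulmxKV ?gramR_unit// subrr.
have [c hc] := perp_span hM.
have zE : z = orth_proj M z *m EM + c *m EN by rewrite -hc addrC subrK.
by rewrite {3}zE proj_N.
Qed.

Lemma form_glue a b a' b' :
  form G (a *m EM + b *m EN) (a' *m EM + b' *m EN) = form GM a a' + form GN b b'.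
Proof.
have e1 (u u' : 'rV[R]_(rank M)) : bf G (u *m EM) (u' *m EM) = form GM u u'.
  by rewrite /bf /form trmx_mul gramR_sub !mulmxA.
have e2 (u u' : 'rV[R]_(rank N)) : bf G (u *m EN) (u' *m EN) = form GN u u'.
  by rewrite /bf /form trmx_mul gramR_sub !mulmxA.
have e3 (u : 'rV[R]_(rank M)) (u' : 'rV[R]_(rank N)) : bf G (u *m EM) (u' *m EN) = 0.
  by rewrite /bf trmx_mul -!mulmxA (mulmxA EM) (mulmxA _ EN^T) EM_perp_EN mul0mx mulmx0 mxE.
rewrite -[LHS]/(bf G (a *m EM + b *m EN) (a' *m EM + b' *m EN)) bfDl !bfDr e1 e2 e3.
by rewrite (bf_sym (b *m EN) (a' *m EM) (gramR_sym R L)) e3 addr0 add0r.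
Qed.

Lemma EM_int (a : 'rV[R]_(rank M)) : a \is a mxOver Num.int -> a *m EM \is a mxOver Num.int.
Proof. by move=> h; apply: mulmx_int => //; apply: map_intr_int. Qed.

Lemma EN_int (a : 'rV[R]_(rank N)) : a \is a mxOver Num.int -> a *m EN \is a mxOver Num.int.
Proof. by move=> h; apply: mulmx_int => //; apply: map_intr_int. Qed.

Definition glue x : 'rV[R]_(rank L) := drepr x.1 *m EM + drepr x.2 *m EN.

(** The dual lattice of L acts on pairs of classes by translation through [tau]; the glue vector
    then moves by l up to a vector of M + N. *)
Definition tau (l : dual R L) : DM * DN := (dclass (dual_proj M l), dclass (dual_proj N l)).

Lemma glue_tau x (l : dual R L) : exists (a : 'rV[R]_(rank M)) (b : 'rV[R]_(rank N)),
  [/\ a \is a mxOver Num.int, b \is a mxOver Num.int &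
      glue (x + tau l) = glue x + dual_val l + (a *m EM + b *m EN)].
Proof.
have h1 := dreprD x.1 (dual_proj M l); have h2 := dreprD x.2 (dual_proj N l).
set a := _ - _ in h1; set b := _ - _ in h2; exists a, b; split=> //.
rewrite {1}(proj_split (dual_val l)) /glue /a /b !mulmxBl !mulmxDl /=.
exact: addr_regroup6.
Qed.

Definition chi x y : C := ebf (- (dbil x.1 y.1 + dbil x.2 y.2))%:C.

Lemma chiE x y : chi x y = ebf (- form G (glue x) (glue y))%:C.
Proof. by rewrite /chi /glue form_glue. Qed.

(** f as a function on all of L_R, periodic under the lattice and zero off its dual. It encodes the
    condition that dual vectors of M and N add up to a dual vector of L. *)
Definition Fext (f : DL -> C) z : C := \sum_g (z - drepr g \is a mxOver Num.int)%:R * f g.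

Lemma Fext_dual f (l : dual R L) : Fext f l = f (dclass l).
Proof.
rewrite /Fext (bigD1 (dclass l))//= dclass_repr mul1r big1 ?addr0// => g gl.
rewrite (_ : _ \is a _ = false) ?mul0r//; apply/negbTE; apply: contra gl.
by rewrite -dclass_eq dreprK eq_sym.
Qed.

Lemma Fext_notdual f z : z \notin @dual_pred R L -> Fext f z = 0.
Proof.
move=> hz; rewrite /Fext big1// => g _; rewrite (_ : _ \is a _ = false) ?mul0r//.
by apply/negbTE; apply: contra hz => h; rewrite (dual_congr h) dual_valP.
Qed.

Lemma Fext_congr f z z' : z - z' \is a mxOver Num.int -> Fext f z = Fext f z'.
Proof.
move=> h; rewrite /Fext; apply: eq_bigr => g _; congr (_%:R * _); congr nat_of_bool.
apply: int_congr; rewrite (_ : _ - _ = z - z')//.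
by rewrite opprB addrA subrK.
Qed.

Lemma drepr0_int : (dual_val (drepr (0 : DL))) \is a mxOver Num.int.
Proof.
have := dclass_eq (drepr (0 : DL)) (0 : dual R L).
by rewrite dreprK (dclass0 R L) eqxx subr0 => <-.
Qed.

Definition hits g x : bool := glue x - drepr g \is a mxOver Num.int.

(** The order of the glue group L / (M + N), as the number of pairs of classes whose glue vector
    lies in L. *)
Definition nhits : nat := #|[set x | hits 0 x]|.

(** Translation by [tau (drepr g)] maps the fibre over 0 onto the fibre over g. *)
Lemma hits_count g : \sum_x (hits g x)%:R = nhits%:R :> C.
Proof.
rewrite /nhits -sum1_card natr_sum [RHS]big_mkcond /= [LHS](reindex_inj (addIr (tau (drepr g)))).
apply: eq_bigr => x _; rewrite inE.
have -> : hits g (x + tau (drepr g)) = hits 0 x.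
  rewrite /hits; have [a [b [ia ib ->]]] := glue_tau x (drepr g); apply: int_congr.
  have -> : glue x + drepr g + (a *m EM + b *m EN) - drepr g - (glue x - drepr 0) =
    (a *m EM + b *m EN) + drepr 0.
    exact: addr_cancel4.
  by apply: intD drepr0_int; apply: intD; [exact: EM_int|exact: EN_int].
by case: (hits 0 x).
Qed.

(** For a glue vector in the dual lattice the character is constant on the fibre over g. Otherwise
    it is nontrivial on L, which acts on the fibre through [tau], and the sum vanishes. *)
Lemma glue_char g x : \sum_y (hits g y)%:R * chi x y =
  nhits%:R * Fext (fun h => ebf (- dbil h g)%:C) (glue x).
Proof.
have [hx|hx] := boolP (glue x \in @dual_pred R L).
  have e := todualK hx; rewrite -[X in Fext _ X]e Fext_dual -(hits_count g) mulr_suml.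
  apply: eq_bigr => y _; have [hy|] := boolP (hits g y); last by rewrite !mul0r.
  rewrite !mul1r chiE (ebf_form_congr hx hy).
  rewrite formC; have := dclass_repr (todual (glue x)); rewrite e => h.
  by rewrite (ebf_form_congr (dual_valP _) h) /dbil formC.
rewrite Fext_notdual// mulr0.
have [i hi] : exists i, ~ (glue x *m G) 0 i \is a Num.int.
  apply: contrapT => H; case/negP: hx; rewrite dualP; apply/mxOverP => k i; rewrite ord1.
  by apply: contrapT => hi; apply: H; exists i.
pose l : dual R L := todual (iv (delta_mx 0 i)).
have lE : dual_val l = iv (delta_mx 0 i) by rewrite todualK// int_dual// iv_int.
have fE : form G (glue x) l = (glue x *m G) 0 i.
  by rewrite lE /Defs.form /iv map_delta_mx trmx_delta -colE mxE.
set S := \sum_y _; have E : S = ebf (- form G (glue x) l)%:C * S.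
  rewrite /S [LHS](reindex_inj (addIr (tau l))) mulr_sumr; apply: eq_bigr => y _.
  have [a [b [ia ib e]]] := glue_tau y l.
  have -> : hits g (y + tau l) = hits g y.
    rewrite /hits e; apply: int_congr.
    have -> : glue y + dual_val l + (a *m EM + b *m EN) - drepr g - (glue y - drepr g) = dual_val l + (a *m EM + b *m EN).
      exact: addr_cancel3.
    by rewrite lE; apply: intD (iv_int _ _) _; apply: intD; [exact: EM_int|exact: EN_int].
  rewrite [RHS]mulrCA; congr (_ * _); rewrite !chiE e -ebfD -rmorphD; apply: ebf_eq_int.
  have -> : form G (glue x) (glue y + dual_val l + (a *m EM + b *m EN)) =
     form G (glue x) (glue y) + form G (glue x) l + (form GM (drepr x.1) a + form GN (drepr x.2) b).
    by rewrite -form_glue -/(glue x) /Defs.form -!/(bf _ _ _) !bfDr.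
  rewrite (_ : _ - _ = - (form GM (drepr x.1) a + form GN (drepr x.2) b)); last by ring.
  by rewrite rpredN rpredD// dual_form_int// dual_valP.
apply/eqP; apply: contraT => S0; case: hi; rewrite -fE.
have := congr1 (fun z : C => z * S^-1) E; rewrite -mulrA mulfV// mulr1 => /esym/ebf_eq1.
by rewrite rpredN.
Qed.

Lemma drepr_int_eq0 (P : lattice) (g : discr R P) :
  (dual_val (drepr g) \is a mxOver Num.int) = (g == dclass 0).
Proof. by have := dclass_eq (drepr g) (0 : dual R P); rewrite dreprK subr0 => <-. Qed.

(** The values [chi x y] are summed over all x and over the y with glue vector in L. Summing over x
    first leaves only y = 0; summing over y first gives [glue_char] and then [hits_count]. *)
Lemma glue_index : nhits%:R ^+ 2 * #|{: DL}|%:R = #|{: DM}|%:R * #|{: DN}|%:R :> C.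
Proof.
have e0 : \sum_x \sum_y (hits 0 y)%:R * chi x y = #|{: DM}|%:R * #|{: DN}|%:R :> C.
  rewrite exchange_big /=.
  have h (y : DM * DN) : \sum_x (hits 0 y)%:R * chi x y =
      (hits 0 y)%:R * ((if y.1 == 0 then #|{: DM}|%:R else 0) * (if y.2 == 0 then #|{: DN}|%:R else 0)).
    rewrite -mulr_sumr; congr (_ * _); rewrite -[y.1 == 0]/(y.1 == _) -(dclass0 R M) -(dclass0 R N).
    rewrite -!drepr_int_eq0 -!char_sum big_distrlr /= pair_big /=.
    by apply: eq_bigr => x _; rewrite /chi -ebfD -rmorphD /= opprD.
  rewrite (eq_bigr _ (fun y _ => h y)) (bigD1 (0, 0))//= !eqxx big1 => [|[y1 y2] /=].
    rewrite addr0 (_ : hits 0 (0, 0) = true) ?mul1r//.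
    have d0 (P : lattice) : dual_val (drepr (0 : discr R P)) \is a mxOver Num.int.
      by rewrite drepr_int_eq0 dclass0.
    by apply: intB (d0 _); apply: intD; [apply: EM_int|apply: EN_int]; apply: d0.
  by rewrite xpair_eqE negb_and => /orP[] /negbTE ->; rewrite ?(mul0r, mulr0).
rewrite -e0 (eq_bigr _ (fun x _ => glue_char 0 x)) -mulr_sumr expr2 -mulrA; congr (_ * _).
rewrite /Fext exchange_big /= (eq_bigr (fun=> nhits%:R)) ?sumr_const ?mulr_natr// => g _.
rewrite -[RHS](hits_count g); apply: eq_bigr => x _.
rewrite (_ : ebf _ = 1) ?mulr1//.
have e : ebf (- dbil g 0)%:C = ebf (0 : R)%:C :> C.
  by apply: ebf_eq_int; rewrite subr0 rpredN dual_form_int ?dual_valP ?drepr0_int.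
exact: etrans e (ebf0 R).
Qed.

End Glue.

(** * Theta series of the classes of a discriminant group *)

Section ThetaClasses.
Variables (R : realType) (N : lattice) (w : decomp R (rank N)).
Hypothesis wP : Gr (gramR R N) w.
Local Notation C := R[i].
Local Notation Q := (gramR R N).
Local Notation n := (rank N).
Local Notation D := (discr R N).
Local Notation iv := (@iv R _).
Local Notation r := (\rank (Pp w)).
Implicit Types (t : C) (c : D) (p : mpoly.mpoly n C).
Let sQ := gramR_sym R N.
Let uQ := gramR_unit R N.

Definition thsum p t c : C := tsum (fun k : 'rV[int]_n => theta_term Q w p t (iv k + drepr c)).

Lemma thsum_dual p t : 0 < complex.Im t ->
  asum (fun x : dual R N => theta_term Q w p t x) /\
  forall c', tsum (fun x : dual R N => theta_term Q w p t x * ebf (- form Q x (drepr c'))%:C) =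
  \sum_c ebf (- dbil c c')%:C * thsum p t c.
Proof.
move=> t0; have at0 c := asum_theta_term sQ wP p (dual_val (drepr c)) t0.
have [a1 _] := tsum_dual at0; split=> // c'.
have e (c : D) (k : 'rV[int]_n) : ebf (- form Q (iv k + drepr c) (drepr c'))%:C = ebf (- dbil c c')%:C :> C.
  rewrite (formC (iv k + _)) /dbil (formC (drepr c)); apply: ebf_form_congr; first exact: dual_valP.
  by rewrite addrK iv_int.
have at1 c : asum (fun k : 'rV[int]_n => theta_term Q w p t (iv k + drepr c) *
    ebf (- form Q (iv k + drepr c) (drepr c'))%:C).
  have := at0 c; apply: asum_le => k.
  by rewrite (cabsM (theta_term _ _ _ _ _)) cabs_ebf_real mulr1.
have [_ ->] := tsum_dual (f := fun x => theta_term Q w p t x * ebf (- form Q x (drepr c'))%:C) at1.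
apply: eq_bigr => c _; rewrite -tsumZ_neq0 ?ebf_neq0//; apply: eq_tsum => k.
by rewrite e mulrC.
Qed.

Lemma thsum_inv p t c' : 0 < complex.Im t ->
  tsum (fun m : 'rV[int]_n => theta_term Q w p t (iv m *m invmx Q) *
     ebf (- dot (iv m) (drepr c'))%:C) = \sum_c ebf (- dbil c c')%:C * thsum p t c.
Proof.
move=> t0; have [a1 <-] := thsum_dual p t0.
pose f (x : 'rV[R]_n) := theta_term Q w p t x * ebf (- form Q x (drepr c'))%:C.
have af : asum (fun x : dual R N => f x).
  move: a1; apply: asum_le => x; rewrite /f.
  by rewrite (cabsM (theta_term _ _ _ _ _)) cabs_ebf_real mulr1.
rewrite -(tsum_dual_inv af); apply: eq_tsum => m; rewrite /f; congr (_ * ebf (- _)%:C).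
by rewrite /form /dot -!mulmxA (mulmxA (invmx Q)) mulVmx// mul1mx.
Qed.

(** Inversion fixes i, and for p = 1 the law becomes a linear relation among the theta constants at
    i. *)
Lemma thsum_i c' : thsum (mpoly.mpolyC n 1) 'i%C c' =
  invsqrt_det (At Q w 'i%C) * \sum_c ebf (- dbil c c')%:C * thsum (mpoly.mpolyC n 1) 'i%C c.
Proof.
have hom : homogeneous w 0 0 (mpoly.mpolyC n (1 : C)).
  by move=> x cp cm; rewrite /peval !mpoly.mevalC !expr0 mulr1 mul1r.
have := theta_coset sQ uQ wP (dual_val (drepr c')) (i_upper R) hom.
have ei : - ('i%C : C)^-1 = 'i%C by apply: complex_eq; rewrite /= ?oppr0 ?opprK ?(expr0n, expr1n, add0r, divr1, mul0r, oppr0).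
rewrite ei !expr0 !mulr1 => E; rewrite -(thsum_inv _ _ (i_upper R)); exact: E.
Qed.

(** At t = i the exponents are real, so all terms are positive. *)
Lemma thsum_i_neq0 : thsum (mpoly.mpolyC n 1) 'i%C 0 != 0.
Proof.
have e x : exists2 u : R, 0 < u & theta_term Q w (mpoly.mpolyC n (1 : C)) 'i%C x = u%:C.
  rewrite theta_termE//; have -> : mpoly.mpolyC n (1 : C) = lform 0 ^+ 0 by [].
  rewrite evalC_explp_lformX fact0 /herm /= big_cons big_nil /= /ecoef !expr0 fact0 divr1 !mul1r addr0.
  rewrite bf_At//; move: (bf _ _ _) (bf _ _ _) => b a.
  exists (expR (- (pi * (a - b)))); first exact: expR_gt0.
  rewrite mul1r -cexp_real; congr cexp; apply: complex_eq; rewrite !(ReM, ImM, ReD, ImD, ReN, ImN) /=; ring.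
have at0 := asum_theta_term sQ wP (mpoly.mpolyC n (1 : C)) (dual_val (drepr (0 : D))) (i_upper R).
have := Re_tsum_ge (0 : 'rV[int]_n) at0 => /(_ _)/wrap[].
  by move=> k; have [u u0 ->] := e (iv k + drepr (0 : D)); apply: ltW.
have [u u0 eu] := e (iv (0 : 'rV[int]_n) + drepr (0 : D)).
move=> h; apply: contraTneq u0 => h0; rewrite -leNgt.
by have := h; rewrite -/(iv _) eu -/(thsum _ _ _) h0 /=.
Qed.

(** Applying the relation at i twice multiplies the nonzero theta constant of the class 0 by K^2
    |D|, by orthogonality of characters. *)
Lemma invsqrt_det_i_sqr : invsqrt_det (At Q w 'i%C) ^+ 2 * #|{: D}|%:R = 1.
Proof.
set T := thsum (mpoly.mpolyC n 1) 'i%C; set K := invsqrt_det _.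
have T0 : T 0 != 0 := thsum_i_neq0.
apply: (mulIf T0); rewrite mul1r [RHS](thsum_i 0) -/K -/T.
have E : \sum_c ebf (- dbil c 0)%:C * T c = K * (#|{: D}|%:R * T 0).
  transitivity (\sum_c \sum_c' K * (ebf (- dbil c' c)%:C * T c')).
    apply: eq_bigr => c _; rewrite (_ : ebf _ = 1) ?mul1r ?[LHS]thsum_i ?mulr_sumr//.
    have e : ebf (- dbil c 0)%:C = ebf (0 : R)%:C :> C.
      by apply: ebf_eq_int; rewrite subr0 rpredN dual_form_int ?dual_valP// drepr_int_eq0 dclass0.
    exact: etrans e (ebf0 R).
  have cs c' : \sum_c ebf (- dbil c' c)%:C = if c' == 0 then #|{: D}|%:R else 0 :> C.
    rewrite -(dclass0 R N) -drepr_int_eq0 -char_sum; apply: eq_bigr => c _.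
    by rewrite /dbil formC.
  rewrite exchange_big.
  transitivity (\sum_c' K * ((if c' == 0 then #|{: D}|%:R else 0 : C) * T c')).
    by apply: eq_bigr => c' _; rewrite -(cs c') mulr_suml mulr_sumr.
  rewrite (bigD1 0 isT) eqxx big1 => [|c' c0]; first exact: addr0.
  by rewrite (negbTE c0) mul0r mulr0.
by rewrite E; ring.
Qed.

Lemma invsqrt_det_i_real : invsqrt_det (At Q w 'i%C) = ((Num.sqrt #|{: D}|%:R)^-1)%:C.
Proof.
have [k k0 e] := invsqrt_det_real (At_sym sQ wP 'i%C) (At_pos sQ wP (i_upper R)) (At_i_real Q w).
have := invsqrt_det_i_sqr; rewrite e natC -rmorphXn -rmorphM /= => /(@complexI R) h; congr (_%:C).
have d0 : 0 < #|{: D}|%:R :> R by rewrite ltr0n; apply/card_gt0P; exists 0.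
have s0 : 0 < Num.sqrt #|{: D}|%:R :> R by rewrite sqrtr_gt0.
apply: (mulIf (lt0r_neq0 s0)); rewrite mulVf ?lt0r_neq0//.
have := sqr_sqrtr (ltW d0) => e2.
apply/eqP; rewrite -(@eqrXn2 _ 2)// ?mulr_ge0 ?(ltW k0) ?(ltW s0)//.
by rewrite exprMn e2 h expr1n.
Qed.

Lemma thsum_S mp mm p t c' (e := (n - r)%:R / 2 + mm%:R : R) :
  0 < complex.Im t -> homogeneous w mp mm p ->
  (complex.Im (- t^-1) `^ e)%:C * thsum p (- t^-1) c' =
  ((Num.sqrt #|{: D}|%:R)^-1)%:C * ebf (((n - r)%:R - r%:R) / 8)%:C *
  sqrtc t ^ (r%:Z - (n - r)%N%:Z + 2 * (mp%:Z - mm%:Z)) *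
  \sum_c ebf (- dbil c c')%:C * ((complex.Im t `^ e)%:C * thsum p t c).
Proof.
move=> t0 hom; have := theta_law sQ uQ wP (dual_val (drepr c')) t0 hom.
rewrite invsqrt_det_i_real -/e -/(thsum _ _ c') => E; apply: etrans E _; congr (_ * _).
rewrite [X in _ * X](thsum_inv p c' t0) mulr_sumr; apply: eq_bigr => c _.
by rewrite mulrCA.
Qed.

End ThetaClasses.

Section EvenLattice.
Variables (R : realType) (P : lattice).
Hypothesis evenP : even_lattice P.
Local Notation G := (gramR R P).

Lemma even_int (x : 'rV[R]_(rank P)) : x \is a mxOver Num.int -> form G x x / 2 \is a Num.int.
Proof.
move=> /ivP[k ->]; have /dvdzP[q hq] := evenP k.
have -> : form G (iv R k) (iv R k) = ((k *m gram P *m k^T) 0 0)%:~R.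
  by rewrite /form /iv /gramR map_trmx -!map_mxM mxE.
by rewrite hq intrM mulfK ?intr_int// pnatr_eq0.
Qed.

Lemma quad_congr (x y : 'rV[R]_(rank P)) : y \in @dual_pred R P -> x - y \is a mxOver Num.int ->
  form G x x / 2 - form G y y / 2 \is a Num.int.
Proof.
move=> hy h; have -> : form G x x / 2 - form G y y / 2 = form G (x - y) (x - y) / 2 + form G y (x - y).
  have E u v : form G u v = bf G u v by [].
  by rewrite !E !(bfBl, bfBr) (bf_sym y x (gramR_sym R P)); field.
by rewrite rpredD ?even_int// dual_form_int.
Qed.

End EvenLattice.

Lemma even_sub (L : lattice) (N : sublattice L) : even_lattice L -> even_lattice N.
Proof.
move=> h x; have := h (x *m sub_emb N); rewrite sub_gram trmx_mul !mulmxA.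
by [].
Qed.

Lemma theta_term_T (R : realType) n (Q : 'M[R]_n) (v : decomp R n) p (t : R[i]) x :
  Q^T = Q -> Gr Q v ->
  theta_term Q v p (t + 1) x = ebf (form Q x x / 2)%:C * theta_term Q v p t x.
Proof.
move=> sQ vP; have eIm : complex.Im (t + 1) = complex.Im t by rewrite ImD /= addr0.
have h2 (a b : R) : ((a + b) / 2)%:C = (a / 2)%:C + (b / 2)%:C :> R[i] by rewrite mulrDl rmorphD.
have ec : (t + 1)^*%C = t^*%C + 1 by case: (t) => a b; apply: complex_eq; rewrite /= ?oppr0 ?addr0.
rewrite /theta_term eIm ec [RHS]mulrCA -ebfD; congr (_ * ebf _).
rewrite (form_split sQ vP x) h2.
by move: ((_ / 2)%:C : R[i]) ((_ / 2)%:C : R[i]) => a b; ring.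
Qed.

(** * Transformation of the contraction under S and T *)

Section WLaw.
Variables (R : realType) (L : lattice) (M N : sublattice L).
Hypothesis perpN : is_orth_complement M N.
Hypothesis evenL : even_lattice L.
Local Notation C := R[i].
Local Notation DM := (discr R M).
Local Notation DN := (discr R N).
Local Notation DL := (discr R L).
Local Notation glue := (@glue R L M N).
Variables (w : decomp R (rank N)) (p : mpoly.mpoly (rank N) C) (e : R).
Hypothesis wP : Gr (gramR R N) w.
Local Notation r := (\rank (Pp w)).
Local Notation r' := (rank N - r)%N.

(** One coordinate of the theta contraction, as [contractionE] shows, as a finite sum over D_N to
    which the laws of the coset theta series apply. *)
Definition Wsum (F : DL -> C) (t : C) (d : DM) : C :=
  \sum_(c : DN) ((complex.Im t `^ e)%:C * thsum w p t c) * Fext F (glue (d, c)).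

Lemma Fext_sum (F : DL -> C) y : Fext F (glue y) = \sum_g (hits g y)%:R * F g.
Proof. by []. Qed.

Lemma FextZ (F : DL -> C) a z : Fext (fun g => a * F g) z = a * Fext F z.
Proof. by rewrite /Fext mulr_sumr; apply: eq_bigr => g _; rewrite mulrCA. Qed.

Lemma eq_Fext (F F' : DL -> C) z : F =1 F' -> Fext F z = Fext F' z.
Proof. by move=> h; rewrite /Fext; apply: eq_bigr => g _; rewrite h. Qed.

(** Pulling functions back from D_L to pairs of classes commutes with the finite Fourier transforms,
    up to the glue index. By linearity in F this is [glue_char]. *)
Lemma glue_fourier (F : DL -> C) (x : DM * DN) :
  \sum_y chi x y * Fext F (glue y) =
  (nhits R M N)%:R * Fext (fun h => \sum_g ebf (- dbil h g)%:C * F g) (glue x).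
Proof.
transitivity (\sum_g F g * ((nhits R M N)%:R * Fext (fun h => ebf (- dbil h g)%:C) (glue x))).
  under eq_bigr do rewrite Fext_sum mulr_sumr.
  rewrite exchange_big; apply: eq_bigr => g _ /=.
  rewrite -(glue_char perpN) mulr_sumr; apply: eq_bigr => y _.
  by move: (chi _ _) (F g) => u v; ring.
under eq_bigr do rewrite mulrCA; rewrite -mulr_sumr; congr (_ * _).
under eq_bigr do rewrite -FextZ.
rewrite /Fext exchange_big; apply: eq_bigr => h _ /=; rewrite -mulr_sumr; congr (_ * _).
by apply: eq_bigr => g _; rewrite mulrC.
Qed.

(** On pairs (d, c) that glue to g, the quadratic forms satisfy q(d) + q(c) = q(g) modulo 1, so the
    phases of c and of F' leave the inverse phase of d. *)
Lemma Wsum_T (F F' : DL -> C) t d : (forall g, F' g = ebf (- dquad g)%:C * F g) ->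
  Wsum F' (t + 1) d = ebf (- dquad d)%:C * Wsum F t d.
Proof.
move=> hF; rewrite /Wsum mulr_sumr ImD /= addr0; apply: eq_bigr => c _.
have -> : thsum w p (t + 1) c = ebf (dquad c)%:C * thsum w p t c.
  rewrite /thsum -tsumZ_neq0 ?ebf_neq0//; apply: eq_tsum => k.
  rewrite (theta_term_T _ _ _ (gramR_sym R N) wP); congr (_ * _); apply: ebf_eq_int.
  apply: (quad_congr (even_sub evenL)); first exact: dual_valP.
  by rewrite addrK iv_int.
suff K : ebf (dquad c)%:C * Fext F' (glue (d, c)) = ebf (- dquad d)%:C * Fext F (glue (d, c)).
  move: K; move: (Fext F' _) (Fext F _) (thsum _ _ _ _) (_ `^ _)%:C (ebf _) (ebf _) => a b T Y u v K.
  transitivity (Y * T * (v * a)); first ring.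
  by rewrite K; ring.
rewrite !Fext_sum !mulr_sumr; apply: eq_bigr => g _; rewrite hF.
have [h|] := boolP (hits g (d, c)); last by rewrite !mul0r !mulr0.
rewrite !mul1r mulrA -ebfD -rmorphD /=; congr (_ * _); apply: ebf_eq_int.
have h2 := quad_congr evenL (dual_valP (drepr g)) h.
have : form (gramR R L) (glue (d, c)) (glue (d, c)) = form (gramR R M) (drepr d) (drepr d) + form (gramR R N) (drepr c) (drepr c).
  by rewrite -form_glue.
move=> hg; rewrite /dquad; move: h2; rewrite hg.
move: (form _ _ _) (form _ _ _) (form _ _ _) => a b c' h2.
by rewrite (_ : _ - _ = (c' + b) / 2 - a / 2)//; field.
Qed.

(** The S-matrix stands on the transformed side, the form that [dual_law] consumes and [FL]
    provides. The constants fit because nhits / sqrt (|D_M| |D_N|) = 1 / sqrt |D_L| by [glue_index],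
    and the eighth roots by [zE]. *)
Lemma Wsum_S mp mm (F F' : DL -> C) t d (kL : int) (zM zL : R) :
  0 < complex.Im t -> homogeneous w mp mm p -> e = r'%:R / 2 + mm%:R ->
  zM + (r'%:R - r%:R) / 8 = zL ->
  (forall g, (ebf zL%:C / (Num.sqrt #|{: DL}|%:R)%:C) * \sum_h ebf (- dbil g h)%:C * F' h =
     sqrtc t ^ kL * F g) ->
  (ebf zM%:C / (Num.sqrt #|{: DM}|%:R)%:C) * \sum_d' ebf (- dbil d d')%:C * Wsum F' (- t^-1) d' =
  sqrtc t ^ (kL + (r%:Z - r'%:Z + 2 * (mp%:Z - mm%:Z))) * Wsum F t d.
Proof.
move=> t0 hom eE zE FL.
have s0 : sqrtc t != 0 by rewrite sqrtc_eq0 im_neq0.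
pose sq (P : lattice) : R := Num.sqrt #|{: discr R P}|%:R.
have sq0 (P : lattice) : 0 < sq P.
  by rewrite sqrtr_gt0 ltr0n; apply/card_gt0P; exists 0.
have sqE (P : lattice) : sq P ^+ 2 = #|{: discr R P}|%:R by rewrite sqr_sqrtr.
pose kN := r%:Z - r'%:Z + 2 * (mp%:Z - mm%:Z).
pose th c := (complex.Im t `^ e)%:C * thsum w p t c.
pose KN := ((sq N)^-1)%:C * ebf ((r'%:R - r%:R) / 8)%:C * sqrtc t ^ kN.
have thS c' : (complex.Im (- t^-1) `^ e)%:C * thsum w p (- t^-1) c' = KN * \sum_c ebf (- dbil c c')%:C * th c.
  by have := thsum_S wP c' t0 hom; rewrite -eE.
have A : \sum_d' ebf (- dbil d d')%:C * Wsum F' (- t^-1) d' =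
    KN * \sum_c th c * \sum_y chi (d, c) y * Fext F' (glue y).
  transitivity (\sum_d' \sum_c' \sum_c KN * (th c * (chi (d, c) (d', c') * Fext F' (glue (d', c'))))).
    apply: eq_bigr => d' _; rewrite /Wsum mulr_sumr; apply: eq_bigr => c' _.
    rewrite thS; set f := Fext _ _; set u := ebf _.
    transitivity (\sum_c (u * KN * f) * (ebf (- dbil c c')%:C * th c)).
      by rewrite -mulr_sumr; move: (\sum_c _) => S; ring.
    apply: eq_bigr => c _; rewrite /chi opprD rmorphD ebfD /= -/u.
    by move: (ebf _) (th c) => b v; ring.
  rewrite pair_big /= exchange_big /= mulr_sumr; apply: eq_bigr => c _.
  by rewrite mulr_sumr mulr_sumr; apply: eq_bigr => -[d' c'] _.
pose cL := ebf zL%:C / (sq L)%:C.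
have cL0 : cL != 0.
  by rewrite mulf_neq0 ?ebf_neq0// invr_eq0 -cabs_gt0 cabs_real normr_gt0 lt0r_neq0.
have B c : \sum_y chi (d, c) y * Fext F' (glue y) =
    (nhits R M N)%:R * (cL^-1 * sqrtc t ^ kL) * Fext F (glue (d, c)).
  rewrite glue_fourier -mulrA; congr (_ * _); rewrite -FextZ; apply: eq_Fext => h.
  by apply: (mulfI cL0); rewrite [LHS]FL !mulrA mulfV// mul1r.
rewrite A (eq_bigr (fun c => ((nhits R M N)%:R * (cL^-1 * sqrtc t ^ kL)) * (th c * Fext F (glue (d, c))))); last first.
  by move=> c _; rewrite B mulrCA.
rewrite -mulr_sumr -/(Wsum F t d) expfzDr// -/kN.
have X : ebf zM%:C / (sq M)%:C * (((sq N)^-1)%:C * ebf ((r'%:R - r%:R) / 8)%:C) * (nhits R M N)%:R = cL.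
  rewrite /cL -zE rmorphD /= ebfD.
  have hR : (sq M)^-1 * (sq N)^-1 * (nhits R M N)%:R = (sq L)^-1.
    apply: (mulIf (lt0r_neq0 (sq0 L))); rewrite mulVf ?lt0r_neq0//.
    have n0 : 0 <= (nhits R M N)%:R :> R by [].
    apply/eqP; rewrite -(@eqrXn2 _ 2)// ?mulr_ge0 ?invr_ge0 ?(ltW (sq0 _))//.
    rewrite expr1n !exprMn !exprVn !sqE; have := @glue_index R L M N perpN.
    have d0 (P : lattice) : #|{: discr R P}|%:R != 0 :> R by rewrite -sqE expf_neq0 ?lt0r_neq0.
    have h : (nhits R M N)%:R ^+ 2 * #|{: DL}|%:R = #|{: DM}|%:R * #|{: DN}|%:R :> R.
      by apply: (@complexI R); rewrite rmorphM rmorphXn rmorphM /= -!natC; exact: (@glue_index R L M N perpN).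
    by move=> _; rewrite -mulrA h; apply/eqP; field; rewrite !d0.
  have := congr1 (fun z => z%:C : C) hR; rewrite !rmorphM /= !fmorphV /= -natC => hC.
  rewrite -hC; move: (ebf _) (ebf _) => a b; ring.
transitivity ((ebf zM%:C / (sq M)%:C * (((sq N)^-1)%:C * ebf ((r'%:R - r%:R) / 8)%:C) * (nhits R M N)%:R) / cL *
  (sqrtc t ^ kL * sqrtc t ^ kN * Wsum F t d)); last by rewrite X mulfV// mul1r.
rewrite /KN; move: (ebf _ / _) (_ ^ kN) (_ ^ kL) (((sq N)^-1)%:C * ebf _) (Wsum F t d) (cL^-1) ((nhits R M N)%:R : C).
by move=> u v x y z s q; ring.
Qed.

End WLaw.

(** * The metaplectic group and its Weil representations *)

Section SL2Words.
Local Open Scope int_scope.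
Variable Q : int -> int -> int -> int -> Prop.
Hypothesis Q1 : Q 1 0 0 1.
Hypothesis QS : forall a b c d : int, Q a b c d -> Q (- c) (- d) a b.
Hypothesis QT : forall a b c d : int, Q a b c d -> Q (a + c) (b + d) c d.

Lemma Q_eq (a b c d a' b' c' d' : int) : Q a b c d -> a = a' -> b = b' -> c = c' -> d = d' -> Q a' b' c' d'.
Proof. by move=> h <- <- <- <-. Qed.

Lemma QSV (a b c d : int) : Q a b c d -> Q c d (- a) (- b).
Proof. by move=> h; apply: (Q_eq (QS (QS (QS h)))); rewrite ?opprK. Qed.

Lemma QTV (a b c d : int) : Q a b c d -> Q (a - c) (b - d) c d.
Proof.
move=> h; have := QS (QS (QS (QT (QS (QT (QS h)))))).
by move=> k; apply: (Q_eq k); lia.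
Qed.

Lemma QTq (q a b c d : int) : Q a b c d -> Q (a + q * c) (b + q * d) c d.
Proof.
move=> h; case: q => q.
  elim: q => [|q IH]; first by apply: (Q_eq h); lia.
  by apply: (Q_eq (QT IH)); lia.
elim: q => [|q IH]; first by apply: (Q_eq (QTV h)); lia.
by apply: (Q_eq (QTV IH)); lia.
Qed.

(** The Euclidean algorithm on the first column: division of a by c is a power of T, and S exchanges
    the rows up to sign. Inverses of S and T are positive words by [QSV] and [QTV]. *)
Lemma SL2_words (a b c d : int) : a * d - b * c = 1 -> Q a b c d.
Proof.
have [m] := ubnP `|c|%N; elim: m a b c d => // m IH a b c d cm det.
have [c0|c0] := eqVneq c 0.
  have ad : a * d = 1 by rewrite c0 mulr0 subr0 in det.
  have [[a1 d1]|[a1 d1]] : (a = 1 /\ d = 1) \/ (a = -1 /\ d = -1).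
    have : (`|a| * `|d|)%N == 1%N by rewrite -abszM ad.
    rewrite muln_eq1 => /andP[/eqP h1 _].
    have [e|e] : a = 1 \/ a = -1 by lia.
      by left; rewrite e mul1r in ad.
    by right; split=> //; rewrite e mulN1r in ad; lia.
    by apply: (Q_eq (QTq b Q1)); lia.
  by apply: (Q_eq (QS (QS (QTq (- b) Q1)))); lia.
have e := divz_eq a c; set q := divz a c in e; set a' := modz a c in e.
have a0 : 0 <= a' by apply: modz_ge0.
have ac : a' < `|c| by apply: ltz_mod.
have h : Q (- c) (- d) a' (b - q * d).
  apply: IH; first by lia.
  have -> : a' = a - q * c by lia.
  by rewrite -det; ring.
by apply: (Q_eq (QTq q (QSV h))); lia.
Qed.

End SL2Words.

(** * Automorphy factors and words in S and T *)

Section Metaplectic.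
Variable R : realType.
Local Notation C := R[i].
Local Notation mp2 := ('M[R]_2 * (C -> C))%type.
Implicit Types (g h : mp2) (t : C) (A B : 'M[R]_2).
Local Notation up t := (0 < complex.Im t).

Definition den A t : C := (A 1 0)%:C * t + (A 1 1)%:C.

Lemma det22 A : \det A = A 0 0 * A 1 1 - A 0 1 * A 1 0.
Proof.
rewrite (expand_det_row _ 0) big_ord_recl big_ord1 /cofactor !det_mx11 !mxE /= expr0 expr1 mul1r mulN1r mulrN.
by congr (A _ _ * A _ _ - A _ _ * A _ _); apply: val_inj.
Qed.

Lemma den_neq0 A t : \det A = 1 -> up t -> den A t != 0.
Proof.
move=> dA t0; apply: contraTneq isT => h.
have h1 := congr1 (@complex.Im R) h; have h2 := congr1 (@complex.Re R) h.
move: h1 h2; rewrite /den !ImD !ReD !ImM !ReM /= !mul0r addr0 subr0 addr0 => h1 h2.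
have c0 : A 1 0 = 0.
  by apply/eqP; move/eqP: h1; rewrite mulf_eq0 (gt_eqF t0) orbF.
move: h2; rewrite c0 mul0r add0r => d0.
by move: dA; rewrite det22 c0 d0 !mulr0 subr0 => /eqP; rewrite eq_sym oner_eq0.
Qed.

Lemma Im_moebius A t : \det A = 1 -> up t -> up (moebius A t).
Proof.
move=> dA t0; have d0 := den_neq0 dA t0.
have c0 : 0 < cabs (den A t) ^+ 2 by rewrite exprn_gt0// cabs_gt0.
have e : moebius A t = ((cabs (den A t) ^+ 2)^-1)%:C * (((A 0 0)%:C * t + (A 0 1)%:C) * (den A t)^*%C).
  have h := mul_conj (den A t).
  have cn : ((cabs (den A t) ^+ 2)%:C : C) != 0 by rewrite -cabs_gt0 cabs_real normr_gt0 gt_eqF.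
  apply: (mulIf d0); rewrite /moebius -/(den A t) divfK// fmorphV.
  by rewrite -mulrA -mulrA [_^*%C * _]mulrC h mulrCA mulVf// mulr1.
rewrite e ImM /= mul0r addr0 mulr_gt0 ?invr_gt0//.
rewrite /den; move: dA; rewrite det22 => dA.
case: t t0 {d0 c0 e} => x y /= y0.
rewrite [X in 0 < X](_ : _ = y * (A 0 0 * A 1 1 - A 0 1 * A 1 0)); last by ring.
by rewrite dA mulr1.
Qed.

Lemma den_mul A B t : \det B = 1 -> up t -> den (A *m B) t = den A (moebius B t) * den B t.
Proof.
move=> dB t0; have d0 := den_neq0 dB t0.
rewrite {2}/den mulrDl /moebius -/(den B t) -mulrA divfK// /den !mxE !big_ord_recl !big_ord0 /=.
rewrite !addr0 !(rmorphD (real_complex R)) !(rmorphM (real_complex R)) /=.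
have -> : lift ord0 ord0 = 1 :> 'I_2 by apply: val_inj.
by ring.
Qed.

Lemma moebius_mul A B t : \det A = 1 -> \det B = 1 -> up t ->
  moebius (A *m B) t = moebius A (moebius B t).
Proof.
move=> dA dB t0; have d0 := den_neq0 dB t0.
have d1 := den_neq0 dA (Im_moebius dB t0).
have dM := den_mul A dB t0.
rewrite [LHS]/moebius -/(den _ _) dM [RHS]/moebius -/(den A _).
apply: (mulIf (mulf_neq0 d1 d0)); rewrite divfK ?mulf_neq0// mulrA divfK//.
rewrite mulrDl /moebius -/(den B t) -mulrA divfK// /den !mxE !big_ord_recl !big_ord0 /=.
rewrite !addr0 !(rmorphD (real_complex R)) !(rmorphM (real_complex R)) /=.
have -> : lift ord0 ord0 = 1 :> 'I_2 by apply: val_inj.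
by ring.
Qed.

Lemma moebius_S t : moebius (@mpS R).1 t = - t^-1.
Proof. by rewrite /moebius /= !mxE /= mul0r add0r mul1r addr0 rmorphN rmorph1 mulN1r. Qed.

Lemma moebius_T t : moebius (@mpT R).1 t = t + 1.
Proof. by rewrite /moebius /= !mxE /= mul0r add0r mul1r divr1. Qed.

Lemma moebius_1 t : moebius 1%:M t = t.
Proof. by rewrite /moebius !mxE /= mul0r add0r mul1r divr1 addr0. Qed.

Lemma on_upperE (f : C -> C) t : up t -> on_upper f t = f t.
Proof. by rewrite /on_upper => ->. Qed.

(** Letters are added on the left and without inverses: this matches the closure properties in
    [SL2_words] and makes modularity an induction on the word. *)
Inductive word : mp2 -> Prop :=
| word1 : word (@mp_one R)
| wordS g : word g -> word (mp_mul (@mpS R) g)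
| wordT g : word g -> word (mp_mul (@mpT R) g).

Definition neg g : mp2 := (g.1, fun t => - g.2 t).

Lemma mxS4 : (@mpS R).1 *m (@mpS R).1 = - 1%:M.
Proof.
apply/matrixP => i j; rewrite !mxE big_ord_recl big_ord1 !mxE /=.
case: i => [[|[|i]] hi] //; case: j => [[|[|j]] hj] //; rewrite /= ?(mul0r, mulr0, mulr1, mul1r, addr0, add0r, oppr0) ?mulr1n //.
Qed.

Lemma det_S : \det (@mpS R).1 = 1. Proof. by rewrite det22 !mxE /=; ring. Qed.
Lemma det_T : \det (@mpT R).1 = 1. Proof. by rewrite det22 !mxE /=; ring. Qed.

(* [S ^ 4 = (1, -1)] *)
Lemma S4_neg g : \det g.1 = 1 -> (forall t, ~ up t -> g.2 t = 0) ->
  mp_mul (@mpS R) (mp_mul (@mpS R) (mp_mul (@mpS R) (mp_mul (@mpS R) g))) = neg g.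
Proof.
move=> dg g0; rewrite /neg /mp_mul /=; congr pair.
  have S4 : (mx22 0 (-1) 1 0 : 'M[R]_2) *m mx22 0 (-1) 1 0 = - 1%:M := mxS4.
  by rewrite !mulmxA S4 -(mulmxA (- 1%:M)) S4 mulmxN mulmx1 opprK mul1mx.
apply/funext => t; rewrite /on_upper; case: ifPn => [t0|/negP tn]; last by rewrite g0// oppr0.
set u := moebius g.1 t; have u0 : up u by apply: Im_moebius.
have v0 : up (- u^-1) by apply: upper_oppV.
have uu : - (- u^-1)^-1 = u by rewrite invrN invrK opprK.
have dS := det_S; set S := mx22 _ _ _ _ in dS *.
have mS z : moebius S z = - z^-1 := moebius_S z.
have d1 : \det (S *m g.1) = 1 by rewrite det_mulmx dS dg mulr1.
have d2 : \det (S *m (S *m g.1)) = 1 by rewrite det_mulmx dS d1 mulr1.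
have m1 : moebius (S *m g.1) t = - u^-1 by rewrite moebius_mul// mS.
have m2 : moebius (S *m (S *m g.1)) t = u by rewrite moebius_mul// m1 mS uu.
have m3 : moebius (S *m (S *m (S *m g.1))) t = - u^-1 by rewrite moebius_mul// m2 mS.
rewrite t0 -/u m1 m2 m3 u0 v0.
have e : (sqrtc (- u^-1) * sqrtc u) ^+ 2 = -1.
  by rewrite exprMn !sqr_sqrtc mulNr mulVf// im_neq0.
transitivity ((sqrtc (- u^-1) * sqrtc u) ^+ 2 * g.2 t); last by rewrite e mulN1r.
by move: (sqrtc _) (sqrtc _) (g.2 t) => x y z; ring.
Qed.

Lemma word_neg g : \det g.1 = 1 -> (forall t, ~ up t -> g.2 t = 0) -> word g -> word (neg g).
Proof. by move=> dg g0 wg; rewrite -S4_neg//; do 4 apply: wordS. Qed.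

End Metaplectic.

(** * Holomorphy of square roots of c t + d *)

Section ComplexContinuity.
Local Open Scope classical_set_scope.
Local Open Scope ring_scope.
Local Open Scope complex_scope.
Variable R : realType.
Local Notation C := R[i].
Local Notation up t := (0 < complex.Im t).

(** Continuity in terms of the real-valued [cabs], so that it composes with [ccont] along real
    paths. *)
Definition econtinuous (f : C -> C) (z : C) : Prop := forall e : R, 0 < e ->
  exists2 d : R, 0 < d & forall w, cabs (w - z) < d -> cabs (f w - f z) < e.

Lemma ltC_real (x : C) (e : R) : (`|x| < e%:C) = (cabs x < e).
Proof. by rewrite -cabsE ltcR. Qed.

Lemma posC (e : C) : 0 < e -> 0 < complex.Re e /\ e = (complex.Re e)%:C.
Proof.
rewrite ltcE /= => /andP[/eqP h1 h2]; split=> //; apply: complex_eq => //=.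
Qed.

Lemma nbhs_cabs (z : C^o) (P : C^o -> Prop) :
  nbhs z P <-> exists2 d : R, 0 < d & forall w : C, cabs (w - z) < d -> P w.
Proof.
rewrite nbhs_ballP; split.
  move=> [e /= e0 h]; have [r0 eE] := posC e0; exists (complex.Re e) => // w hw; apply: h.
  by rewrite -ball_normE /= distrC eE ltC_real.
move=> [d d0 h]; exists d%:C => /=; first by rewrite ltcR.
by move=> w; rewrite -ball_normE /= distrC ltC_real; apply: h.
Qed.

Lemma econtP (f : C^o -> C^o) (z : C^o) : {for z, continuous f} <-> econtinuous f z.
Proof.
split=> [h e e0|h].
  have h2 : nbhs z [set w : C^o | cabs (f w - f z) < e].
    have hn : nbhs (f z) [set u : C^o | cabs (u - f z) < e] by apply/nbhs_cabs; exists e.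
    exact: (h _ hn).
  by case/nbhs_cabs: h2 => d d0 hd; exists d.
move=> P /nbhs_cabs[e e0 he]; apply/nbhs_cabs; have [d d0 hd] := h e e0.
by exists d => // w hw; apply: he; apply: hd.
Qed.

Lemma econt_ccont (f : C -> C) (g : R -> C) : ccont g -> (forall s, econtinuous f (g s)) ->
  ccont (fun s => f (g s)).
Proof.
move=> cg cf s e e0; have [d d0 hd] := cf s e e0; have [d' d'0 hd'] := cg s d d0.
by exists d' => // t ht; apply: hd; apply: hd'.
Qed.

Lemma econt_comp (f g : C -> C) z : econtinuous g z -> econtinuous f (g z) -> econtinuous (fun w => f (g w)) z.
Proof.
move=> cg cf e e0; have [d d0 hd] := cf e e0; have [d' d'0 hd'] := cg d d0.
by exists d' => // t ht; apply: hd; apply: hd'.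
Qed.

Lemma econtM (f g : C -> C) z : econtinuous f z -> econtinuous g z -> econtinuous (fun w => f w * g w) z.
Proof.
by move=> h1 h2; apply/econtP; exact: (cvgM ((econtP f z).2 h1) ((econtP g z).2 h2)).
Qed.

Lemma econtD (f g : C -> C) z : econtinuous f z -> econtinuous g z -> econtinuous (fun w => f w + g w) z.
Proof.
by move=> h1 h2; apply/econtP; exact: (cvgD ((econtP f z).2 h1) ((econtP g z).2 h2)).
Qed.

Lemma econtV (f : C -> C) z : f z != 0 -> econtinuous f z -> econtinuous (fun w => (f w)^-1) z.
Proof. by move=> f0 h1; apply/econtP; exact: (cvgV f0 ((econtP f z).2 h1)). Qed.

Lemma econt_cst (a : C) z : econtinuous (fun=> a) z.
Proof. by move=> e e0; exists 1 => // w _; rewrite subrr cabs0. Qed.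

Lemma econt_id z : econtinuous (fun w => w) z.
Proof. by move=> e e0; exists e. Qed.

Lemma econt_moebius (A : 'M[R]_2) t : \det A = 1 -> up t -> econtinuous (moebius A) t.
Proof.
move=> dA t0; apply: (@econtM (fun t => (A 0 0)%:C * t + (A 0 1)%:C)).
  apply: (@econtD (fun t => (A 0 0)%:C * t)); last exact: econt_cst.
  by apply: econtM; [exact: econt_cst|exact: econt_id].
apply: (@econtV (den A)); first exact: den_neq0.
apply: (@econtD (fun t => (A 1 0)%:C * t)); last exact: econt_cst.
by apply: econtM; [exact: econt_cst|exact: econt_id].
Qed.

Lemma econt_sqrtc t : up t -> econtinuous (@sqrtc R) t.
Proof.
move=> t0; have [re0 _] := sqrtc_upper t0; move=> e e0.
exists (e * complex.Re (sqrtc t)); first exact: mulr_gt0.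
move=> w hw; have := le_lt_trans (sqrtc_dist w re0) hw.
by rewrite ltr_pM2r.
Qed.

Lemma up_near t : up t -> exists2 d : R, 0 < d & forall w, cabs (w - t) < d -> up w.
Proof.
move=> t0; exists (complex.Im t) => // w; move=> /(le_lt_trans (Im_le_cabs _)).
rewrite ImD ImN => h; have := ler_norm (complex.Im t - complex.Im w).
by rewrite distrC => h2; have := le_lt_trans h2 h; rewrite ltrBlDr ltrDl.
Qed.

Lemma econt_on_upper (f : C -> C) t : up t -> econtinuous f t -> econtinuous (on_upper f) t.
Proof.
move=> t0 cf e e0; have [d d0 hd] := cf e e0; have [d' d'0 hd'] := up_near t0.
exists (Num.min d d'); first by rewrite lt_min d0.
move=> w; rewrite lt_min => /andP[h1 h2].
by rewrite (on_upperE f (hd' w h2)) (on_upperE f t0); exact: hd.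
Qed.

Lemma holo_econt (f : C -> C) t : @holomorphic_on R (@upper R) f -> up t -> econtinuous f t.
Proof. by move=> h t0; apply/econtP; apply/differentiable_continuous/derivable1_diffP/h. Qed.

(* The difference quotient of [f] at [z] is [c / (f (z + h) + f z)]. *)
Lemma sqrt_holo (f : C -> C) (A : 'M[R]_2) : \det A = 1 -> (forall t, up t -> econtinuous f t) ->
  (forall t, up t -> f t ^+ 2 = den A t) -> @holomorphic_on R (@upper R) f.
Proof.
move=> dA cf f2 z z0; have z0' : up z by [].
have fn : f z != 0 by apply: contra_neq (den_neq0 dA z0') => h; rewrite -f2// h expr0n.
set c := (A 1 0)%:C; pose l := c / (2 * f z).
suff h : (fun h : C^o => h^-1 *: (((f : C^o -> C^o) \o shift (z : C^o)) (h *: (1 : C^o)) - f z)) @ 0^' --> (l : C^o).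
  by apply/cvg_ex; exists l.
apply/cvgrPdist_lt => e e0; have [r0 eE] := posC e0; set r := complex.Re e in r0 eE.
have m0 : 0 < cabs (f z) by rewrite cabs_gt0.
set m := cabs (f z) in m0.
pose q := Num.min m (r * m ^+ 2 / (cabs c + 1)).
have c1 : 0 < cabs c + 1 by rewrite ltr_wpDl ?cabs_ge0.
have q0 : 0 < q by rewrite lt_min m0 divr_gt0// mulr_gt0// exprn_gt0.
have [d d0 hd] := cf z z0' q q0; have [d' d'0 hd'] := up_near z0'.
have : \forall h \near (0 : C^o)^', `|h| < (Num.min d d')%:C.
  by apply: dnbhs0_lt; rewrite ltcR lt_min d0.
have : \forall h \near (0 : C^o)^', h != 0 by exact: nbhs_dnbhs_neq.
apply: filterS2 => h hn; rewrite ltC_real lt_min => /andP[h1 h2].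
rewrite /= eE ltC_real /shift /= -[h *: 1]/(h * 1) mulr1.
have wz : h + z - z = h by rewrite addrK.
have wu : up (h + z) by apply: hd'; rewrite wz.
have := hd (h + z); rewrite wz => /(_ h1); set F := f (h + z).
rewrite lt_min => /andP[g1 g2].
have F2 : F ^+ 2 - f z ^+ 2 = c * h.
  by rewrite !f2// /den; ring.
have s0 : F + f z != 0.
  apply: contraTneq g1 => e1; have -> : F = - f z by apply/eqP; rewrite -addr_eq0 e1.
  rewrite -opprD cabsN -leNgt -mulr2n -mulr_natl cabsM -/m.
  by rewrite (cabs_nat R 2) ler_peMl ?(ltW m0)// ler1n.
have sm : m <= cabs (F + f z).
  have e2 : 2 * f z = (F + f z) - (F - f z) by ring.
  have h5 : cabs (2 * f z) = 2 * m by rewrite cabsM (cabs_nat R 2).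
  have h4 := cabsB (F + f z) (F - f z); rewrite -e2 h5 in h4.
  have : m + m <= cabs (F + f z) + m.
    by rewrite -mulr2n -mulr_natl; apply: le_trans h4 _; rewrite lerD2l ltW.
  by rewrite lerD2r.
have E : l - h^-1 *: (F - f z) = l * ((F - f z) / (F + f z)).
  have hq : F - f z = c * h / (F + f z) by apply: (mulIf s0); rewrite divfK// -F2; ring.
  rewrite -[h^-1 *: _]/(h^-1 * _).
  have -> : h^-1 * (F - f z) = c / (F + f z) by apply: (mulfI hn); rewrite mulrA mulfV// mul1r hq; ring.
  by rewrite /l; field; rewrite fn s0.
rewrite E /l (cabsM (c / _)) (cabsM c) (cabsM (F - f z)) (cabsV (2 * f z)) (cabsV (F + f z)).
rewrite (cabsM 2) (cabs_nat R 2) -/m.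
have k0 : 0 < cabs (F + f z) := lt_le_trans m0 sm.
have n0 : 0 <= cabs c := cabs_ge0 _.
have v0 : 0 <= cabs (F - f z) := cabs_ge0 _.
move: g2; rewrite ltr_pdivlMr// => g2.
move: (cabs (F - f z)) (cabs (F + f z)) (cabs c) v0 k0 n0 sm g2 c1 => v k a v0 k0 a0 mk g2 _.
have -> : a / (2 * m) * (v / k) = (a * v) / (2 * m * k) by field; rewrite !gt_eqF.
rewrite ltr_pdivrMr; last by rewrite !mulr_gt0.
have : r * m ^+ 2 <= r * (m * k) by rewrite ler_pM2l// expr2 ler_pM2l.
have : 0 < r * (m * k) by rewrite !mulr_gt0.
have -> : r * (2 * m * k) = 2 * (r * (m * k)) by ring.
move: (r * (m * k)) (r * m ^+ 2) g2 => x y g2 x0 yx.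
by nra.
Qed.

End ComplexContinuity.

Section UpperPath.
Variable R : realType.
Local Notation C := R[i].

Definition hpath (t : C) (s : R) : C := (s * complex.Re t) +i* ((1 - s) ^+ 2 + s ^+ 2 * complex.Im t).

Lemma upper_path (t : C) : 0 < complex.Im t ->
  [/\ ccont (hpath t), forall s, 0 < complex.Im (hpath t s), hpath t 0 = 'i%C & hpath t 1 = t].
Proof.
move=> t0.
have ttE s : hpath t s = s%:C * (complex.Re t)%:C + 'i * ((1 - s%:C) ^+ 2 + s%:C ^+ 2 * (complex.Im t)%:C).
  apply: complex_eq; rewrite /hpath !expr2 !(ReM, ImM, ReD, ImD, ReN, ImN) /=; ring.
have tt0 s : 0 < complex.Im (hpath t s).
  rewrite /hpath /=; have [->|s0] := eqVneq s 0; first by rewrite subr0 expr1n expr0n mul0r addr0.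
  by rewrite ltr_wpDl ?sqr_ge0// mulr_gt0// exprn_even_gt0.
have ctt : ccont (hpath t).
  rewrite (_ : hpath t = fun s => s%:C * (complex.Re t)%:C + 'i * ((1 + (-1) * s%:C) ^+ 2 + s%:C ^+ 2 * (complex.Im t)%:C)).
    have c0 : ccont (fun s => (-1) * s%:C : C).
      by apply: (@ccontM R (fun=> -1) (fun s => s%:C)); [exact: ccont_cst|exact: ccont_id].
    have c1 : ccont (fun s => 1 + (-1) * s%:C : C).
      by apply: (@ccontD R (fun=> 1) (fun s => (-1) * s%:C)) => //; exact: ccont_cst.
    have c2 : ccont (fun s => s%:C ^+ 2 * (complex.Im t)%:C).
      apply: (@ccontM R (fun s => s%:C ^+ 2)); last exact: ccont_cst.
      by apply: (@ccontX R (fun s => s%:C) 2); exact: ccont_id.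
    have c3 : ccont (fun s => (1 + (-1) * s%:C) ^+ 2 + s%:C ^+ 2 * (complex.Im t)%:C).
      apply: (@ccontD R (fun s => (1 + (-1) * s%:C) ^+ 2)) => //.
      by apply: (@ccontX R (fun s => 1 + (-1) * s%:C) 2).
    apply: (@ccontD R (fun s => s%:C * (complex.Re t)%:C)).
      by apply: (@ccontM R (fun s => s%:C)); [exact: ccont_id|exact: ccont_cst].
    by apply: (@ccontM R (fun=> 'i)) => //; exact: ccont_cst.
  by apply/funext => s; rewrite ttE mulN1r.
split=> //.
  by apply: complex_eq; rewrite /hpath /= ?mul0r// subr0 expr1n expr0n mul0r addr0.
by rewrite /hpath; case: (t) => a b /=; rewrite !mul1r subrr expr0n expr1n add0r mul1r.
Qed.

End UpperPath.

(** * Generators of the metaplectic group *)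

Section Mp2Words.
Variable R : realType.
Local Notation C := R[i].
Local Notation mp2 := ('M[R]_2 * (C -> C))%type.
Local Notation up t := (0 < complex.Im t).
Implicit Types (g h : mp2).

Lemma Mp2Z_det g : Mp2Z g -> \det g.1 = 1. Proof. by move=> [[]]. Qed.
Lemma Mp2Z_sqr g t : Mp2Z g -> up t -> g.2 t ^+ 2 = den g.1 t.
Proof. by move=> [[_ _ h _] _]; apply: h. Qed.
Lemma Mp2Z_off g t : Mp2Z g -> ~ up t -> g.2 t = 0.
Proof. by move=> [[_ _ _ h] _]; apply: h. Qed.
Lemma Mp2Z_econt g t : Mp2Z g -> up t -> econtinuous g.2 t.
Proof. by move=> [[_ h _ _] _]; apply: holo_econt. Qed.
Lemma Mp2Z_neq0 g t : Mp2Z g -> up t -> g.2 t != 0.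
Proof.
move=> hg t0; have := den_neq0 (Mp2Z_det hg) t0; apply: contra_neq => h.
by rewrite -(Mp2Z_sqr hg t0) h expr0n.
Qed.

(** A continuous square root of c t + d is holomorphic by [sqrt_holo], so membership reduces to
    continuity. *)
Lemma Mp2Z_mk (A : 'M[int]_2) (f : C -> C) : \det A = 1 ->
  (forall t, up t -> econtinuous f t) ->
  (forall t, up t -> f t ^+ 2 = den (map_mx intr A) t) -> (forall t, ~ up t -> f t = 0) ->
  Mp2Z (map_mx intr A, f).
Proof.
move=> dA cf f2 f0; have dR : \det (map_mx intr A : 'M[R]_2) = 1 by rewrite det_map_mx dA.
by split; [split=> //=; exact: sqrt_holo dR cf f2|exists A].
Qed.

Lemma Mp2Z_mul g h : Mp2Z g -> Mp2Z h -> Mp2Z (mp_mul g h).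
Proof.
move=> hg hh; have [_ [A [dA gA]]] := hg; have [_ [B [dB hB]]] := hh.
have dg := Mp2Z_det hg; have dh := Mp2Z_det hh.
rewrite /mp_mul gA hB -map_mxM -hB; apply: Mp2Z_mk.
- by rewrite det_mulmx dA dB.
- move=> t t0; apply: econt_on_upper => //; apply: econtM; last exact: Mp2Z_econt.
  apply: econt_comp; first exact: econt_moebius.
  by apply: Mp2Z_econt => //; apply: Im_moebius.
- move=> t t0; rewrite on_upperE// exprMn (Mp2Z_sqr hh t0) (Mp2Z_sqr hg (Im_moebius dh t0)).
  by rewrite map_mxM -gA -hB den_mul.
by move=> t /negP/negbTE; rewrite /on_upper => ->.
Qed.

Definition mk2 (S : pzRingType) (a b c d : S) : 'M[S]_2 :=
  \matrix_(i, j) (if i == 0 then (if j == 0 then a else b) else if j == 0 then c else d).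

Lemma mk2_map (a b c d : int) : map_mx intr (mk2 a b c d) = mx22 a%:~R b%:~R c%:~R d%:~R :> 'M[R]_2.
Proof. by apply/matrixP => i j; rewrite !mxE; case: ifP => _; case: ifP. Qed.

Lemma mk2_eta (S : pzRingType) (A : 'M[S]_2) : A = mk2 (A 0 0) (A 0 1) (A 1 0) (A 1 1).
Proof.
apply/matrixP => i j; rewrite mxE; case: (eqVneq i 0) => [->|i0]; case: (eqVneq j 0) => [->|j0] //.
- by congr (A _ _); apply: val_inj; case: j j0 => [[|[|]]].
- by congr (A _ _); apply: val_inj; case: i i0 => [[|[|]]].
by congr (A _ _); apply: val_inj; [case: i i0 => [[|[|]]]|case: j j0 => [[|[|]]]].
Qed.

Lemma det_mk2 (S : comPzRingType) (a b c d : S) : \det (mk2 a b c d) = a * d - b * c.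
Proof.
rewrite (expand_det_row _ 0) big_ord_recl big_ord1 /cofactor !det_mx11 !mxE /= expr0 expr1 mul1r.
by rewrite mulN1r mulrN.
Qed.

Lemma den_mx22 (a b c d : R) t : den (mx22 a b c d) t = c%:C * t + d%:C.
Proof. by rewrite /den !mxE. Qed.

Lemma Mp2Z_one : Mp2Z (@mp_one R).
Proof.
have := @Mp2Z_mk (mk2 1 0 0 1) (on_upper (fun=> 1)).
have -> : map_mx intr (mk2 1 0 0 1 : 'M[int]_2) = 1%:M :> 'M[R]_2.
  by rewrite [RHS]mk2_eta mk2_map !mxE.
apply; first by rewrite det_mk2 mulr0 subr0 mulr1.
- by move=> t t0; apply: econt_on_upper => //; apply: econt_cst.
- by move=> t t0; rewrite on_upperE// expr1n /den !mxE /= mul0r add0r.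
by move=> t /negP/negbTE; rewrite /on_upper => ->.
Qed.

Lemma Mp2Z_S : Mp2Z (@mpS R).
Proof.
have := @Mp2Z_mk (mk2 0 (-1) 1 0) (on_upper (@sqrtc R)); rewrite mk2_map; apply.
- by rewrite det_mk2 mul0r mulN1r sub0r opprK.
- by move=> t t0; apply: econt_on_upper => //; apply: econt_sqrtc.
- by move=> t t0; rewrite on_upperE// sqr_sqrtc den_mx22 mul1r addr0.
by move=> t /negP/negbTE; rewrite /on_upper => ->.
Qed.

Lemma Mp2Z_T : Mp2Z (@mpT R).
Proof.
have := @Mp2Z_mk (mk2 1 1 0 1) (on_upper (fun=> 1)); rewrite mk2_map; apply.
- by rewrite det_mk2 mulr0 subr0 mulr1.
- by move=> t t0; apply: econt_on_upper => //; apply: econt_cst.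
- by move=> t t0; rewrite on_upperE// expr1n den_mx22 mul0r add0r.
by move=> t /negP/negbTE; rewrite /on_upper => ->.
Qed.

Lemma word_Mp2Z g : word g -> Mp2Z g.
Proof.
elim=> [|h _ hh|h _ hh]; first exact: Mp2Z_one.
  exact: Mp2Z_mul Mp2Z_S hh.
exact: Mp2Z_mul Mp2Z_T hh.
Qed.

Lemma mx22M (a b c d a' b' c' d' : R) : mx22 a b c d *m mx22 a' b' c' d' =
  mx22 (a * a' + b * c') (a * b' + b * d') (c * a' + d * c') (c * b' + d * d').
Proof.
rewrite -[LHS]/(mk2 a b c d *m mk2 a' b' c' d') [LHS]mk2_eta.
by rewrite /mk2 !mxE !big_ord_recl !big_ord0 !mxE /= !addr0.
Qed.

Lemma word_exists (A : 'M[int]_2) : \det A = 1 -> exists2 g : mp2, word g & g.1 = map_mx intr A.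
Proof.
pose Q (a b c d : int) := exists2 g : mp2, word g & g.1 = mx22 a%:~R b%:~R c%:~R d%:~R :> 'M[R]_2.
have Q1 : Q 1 0 0 1.
  exists (@mp_one R); first exact: word1.
  by rewrite -mk2_map [LHS]mk2_eta mk2_map !mxE.
have QS a b c d : Q a b c d -> Q (- c) (- d) a b.
  move=> [g wg e]; exists (mp_mul (@mpS R) g); first exact: wordS.
  by rewrite /= e mx22M !mul0r !mulN1r !mul1r !addr0 !add0r !rmorphN.
have QT a b c d : Q a b c d -> Q (a + c) (b + d) c d.
  move=> [g wg e]; exists (mp_mul (@mpT R) g); first exact: wordT.
  by rewrite /= e mx22M !mul0r !mul1r !add0r !rmorphD.
rewrite [A]mk2_eta det_mk2 => dA; rewrite mk2_map.
exact: SL2_words Q1 QS QT _ _ _ _ dA.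
Qed.

Lemma Mp2Z_word h : Mp2Z h -> word h.
Proof.
move=> hh; have [_ [A [dA hA]]] := hh; have [g wg gA] := word_exists dA.
have hg := word_Mp2Z wg; have dg := Mp2Z_det hg.
(* Over one matrix the quotient of the two factors squares to 1 and is continuous along the path
   from i to t, so agreement at i suffices. *)
have key (k : mp2) : Mp2Z k -> k.1 = h.1 -> h.2 'i%C = k.2 'i%C -> h = k.
  move=> hk e ei; rewrite [h]surjective_pairing [k]surjective_pairing e; congr pair.
  apply/funext => t; have [t0|/negP tn] := boolP (up t); last first.
    by rewrite (Mp2Z_off hh tn) (Mp2Z_off hk tn).
  have [ctt tt0 e0 e1] := upper_path t0.
  set tt := hpath t in ctt tt0 e0 e1.
  pose f s := h.2 (tt s) * (k.2 (tt s))^-1.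
  have kn s := Mp2Z_neq0 hk (tt0 s).
  suff f1 : f 1 = 1.
    by apply: (mulIf (invr_neq0 (kn 1))); rewrite -{1}e1 -/(f 1) f1 -[in RHS]e1 mulfV.
  apply: sqr1_path_const.
  - apply: ccontM; first by apply: econt_ccont => // s; apply: Mp2Z_econt.
    by apply: ccontV => //; apply: econt_ccont => // s; apply: Mp2Z_econt.
  - by move=> s; rewrite exprMn exprVn (Mp2Z_sqr hh (tt0 s)) (Mp2Z_sqr hk (tt0 s)) e mulfV// den_neq0// -e (Mp2Z_det hk).
  by rewrite /f e0 ei mulfV// -e0.
have gh : g.1 = h.1 by rewrite gA hA.
have : h.2 'i%C ^+ 2 = g.2 'i%C ^+ 2.
  by rewrite (Mp2Z_sqr hh (i_upper R)) (Mp2Z_sqr hg (i_upper R)) gh.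
move/eqP; rewrite eqf_sqr => /orP[/eqP ei|/eqP ei]; first by rewrite (key g).
have wn := word_neg dg (fun t => Mp2Z_off hg (t := t)) wg.
by rewrite (key (neg g) (word_Mp2Z wn)).
Qed.

End Mp2Words.

(** * Dual representations and reduction to generators *)

Section DualRepresentation.
Variables (R : realType) (P : lattice).
Local Notation C := R[i].
Local Notation D := (discr R P).
Local Notation CD := {ffun D -> C^o}.
Local Notation mp2 := ('M[R]_2 * (C -> C))%type.
Local Notation up t := (0 < complex.Im t).
Implicit Types (f u V : CD) (g h : mp2) (d : D).

Lemma pairing_basis d u : pairing (dbasis d) u = u d.
Proof.
rewrite /pairing (bigD1 d)//= ffunE eqxx mul1r big1 ?addr0// => c cd.
by rewrite ffunE (negbTE cd) mul0r.
Qed.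

Lemma ffun_basis f : f = \sum_d (f d : C) *: dbasis d.
Proof.
apply/ffunP => c; rewrite sum_ffunE.
have e d : ((f d : C) *: dbasis d) c = f d * (c == d)%:R by rewrite ffunE /dbasis ffunE.
rewrite (eq_bigr _ (fun d _ => e d)) (bigD1 c isT) eqxx mulr1 big1 => [|d dc]; first exact: esym (addr0 _).
by rewrite eq_sym (negbTE dc) mulr0.
Qed.

Lemma pairing_sum (I : finType) (a : I -> C) (F : I -> CD) u :
  pairing (\sum_i a i *: F i) u = \sum_i a i * pairing (F i) u.
Proof.
rewrite /pairing; transitivity (\sum_c \sum_i a i * (F i c * u c)).
  apply: eq_bigr => c _; rewrite sum_ffunE mulr_suml; apply: eq_bigr => i _.
  by rewrite ffunE -[(a i *: F i c) * u c]/((a i * F i c) * u c) mulrA.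
by rewrite exchange_big; apply: eq_bigr => i _; rewrite mulr_sumr.
Qed.

Variable rho : mp2 -> 'End(CD).

Lemma pairing_lin (phi : 'End(CD)) f u : pairing (phi f) u = \sum_d f d * pairing (phi (dbasis d)) u.
Proof.
rewrite {1}(ffun_basis f) linear_sum -pairing_sum; congr pairing.
by apply: eq_bigr => d _; rewrite linearZ.
Qed.

Lemma pairing_dual f g u : pairing f (dual_rep rho g u) = pairing ((rho g)^-1%VF f) u.
Proof. by rewrite pairing_lin; apply: eq_bigr => d _; rewrite ffunE. Qed.

(** [dual_rep] is defined with the inverse of [rho g], which is a true left inverse when the kernel
    is trivial. Testing against [rho g] of the basis removes it. *)
Lemma dual_law g (a : C) V V' : lker (rho g) == 0%VS ->
  (forall d, pairing (rho g (dbasis d)) V' = a * V d) -> V' = a *: dual_rep rho g V.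
Proof.
move=> k H; have H2 f : pairing (rho g f) V' = a * pairing f V.
  rewrite pairing_lin /pairing mulr_sumr; apply: eq_bigr => d _.
  by rewrite -/(pairing _ _) H mulrCA.
apply/ffunP => d; rewrite !ffunE -[LHS]pairing_basis -{1}(lker0_lfunVK k (dbasis d)).
exact: H2.
Qed.

Lemma dual_law_inv g (a : C) V V' : lker (rho g) == 0%VS -> V' = a *: dual_rep rho g V ->
  forall d, pairing (rho g (dbasis d)) V' = a * V d.
Proof.
move=> k -> d; transitivity (a * pairing (rho g (dbasis d)) (dual_rep rho g V)).
  rewrite /pairing mulr_sumr; apply: eq_bigr => c _; rewrite [in LHS]ffunE.
  by rewrite -[a *: _]/(a * _) mulrCA.
by rewrite pairing_dual (lker0_lfunK k) pairing_basis.
Qed.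

Variables (bp bm : nat).
Hypothesis rhoP : is_weil_rep bp bm rho.

(** S^4 = (1, -1) has square 1, so the homomorphism property makes the eighth power of rho (S) the
    identity. *)
Lemma rho_S_inj : lker (rho (@mpS R)) == 0%VS.
Proof.
case: rhoP => r1 rm _ _; have h1 := @Mp2Z_one R; have hS := @Mp2Z_S R.
apply/lker0P => x y /eqP; rewrite -subr_eq0 -linearB => /eqP e; apply/eqP; rewrite -subr_eq0.
set z := x - y in e *.
have s4 g : Mp2Z g -> rho (mp_mul (@mpS R) (mp_mul (@mpS R) (mp_mul (@mpS R) (mp_mul (@mpS R) g)))) =
    (rho (@mpS R) \o (rho (@mpS R) \o (rho (@mpS R) \o (rho (@mpS R) \o rho g))))%VF.
  move=> hg; have k1 := Mp2Z_mul hS hg; have k2 := Mp2Z_mul hS k1; have k3 := Mp2Z_mul hS k2.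
  by rewrite !rm.
have hn g : Mp2Z g -> Mp2Z (neg g).
  move=> hg; rewrite -S4_neg; [|exact: Mp2Z_det|by move=> t; apply: Mp2Z_off].
  by do 4 apply: Mp2Z_mul => //.
have e1 := s4 _ h1; have e2 := s4 _ (hn _ h1).
have nn : neg (neg (@mp_one R)) = @mp_one R.
  by rewrite /neg /=; congr pair; apply/funext => t; rewrite opprK.
rewrite S4_neg in e1; [|exact: Mp2Z_det|by move=> t; apply: Mp2Z_off].
rewrite S4_neg in e2; [|exact: (Mp2Z_det (hn _ h1))|by move=> t; apply: (Mp2Z_off (hn _ h1))].
rewrite nn e1 r1 in e2.
have := congr1 (fun phi : 'End(CD) => phi z) e2; rewrite !comp_lfunE !id_lfunE e !linear0 => ->.
exact: eqxx.
Qed.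

Lemma rho_T_inj : lker (rho (@mpT R)) == 0%VS.
Proof.
case: rhoP => _ _ rT _; apply/lker0P => x y /eqP; rewrite -subr_eq0 -linearB => /eqP e.
apply/eqP; rewrite -subr_eq0; set z := x - y in e *; apply/eqP/ffunP => d; rewrite [RHS]ffunE.
have := congr1 (fun f => pairing f (dbasis d)) e; rewrite pairing_lin.
have -> : pairing (0 : CD) (dbasis d) = 0 by rewrite /pairing big1// => c _; rewrite ffunE mul0r.
rewrite (bigD1 d)//= big1 => [|c cd]; last first.
  rewrite rT /pairing big1 ?mulr0// => a _; rewrite !ffunE; case: (eqVneq a d) => [->|_]; last by rewrite mulr0.
  by rewrite eq_sym (negbTE cd) -[_ *: _]/(_ * _) mulr0 mul0r.
rewrite addr0 rT /pairing (bigD1 d)//= big1 => [|a ad]; last by rewrite !ffunE (negbTE ad) mulr0.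
rewrite !ffunE eqxx addr0 mulr1 -[_ *: _]/(_ * _) mulr1 => /eqP.
by rewrite mulf_eq0 (negbTE (ebf_neq0 _)) orbF => /eqP.
Qed.

Lemma lker_comp (f g : 'End(CD)) : lker f == 0%VS -> lker g == 0%VS -> lker (f \o g)%VF == 0%VS.
Proof.
move=> /lker0P hf /lker0P hg; apply/lker0P => x y; rewrite !comp_lfunE => /hf/hg; exact.
Qed.

Lemma rho_word_inj g : word g -> lker (rho g) == 0%VS.
Proof.
case: rhoP => r1 rm _ _; elim=> [|h wh IH|h wh IH].
- by rewrite r1; apply/lker0P => x y; rewrite !id_lfunE.
- by rewrite rm; [apply: lker_comp rho_S_inj IH|exact: Mp2Z_S|exact: word_Mp2Z].
by rewrite rm; [apply: lker_comp rho_T_inj IH|exact: Mp2Z_T|exact: word_Mp2Z].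
Qed.

Lemma dual_rep_mul g h u : Mp2Z g -> Mp2Z h ->
  dual_rep rho (mp_mul g h) u = dual_rep rho g (dual_rep rho h u).
Proof.
move=> hg hh; have wg := Mp2Z_word hg; have wh := Mp2Z_word hh.
have kg := rho_word_inj wg; have kh := rho_word_inj wh.
have kgh : lker (rho (mp_mul g h)) == 0%VS by apply: rho_word_inj; apply: Mp2Z_word; apply: Mp2Z_mul.
apply: esym; rewrite -[RHS]scale1r; apply: dual_law => // d.
case: rhoP => _ rm _ _; rewrite (rm _ _ hg hh) comp_lfunE (pairing_dual _ g) (lker0_lfunK kg).
by rewrite (pairing_dual _ h) (lker0_lfunK kh) pairing_basis mul1r.
Qed.

Lemma dual_rep_one u : dual_rep rho (@mp_one R) u = u.
Proof.
have k := rho_word_inj (word1 R); apply: esym; rewrite -[RHS]scale1r; apply: dual_law => // d.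
by case: rhoP => -> _ _ _; rewrite id_lfunE pairing_basis mul1r.
Qed.

Lemma dual_repZ g (a : C) u : dual_rep rho g (a *: u) = a *: dual_rep rho g u.
Proof.
apply/ffunP => d; rewrite !ffunE /pairing.
rewrite -[RHS]/(a * \sum_c ((rho g)^-1)%VF (dbasis d) c * u c) mulr_sumr.
by apply: eq_bigr => c _; rewrite ffunE -[a *: _]/(a * _); exact: mulrCA.
Qed.

(** Induction on words: the leftmost letter acts at the point moved by the rest of the word, and the
    automorphy factors multiply by the cocycle rule. *)
Lemma modular_of_generators (k : int) (W : C -> CD) :
  (forall t, up t -> W (- t^-1) = (sqrtc t ^ k) *: dual_rep rho (@mpS R) (W t)) ->
  (forall t, up t -> W (t + 1) = dual_rep rho (@mpT R) (W t)) ->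
  modular k (dual_rep rho) W.
Proof.
move=> hS hT g /Mp2Z_word; elim=> [|h wh IH|h wh IH] t t0.
- rewrite moebius_1 dual_rep_one.
  have -> : (@mp_one R).2 t = 1 by exact: on_upperE.
  by rewrite exp1rz scale1r.
- have hh := word_Mp2Z wh; have dh := Mp2Z_det hh.
  have u0 : up (moebius h.1 t) by apply: Im_moebius.
  have e2 : (mp_mul (@mpS R) h).2 t = sqrtc (moebius h.1 t) * h.2 t.
    by rewrite /mp_mul [LHS](on_upperE _ t0); congr (_ * _); exact: on_upperE.
  rewrite dual_rep_mul; [|exact: Mp2Z_S|exact: hh].
  have e1 : moebius (mp_mul (@mpS R) h).1 t = - (moebius h.1 t)^-1.
    by rewrite -moebius_S -moebius_mul//; exact: det_S.
  by rewrite e1 e2 (hS _ u0) (IH _ t0) dual_repZ expfzMl scalerA.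
have hh := word_Mp2Z wh; have dh := Mp2Z_det hh.
have u0 : up (moebius h.1 t) by apply: Im_moebius.
have e2 : (mp_mul (@mpT R) h).2 t = h.2 t.
  rewrite /mp_mul [LHS](on_upperE _ t0) -[RHS]mul1r; congr (_ * _); exact: on_upperE.
rewrite dual_rep_mul; [|exact: Mp2Z_T|exact: hh].
have e1 : moebius (mp_mul (@mpT R) h).1 t = moebius h.1 t + 1.
  by rewrite -moebius_T -moebius_mul//; exact: det_T.
by rewrite e1 e2 (hT _ u0) (IH _ t0) dual_repZ.
Qed.

Lemma pairing_scale (a : C) u V : pairing (a *: u) V = a * pairing u V.
Proof.
by rewrite /pairing mulr_sumr; apply: eq_bigr => c _; rewrite ffunE -[a *: _]/(a * _) mulrA.
Qed.

Lemma weil_S_pairing d V : pairing (rho (@mpS R) (dbasis d)) V =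
  (ebf ((bm%:R - bp%:R) / 8)%:C / (Num.sqrt #|{: D}|%:R)%:C) * \sum_h ebf (- dbil d h)%:C * V h.
Proof.
case: rhoP => _ _ _ ->; rewrite pairing_scale pairing_sum; congr (_ * _).
by apply: eq_bigr => c _; rewrite pairing_basis.
Qed.

Lemma weil_T_pairing d V : pairing (rho (@mpT R) (dbasis d)) V = ebf (dquad d)%:C * V d.
Proof. by case: rhoP => _ _ -> _; rewrite pairing_scale pairing_basis. Qed.

End DualRepresentation.

(** * The theta contraction as a sum over the glue group *)

Section ContractionSum.
Variables (R : realType) (L : lattice) (M N : sublattice L).
Hypothesis perpN : is_orth_complement M N.
Local Notation C := R[i].
Local Notation GM := (gramR R M).
Local Notation GN := (gramR R N).
Local Notation EM := (embR R M).
Local Notation EN := (embR R N).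
Local Notation DM := (discr R M).
Local Notation DN := (discr R N).
Local Notation DL := (discr R L).
Local Notation X := (dual_mod R M).
Local Notation glue := (@glue R L M N).
Variables (w : decomp R (rank N)) (p : mpoly.mpoly (rank N) C) (t : C).
Hypothesis wP : Gr GN w.
Hypothesis t0 : 0 < complex.Im t.
Local Notation term := (theta_term GN w p t).
Implicit Types (d : DM) (f : DL -> C).

Lemma Fext_bound f z : cabs (Fext f z) <= \sum_g cabs (f g).
Proof.
rewrite /Fext; apply: le_trans (cabs_sum _ _) _; apply: ler_sum => g _.
rewrite (cabsM _ (f g)); case: (_ \is a _); last by rewrite cabs0 mul0r cabs_ge0.
by rewrite (cabs_nat R 1) mul1r.
Qed.

Definition coset_fun d f (x : 'rV[R]_(rank N)) : C := term x * Fext f (drepr d *m EM + x *m EN).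

Lemma tsum_coset_fun d f : asum (fun x : dual R N => coset_fun d f x) /\
  tsum (fun x : dual R N => coset_fun d f x) =
  \sum_(c : DN) thsum w p t c * Fext f (glue (d, c)).
Proof.
have e (c : DN) (k : 'rV[int]_(rank N)) : Fext f (drepr d *m EM + (iv R k + drepr c) *m EN) = Fext f (glue (d, c)).
  apply: Fext_congr; rewrite /glue /= mulmxDl.
  have -> : forall a b c' : 'rV[R]_(rank L), a + (b + c') - (a + c') = b.
    by move=> a b c'; rewrite addrCA addrK.
  by apply: EN_int; apply: iv_int.
have at0 c := asum_theta_term (gramR_sym R N) wP p (dual_val (drepr c)) t0.
have a1 c : asum (fun k : 'rV[int]_(rank N) => coset_fun d f (iv R k + drepr c)).
  have := asumZ (Fext f (glue (d, c))) (at0 c); apply: asum_le => k.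
  by rewrite /coset_fun e mulrC.
have [a2 ->] := tsum_dual a1; split=> //; apply: eq_bigr => c _.
rewrite [RHS]mulrC /thsum -tsumZ; last exact: at0.
by apply: eq_tsum => k; rewrite /coset_fun e mulrC.
Qed.

Lemma mrepr_eq (x y : X) : sub_pred M (mrepr x - mrepr y) -> x = y.
Proof.
move=> h; rewrite -[x]reprK -[y]reprK; apply/eqP.
by rewrite -Quotient.idealrBE.
Qed.

Lemma mrepr_pi (l : dual R L) : sub_pred M (mrepr (\pi_({ideal_quot (@sub_pred R L M)})%qT l : X) - l).
Proof.
have : (repr (\pi_({ideal_quot (@sub_pred R L M)})%qT l) == l %[mod {ideal_quot (@sub_pred R L M)}])%qT.
  by rewrite reprK.
by rewrite -Quotient.idealrBE.
Qed.

Lemma sub_predP (l : dual R L) : sub_pred M l <-> exists z, dual_val l = iv R z *m EM.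
Proof.
split=> [/asboolP[z e]|[z e]]; first by exists z; rewrite e map_mxM.
by apply/asboolP; exists z; rewrite map_mxM.
Qed.

Lemma proj_dual (P : sublattice L) (l : dual R L) : dual_val (dual_proj P l) = orth_proj P l.
Proof. by []. Qed.

(** Within the fibre over d, a class modulo M is determined by its projection to N, and a dual
    vector x of N occurs exactly when it glues with the representative of d. [Fext] vanishes at the
    other x, so the sum extends over the whole dual of N. *)
Lemma tsum_contract d f :
  asum (fun x : X => if piM x == d then term (orth_proj N (mrepr x)) * f (dclass (mrepr x)) else 0) /\
  tsum (fun x : X => if piM x == d then term (orth_proj N (mrepr x)) * f (dclass (mrepr x)) else 0) =
  \sum_(c : DN) thsum w p t c * Fext f (glue (d, c)).
Proof.
set psi := fun x : X => _; have [aphi <-] := tsum_coset_fun d f.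
(* Both sums are pulled back to the fibre [J]: [h1] includes it into the classes and [h2] projects
   it to N. *)
pose J : choiceType := {x : X | piM x == d}.
pose h1 (x : J) : X := val x.
pose h2 (x : J) : dual R N := dual_proj N (mrepr (val x)).
have i1 : injective h1 by exact: val_inj.
have xd (x : X) : piM x == d -> orth_proj M (mrepr x) - drepr d \is a mxOver Num.int.
  by rewrite -proj_dual -dclass_eq dreprK.
have i2 : injective h2.
  move=> [x hx] [y hy] e; apply: val_inj => /=; apply: mrepr_eq.
  have e1 : orth_proj N (mrepr x) = orth_proj N (mrepr y) := congr1 (@dual_val R N) e.
  have : orth_proj M (mrepr x) - orth_proj M (mrepr y) \is a mxOver Num.int.
    have -> : orth_proj M (mrepr x) - orth_proj M (mrepr y) =
      (orth_proj M (mrepr x) - drepr d) - (orth_proj M (mrepr y) - drepr d) by rewrite opprB addrA subrK.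
    by apply: intB; apply: xd.
  move=> /ivP[z ez]; apply/sub_predP; exists z; rewrite -ez mulmxBl.
  rewrite -[LHS]/(dual_val (mrepr x) - dual_val (mrepr y)).
  rewrite {1}(proj_split perpN (dual_val (mrepr x))) {1}(proj_split perpN (dual_val (mrepr y))) e1.
  by rewrite opprD addrACA subrr addr0.
have s1 x : (forall j, h1 j <> x) -> psi x = 0.
  move=> H; rewrite /psi; case: ifP => // hx; case: (H (exist _ x hx)) => //.
have s2 (x : dual R N) : (forall j, h2 j <> x) -> coset_fun d f x = 0.
  move=> H; rewrite /coset_fun; have [hd|hd] := boolP (drepr d *m EM + dual_val x *m EN \in @dual_pred R L); last first.
    by rewrite Fext_notdual ?mulr0.
  pose l := todual (drepr d *m EM + dual_val x *m EN).
  pose y : X := \pi_({ideal_quot (@sub_pred R L M)})%qT l.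
  have [z ez] := (sub_predP _).1 (mrepr_pi l).
  have yE : dual_val (mrepr y) = (dual_val (drepr d) + iv R z) *m EM + dual_val x *m EN.
    have -> : dual_val (mrepr y) = dual_val (mrepr y - l) + dual_val l.
      by rewrite -dual_valD subrK.
    by rewrite ez todualK// mulmxDl addrA [iv R z *m EM + _]addrC.
  have hy : piM y == d.
    rewrite -[d]dreprK dclass_eq proj_dual yE proj_M//.
    by rewrite addrAC subrr add0r iv_int.
  case: (H (exist _ y hy)); apply: dual_inj; rewrite /h2 /= yE proj_N//.
have eq12 j : psi (h1 j) = coset_fun d f (h2 j).
  case: j => x hx; rewrite /psi /h1 /h2 /= hx /coset_fun; congr (_ * _).
  rewrite -Fext_dual; apply: Fext_congr.
  rewrite {1}(proj_split perpN (dual_val (mrepr x))).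
  have -> : forall a b c : 'rV[R]_(rank L), a + b - (c + b) = a - c.
    by move=> a b c; rewrite opprD addrACA subrr addr0.
  by rewrite -mulmxBl; apply: EM_int; apply: xd.
have a2 := (asum_reindex i2 s2).1 aphi.
have a1 : asum (fun j => psi (h1 j)).
  by move: a2; apply: asum_le => j; rewrite eq12.
have apsi := (asum_reindex i1 s1).2 a1.
split=> //; rewrite (tsum_reindex i1 s1 apsi) (tsum_reindex i2 s2 aphi).
exact: eq_tsum.
Qed.

Lemma contractionE bm cm mm nm (F : C -> {ffun DL -> C^o}) d :
  theta_contraction M bm cm mm nm w p F t d =
  Wsum w p ((bm%:R - cm%:R) / 2 + mm%:R - nm%:R) (F t) t d.
Proof.
rewrite /theta_contraction /pairing_sub ffunE /Wsum.
set Y := (_ `^ _)%:C.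
have e1 (g : DL) : theta_sub M bm cm mm nm w p t (g, d) = Y * \sum_(c : DN) thsum w p t c * (hits g (d, c))%:R.
  rewrite /theta_sub ffunE -/Y; congr (_ * _).
  transitivity (\sum_(d' : DM) \sum_(c : DN) thsum w p t c * ((hits g (d', c))%:R * (d == d')%:R) : C).
    apply: eq_bigr => d' _.
    (* The coefficient at (g, d) is the sum for the indicator function of g, times the indicator of
       d = d' from the second tensor factor. *)
    have [a e] := tsum_contract d' (fun h => (g == h)%:R * (d == d')%:R).
    rewrite (_ : (fun x : X => _) = (fun x : X => if piM x == d' then
      term (orth_proj N (mrepr x)) * ((g == dclass (mrepr x))%:R * (d == d')%:R) else 0 : C^o)); last first.
      by apply/funext => x; case: ifP => // _; rewrite !ffunE.
    rewrite summability_sum// e; apply: eq_bigr => c _; congr (_ * _).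
    rewrite /Fext (bigD1 g)//= eqxx mul1r big1 ?addr0// => h hg.
    by rewrite eq_sym (negbTE hg) mul0r mulr0.
  rewrite (bigD1 d)//= eqxx [X in _ + X]big1 => [|d' dd]; last first.
    by apply: big1 => c _; rewrite eq_sym (negbTE dd) !mulr0.
  by rewrite addr0; apply: eq_bigr => c _; rewrite mulr1.
transitivity (\sum_(g : DL) \sum_(c : DN) Y * thsum w p t c * ((hits g (d, c))%:R * F t g)).
  apply: eq_bigr => g _; rewrite e1 mulr_sumr mulr_suml; apply: eq_bigr => c _.
  by rewrite -!mulrA.
by rewrite exchange_big; apply: eq_bigr => c _; rewrite Fext_sum mulr_sumr.
Qed.

End ContractionSum.

(** * Splitting along M and its orthogonal complement *)

Section Signature.
Variables (R : realType) (n : nat) (Q : 'M[R]_n).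
Implicit Types v : decomp R n.

Lemma dim_rV : \dim {:'rV[R]_n} = n.
Proof. by rewrite dimvf /dim /= mul1n. Qed.

Lemma Gr_dim v : Gr Q v -> (\dim v.1 + \dim v.2)%N = n.
Proof. by case=> hf hi _ _ _; rewrite -dimv_disjoint_sum// hf dim_rV. Qed.

(** Sylvester's argument: a positive subspace meets a negative one only in 0, so their dimensions
    add up to at most n. *)
Lemma Gr_dim_le v v' : Gr Q v -> Gr Q v' -> (\dim v.1 <= \dim v'.1)%N.
Proof.
move=> hv hv'; have e' := Gr_dim hv'.
have h0 : (v.1 :&: v'.2 = 0)%VS.
  apply/eqP; rewrite -subv0; apply/subvP => x; rewrite memv_cap memv0 => /andP[x1 x2].
  apply: contraT => x0; case: hv => _ _ hp _ _; case: hv' => _ _ _ hm _.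
  by have := lt_trans (hp _ x1 x0) (hm _ x2 x0); rewrite ltxx.
have := dimvS (subvf (v.1 + v'.2)); rewrite (dimv_disjoint_sum h0) dim_rV => h.
by rewrite -(leq_add2r (\dim v'.2)) e'.
Qed.

Lemma Gr_dim_eq v v' : Gr Q v -> Gr Q v' -> \dim v.1 = \dim v'.1 /\ \dim v.2 = \dim v'.2.
Proof.
move=> hv hv'; have e1 : \dim v.1 = \dim v'.1 by apply/eqP; rewrite eqn_leq !Gr_dim_le.
split=> //; have := Gr_dim hv; have := Gr_dim hv'; lia.
Qed.

(** The exponents of the inversion law are ranks of the projection matrix; this connects them to the
    signature. *)
Lemma rank_Pp v : Gr Q v -> \rank (Pp v) = \dim v.1.
Proof.
move=> hv; pose b := vbasis v.1.
pose X : 'M[R]_(\dim v.1, n) := \matrix_(i < \dim v.1) b`_i.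
have bv i : (i < \dim v.1)%N -> b`_i \in v.1.
  by move=> hi; apply: vbasis_mem; apply: mem_nth; rewrite size_tuple.
have uX (u : 'rV_(\dim v.1)) : u *m X = \sum_i u 0 i *: b`_i.
  by rewrite mulmx_sum_row; apply: eq_bigr => i _; rewrite rowK.
have rX : row_free X.
  apply: inj_row_free => u; rewrite uX => h; apply/rowP => i; rewrite [RHS]mxE.
  have /freeP fb : free b by apply: (basis_free (vbasisP v.1)).
  exact: fb.
have e : (Pp v :=: X)%MS.
  apply/eqmxP/andP; split; apply/row_subP => i.
    rewrite rowE -projpE (coord_vbasis (projp_in v (delta_mx 0 i))).
    by apply/submxP; exists (\row_j coord b j (projp v (delta_mx 0 i))); rewrite uX; apply: eq_bigr => j _; rewrite mxE.
  have <- : row i X *m Pp v = row i X.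
    rewrite -projpE rowK; case: hv => _ hi _ _ _; apply: daddv_pi_id => //; exact: bv.
  exact: submxMl.
by rewrite e; apply/eqP.
Qed.

End Signature.

Section OrthogonalSum.
Variables (R : realType) (L : lattice) (M N : sublattice L).
Hypothesis perpN : is_orth_complement M N.
Local Notation G := (gramR R L).
Local Notation GM := (gramR R M).
Local Notation GN := (gramR R N).
Local Notation EM := (embR R M).
Local Notation EN := (embR R N).
Variables (u : decomp R (rank M)) (w : decomp R (rank N)).
Hypotheses (uP : Gr GM u) (wP : Gr GN w).
Local Notation v := (oplus u w).
Let fM := linfun (mulmxr EM) : 'Hom('rV[R]_(rank M), 'rV[R]_(rank L)).
Let fN := linfun (mulmxr EN) : 'Hom('rV[R]_(rank N), 'rV[R]_(rank L)).

Lemma mem_oplus (U : {vspace 'rV[R]_(rank M)}) (W : {vspace 'rV[R]_(rank N)}) x :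
  reflect (exists a b, [/\ a \in U, b \in W & x = a *m EM + b *m EN])
    (x \in (fM @: U + fN @: W)%VS).
Proof.
apply: (iffP memv_addP) => [[_ /memv_imgP[a aU ->]] [_ /memv_imgP[b bW ->] ->]|[a [b [aU bW ->]]]].
  by exists a, b; split=> //; rewrite !lfunE.
by exists (a *m EM); [apply/memv_imgP; exists a => //; rewrite lfunE|
  exists (b *m EN) => //; apply/memv_imgP; exists b => //; rewrite lfunE].
Qed.

Lemma form_glue0 (a : 'rV[R]_(rank M)) (b : 'rV[R]_(rank N)) :
  form G (a *m EM + b *m EN) (a *m EM + b *m EN) = form GM a a + form GN b b.
Proof. exact: form_glue. Qed.

Lemma glue_neq0 (a : 'rV[R]_(rank M)) (b : 'rV[R]_(rank N)) : a *m EM + b *m EN != 0 -> a != 0 \/ b != 0.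
Proof.
move=> h; have [a0|] := eqVneq a 0; last by left.
by right; apply: contra_neq h => ->; rewrite a0 !mul0mx addr0.
Qed.

Lemma Gr_oplus : Gr G v.
Proof.
case: (uP) => uf ui up um uo; case: (wP) => wf wi wp wm wo.
have pos x : x \in v.1 -> x != 0 -> 0 < form G x x.
  move=> /mem_oplus[a [b [aU bW ->]]] /glue_neq0 ab; rewrite form_glue0.
  have f0 k (P : 'M[R]_k) : form P 0 0 = 0 by rewrite /form !mul0mx mxE.
  have pa : 0 <= form GM a a by have [->|a0] := eqVneq a 0; [rewrite f0|apply/ltW/up].
  have pb : 0 <= form GN b b by have [->|b0] := eqVneq b 0; [rewrite f0|apply/ltW/wp].
  by case: ab => h; [rewrite ltr_wpDr// up|rewrite ltr_wpDl// wp].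
have neg x : x \in v.2 -> x != 0 -> form G x x < 0.
  move=> /mem_oplus[a [b [aU bW ->]]] /glue_neq0 ab; rewrite form_glue0.
  have f0 k (P : 'M[R]_k) : form P 0 0 = 0 by rewrite /form !mul0mx mxE.
  have pa : form GM a a <= 0 by have [->|a0] := eqVneq a 0; [rewrite f0|apply/ltW/um].
  have pb : form GN b b <= 0 by have [->|b0] := eqVneq b 0; [rewrite f0|apply/ltW/wm].
  by rewrite -oppr_gt0 opprD; case: ab => h; [rewrite ltr_wpDr ?oppr_ge0// oppr_gt0 um|rewrite ltr_wpDl ?oppr_ge0// oppr_gt0 wm].
split=> //.
- apply/eqP; rewrite eqEsubv subvf /=; apply/subvP => x _.
  have hu := proj_add uP (orth_proj M x); have hw := proj_add wP (orth_proj N x).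
  rewrite (proj_split perpN x) -hu -hw !mulmxDl addrACA; apply: memv_add.
    by apply/mem_oplus; exists (projp u (orth_proj M x)), (projp w (orth_proj N x)); split=> //; apply: projp_in.
  by apply/mem_oplus; exists (projm u (orth_proj M x)), (projm w (orth_proj N x)); split=> //; apply: projm_in.
- apply/eqP; rewrite -subv0; apply/subvP => x; rewrite memv_cap memv0 => /andP[x1 x2].
  by apply: contraT => x0; have := lt_trans (pos _ x1 x0) (neg _ x2 x0); rewrite ltxx.
move=> x y /mem_oplus[a [b [aU bW ->]]] /mem_oplus[a' [b' [aU' bW' ->]]].
by rewrite form_glue// uo// wo// addr0.
Qed.

(** The sums of the componentwise projections lie in v_+ and v_- and add up to x, so they are its
    projections. *)
Lemma projp_oplus x : projp v x = projp u (orth_proj M x) *m EM + projp w (orth_proj N x) *m EN /\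
  projm v x = projm u (orth_proj M x) *m EM + projm w (orth_proj N x) *m EN.
Proof.
set a := _ + _; set b := _ + _.
have av : a \in v.1.
  by apply/mem_oplus; exists (projp u (orth_proj M x)), (projp w (orth_proj N x)); split=> //; apply: projp_in.
have bv : b \in v.2.
  by apply/mem_oplus; exists (projm u (orth_proj M x)), (projm w (orth_proj N x)); split=> //; apply: projm_in.
have hu := proj_add uP (orth_proj M x); have hw := proj_add wP (orth_proj N x).
have xE : x = a + b by rewrite {1}(proj_split perpN x) -{1}hu -{1}hw !mulmxDl addrACA.
have [_ hi _ _ _] := Gr_oplus; have hi' : (v.2 :&: v.1 = 0)%VS by rewrite capvC.
have pa : projp v a = a by apply: daddv_pi_id.
have pb : projm v b = b by apply: daddv_pi_id.
have qa : projm v a = 0 by apply: (addrI (projp v a)); rewrite (proj_add Gr_oplus) addr0 pa.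
have qb : projp v b = 0 by apply: (addIr (projm v b)); rewrite (proj_add Gr_oplus) add0r pb.
have hp y z : projp v (y + z) = projp v y + projp v z by rewrite !projpE mulmxDl.
have hm y z : projm v (y + z) = projm v y + projm v z by rewrite !projmE mulmxDl.
by split; [rewrite xE hp pa qb addr0|rewrite xE hm pb qa add0r].
Qed.

Lemma dim_oplus : \dim v.1 = (\dim u.1 + \dim w.1)%N /\ \dim v.2 = (\dim u.2 + \dim w.2)%N.
Proof.
have kM : lker fM == 0%VS.
  apply/lker0P => x y; rewrite !lfunE /= => h.
  by have := congr1 (fun z => orth_proj M (z + 0 *m EN)) h; rewrite !(proj_M perpN).
have kN : lker fN == 0%VS.
  apply/lker0P => x y; rewrite !lfunE /= => h.
  by have := congr1 (fun z => orth_proj N (0 *m EM + z)) h; rewrite !(proj_N perpN).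
have d (U : {vspace 'rV[R]_(rank M)}) (W : {vspace 'rV[R]_(rank N)}) :
    \dim (fM @: U + fN @: W)%VS = (\dim U + \dim W)%N.
  rewrite dimv_disjoint_sum.
    by rewrite !limg_dim_eq ?(eqP kM) ?(eqP kN) ?capv0.
  apply/eqP; rewrite -subv0; apply/subvP => x; rewrite memv_cap memv0 => /andP[].
  move=> /memv_imgP[a _ ->] /memv_imgP[b _]; rewrite !lfunE /= => h.
  have := congr1 (fun z => orth_proj M (z + 0 *m EN)) h; rewrite (proj_M perpN).
  rewrite mul0mx addr0 -[b *m EN]add0r -(mul0mx 1 EM) (proj_M perpN) => ->.
  by rewrite mul0mx eqxx.
by split; apply: d.
Qed.

End OrthogonalSum.

(** Pascal's rule in the form needed for powers of a sum of two commuting operators, one acting on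
    each factor. *)
Lemma pascal_sum (V : zmodType) (a : nat -> nat -> V) k :
  \sum_(i < k.+2) a i (k.+1 - i)%N *+ 'C(k.+1, i) =
  \sum_(i < k.+1) a i.+1 (k - i)%N *+ 'C(k, i) + \sum_(i < k.+1) a i (k - i).+1 *+ 'C(k, i).
Proof.
rewrite big_ord_recl /= bin0 mulr1n subn0.
transitivity (a 0%N k.+1 + (\sum_(i < k.+1) a i.+1 (k - i)%N *+ 'C(k, i.+1) +
    \sum_(i < k.+1) a i.+1 (k - i)%N *+ 'C(k, i))).
  congr (_ + _); rewrite -big_split; apply: eq_bigr => i _.
  by rewrite /bump /= add1n binS mulrnDr subSS.
rewrite addrA addrC; congr (_ + _).
have -> : \sum_(i < k.+1) a i (k - i).+1 *+ 'C(k, i) = \sum_(i < k.+2) a i (k.+1 - i)%N *+ 'C(k, i).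
  rewrite [RHS]big_ord_recr /= bin_small// mulr0n addr0.
  by apply: eq_bigr => i _; rewrite subSn// -ltnS.
by rewrite [RHS]big_ord_recl /= bin0 mulr1n subn0; congr (_ + _).
Qed.

Lemma congr_mx_sum (C : comNzRingType) (V : lmodType C) r m n (K : 'M[C]_r)
    (b : 'M[C]_(r, m)) (a : 'M[C]_(r, n)) (Z : 'I_m -> 'I_n -> V) :
  \sum_i \sum_j K i j *: (\sum_s \sum_t (b i s * a j t) *: Z s t) =
  \sum_s \sum_t (b^T *m K *m a) s t *: Z s t.
Proof.
transitivity (\sum_i \sum_j \sum_s \sum_t (b i s * K i j * a j t) *: Z s t).
  apply: eq_bigr => i _; apply: eq_bigr => j _; rewrite scaler_sumr; apply: eq_bigr => s _.
  by rewrite scaler_sumr; apply: eq_bigr => t _; rewrite scalerA mulrA [K i j * _]mulrC.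
transitivity (\sum_i \sum_s \sum_j \sum_t (b i s * K i j * a j t) *: Z s t).
  by apply: eq_bigr => i _; rewrite exchange_big.
rewrite exchange_big; apply: eq_bigr => s _.
transitivity (\sum_i \sum_t \sum_j (b i s * K i j * a j t) *: Z s t).
  by apply: eq_bigr => i _; rewrite exchange_big.
rewrite exchange_big; apply: eq_bigr => t _; rewrite exchange_big mxE scaler_suml.
apply: eq_bigr => j _; rewrite mxE mulr_suml scaler_suml; apply: eq_bigr => i _.
by rewrite mxE.
Qed.

(** * Laplacians of products in orthogonal variables *)

Section LaplacianProduct.
Variables (R : realType) (r m n : nat).
Local Notation C := R[i].
Variables (K : 'M[R]_r) (KM : 'M[R]_m) (KN : 'M[R]_n) (a : 'M[R]_(r, m)) (b : 'M[R]_(r, n)).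
Hypotheses (Kaa : a^T *m K *m a = KM) (Kbb : b^T *m K *m b = KN).
Hypotheses (Kab : a^T *m K *m b = 0) (Kba : b^T *m K *m a = 0).
Local Notation ca := (mxcomp (toC a)).
Local Notation cb := (mxcomp (toC b)).

Lemma lapl_sum4 m1 m2 (b1 : 'M[R]_(r, m1)) (a1 : 'M[R]_(r, m2)) (Z : 'I_m1 -> 'I_m2 -> mpoly.mpoly r C) :
  \sum_i \sum_j (K i j)%:C *: (\sum_s \sum_t (toC b1 i s * toC a1 j t) *: Z s t) =
  \sum_s \sum_t ((b1^T *m K *m a1) s t)%:C *: Z s t.
Proof.
transitivity (\sum_i \sum_j toC K i j *: (\sum_s \sum_t (toC b1 i s * toC a1 j t) *: Z s t)).
  by apply: eq_bigr => i _; apply: eq_bigr => j _; rewrite [toC K i j]mxE.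
rewrite congr_mx_sum; apply: eq_bigr => s _; apply: eq_bigr => t _; congr (_ *: _).
by rewrite toC_tr -!toCM [LHS]mxE.
Qed.

Lemma mderiv2_mxcomp k (a1 : 'M[R]_(r, k)) i j f :
  mpoly.mderiv i (mpoly.mderiv j (mxcomp (toC a1) f)) =
  \sum_s \sum_t (toC a1 i s * toC a1 j t) *: mxcomp (toC a1) (mpoly.mderiv s (mpoly.mderiv t f)).
Proof.
rewrite mderiv_mxcomp mderiv_sum exchange_big; apply: eq_bigr => t _.
rewrite mpoly.mderivZ mderiv_mxcomp scaler_sumr; apply: eq_bigr => s _.
by rewrite scalerA mulrC.
Qed.

Lemma mderiv_prod k1 k2 (a1 : 'M[R]_(r, k1)) (a2 : 'M[R]_(r, k2)) i j f g :
  mpoly.mderiv i (mxcomp (toC a1) f) * mpoly.mderiv j (mxcomp (toC a2) g) =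
  \sum_s \sum_t (toC a1 i s * toC a2 j t) *:
    (mxcomp (toC a1) (mpoly.mderiv s f) * mxcomp (toC a2) (mpoly.mderiv t g)).
Proof.
rewrite !mderiv_mxcomp mulr_suml; apply: eq_bigr => s _; rewrite mulr_sumr; apply: eq_bigr => t _.
by rewrite -scalerAl -scalerAr scalerA.
Qed.

(** The mixed terms of the Leibniz rule are weighted by the off-diagonal blocks of the inverse
    metric, which vanish by [Kab] and [Kba]. *)
Lemma lapl_prod f g :
  lapl K (ca f * cb g) = ca (lapl KM f) * cb g + ca f * cb (lapl KN g).
Proof.
have e i j : mpoly.mderiv i (mpoly.mderiv j (ca f * cb g)) =
    mpoly.mderiv i (mpoly.mderiv j (ca f)) * cb g + ca f * mpoly.mderiv i (mpoly.mderiv j (cb g)) +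
    (mpoly.mderiv i (cb g) * mpoly.mderiv j (ca f) + mpoly.mderiv i (ca f) * mpoly.mderiv j (cb g)).
  rewrite mpoly.mderivM mpoly.mderivD !mpoly.mderivM.
  set x1 := _ * cb g; set x2 := mpoly.mderiv j _ * _; set x3 := mpoly.mderiv i _ * _; set x4 := ca f * _.
  have -> : mpoly.mderiv i (cb g) * mpoly.mderiv j (ca f) = x2 by exact: mulrC.
  have aux (V : zmodType) (y1 y2 y3 y4 : V) : y1 + y2 + (y3 + y4) = y1 + y4 + (y2 + y3).
    by rewrite [y3 + y4]addrC addrACA.
  exact: aux.
rewrite {1}/lapl.
pose S1 := \sum_i \sum_j (K i j)%:C *: (mpoly.mderiv i (mpoly.mderiv j (ca f)) * cb g).
pose S2 := \sum_i \sum_j (K i j)%:C *: (ca f * mpoly.mderiv i (mpoly.mderiv j (cb g))).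
pose S3 := \sum_i \sum_j (K i j)%:C *: (mpoly.mderiv i (cb g) * mpoly.mderiv j (ca f)).
pose S4 := \sum_i \sum_j (K i j)%:C *: (mpoly.mderiv i (ca f) * mpoly.mderiv j (cb g)).
transitivity (S1 + S2 + (S3 + S4)).
  rewrite -!big_split; apply: eq_bigr => i _; rewrite -!big_split; apply: eq_bigr => j _.
  by rewrite e !scalerDr.
have z m1 m2 (Z : 'I_m1 -> 'I_m2 -> mpoly.mpoly r C) (B : 'M[R]_(m1, m2)) : B = 0 ->
    \sum_s \sum_t (B s t)%:C *: Z s t = 0.
  by move=> ->; rewrite big1// => s _; rewrite big1// => t _; rewrite mxE scale0r.
have -> : S3 = 0.
  rewrite /S3; under eq_bigr do under eq_bigr do rewrite mderiv_prod.
  by rewrite lapl_sum4; exact: z.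
have -> : S4 = 0.
  rewrite /S4; under eq_bigr do under eq_bigr do rewrite mderiv_prod.
  by rewrite lapl_sum4; exact: z.
rewrite /S1 /S2 {S1 S2 S3 S4}.
rewrite addr0 addr0; congr (_ + _).
  transitivity ((\sum_i \sum_j (K i j)%:C *: mpoly.mderiv i (mpoly.mderiv j (ca f))) * cb g).
    rewrite mulr_suml; apply: eq_bigr => i _; rewrite mulr_suml; apply: eq_bigr => j _.
    by rewrite scalerAl.
  congr (_ * _); under eq_bigr do under eq_bigr do rewrite mderiv2_mxcomp.
  rewrite lapl_sum4 Kaa /lapl mxcomp_sum; apply: eq_bigr => s _; rewrite mxcomp_sum.
  by apply: eq_bigr => t _; rewrite mxcompZ.
transitivity (ca f * (\sum_i \sum_j (K i j)%:C *: mpoly.mderiv i (mpoly.mderiv j (cb g)))).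
  rewrite mulr_sumr; apply: eq_bigr => i _; rewrite mulr_sumr; apply: eq_bigr => j _.
  by rewrite scalerAr.
congr (_ * _); under eq_bigr do under eq_bigr do rewrite mderiv2_mxcomp.
rewrite lapl_sum4 Kbb /lapl mxcomp_sum; apply: eq_bigr => s _; rewrite mxcomp_sum.
by apply: eq_bigr => t _; rewrite mxcompZ.
Qed.

Lemma iter_lapl_prod k f g z :
  evalC (iter k (lapl K) (ca f * cb g)) z =
  \sum_(i < k.+1) (evalC (iter i (lapl KM) f) (z *m toC a) *
     evalC (iter (k - i) (lapl KN) g) (z *m toC b)) *+ 'C(k, i).
Proof.
elim: k f g => [|k IH] f g.
  by rewrite big_ord1 bin0 mulr1n /= evalCM !evalC_mxcomp.
have -> : iter k.+1 (lapl K) (ca f * cb g) =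
    iter k (lapl K) (ca (lapl KM f) * cb g) + iter k (lapl K) (ca f * cb (lapl KN g)).
  by rewrite iterSr (lapl_prod f g) iter_laplD.
apply: etrans (evalCD _ _ z) _.
apply: etrans (congr2 +%R (IH (lapl KM f) g) (IH f (lapl KN g))) _.
apply: esym.
apply: etrans (pascal_sum (fun i j => evalC (iter i (lapl KM) f) (z *m toC a) * evalC (iter j (lapl KN) g) (z *m toC b)) k) _.
apply: (congr2 +%R); apply: eq_bigr => i _; congr (_ *+ _).
  by congr (_ * _); congr evalC; exact: iterSr.
by congr (_ * _); congr evalC; exact: iterSr.
Qed.

Lemma explp_prod c f g z :
  evalC (explp K c (ca f * cb g)) z =
  evalC (explp KM c f) (z *m toC a) * evalC (explp KN c g) (z *m toC b).
Proof.
pose x k : C := (c ^+ k / k`!%:R)%:C * evalC (iter k (lapl KM) f) (z *m toC a).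
pose y k : C := (c ^+ k / k`!%:R)%:C * evalC (iter k (lapl KN) g) (z *m toC b).
pose d1 := mpoly.msize f; pose d2 := mpoly.msize g.
(* The truncated exponential series become polynomials evaluated at 1: their product organises the
   Cauchy product, and different truncation lengths are absorbed by vanishing coefficients. *)
pose P := \poly_(i < d1) x i; pose Q := \poly_(i < d2) y i.
have xE : evalC (explp KM c f) (z *m toC a) = P.[1].
  rewrite (horner_coef_wide 1 (size_poly d1 x)) /explp /explap evalC_sum.
  by apply: eq_bigr => i _; rewrite evalCZ expr1n mulr1 coef_poly ltn_ord.
have yE : evalC (explp KN c g) (z *m toC b) = Q.[1].
  rewrite (horner_coef_wide 1 (size_poly d2 y)) /explp /explap evalC_sum.
  by apply: eq_bigr => i _; rewrite evalCZ expr1n mulr1 coef_poly ltn_ord.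
have ev0 k (u : 'rV[C]_k) : evalC 0 u = 0 by rewrite -(scale0r 0) evalCZ mul0r.
have xP i : P`_i = x i.
  rewrite coef_poly; case: ltnP => // h; rewrite /x.
  by rewrite (iter_lapl_eq0 _ (@deglt_msize R m f) h) ev0 mulr0.
have yP i : Q`_i = y i.
  rewrite coef_poly; case: ltnP => // h; rewrite /y.
  by rewrite (iter_lapl_eq0 _ (@deglt_msize R n g) h) ev0 mulr0.
pose d := maxn (mpoly.msize (ca f * cb g)) (size (P * Q)).
have hd := deglt_le (leq_maxl _ (size (P * Q))) (@deglt_msize R r (ca f * cb g)).
rewrite xE yE -hornerM (horner_coef_wide 1 (leq_maxr (mpoly.msize (ca f * cb g)) _)).
rewrite (explpE K c hd) /explap evalC_sum; apply: eq_bigr => k _.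
rewrite evalCZ expr1n mulr1 iter_lapl_prod coefM mulr_sumr; apply: eq_bigr => i _.
rewrite xP yP /x /y.
have ik : (i <= k)%N by rewrite -ltnS.
set e1 := evalC _ _; set e2 := evalC _ _.
have -> : (c ^+ k / k`!%:R)%:C * (e1 * e2 *+ 'C(k, i)) = ((c ^+ k / k`!%:R) * 'C(k, i)%:R)%:C * (e1 * e2).
  have nC : ('C(k, i)%:R : R)%:C = 'C(k, i)%:R :> C by exact: rmorph_nat.
  have aux (A B D : C) : A * (B * D) = A * D * B by rewrite mulrA mulrAC.
  apply: etrans (_ : (c ^+ k / k`!%:R)%:C * (e1 * e2 * ('C(k, i)%:R : R)%:C) = _).
    by congr (_ * _); rewrite nC; exact: esym (mulr_natr _ _).
  by rewrite [X in _ = X * _]rmorphM; exact: aux.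
rewrite [RHS]mulrACA -rmorphM; congr (_%:C * _).
have -> : c ^+ k = c ^+ i * c ^+ (k - i) by rewrite -exprD subnKC.
have /(congr1 (fun q : nat => q%:R : R)) := bin_fact ik; rewrite !natrM => <-.
have h1 : (i`!%:R : R) != 0 by rewrite pnatr_eq0 -lt0n fact_gt0.
have h2 : ((k - i)`!%:R : R) != 0 by rewrite pnatr_eq0 -lt0n fact_gt0.
have h3 : ('C(k, i)%:R : R) != 0 by rewrite pnatr_eq0 -lt0n bin_gt0.
by field; rewrite h1 h2 h3.
Qed.

End LaplacianProduct.

Lemma majorant_unit (R : realType) n (Q : 'M[R]_n) (v : decomp R n) :
  Q^T = Q -> Q \in unitmx -> Gr Q v -> majorant Q v \in unitmx.
Proof.
move=> sQ uQ vP; have e : majorant Q v *m (invmx Q *m (Pp v - Pm v)) = 1%:M.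
  rewrite (majorantE sQ vP) -mulmxA mulmxA mulmxA mulmxK// mulmxBl !mulmxBr.
  by rewrite (PpPp vP) (PmPm vP) (PpPm vP) (PmPp vP) subr0 sub0r opprK (PpPm_add vP).
by have [] := mulmx1_unit e.
Qed.

(** [O1], [O2] are the coordinate maps of two complementary projections and [E1], [E2] the
    inclusions. The sum of the two metrics is inverted blockwise. *)
Lemma orthogonal_sum_inv (F : comNzRingType) r m n (O1 : 'M[F]_(r, m)) (O2 : 'M[F]_(r, n))
    (E1 : 'M[F]_(m, r)) (E2 : 'M[F]_(n, r)) (A1 K1 : 'M[F]_m) (A2 K2 : 'M[F]_n) :
  O1 *m E1 + O2 *m E2 = 1%:M ->
  E1 *m O1 = 1%:M -> E2 *m O2 = 1%:M -> E1 *m O2 = 0 -> E2 *m O1 = 0 ->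
  A1 *m K1 = 1%:M -> A2 *m K2 = 1%:M ->
  let K := E1^T *m K1 *m E1 + E2^T *m K2 *m E2 in
  (O1 *m A1 *m O1^T + O2 *m A2 *m O2^T) *m K = 1%:M /\
  [/\ O1^T *m K *m O1 = K1, O2^T *m K *m O2 = K2, O1^T *m K *m O2 = 0 & O2^T *m K *m O1 = 0].
Proof.
move=> h h11 h22 h12 h21 i1 i2 K.
have t11 : O1^T *m E1^T = 1%:M by rewrite -trmx_mul h11 trmx1.
have t22 : O2^T *m E2^T = 1%:M by rewrite -trmx_mul h22 trmx1.
have t21 : O2^T *m E1^T = 0 by rewrite -trmx_mul h12 trmx0.
have t12 : O1^T *m E2^T = 0 by rewrite -trmx_mul h21 trmx0.
have k1 : O1^T *m K = K1 *m E1.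
  by rewrite mulmxDr !mulmxA t11 t12 !mul0mx addr0 mul1mx.
have k2 : O2^T *m K = K2 *m E2.
  by rewrite mulmxDr !mulmxA t21 t22 !mul0mx add0r mul1mx.
split; last by split; rewrite ?k1 ?k2 -mulmxA ?h11 ?h22 ?h12 ?h21 ?mulmx1 ?mulmx0.
rewrite mulmxDl -!mulmxA k1 k2 (mulmxA A1) (mulmxA A2) i1 i2 !mul1mx; exact: h.
Qed.

(** * Factorisation of the theta summand *)

Section ThetaProduct.
Variables (R : realType) (L : lattice) (M N : sublattice L).
Hypothesis perpN : is_orth_complement M N.
Local Notation C := R[i].
Local Notation G := (gramR R L).
Local Notation GM := (gramR R M).
Local Notation GN := (gramR R N).
Local Notation EM := (embR R M).
Local Notation EN := (embR R N).

Definition orth_mx (P : sublattice L) : 'M[R]_(rank L, rank P) :=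
  G *m (embR R P)^T *m invmx (gramR R P).
Local Notation OM := (orth_mx M).
Local Notation ON := (orth_mx N).

Lemma orth_projE (P : sublattice L) x : orth_proj P x = x *m orth_mx P.
Proof. by rewrite /orth_mx !mulmxA. Qed.

Lemma orth_mx_gram (P : sublattice L) : gramR R P *m (orth_mx P)^T = embR R P *m G.
Proof.
rewrite /orth_mx !trmx_mul trmxK (gramR_sym R L) trmx_inv (gramR_sym R P).
by rewrite mulKVmx ?gramR_unit.
Qed.

Lemma orth_split : OM *m EM + ON *m EN = 1%:M.
Proof.
by apply: mx_eqP => x; rewrite mulmx1 mulmxDr (mulmxA x OM) (mulmxA x ON) -(orth_projE M x) -(orth_projE N x) -(proj_split perpN).
Qed.

Lemma EM_OM : EM *m OM = 1%:M.
Proof.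
apply: mx_eqP => a; have := proj_M perpN a 0.
by rewrite mul0mx addr0 orth_projE mulmx1 mulmxA.
Qed.

Lemma EN_ON : EN *m ON = 1%:M.
Proof.
apply: mx_eqP => a; have := proj_N perpN 0 a.
by rewrite mul0mx add0r orth_projE mulmx1 mulmxA.
Qed.

Lemma EM_ON : EM *m ON = 0.
Proof.
apply: mx_eqP => a; have := proj_N perpN a 0.
by rewrite mul0mx addr0 orth_projE mulmx0 mulmxA.
Qed.

Lemma EN_OM : EN *m OM = 0.
Proof.
apply: mx_eqP => a; have := proj_M perpN 0 a.
by rewrite mul0mx add0r orth_projE mulmx0 mulmxA.
Qed.

Variables (u : decomp R (rank M)) (w : decomp R (rank N)).
Hypotheses (uP : Gr GM u) (wP : Gr GN w).
Local Notation v := (oplus u w).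
Local Notation KM := (invmx (majorant GM u)).
Local Notation KN := (invmx (majorant GN w)).
Local Notation K := (invmx (majorant G v)).
Let vP : Gr G v := Gr_oplus perpN uP wP.

Lemma majorant_oplus : majorant G v = OM *m majorant GM u *m OM^T + ON *m majorant GN w *m ON^T.
Proof.
have hp : Pp v = OM *m Pp u *m EM + ON *m Pp w *m EN.
  apply: mx_eqP => x; rewrite -projpE (projp_oplus perpN uP wP x).1 !orth_projE !projpE.
  by rewrite mulmxDr !mulmxA.
have hm : Pm v = OM *m Pm u *m EM + ON *m Pm w *m EN.
  apply: mx_eqP => x; rewrite -projmE (projp_oplus perpN uP wP x).2 !orth_projE !projmE.
  by rewrite mulmxDr !mulmxA.
rewrite (majorantE (gramR_sym R L) vP) (majorantE (gramR_sym R M) uP) (majorantE (gramR_sym R N) wP).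
rewrite -!mulmxA !orth_mx_gram hp hm opprD addrACA !mulmxBl !mulmxBr mulmxDl !mulmxBl.
by rewrite !mulmxA.
Qed.

Lemma K_congr : [/\ OM^T *m K *m OM = KM, ON^T *m K *m ON = KN,
  OM^T *m K *m ON = 0 & ON^T *m K *m OM = 0].
Proof.
have iM : majorant GM u *m KM = 1%:M.
  by apply: mulmxV; apply: majorant_unit uP; [exact: gramR_sym|exact: gramR_unit].
have iN : majorant GN w *m KN = 1%:M.
  by apply: mulmxV; apply: majorant_unit wP; [exact: gramR_sym|exact: gramR_unit].
have [h hK] := orthogonal_sum_inv orth_split EM_OM EN_ON EM_ON EN_OM iM iN.
have -> // : K = EM^T *m KM *m EM + EN^T *m KN *m EN.
rewrite majorant_oplus; have [hu _] := mulmx1_unit h.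
by rewrite -[LHS]mulmx1 -h mulKmx.
Qed.

Variables (p : mpoly.mpoly (rank L) C) (pM : mpoly.mpoly (rank M) C) (pN : mpoly.mpoly (rank N) C).
Hypothesis p_split : forall x : 'rV[R]_(rank L),
  peval p x = peval pM (orth_proj M x) * peval pN (orth_proj N x).

(** [p_split] is an identity of values at real points; [peval_inj] turns it into one of polynomials,
    on which the Laplacian acts. *)
Lemma split_mxcomp : p = mxcomp (toC OM) pM * mxcomp (toC ON) pN.
Proof.
apply: peval_inj => x; rewrite p_split !pevalE evalCM !evalC_mxcomp !orth_projE.
by rewrite !toCM.
Qed.

Lemma theta_term_oplus t x : theta_term G v p t x =
  theta_term GM u pM t (orth_proj M x) * theta_term GN w pN t (orth_proj N x).
Proof.
rewrite (theta_termE (gramR_sym R L) vP) (theta_termE (gramR_sym R M) uP) (theta_termE (gramR_sym R N) wP).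
have [k1 k2 k3 k4] := K_congr.
rewrite split_mxcomp (explp_prod k1 k2 k3 k4) -!toCM -!orth_projE [RHS]mulrACA -cexpD; congr (_ * cexp _).
rewrite -opprD -mulrDr; congr (- (_ * _)).
rewrite (bf_At G v) (bf_At GM u) (bf_At GN w) -mulrDr; congr (_ * _).
rewrite -(form_projp (gramR_sym R L) vP) -(form_projm (gramR_sym R L) vP).
rewrite -(form_projp (gramR_sym R M) uP) -(form_projm (gramR_sym R M) uP).
rewrite -(form_projp (gramR_sym R N) wP) -(form_projm (gramR_sym R N) wP).
have [-> ->] := projp_oplus perpN uP wP x.
by rewrite !(form_glue perpN) !rmorphD !mulrDr addrACA.
Qed.

End ThetaProduct.

Lemma asum_mulb (R : realType) (I : choiceType) (f g : I -> R[i]) (B : R) :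
  0 <= B -> asum f -> (forall i, cabs (g i) <= B) -> asum (fun i => f i * g i).
Proof.
move=> B0 [A hA] hg; apply: (asum_ler (g := fun i => B * cabs (f i))) (sboundZ B0 hA) => i.
rewrite (cabsM (f i)) [X in X <= _]mulrC; apply: ler_wpM2r; [exact: cabs_ge0|exact: hg].
Qed.

Lemma asum_mul_class (R : realType) (P : lattice) (f : dual R P -> R[i]) (h : discr R P -> R[i]) :
  asum f -> asum (fun x => f x * h (dclass x)).
Proof.
move=> af; apply: (asum_mulb (B := \sum_d cabs (h d))) => // [|x].
  by apply: sumr_ge0 => d _; apply: cabs_ge0.
by rewrite (bigD1 (dclass x))//= lerDl; apply: sumr_ge0 => d _; apply: cabs_ge0.
Qed.

(** * Lift integrands as series over the dual lattice *)

Section Integrand.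
Variables (R : realType) (P : lattice) (v : decomp R (rank P)).
Hypothesis vP : Gr (gramR R P) v.
Variables (p : mpoly.mpoly (rank P) R[i]) (t : R[i]).
Hypothesis t0 : 0 < complex.Im t.
Local Notation term := (theta_term (gramR R P) v p t).

Lemma asum_theta_dual : asum (fun x : dual R P => term x).
Proof.
by have [] := tsum_dual (fun g => asum_theta_term (gramR_sym R P) vP p (dual_val (drepr g)) t0).
Qed.

Lemma lift_integrandE bm mm (F : R[i] -> {ffun discr R P -> R[i]^o}) :
  lift_integrand bm mm F v p t =
  (complex.Im t `^ (bm%:R / 2 + mm%:R))%:C * tsum (fun x : dual R P => term x * F t (dclass x)).
Proof.
rewrite /lift_integrand /pairing; set Y := (_ `^ _)%:C.
have a g : asum (fun x : dual R P => term x * (g == dclass x)%:R).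
  exact: (asum_mul_class (fun d => (g == d)%:R)) asum_theta_dual.
have e g : theta bm mm v p t g = Y * tsum (fun x : dual R P => term x * (g == dclass x)%:R).
  rewrite /theta ffunE -/Y; congr (_ * _).
  rewrite (_ : (fun x : dual R P => _) = (fun x : dual R P => term x * (g == dclass x)%:R : R[i]^o)).
    exact: summability_sum.
  by apply/funext => x; rewrite ffunE.
transitivity (\sum_g Y * tsum (fun x : dual R P => F t g * (term x * (g == dclass x)%:R))).
  by apply: eq_bigr => g _; rewrite e tsumZ// mulrAC mulrA.
rewrite -mulr_sumr -tsum_sum => [|g _]; last exact: asumZ.
congr (_ * _); apply: eq_tsum => x; rewrite (bigD1 (dclass x))//= eqxx mulr1 big1 => [|g gx].
  by rewrite addr0 mulrC.
by rewrite (negbTE gx) !mulr0.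
Qed.

End Integrand.

(** * The seesaw identity *)

Section Seesaw.
Variables (R : realType) (L : lattice) (M N : sublattice L).
Hypothesis perpN : is_orth_complement M N.
Local Notation C := R[i].
Local Notation G := (gramR R L).
Local Notation GM := (gramR R M).
Local Notation GN := (gramR R N).
Local Notation EM := (embR R M).
Local Notation EN := (embR R N).
Local Notation DL := (discr R L).
Variables (u : decomp R (rank M)) (w : decomp R (rank N)).
Hypotheses (uP : Gr GM u) (wP : Gr GN w).
Variables (p : mpoly.mpoly (rank L) C) (pM : mpoly.mpoly (rank M) C) (pN : mpoly.mpoly (rank N) C).
Hypothesis p_split : forall x : 'rV[R]_(rank L),
  peval p (x) = peval pM (orth_proj M x) * peval pN (orth_proj N x).
Variable t : C.
Hypothesis t0 : 0 < complex.Im t.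
Local Notation v := (oplus u w).
Local Notation termL := (theta_term G v p t).
Local Notation termM := (theta_term GM u pM t).
Local Notation termN := (theta_term GN w pN t).

Lemma tsum_seesaw (f : DL -> C) :
  tsum (fun x : dual R L => termL x * f (dclass x)) =
  tsum (fun x : dual R M => termM x * \sum_c thsum w pN t c * Fext f (glue (dclass x, c))).
Proof.
(* The factor [Fext] cuts out the pairs that come from the dual of L, so a sum over a subgroup of
   the product becomes a sum over the whole product, to which Fubini applies. *)
pose phi (z : dual R M * dual R N) := termM z.1 * termN z.2 * Fext f (dual_val z.1 *m EM + dual_val z.2 *m EN).
have aphi : asum phi.
  apply: (asum_mulb (B := \sum_g cabs (f g))) => [||z]; last exact: Fext_bound.
    by apply: sumr_ge0 => d _; apply: cabs_ge0.
  exact: (asum_mul (asum_theta_dual uP pM t0) (asum_theta_dual wP pN t0)).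
pose h (x : dual R L) := (dual_proj M x, dual_proj N x).
have hinj : injective h.
  move=> x y e; apply: dual_inj.
  have e1 : orth_proj M x = orth_proj M y := congr1 (fun z => dual_val z.1) e.
  have e2 : orth_proj N x = orth_proj N y := congr1 (fun z => dual_val z.2) e.
  by rewrite (proj_split perpN (dual_val x)) e1 e2 -(proj_split perpN).
have hsup z : (forall x, h x <> z) -> phi z = 0.
  case: z => [a b] H; rewrite /phi /=.
  have [hd|hd] := boolP (dual_val a *m EM + dual_val b *m EN \in @dual_pred R L); last first.
    by rewrite Fext_notdual ?mulr0.
  case: (H (todual (dual_val a *m EM + dual_val b *m EN))); congr pair; apply: dual_inj.
    by rewrite /= todualK// (proj_M perpN).
  by rewrite /= todualK// (proj_N perpN).
transitivity (tsum phi).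
  rewrite (tsum_reindex hinj hsup aphi); apply: eq_tsum => x.
  rewrite /phi /h [(_, _).1]/= [(_, _).2]/= (theta_term_oplus perpN uP wP p_split); congr (_ * _).
  by rewrite -Fext_dual {1}(proj_split perpN (dual_val x)).
rewrite (fubini aphi); apply: eq_tsum => x.
have [ac <-] := tsum_coset_fun pN wP t0 (dclass x) f.
rewrite -tsumZ//; apply: eq_tsum => y; rewrite /phi [(_, _).1]/= [(_, _).2]/= /coset_fun.
rewrite -(mulrA (termM x)); congr (_ * (_ * _)); apply: Fext_congr.
rewrite opprD addrACA subrr addr0 -mulmxBl; apply: EM_int; exact: dclass_repr.
Qed.

Lemma lift_integrand_seesaw bm cm mm nm (F : C -> {ffun DL -> C^o}) :
  lift_integrand bm mm F v p t =
  lift_integrand cm nm (theta_contraction M bm cm mm nm w pN F) u pM t.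
Proof.
rewrite (lift_integrandE (Gr_oplus perpN uP wP) p t0) (lift_integrandE uP pM t0) tsum_seesaw.
set YL := (_ `^ _)%:C; set YM := (_ `^ (cm%:R / 2 + _))%:C.
pose YN : C := (complex.Im t `^ ((bm%:R - cm%:R) / 2 + mm%:R - nm%:R))%:C.
pose W (d : discr R M) := \sum_c thsum w pN t c * Fext (F t) (glue (d, c)).
(* The exponents of y add up: bm/2 + mm = (cm/2 + nm) + ((bm - cm)/2 + mm - nm). *)
have -> : YL = YM * YN.
  rewrite /YL /YM /YN -rmorphM -powRD; last by rewrite (gt_eqF t0) implybT.
  by congr (_ `^ _)%:C; field.
rewrite -mulrA -tsumZ; last exact: (asum_mul_class W) (asum_theta_dual uP pM t0).
congr (_ * _); apply: eq_tsum => x; rewrite (contractionE perpN pN wP t0) /Wsum -/YN.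
rewrite mulrCA; congr (_ * _); rewrite mulr_sumr; apply: eq_bigr => c _; exact: mulrA.
Qed.

End Seesaw.

(** * Signatures, modularity and equality of lifts *)

Lemma cintegral_eq (R : realType) (D : set (R * R)) (f g : R * R -> R[i]) :
  (forall z, D z -> f z = g z) -> cintegral D f = cintegral D g.
Proof.
move=> h; rewrite /cintegral; congr (_ +i* _); apply: eq_Rintegral => z /set_mem /h -> //.
Qed.

(** The truncated fundamental domain lies in the upper half-plane, so agreement there determines the
    integral. *)
Lemma truncated_lift_eq (R : realType) (h1 h2 : R[i] -> R[i]) s Y :
  (forall t, 0 < complex.Im t -> h1 t = h2 t) -> truncated_lift h1 s Y = truncated_lift h2 s Y.
Proof. by move=> h; apply: cintegral_eq => z [_ _ z0 _]; rewrite h. Qed.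

Lemma is_regularized_integral_eq (R : realType) (h1 h2 : R[i] -> R[i]) c :
  (forall t, 0 < complex.Im t -> h1 t = h2 t) ->
  is_regularized_integral h1 c -> is_regularized_integral h2 c.
Proof.
move=> h [a [Phi [h3 h4 h5 h6]]]; exists a, Phi; split; [|exact: h4|exact: h5|exact: h6] => s as_.
have -> : (fun Y => truncated_lift h2 s Y : R[i]^o) = (fun Y => truncated_lift h1 s Y).
  by apply/funext => Y; apply/esym/truncated_lift_eq.
exact: h3.
Qed.

(** Dimensions add over the orthogonal sum, and by inertia any point of the Grassmannian computes
    the signature. This expresses b_+ - c_+ and b_- - c_- through w. *)
Lemma signature_complement (R : realType) (L : lattice) (M N : sublattice L)
    (w : decomp R (rank N)) bp bm cp cm :
  is_orth_complement M N -> Gr (gramR R N) w ->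
  has_signature R L bp bm -> has_signature R M cp cm ->
  [/\ bp = (cp + \rank (Pp w))%N, bm = (cm + (rank N - \rank (Pp w)))%N &
      (\rank (Pp w) <= rank N)%N].
Proof.
move=> perpN wP [v [vP <- <-]] [u [uP <- <-]]; rewrite (rank_Pp wP).
have [-> ->] := Gr_dim_eq vP (Gr_oplus perpN uP wP); have [-> ->] := dim_oplus perpN u w.
have h := Gr_dim wP; split=> //; lia.
Qed.

Lemma mpS_upper (R : realType) (t : R[i]) : 0 < complex.Im t -> (@mpS R).2 t = sqrtc t.
Proof. exact: on_upperE. Qed.

Lemma mpT_upper (R : realType) (t : R[i]) : 0 < complex.Im t -> (@mpT R).2 t = 1.
Proof. exact: on_upperE. Qed.

Lemma contraction_modular (R : realType) (L : lattice) (M N : sublattice L)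
    (bp bm cp cm mp mm np nm : nat) (evenL : even_lattice L)
    (sigL : has_signature R L bp bm) (sigM : has_signature R M cp cm)
    (perpN : is_orth_complement M N)
    (w : decomp R (rank N)) (wP : Gr (gramR R N) w)
    (le_np : (np <= mp)%N) (le_nm : (nm <= mm)%N)
    (pN : mpoly.mpoly (rank N) R[i])
    (pN_homog : homogeneous w (mp - np) (mm - nm) pN)
    (rhoL : 'M[R]_2 * (R[i] -> R[i]) -> 'End({ffun discr R L -> R[i]^o}))
    (rhoLP : is_weil_rep bp bm rhoL)
    (rhoM : 'M[R]_2 * (R[i] -> R[i]) -> 'End({ffun discr R M -> R[i]^o}))
    (rhoMP : is_weil_rep cp cm rhoM)
    (F : R[i] -> {ffun discr R L -> R[i]^o})
    (F_modular : modular (bm%:Z - bp%:Z + 2 * (mm%:Z - mp%:Z)) (dual_rep rhoL) F) :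
  modular (cm%:Z - cp%:Z + 2 * (nm%:Z - np%:Z)) (dual_rep rhoM)
    (theta_contraction M bm cm mm nm w pN F).
Proof.
have [ebp ebm ler] := signature_complement perpN wP sigL sigM.
apply: (modular_of_generators rhoMP) => t t0.
  apply: (dual_law (rho_S_inj rhoMP)) => d.
  (* Modularity of F at S in transposed form: the S-matrix of L is applied to F (-1/t). *)
  have FS g : (ebf ((bm%:R - bp%:R) / 8)%:C / (Num.sqrt #|{: discr R L}|%:R)%:C) *
      (\sum_h ebf (- dbil g h)%:C * F (- t^-1) h) =
      sqrtc t ^ (bm%:Z - bp%:Z + 2 * (mm%:Z - mp%:Z)) * F t g.
    rewrite -(weil_S_pairing rhoLP); apply: (dual_law_inv (rho_S_inj rhoLP)).
    have := F_modular (@mpS R) (@Mp2Z_S R) t t0.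
    by rewrite moebius_S (mpS_upper t0).
  rewrite (weil_S_pairing rhoMP) (contractionE perpN pN wP t0).
  under eq_bigr do rewrite (contractionE perpN pN wP (upper_oppV t0)).
  have eE : (bm%:R - cm%:R) / 2 + mm%:R - nm%:R = (rank N - \rank (Pp w))%N%:R / 2 + (mm - nm)%N%:R :> R.
    by rewrite ebm natrD (natrB _ le_nm) [_%:R + _ - _]addrAC subrr add0r addrA.
  have zE : (cm%:R - cp%:R) / 8 + ((rank N - \rank (Pp w))%N%:R - (\rank (Pp w))%:R) / 8 =
      (bm%:R - bp%:R) / 8 :> R.
    by rewrite ebm ebp !natrD; field.
  have := Wsum_S perpN wP d t0 pN_homog eE zE FS.
  move=> ->; congr (_ ^ _ * _); rewrite ebm ebp; lia.
rewrite -[RHS]scale1r; apply: (dual_law (rho_T_inj rhoMP)) => d.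
have FT g : F (t + 1) g = ebf (- dquad g)%:C * F t g.
  have := F_modular (@mpT R) (@Mp2Z_T R) t t0; rewrite moebius_T (mpT_upper t0) exp1rz.
  move=> /(dual_law_inv (rho_T_inj rhoLP)) /(_ g); rewrite (weil_T_pairing rhoLP) mul1r => <-.
  by rewrite mulrA -ebfD -rmorphD addNr ebf0 mul1r.
have t1 : 0 < complex.Im (t + 1) by rewrite ImD /= addr0.
rewrite (weil_T_pairing rhoMP) (contractionE perpN pN wP t0) (contractionE perpN pN wP t1).
rewrite (Wsum_T perpN evenL _ _ wP _ _ FT) mul1r.
by rewrite mulrA -ebfD -rmorphD subrr ebf0 mul1r.
Qed.

Theorem theorem2p6 (R : realType) (L : lattice) (M N : sublattice L)
    (bp bm cp cm mp mm np nm : nat)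
    (evenL : even_lattice L) (sigL : has_signature R L bp bm)
    (primM : primitive M) (sigM : has_signature R M cp cm)
    (perpN : is_orth_complement M N)
    (w : decomp R (rank N)) (wP : Gr (gramR R N) w)
    (p : decomp R (rank L) -> mpoly.mpoly (rank L) R[i])
    (p_smooth : smooth_family (gramR R L) p)
    (p_homog : forall v, Gr (gramR R L) v -> homogeneous v mp mm (p v))
    (le_np : (np <= mp)%N) (le_nm : (nm <= mm)%N)
    (pM : decomp R (rank M) -> mpoly.mpoly (rank M) R[i])
    (pM_homog : forall u, Gr (gramR R M) u -> homogeneous u np nm (pM u))
    (pN : mpoly.mpoly (rank N) R[i])
    (pN_homog : homogeneous w (mp - np) (mm - nm) pN)
    (p_split : forall u, Gr (gramR R M) u -> forall x : 'rV[R]_(rank L),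
       peval (p (oplus u w)) x =
       peval (pM u) (orth_proj M x) * peval pN (orth_proj N x))
    (rhoL : 'M[R]_2 * (R[i] -> R[i]) -> 'End({ffun discr R L -> R[i]^o}))
    (rhoLP : is_weil_rep bp bm rhoL)
    (rhoM : 'M[R]_2 * (R[i] -> R[i]) -> 'End({ffun discr R M -> R[i]^o}))
    (rhoMP : is_weil_rep cp cm rhoM)
    (F : R[i] -> {ffun discr R L -> R[i]^o})
    (F_smooth : smooth_upper F)
    (F_modular : modular (bm%:Z - bp%:Z + 2 * (mm%:Z - mp%:Z)) (dual_rep rhoL) F)
    (liftL : forall u, Gr (gramR R M) u ->
       theta_lift_defined bm mm F (oplus u w) (p (oplus u w)))
    (liftM : forall u, Gr (gramR R M) u ->
       theta_lift_defined cm nm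
         (theta_contraction M bm cm mm nm w pN F) u (pM u)) :
  modular (cm%:Z - cp%:Z + 2 * (nm%:Z - np%:Z)) (dual_rep rhoM)
    (theta_contraction M bm cm mm nm w pN F) /\
  forall u, Gr (gramR R M) u ->
    theta_lift bm mm F (oplus u w) (p (oplus u w)) =
    theta_lift cm nm (theta_contraction M bm cm mm nm w pN F) u (pM u).
Proof.
split=> [|u uP]; first exact: (contraction_modular evenL sigL sigM perpN wP le_np le_nm pN_homog rhoLP rhoMP F_modular).
have e t : 0 < complex.Im t ->
    lift_integrand bm mm F (oplus u w) (p (oplus u w)) t =
    lift_integrand cm nm (theta_contraction M bm cm mm nm w pN F) u (pM u) t.
  by move=> t0; apply: lift_integrand_seesaw => //; apply: p_split.
(* Both lifts are chosen from a set of regularized values, and integrands that agree on the upper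
   half-plane define the same set. *)
rewrite /theta_lift; congr xget; apply/funext => c; apply/propext; split.
  exact: is_regularized_integral_eq e.
by apply: is_regularized_integral_eq => t t0; exact: esym (e t t0).
Qed.
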